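(* Let $(X,d,G)$ be a $G$-system and let $\{F_n\}$ be a tempered Følner sequence of $G$. Then $$\overline{D}_M(G,X,d)=\max_{\mu\in M(X,G)}\overline{D}_M(\mu,\{F_n\},d).$$
   Context: $G$ is a countably infinite discrete amenable group; a $G$-system $(X,d,G)$ is a compact metric space with a continuous $G$-action by homeomorphisms. Følner sequence: nonempty finite $F_n\subset G$ with $|gF_n\triangle F_n|/|F_n|\to0$ for all $g$; tempered: $|\bigcup_{j<n}F_j^{-1}F_n|\le C|F_n|$ for some $C>0$, all $n$. $d_F(x,y)=\max_{g\in F}d(gx,gy)$; $s(X,d_F,\epsilon)$ is the maximal cardinality of a subset of $X$ whose distinct points are at $d_F$-distance $>\epsilon$; $h_{top}(G,X,d,\{F_n\},\epsilon)=\limsup_n\frac1{|F_n|}\log s(X,d_{F_n},\epsilon)$. For $s>0$, $\overline{\mathrm{mdim}}_M(G,X,s,d)=\limsup_{\epsilon\to0}h_{top}(G,X,d,\{F_n\},\epsilon)/(\log\frac1\epsilon)^s$, and the infinite upper entropy dimension is $\overline{D}_M(G,X,d)=\inf\{s>0:\overline{\mathrm{mdim}}_M(G,X,s,d)=0\}$ (independent of the Følner sequence). $M(X,G)$: invariant Borel probability measures (weak* ); $E(X,G)$: ergodic ones; $\mathrm{co}(E(X,G))$: finite convex combinations, each uniquely $\mu=\sum_j\lambda_j\mu_j$ with distinct ergodic $\mu_j$, $\lambda_j>0$. For $\mu\in M(X,G)$ and finite Borel partition $\alpha$, $h_\mu(G,\alpha)=\lim_n\frac1{|F_n|}H_\mu(\bigvee_{g\in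 F_n}g^{-1}\alpha)$. For ergodic $\nu$, $h_\nu(\epsilon)=\inf\{h_\nu(G,\alpha):\mathrm{diam}(\alpha)\le\epsilon\}$; for $\mu=\sum\lambda_j\mu_j\in\mathrm{co}(E(X,G))$, $F(\mu,\epsilon)=\sum_j\lambda_jh_{\mu_j}(\epsilon)$. $M_G(\mu)$ is the set of families $(\mu_\epsilon)_{\epsilon>0}\subset\mathrm{co}(E(X,G))$ with $\mu_\epsilon\to\mu$ weak* as $\epsilon\to0$. For $s>0$, $\overline{\mathrm{mdim}}_M(\mu,s,\{F_n\},d)=\sup_{(\mu_\epsilon)\in M_G(\mu)}\limsup_{\epsilon\to0}F(\mu_\epsilon,\epsilon)/(\log\frac1\epsilon)^s$, and $\overline{D}_M(\mu,\{F_n\},d)=\inf\{s>0:\overline{\mathrm{mdim}}_M(\mu,s,\{F_n\},d)=0\}$. (The paper allows several equivalent choices of measure-theoretic $\epsilon$-entropy in place of $h_\nu(\epsilon)$, e.g. upper Katok $\epsilon$-entropy along $\{F_n\}$.) *)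

(* Defs.v *)
From HB Require Import structures.
From mathcomp Require Import all_boot all_order all_algebra.
From mathcomp Require Import all_classical all_reals all_analysis.
From mathcomp Require Import finmap.
From Stdlib Require Lists.List.
Set Implicit Arguments. Unset Strict Implicit. Unset Printing Implicit Defensive.
Import Order.TTheory GRing.Theory Num.Theory numFieldNormedType.Exports.
Local Open Scope classical_set_scope.
Local Open Scope ring_scope.

Section Metric.
Context {R : realType} {X : Type} (d : X -> X -> R).

Definition is_metric : Prop :=
  [/\ forall x y, 0 <= d x y,
      forall x y, d x y = 0 <-> x = y,
      forall x y, d x y = d y x &
      forall x y z, d x z <= d x y + d y z].

Definition d_open (A : set X) : Prop :=
  forall x, A x -> exists2 r : R, 0 < r & forall y, d x y < r -> A y.

Definition d_compact : Prop :=
  forall (I : Type) (U : I -> set X), (forall i, d_open (U i)) ->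
    setT `<=` \bigcup_i U i ->
    exists s : seq I, forall x, exists i, Stdlib.Lists.List.In i s /\ U i x.

Definition d_continuous (f : X -> X) : Prop :=
  forall x (e : R), 0 < e -> exists2 r : R, 0 < r &
    forall y, d x y < r -> d (f x) (f y) < e.

Definition d_continuous_real (f : X -> R) : Prop :=
  forall x (e : R), 0 < e -> exists2 r : R, 0 < r &
    forall y, d x y < r -> `|f x - f y| < e.

End Metric.

Local Open Scope fset_scope.

Definition is_action {G : groupType} {X : Type} (act : G -> X -> X) : Prop :=
  (forall x, act 1%g x = x) /\
  (forall g h x, act (g * h)%g x = act g (act h x)).

Definition translate {G : groupType} (g : G) (F : {fset G}) : {fset G} :=
  [fset (g * x)%g | x in F].

Definition fsym_diff {G : choiceType} (A B : {fset G}) : {fset G} :=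
  (A `\` B) `|` (B `\` A).

Definition folner {R : realType} {G : groupType} (F : nat -> {fset G}) : Prop :=
  (forall n, F n != fset0) /\
  forall g : G, (fun n => (#|` fsym_diff (translate g (F n)) (F n)|%:R
                            / #|` F n|%:R : R)) @ \oo --> (0 : R).

Definition inv_prod {G : groupType} (A B : {fset G}) : {fset G} :=
  [fset (a^-1 * b)%g | a in A, b in B].

Definition tempered {R : realType} {G : groupType} (F : nat -> {fset G}) : Prop :=
  exists2 C : R, 0 < C & forall n,
    (#|` inv_prod (\big[fsetU/fset0]_(j < n) F j) (F n)|%:R : R)
      <= C * #|` F n|%:R.

Local Close Scope fset_scope.

Section Top.
Context {R : realType} {G : groupType} {X : Type}
  (act : G -> X -> X) (d : X -> X -> R) (F : nat -> {fset G}).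

Definition dF (A : {fset G}) (x y : X) : R :=
  \big[Num.max/0]_(g <- A) d (act g x) (act g y).

(* maximal cardinality of an (A,eps)-separated subset of X (for eps > 0 the
   points p i of such a family are automatically distinct) *)
Definition sep_num (A : {fset G}) (eps : R) : R :=
  sup [set n%:R | n in [set n : nat | exists p : 'I_n -> X,
        forall i j, i != j -> eps < dF A (p i) (p j)]].

Definition htop_eps (eps : R) : \bar R :=
  limn_esup (fun n => ((#|` F n|%:R)^-1 * ln (sep_num (F n) eps))%:E).

Definition mdimM_top (s : R) : \bar R :=
  limf_esup (fun eps => htop_eps eps * ((ln (eps^-1) `^ s)^-1)%:E)%E (at_right 0).

Definition DM_top : \bar R :=
  ereal_inf [set s%:E | s in [set s : R | 0 < s /\ mdimM_top s = 0%E]].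

End Top.

Section Meas.
Context {R : realType} {G : groupType} {dX : measure_display}
  {X : measurableType dX} (act : G -> X -> X) (d : X -> X -> R)
  (F : nat -> {fset G}).

Definition invariant_measure (mu : probability X R) : Prop :=
  forall g A, measurable A -> mu (act g @^-1` A) = mu A.

Definition ergodic_measure (mu : probability X R) : Prop :=
  invariant_measure mu /\
  forall A, measurable A -> (forall g, act g @^-1` A = A) ->
    mu A = 0%E \/ mu A = 1%E.

Definition is_partition (k : nat) (alpha : 'I_k -> set X) : Prop :=
  [/\ forall i, measurable (alpha i),
      forall i j, i != j -> alpha i `&` alpha j = set0 &
      setT `<=` \bigcup_i alpha i].

Definition diam_le (k : nat) (alpha : 'I_k -> set X) (eps : R) : Prop :=
  forall i x y, alpha i x -> alpha i y -> d x y <= eps.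

Definition ent (t : R) : R := - (t * ln t).

(* H_mu( \/_{g in A} g^{-1} alpha ): the atoms are indexed by c : A -> 'I_k *)
Definition H_join (mu : probability X R) (k : nat) (alpha : 'I_k -> set X)
    (A : {fset G}) : R :=
  \sum_(c : {ffun A -> 'I_k})
     ent (fine (mu [set x | forall g : A, alpha (c g) (act (val g) x)])).

Definition h_part (mu : probability X R) (k : nat) (alpha : 'I_k -> set X) : R :=
  limn (fun n => (#|` F n|%:R)^-1 * H_join mu alpha (F n)).

Definition h_eps (mu : probability X R) (eps : R) : R :=
  inf [set h | exists k (alpha : 'I_k -> set X),
         [/\ is_partition alpha, diam_le alpha eps & h = h_part mu alpha]].

(* an element of co(E(X,G)) together with its (unique) decomposition
   sum_{j<n} w_j mu_j, mu_j distinct ergodic, w_j > 0 *)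
Record ergodic_comb := ErgComb {
  ec_n : nat;
  ec_w : nat -> {nonneg R};
  ec_mu : nat -> probability X R }.

Definition ergodic_comb_ok (c : ergodic_comb) : Prop :=
  [/\ forall j, (j < ec_n c)%N -> 0 < (ec_w c j)%:num,
      \sum_(j < ec_n c) (ec_w c j)%:num = 1,
      forall j, (j < ec_n c)%N -> ergodic_measure (ec_mu c j) &
      forall i j, (i < ec_n c)%N -> (j < ec_n c)%N -> ec_mu c i = ec_mu c j ->
        i = j].

Definition ec_measure (c : ergodic_comb) :=
  msum (fun j => mscale (ec_w c j) (ec_mu c j)) (ec_n c).

Definition Fcomb (c : ergodic_comb) (eps : R) : R :=
  \sum_(j < ec_n c) (ec_w c j)%:num * h_eps (ec_mu c j) eps.

Definition in_MG (mu : probability X R) (fam : R -> ergodic_comb) : Prop :=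
  (forall eps, 0 < eps -> ergodic_comb_ok (fam eps)) /\
  forall f : X -> R, d_continuous_real d f ->
    (fun eps => (\int[ec_measure (fam eps)]_x (f x)%:E)%E) @ at_right 0
      --> (\int[mu]_x (f x)%:E)%E.

Definition mdimM_meas (mu : probability X R) (s : R) : \bar R :=
  ereal_sup [set limf_esup
     (fun eps => ((Fcomb (fam eps) eps) * (ln (eps^-1) `^ s)^-1)%:E) (at_right 0)
     | fam in [set fam | in_MG mu fam]].

Definition DM_meas (mu : probability X R) : \bar R :=
  ereal_inf [set s%:E | s in [set s : R | 0 < s /\ mdimM_meas mu s = 0%E]].

End Meas.

(* Main.v *)
(* For an ergodic measure nu, h_nu(2 delta) is at most twice the topological entropy at scale delta plus a
   constant: a quasi-tiling of X by orbit pieces of a few Folner shapes turns delta-nets for the metrics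
   d_(F_n) into one partition of diameter at most 2 delta. When almost all stabilizers have k points the
   tiling covers X up to 2k times, but the entropy of a label then drops by the factor k.
   Conversely, if the topological entropy at scale 16 eps exceeds T, some ergodic nu has
   h_nu(eps) >= T - 4: Misiurewicz' empirical measures give an invariant measure, Shearer's inequality
   replacing tilings and continuous approximations of the atoms making the bound uniform over all
   partitions; the ergodic decomposition then yields an ergodic one.
   The first bound controls every family in M_G(mu). For the maximum, take scales eps_m -> 0 along which
   the topological entropy is large, ergodic nu_m with large eps_m-entropy, and a weak limit mu of a
   subsequence: the family equal to nu_m at eps_m witnesses the dimension. *)

Require Import Defs.
From HB Require Import structures.
From mathcomp Require Import all_boot all_order all_algebra.
From mathcomp Require Import all_classical all_reals all_analysis.
From mathcomp Require Import finmap.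
From mathcomp Require Import measurable_realfun.
From mathcomp Require Import lra ring zify.
Import Order.TTheory GRing.Theory Num.Theory numFieldNormedType.Exports.
Local Open Scope classical_set_scope.
Local Open Scope ring_scope.
Set Implicit Arguments.
Unset Strict Implicit.
Unset Printing Implicit Defensive.

(** * Entropy of finite-valued functions *)

(** Additive constants and rescalings of eps in both bounds are harmless: the entropies are compared
    with (log 1/eps)^s for s > 0, so additive terms disappear and a bounded change of scale costs at
    most a factor 2^s. The upper bound has to exhibit a partition, but the action need not be free,
    so points of a tile may coincide. By ergodicity the order of the stabilizer is almost everywhere
    constant, finite or infinite, and when finite it bounds the overcount of the tiling. In the
    lower bound h_nu(eps) is an infimum over arbitrary Borel partitions, whose entropies do not pass
    to weak limits; the estimates therefore let the diameter grow by a factor 4 in exchange for one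
    unit of window entropy. Doing this twice, for the invariant measure and for its ergodic
    components, produces the factor 16. Entropy rates are infima over all finite windows, not only
    limits along F_n, so one good window bounds a rate. No disintegration is used: finite partitions
    into almost invariant boxes stand in for the ergodic components. *)

Section Ent.
Context {R : realType}.

Lemma ent0 : ent (0 : R) = 0. Proof. by rewrite /ent mul0r oppr0. Qed.

Lemma ent1 : ent (1 : R) = 0. Proof. by rewrite /ent ln1 mulr0 oppr0. Qed.

Lemma ent_ge0 (t : R) : 0 <= t <= 1 -> 0 <= ent t.
Proof.
move=> /andP[t0 t1]; rewrite /ent oppr_ge0 mulr_ge0_le0 //.
exact: ln_le0.
Qed.

Lemma ln_le_subr1 (x : R) : 0 < x -> ln x <= x - 1.
Proof. by move=> x0; have := @le_ln1Dx R (x - 1); rewrite (addrC 1) subrK; apply; lra. Qed.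

Lemma ln_card_ge0 (T : finType) : 0 <= ln #|T|%:R :> R.
Proof. by case: (posnP #|T|) => [->|?]; [rewrite ln0|rewrite ln_ge0 // ler1n]. Qed.

(** This is [ln t <= t - 1] at t = y / x. Keeping the linear term y - x makes it usable for masses
    that are not normalized; it cancels when both families have the same total. Most entropy
    estimates below are this inequality for a well-chosen comparison value y. *)
Lemma ent_gibbs (x y : R) : 0 <= x -> 0 <= y -> (y = 0 -> x = 0) ->
  ent x <= - (x * ln y) + (y - x).
Proof.
move=> x0 y0 yx.
have [->|xn] := eqVneq x 0; first by rewrite ent0 mul0r; lra.
have xp : 0 < x by rewrite lt_def xn.
have yp : 0 < y by rewrite lt_def y0 andbT; apply/eqP => /yx/eqP; rewrite (negbTE xn).
have yxp : 0 < y / x by rewrite divr_gt0.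
have := ln_le_subr1 yxp; rewrite ln_div ?posrE // => h.
have := ler_wpM2l x0 h; rewrite !mulrBr mulr1 mulrCA divff // mulr1 /ent; lra.
Qed.

Lemma ent_add (x y : R) : 0 <= x -> 0 <= y -> ent (x + y) <= ent x + ent y.
Proof.
move=> x0 y0.
have [->|xn] := eqVneq x 0; first by rewrite ent0 !add0r.
have [->|yn] := eqVneq y 0; first by rewrite ent0 !addr0.
have xp : 0 < x by rewrite lt_def xn.
have yp : 0 < y by rewrite lt_def yn.
rewrite /ent mulrDl opprD lerD // lerN2 ler_pM2l // ler_ln ?posrE; lra.
Qed.

Lemma ent_sum (I : finType) (p : I -> R) : (forall i, 0 <= p i) ->
  ent (\sum_i p i) <= \sum_i ent (p i).
Proof.
move=> p0.
suff [] : 0 <= \sum_i p i /\ ent (\sum_i p i) <= \sum_i ent (p i) by [].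
elim/big_rec2: _ => [|i a b _ [b0 ab]]; first by rewrite ent0.
by split; [exact: addr_ge0|apply: le_trans (ent_add _ _) _ => //; rewrite lerD2l].
Qed.

(** Comparison of each x i with the barycentre: after weighting, the linear terms cancel. *)
Lemma ent_jensen (I : finType) (w x : I -> R) : (forall i, 0 <= w i) ->
  (forall i, 0 <= x i) -> \sum_i w i = 1 ->
  \sum_i w i * ent (x i) <= ent (\sum_i w i * x i).
Proof.
move=> w0 x0 w1; set b := \sum_i w i * x i.
have b0 : 0 <= b by apply: sumr_ge0 => i _; rewrite mulr_ge0.
have h i : w i * ent (x i) <= - (w i * x i * ln b) + (w i * b - w i * x i).
  have [->|wi] := eqVneq (w i) 0; first by rewrite !mul0r; lra.
  have bx : b = 0 -> x i = 0.
    move=> bz; have : w i * x i = 0.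
      by apply: (psumr_eq0P _ bz) => // j _; rewrite mulr_ge0.
    by move/eqP; rewrite mulf_eq0 (negbTE wi) => /eqP.
  have g := ent_gibbs (x0 i) b0 bx.
  by apply: le_trans (ler_wpM2l (w0 i) g) _; rewrite le_eqVlt; apply/orP; left; apply/eqP; ring.
apply: le_trans (ler_sum _ (fun i _ => h i)) _.
rewrite big_split /= sumrB sumrN -!mulr_suml w1 mul1r -/b /ent; lra.
Qed.

(** Comparison with the uniform value s / n. The total mass s is left free because the lemma is
    applied to labels carried by a set of small measure, whose cost is then proportional to that
    measure. *)
Lemma sum_ent_le (I : finType) (P : pred I) (p : I -> R) (n : nat) :
  (forall i, 0 <= p i) -> (#|P| <= n)%N ->
  \sum_(i | P i) ent (p i) <= ent (\sum_(i | P i) p i) +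
     (\sum_(i | P i) p i) * ln n%:R.
Proof.
move=> p0; set s := \sum_(i | P i) p i => Pn.
have s0 : 0 <= s by exact: sumr_ge0.
have [sz|sn] := eqVneq s 0.
  rewrite sz mul0r ent0 addr0 big1 // => i Pi.
  suff -> : p i = 0 by rewrite ent0.
  by apply: (psumr_eq0P _ sz).
have sp : 0 < s by rewrite lt_def sn.
have np : (0 < n)%N.
  apply: leq_trans Pn; rewrite lt0n; apply: contra sn => /eqP/card0_eq P0.
  by rewrite /s big_pred0.
have np' : 0 < n%:R :> R by rewrite ltr0n.
have h i : ent (p i) <= - (p i * ln (s / n%:R)) + (s / n%:R - p i).
  apply: ent_gibbs => //; first by rewrite divr_ge0.
  by move/eqP; rewrite mulf_eq0 (negbTE sn) invr_eq0 gt_eqF.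
apply: le_trans (ler_sum _ (fun i _ => h i)) _.
rewrite big_split /= sumrB sumrN -!mulr_suml -/s sumr_const ln_div ?posrE // /ent.
suff : s / n%:R *+ #|P| <= s by lra.
by rewrite -mulr_natr -mulrA ler_piMr // mulrC ler_pdivrMr // mul1r ler_nat.
Qed.

(** Nonnegativity of mutual information, by comparing a t s with the product of its marginals
    divided by the total. The total is not assumed to be 1, so that the inequality applies on each
    atom of a coarser partition. *)
Lemma sum_ent_submod (T S : finType) (a : T -> S -> R) :
  (forall t s, 0 <= a t s) ->
  \sum_t \sum_s ent (a t s) + ent (\sum_t \sum_s a t s) <=
  \sum_t ent (\sum_s a t s) + \sum_s ent (\sum_t a t s).
Proof.
move=> a0; set A := \sum_t \sum_s a t s.
set r := fun t => \sum_s a t s; set c := fun s => \sum_t a t s.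
have r0 t : 0 <= r t by exact: sumr_ge0.
have c0 s : 0 <= c s by exact: sumr_ge0.
have rA : \sum_t r t = A by [].
have cA : \sum_s c s = A by rewrite /A exchange_big.
have A0 : 0 <= A by rewrite -rA sumr_ge0.
have h t s : ent (a t s) <= - (a t s * ln (r t)) - a t s * ln (c s) + a t s * ln A
     + (r t * c s / A - a t s).
  have [->|an] := eqVneq (a t s) 0.
    by rewrite ent0 !mul0r !subr0 addr0 oppr0 add0r divr_ge0 // mulr_ge0.
  have ap : 0 < a t s by rewrite lt_def an a0.
  have rp : 0 < r t by apply: lt_le_trans ap _; rewrite /r (bigD1 s) //= lerDl sumr_ge0.
  have cp : 0 < c s by apply: lt_le_trans ap _; rewrite /c (bigD1 t) //= lerDl sumr_ge0.
  have Ap : 0 < A by apply: lt_le_trans rp _; rewrite -rA (bigD1 t) //= lerDl sumr_ge0.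
  have bp : 0 < r t * c s / A by rewrite divr_gt0 // mulr_gt0.
  have := @ent_gibbs (a t s) (r t * c s / A) (a0 _ _) (ltW bp).
  have bn : r t * c s / A = 0 -> a t s = 0 by move/eqP; rewrite gt_eqF.
  move=> /(_ bn); rewrite ln_div ?posrE ?mulr_gt0 // lnM ?posrE //; lra.
have sumE (f : S -> R) : \sum_t \sum_s a t s * f s = \sum_s c s * f s.
  by rewrite exchange_big; apply: eq_bigr => s _; rewrite mulr_suml.
have le1 : \sum_t \sum_s ent (a t s) <= \sum_t \sum_s (- (a t s * ln (r t))
   - a t s * ln (c s) + a t s * ln A + (r t * c s / A - a t s)).
  by apply: ler_sum => t _; apply: ler_sum => s _.
have le2 : \sum_t \sum_s (- (a t s * ln (r t))
   - a t s * ln (c s) + a t s * ln A + (r t * c s / A - a t s)) =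
   - (\sum_t r t * ln (r t)) - (\sum_s c s * ln (c s)) + A * ln A + (A * A / A - A).
  rewrite (eq_bigr (fun t => - (r t * ln (r t)) - (\sum_s a t s * ln (c s))
     + r t * ln A + (r t * A / A - r t))); last first.
    move=> t _; rewrite !big_split /= !sumrN -!mulr_suml; congr (_ + _ + _ + (_ - _)).
    by rewrite -mulr_sumr cA.
  by rewrite !big_split /= !sumrN sumE -!mulr_suml rA.
rewrite (_ : \sum_t ent _ = - (\sum_t r t * ln (r t))); last by rewrite -sumrN.
rewrite (_ : \sum_s ent _ = - (\sum_s c s * ln (c s))); last by rewrite -sumrN.
have AA : A * A / A <= A.
  by have [->|An] := eqVneq A 0; [rewrite !mul0r|rewrite mulfK].
by move: le1; rewrite le2 /ent; lra.
Qed.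

(** Lower bounds on q suffice: both laws have mass 1, so p - e <= q forces q <= p + n e. Such
    one-sided bounds are what integrals of continuous functions lying below indicators can
    supply. *)
Lemma sum_ent_usc (C : finType) (p : C -> R) : (forall c, 0 <= p c) ->
  \sum_c p c = 1 -> exists2 e : R, 0 < e & forall q : C -> R, (forall c, 0 <= q c) ->
    \sum_c q c = 1 -> (forall c, p c - e <= q c) ->
    \sum_c ent (q c) <= \sum_c ent (p c) + 1.
Proof.
move=> p0 p1; set n : R := #|C|%:R.
have n0 : 0 <= n by rewrite ler0n.
(* Comparison with p + k instead of p keeps the logarithm above ln k even where p vanishes. This
   costs n k <= 1/2 in total, and [e] is chosen so that the error n^2 e (- ln k) is at most 1/2 as
   well. *)
pose k := (2 * (n + 1))^-1.
have k0 : 0 < k by rewrite invr_gt0; lra.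
have k1 : k <= 1 by rewrite invf_le1; lra.
have lk : ln k <= 0 by exact: ln_le0.
pose e := (2 * (n + 1) ^+ 2 * (1 - ln k))^-1.
have e0 : 0 < e.
  by rewrite invr_gt0 !mulr_gt0 ?exprn_gt0 //; lra.
exists e => // q q0 q1 qp.
have pn c : p c <= 1 by rewrite -p1 (bigD1 c) //= lerDl sumr_ge0.
have qle c : q c <= p c + n * e.
  have : \sum_(i | i != c) (p i - e) <= \sum_(i | i != c) q i by apply: ler_sum.
  move: p1 q1; rewrite (bigD1 c) //= (bigD1 (F := q) c) //= sumrB => p1 q1.
  have : \sum_(i | i != c) e <= n * e.
    by rewrite sumr_const mulr_natl ler_pMn2l // max_card.
  lra.
have h c : ent (q c) <= ent (p c) + n * e * (- ln k) + (p c + k - q c).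
  have pk : 0 < p c + k by have := p0 c; lra.
  have pz : p c + k = 0 -> q c = 0 by move=> pz; move: pk; rewrite pz ltxx.
  have g := ent_gibbs (q0 c) (ltW pk) pz.
  apply: le_trans g _; rewrite lerD2r.
  have ep : 0 <= ent (p c) by rewrite ent_ge0 // p0 pn.
  have ne : 0 <= n * e * (- ln k) by rewrite !mulr_ge0 // ?oppr_ge0 // ltW.
  have [b1|b1] := leP 0 (ln (p c + k)).
    have : 0 <= q c * ln (p c + k) by rewrite mulr_ge0.
    lra.
  rewrite -mulrN; apply: le_trans (ler_wpM2r _ (qle c)) _; first by lra.
  rewrite mulrDl lerD //.
    rewrite /ent mulrN lerN2; have [->|pcn] := eqVneq (p c) 0; first by rewrite !mul0r.
    have pc : 0 < p c by rewrite lt_def pcn p0.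
    by rewrite ler_pM2l // ler_ln ?posrE //; lra.
  rewrite ler_wpM2l //; first by rewrite mulr_ge0 // ltW.
  by rewrite lerN2 ler_ln ?posrE //; have := p0 c; lra.
apply: le_trans (ler_sum _ (fun c _ => h c)) _.
rewrite big_split sumrB !big_split /= p1 q1 !sumr_const -(mulr_natl (n * e * _)) -(mulr_natl k) -/n.
suff : n * (n * e * - ln k) <= 1/2 /\ n * k <= 1/2 by lra.
split.
  have : n * n * (- ln k) <= (n+1)^+2 * (1 - ln k).
    rewrite expr2; apply: ler_pM; [exact: mulr_ge0|lra| |lra].
    by apply: ler_pM; lra.
  rewrite -(ler_pM2r e0) => le3.
  have E : (n + 1) ^+ 2 * (1 - ln k) * e = 1/2.
    rewrite /e; field; rewrite -?expr2; apply/andP; split; rewrite gt_eqF//; lra.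
  by rewrite E in le3; lra.
by rewrite /k ler_pdivrMr; lra.
Qed.

End Ent.

(** * Shannon entropy for finitely additive probabilities *)

Section Charge.
Context {R : realType} {X : Type}.

Record charge (M : set (set X)) (m : set X -> R) : Prop := {
  chT : M setT;
  chI : forall A B, M A -> M B -> M (A `&` B);
  chC : forall A, M A -> M (~` A);
  ch_ge0 : forall A, M A -> 0 <= m A;
  ch_1 : m setT = 1;
  ch_split : forall A B, M A -> M B -> m A = m (A `&` B) + m (A `&` ~` B) }.

Definition ofin (M : set (set X)) (T : finType) (f : X -> T) :=
  forall t, M [set x | f x = t].

Definition Hent (m : set X -> R) (T : finType) (f : X -> T) : R :=
  \sum_t ent (m [set x | f x = t]).

Variables (M : set (set X)) (m : set X -> R).
Hypothesis cm : charge M m.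

Lemma ch0 : m set0 = 0.
Proof.
have := ch_split cm (chT cm) (chT cm); rewrite setTI setCT setTI; lra.
Qed.

Lemma chM0 : M set0.
Proof. by rewrite -setCT; exact: chC cm _ (chT cm). Qed.

Lemma chU A B : M A -> M B -> M (A `|` B).
Proof. by move=> a b; rewrite -(setCK (A `|` B)) setCU; do ?[apply: (chC cm)|apply: (chI cm)]. Qed.

Lemma ch_mono A B : M A -> M B -> A `<=` B -> m A <= m B.
Proof.
move=> a b AB; rewrite (ch_split cm b a) setIC (setIidl AB) lerDl.
by apply: (ch_ge0 cm); apply: (chI cm) => //; exact: chC cm _ a.
Qed.

Lemma ch_le1 A : M A -> m A <= 1.
Proof. by move=> a; rewrite -(ch_1 cm); apply: ch_mono => //; exact: chT cm. Qed.

Lemma ch_bigI (I : Type) (s : seq I) (P : pred I) (A : I -> set X) : (forall i, M (A i)) ->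
  M (\big[setI/setT]_(i <- s | P i) A i).
Proof. by move=> h; elim/big_rec: _ => [|i B _ b]; [exact: chT cm|exact: chI cm _ _ _ b]. Qed.

Lemma ch_bigU (I : Type) (s : seq I) (P : pred I) (A : I -> set X) : (forall i, M (A i)) ->
  M (\big[setU/set0]_(i <- s | P i) A i).
Proof. by move=> h; elim/big_rec: _ => [|i B _ b]; [exact: chM0|exact: chU]. Qed.

Lemma ch_sum (T : finType) (f : X -> T) A : ofin M f -> M A ->
  m A = \sum_t m (A `&` [set x | f x = t]).
Proof.
move=> mf mA.
have key (s : seq T) : uniq s -> m A = \sum_(t <- s) m (A `&` [set x | f x = t])
      + m (A `&` [set x | f x \notin s]) /\ M [set x | f x \notin s].
  elim: s => [|t s IH] /=.
    move=> _; rewrite big_nil add0r (_ : [set x | _] = setT) ?setIT; last first.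
      by apply/seteqP; split.
    by split=> //; exact: chT cm.
  move=> /andP[ts us]; have [IH1 IH2] := IH us.
  have E : [set x | f x \notin t :: s] = [set x | f x \notin s] `&` ~` [set x | f x = t].
    apply/seteqP; split=> x /=; rewrite inE negb_or.
      by move=> /andP[/eqP].
    by move=> [-> /eqP ->].
  rewrite big_cons E; split; last by apply: (chI cm) => //; exact: chC cm _ (mf t).
  rewrite IH1 (ch_split cm (chI cm mA IH2) (mf t)) -!setIA addrCA addrA; congr (_ + _ + _).
  congr (m (_ `&` _)); apply/seteqP; split=> x /=; first by case.
  by move=> e; rewrite e.
have [] := key _ (index_enum_uniq T); rewrite (_ : [set x | _] = set0); last first.
  by apply/seteqP; split=> x //=; rewrite mem_index_enum.
by rewrite setI0 ch0 addr0.
Qed.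

Lemma ch_sum1 (T : finType) (f : X -> T) : ofin M f -> \sum_t m [set x | f x = t] = 1.
Proof.
move=> mf; rewrite -(ch_1 cm) (ch_sum mf (chT cm)).
by apply: eq_bigr => t _; rewrite setTI.
Qed.

Lemma Hent_ge0 (T : finType) (f : X -> T) : ofin M f -> 0 <= Hent m f.
Proof.
by move=> mf; apply: sumr_ge0 => t _; rewrite ent_ge0 // (ch_ge0 cm) //= ch_le1.
Qed.

Lemma ofin_pair (T S : finType) (f : X -> T) (g : X -> S) : ofin M f -> ofin M g ->
  ofin M (fun x => (f x, g x)).
Proof.
move=> mf mg [t s]; rewrite (_ : [set x | _] = [set x | f x = t] `&` [set x | g x = s]).
  exact: chI cm _ _ _ _.
by apply/seteqP; split=> x /=; [case=> -> ->|case=> -> ->].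
Qed.

Lemma ofin_pred (T : finType) (f : X -> T) (P : pred T) : ofin M f -> M [set x | P (f x)].
Proof.
move=> mf; rewrite (_ : [set x | _] = \big[setU/set0]_(t | P t) [set x | f x = t]).
  exact: ch_bigU.
rewrite -bigcup_seq_cond; apply/seteqP; split=> x /=.
  by move=> Px; exists (f x) => //=; rewrite mem_index_enum.
by move=> [t /=]; rewrite mem_index_enum => /andP[_ Pt] ->.
Qed.

Lemma Hent_pairE (T S : finType) (f : X -> T) (g : X -> S) :
  Hent m (fun x => (f x, g x)) = \sum_t \sum_s ent (m ([set x | f x = t] `&` [set x | g x = s])).
Proof.
rewrite pair_bigA; apply: eq_bigr => -[t s] _ /=; congr (ent (m _)).
by apply/seteqP; split=> x /=; [case=> -> ->|case=> -> ->].
Qed.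

Lemma Hent_mono (T S : finType) (f : X -> T) (g : X -> S) : ofin M f -> ofin M g ->
  (forall x y, f x = f y -> g x = g y) -> Hent m g <= Hent m f.
Proof.
move=> mf mg fg.
have le1 u : ent (m [set x | g x = u]) <=
    \sum_t ent (m ([set x | g x = u] `&` [set x | f x = t])).
  rewrite (ch_sum mf (mg u)); apply: ent_sum => t.
  by apply: (ch_ge0 cm); exact: chI cm _ _ _ _.
apply: le_trans (ler_sum _ (fun u _ => le1 u)) _.
rewrite exchange_big; apply: ler_sum => t _.
have [[x0 /= fx0]|nx] := pselect (exists x, f x = t); last first.
  rewrite big1 ?ent_ge0 ?(ch_ge0 cm) ?ch_le1 // => u _.
  rewrite (_ : _ `&` _ = set0) ?ch0 ?ent0 //.
  by apply/seteqP; split=> x //= [_ h]; apply: nx; exists x.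
rewrite (bigD1 (g x0)) //= big1 ?addr0; last first.
  move=> u un; rewrite (_ : _ `&` _ = set0) ?ch0 ?ent0 //.
  apply/seteqP; split=> x //= [gx h]; move/eqP: un; apply.
  by rewrite -gx; apply: fg; rewrite h.
rewrite (_ : _ `&` _ = [set x | f x = t]) //.
apply/seteqP; split=> x /=; first by case.
by move=> h; split => //; apply: fg; rewrite h.
Qed.

Lemma Hent_eq (T S : finType) (f : X -> T) (g : X -> S) : ofin M f -> ofin M g ->
  (forall x y, f x = f y <-> g x = g y) -> Hent m g = Hent m f.
Proof.
move=> mf mg fg; apply/eqP; rewrite eq_le; apply/andP; split; apply: Hent_mono => // x y;
by have [? ?] := fg x y.
Qed.

(** Strong subadditivity, with h a common factor of f and g and k a factor of their join: on each
    atom of h the joint law of (f, g) is a matrix to which [sum_ent_submod] applies. For windows, h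
    and k are the names over the intersection and over the union. *)
Lemma Hent_submod (T S U V : finType) (f : X -> T) (g : X -> S) (h : X -> U) (k : X -> V) :
  ofin M f -> ofin M g -> ofin M h -> ofin M k ->
  (forall x y, f x = f y -> h x = h y) -> (forall x y, g x = g y -> h x = h y) ->
  (forall x y, f x = f y -> g x = g y -> k x = k y) ->
  Hent m k + Hent m h <= Hent m f + Hent m g.
Proof.
move=> mf mg mh mk fh gh fgk.
have mfg := ofin_pair mf mg.
have mfgh := ofin_pair mh mfg.
have mhf := ofin_pair mh mf.
have mhg := ofin_pair mh mg.
have le1 : Hent m k <= Hent m (fun x => (h x, (f x, g x))).
  by apply: Hent_mono => // x y [_ e1 e2]; exact: fgk.
have -> : Hent m f = Hent m (fun x => (h x, f x)).
  by apply: Hent_eq => // x y; split=> [[]//|e]; rewrite e (fh _ _ e).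
have -> : Hent m g = Hent m (fun x => (h x, g x)).
  by apply: Hent_eq => // x y; split=> [[]//|e]; rewrite e (gh _ _ e).
apply: le_trans (lerD le1 (lexx _)) _.
rewrite !Hent_pairE /Hent -!big_split; apply: ler_sum => u _ /=.
pose a t s := m ([set x | h x = u] `&` [set x | (f x, g x) = (t, s)]).
have -> : \sum_s ent (m ([set x | h x = u] `&` [set x | (f x, g x) = s])) =
    \sum_t \sum_s ent (a t s) by rewrite pair_bigA; apply: eq_bigr => -[].
have Er t : m ([set x | h x = u] `&` [set x | f x = t]) = \sum_s a t s.
  rewrite (ch_sum mg (chI cm (mh u) (mf t))); apply: eq_bigr => s _; congr m.
  by apply/seteqP; split=> x /=; [move=> [[-> ->] ->]|move=> [-> [-> ->]]].
have Ec s : m ([set x | h x = u] `&` [set x | g x = s]) = \sum_t a t s.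
  rewrite (ch_sum mf (chI cm (mh u) (mg s))); apply: eq_bigr => t _; congr m.
  by apply/seteqP; split=> x /=; [move=> [[-> ->] ->]|move=> [-> [-> ->]]].
have Eh : m [set x | h x = u] = \sum_t \sum_s a t s.
  by rewrite (ch_sum mf (mh u)); apply: eq_bigr => t _; rewrite -Er.
rewrite Eh (eq_bigr _ (fun t _ => congr1 ent (Er t))) (eq_bigr (fun s => ent (\sum_t a t s))).
  by apply: sum_ent_submod => t s; exact: (ch_ge0 cm (chI cm (mh _) (mfg _))).
by move=> s _; rewrite Ec.
Qed.

Lemma Hent_le_pair (T S : finType) (f : X -> T) (g : X -> S) : ofin M f -> ofin M g ->
  Hent m (fun x => (f x, g x)) <= Hent m f + Hent m g.
Proof.
move=> mf mg; have mp := ofin_pair mf mg.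
have mt : ofin M (fun x : X => tt).
  by move=> t; rewrite (_ : [set x | _] = setT); [exact: chT cm|apply/seteqP; split=> // x _ /=; case: t].
have h := Hent_submod mf mg mt mp (fun _ _ _ => erefl) (fun _ _ _ => erefl).
by apply: le_trans (h _) => [|x y -> ->//]; rewrite lerDl; exact: Hent_ge0.
Qed.

Lemma Hent_le_ln (T : finType) (f : X -> T) : ofin M f -> Hent m f <= ln #|T|%:R.
Proof.
move=> mf; apply: le_trans (sum_ent_le (P := xpredT) _ (leqnn _)) _.
  by move=> t; exact: ch_ge0 cm _ (mf t).
by rewrite ch_sum1 // ent1 add0r mul1r.
Qed.

End Charge.

(** * Submodular set functions and Shearer's inequality *)

Section Shearer.
Context {R : realType} {G : groupType}.

Variable eta : {fset G} -> R.
Hypothesis eta0 : eta fset0%fset = 0.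
Hypothesis eta_mono : forall A B, (A `<=` B)%fset -> eta A <= eta B.
Hypothesis eta_sub : forall A B, eta (A `|` B)%fset + eta (A `&` B)%fset <= eta A + eta B.

(* The chain-rule increments of a submodular function along an enumeration of W sum to eta(W) and
   never exceed eta on subsets; Shearer's inequality is then a double count. *)
Lemma submod_marginals (W : {fset G}) : exists D : G -> R,
  [/\ forall g, 0 <= D g, \sum_(g <- W) D g = eta W &
      forall S, (S `<=` W)%fset -> \sum_(g <- S) D g <= eta S].
Proof.
elim/finSet_rect: W => W IH.
have [->|/fset0Pn[w wW]] := eqVneq W fset0%fset.
  exists (fun=> 0); split=> //; first by rewrite big_seq_fset0 eta0.
  by move=> S; rewrite fsubset0 => /eqP ->; rewrite big_seq_fset0 eta0.
have [D [D0 DW DS]] := IH (W `\ w)%fset (fproperD1 wW).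
pose D' g := if g == w then eta W - eta (W `\ w)%fset else D g.
have DE (S : {fset G}) : w \notin S -> \sum_(g <- S) D' g = \sum_(g <- S) D g.
  move=> wS; rewrite big_seq [RHS]big_seq; apply: eq_bigr => g gS.
  by rewrite /D'; case: eqP => // gw; rewrite -gw gS in wS.
have DE1 (S : {fset G}) : w \in S -> \sum_(g <- S) D' g =
    (eta W - eta (W `\ w)%fset) + \sum_(g <- (S `\ w)%fset) D g.
  by move=> wS; rewrite (big_fsetD1 w) //= DE ?fsetD11 // {1}/D' eqxx.
exists D'; split.
- by move=> g; rewrite /D'; case: ifP => // _; rewrite subr_ge0 eta_mono // fsubD1set.
- by rewrite DE1 // DW subrK.
- move=> S SW; have [wS|wS] := boolP (w \in S).
    rewrite DE1 //; have /DS : (S `\ w `<=` W `\ w)%fset by exact: fsetSD.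
    have := eta_sub S (W `\ w)%fset.
    have -> : (S `|` W `\ w)%fset = W.
      apply/fsetP => g; rewrite !inE; have [->|] := eqVneq g w; first by rewrite wS wW.
      by move=> _ /=; apply/orP/idP => [[/(fsubsetP SW)|]//|]; right.
    have -> : (S `&` (W `\ w) = S `\ w)%fset.
      apply/fsetP => g; rewrite !inE; have [|] := eqVneq g w; rewrite ?andbF //= => _.
      by have [/(fsubsetP SW) ->//|] := boolP (g \in S).
    lra.
  by rewrite DE //; apply: DS; apply/fsubsetD1P.
Qed.

(** Right translates are the ones that match windows: the name of g x over A is the name of x over A
    g. Moreover A g meets W exactly when g lies in A^-1 W, a set barely larger than W when W is a
    left Folner set. *)
Definition rtrans (A : {fset G}) (g : G) : {fset G} := [fset (a * g)%g | a in A]%fset.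

Lemma mem_rtrans (A : {fset G}) g h : (h \in rtrans A g) = ((h * g^-1)%g \in A).
Proof.
apply/imfsetP/idP => [[a aA ->]|hA]; first by rewrite mulgK.
by exists (h * g^-1)%g => //; rewrite mulgVK.
Qed.

Lemma mem_inv_prod (A B : {fset G}) g :
  reflect (exists2 a, a \in A & (a * g)%g \in B) (g \in inv_prod A B).
Proof.
apply: (iffP (imfset2P _ _ _ _ _)) => [[a aA [b bB ->]]|[a aA bB]].
  by exists a => //; rewrite mulVKg.
by exists a => //; exists (a * g)%g => //; rewrite mulKg.
Qed.

(** Each w in W belongs to E g for the |E| elements g = e^-1 w, all of which lie in E^-1 W; so the
    sum over g counts the increment at w at least |E| times. *)
Lemma shearer (E W : {fset G}) : #|` E|%:R * eta W <=
  \sum_(g <- inv_prod E W) eta (rtrans E g `&` W)%fset.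
Proof.
have [D [D0 DW DS]] := submod_marginals W.
have h g : \sum_(w <- (rtrans E g `&` W)%fset) D w <= eta (rtrans E g `&` W)%fset.
  by apply: DS; exact: fsubsetIr.
apply: le_trans (ler_sum _ (fun g _ => h g)).
rewrite (eq_bigr (fun g => \sum_(w <- W) if w \in rtrans E g then D w else 0)); last first.
  move=> g _; rewrite -big_mkcond /= [RHS]big_fset_condE; apply: eq_fbigl => w.
  by rewrite !inE andbC.
rewrite exchange_big /= -DW mulr_sumr big_seq [leRHS]big_seq; apply: ler_sum => w wW.
rewrite -big_mkcond /= big_fset_condE /=.
set A := [fset _ in _ | _]%fset.
rewrite big_const_seq count_predT iter_addr_0 -[leRHS]mulr_natl ler_wpM2r // ler_nat.
have -> : #|` E| = #|` [fset (e^-1 * w)%g | e in E]%fset|.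
  by rewrite card_imfset //= => e f /mulIg /invg_inj.
apply/fsubset_leq_card/fsubsetP => g /imfsetP[e /= eE ->].
rewrite !inE /= mem_rtrans invgM invgK mulVKg eE andbT.
by apply/mem_inv_prod; exists e => //; rewrite mulVKg.
Qed.

End Shearer.

Lemma sum_fset_const {R : pzRingType} (T : choiceType) (A : {fset T}) (c : R) :
  \sum_(g <- A) c = #|` A|%:R * c.
Proof. by rewrite big_const_seq count_predT iter_addr_0 mulr_natl. Qed.

Lemma leq_card_bigfcup (T S : choiceType) (s : seq T) (A : T -> {fset S}) :
  (#|` (\bigcup_(i <- s) A i)%fset| <= \sum_(i <- s) #|` A i|)%N.
Proof.
elim/big_rec2: _ => [|i n B _ h]; first by rewrite cardfs0.
by apply: leq_trans (leq_card_fsetU _ _).1 _; rewrite leq_add2l.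
Qed.

(** * Folner sets and rates of submodular functions *)

Section Folner.
Context {R : realType} {G : groupType} (F : nat -> {fset G}).
Hypothesis F_folner : @folner R G F.

Lemma folner_card_gt0 n : (0 : R) < #|` F n|%:R.
Proof. by rewrite ltr0n cardfs_gt0; exact: (F_folner.1 n). Qed.

Lemma folner_near (g : G) (e : R) : 0 < e ->
  \forall n \near \oo, #|` fsym_diff (translate g (F n)) (F n)|%:R <= e * #|` F n|%:R.
Proof.
move=> e0; have := F_folner.2 g => /cvgrPdist_le/(_ e e0); apply: filterS => n.
rewrite sub0r normrN ger0_norm ?divr_ge0 //.
by rewrite ler_pdivrMr ?folner_card_gt0.
Qed.

Lemma near_fset (T : choiceType) (A : {fset T}) (P : T -> nat -> Prop) :
  (forall g, g \in A -> \forall n \near \oo, P g n) ->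
  \forall n \near \oo, forall g, g \in A -> P g n.
Proof.
elim/fset1U_rect: A => [|g A gA IH] h; first by near=> n.
have h1 := h g (fset1U1 _ _).
have h2 : \forall n \near \oo, forall g, g \in A -> P g n.
  by apply: IH => k kA; apply: h; rewrite !inE kA orbT.
by near=> n => k; rewrite !inE => /orP[/eqP ->|kA]; [near: n|move: k kA; near: n].
Unshelve. all: end_near. Qed.

Lemma mem_translate (g h : G) (A : {fset G}) : (h \in translate g A) = ((g^-1 * h)%g \in A).
Proof.
apply/imfsetP/idP => [[a aA ->]|hA]; first by rewrite mulKg.
by exists (g^-1 * h)%g => //; rewrite mulVKg.
Qed.

Lemma folner_in (g : G) (e : R) : 0 < e ->
  \forall n \near \oo, #|` [fset h in F n | (g * h)%g \notin F n]%fset|%:R <= e * #|` F n|%:R.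
Proof.
move=> e0; have := folner_near g e0; apply: filterS => n; apply: le_trans.
set A := [fset h in _ | _]%fset; rewrite ler_nat.
have -> : #|` A| = #|` [fset (g * h)%g | h in A]%fset|.
  by rewrite [RHS]card_imfset //= => x y /mulgI.
apply/fsubset_leq_card/fsubsetP => k /imfsetP[h /=]; rewrite !inE /= => /andP[hF ghF] ->.
by rewrite mem_translate mulKg hF ghF.
Qed.

Lemma folner_inv_prod (E : {fset G}) (e : R) : 0 < e ->
  \forall n \near \oo, #|` (inv_prod E (F n) `\` F n)%fset|%:R <= e * #|` F n|%:R.
Proof.
move=> e0; pose c : R := #|` E|%:R + 1.
have c0 : 0 < c by rewrite ltr_wpDl.
have := near_fset (A := E) (P := fun g n => #|` [fset h in F n | (g^-1 * h)%g \notin F n]%fset|%:R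
   <= e / c * #|` F n|%:R) (fun g _ => folner_in g^-1%g (divr_gt0 e0 c0)).
apply: filterS => n h.
have le1 : (#|` (inv_prod E (F n) `\` F n)%fset| <=
    \sum_(g <- E) #|` [fset h in F n | (g^-1 * h)%g \notin F n]%fset|)%N.
  rewrite (eq_bigr (fun g : G => #|` [fset (g^-1 * h)%g | h in
       [fset h in F n | (g^-1 * h)%g \notin F n]%fset]%fset|)); last first.
    by move=> g _; rewrite [RHS]card_imfset //= => x y /mulgI.
  apply: leq_trans (leq_card_bigfcup _ _).
  apply/fsubset_leq_card/fsubsetP => k; rewrite !inE => /andP[kF /mem_inv_prod[a aE akF]].
  apply/bigfcupP; exists a; first by rewrite aE.
  by apply/imfsetP; exists (a * k)%g; rewrite ?mulKg // !inE /= akF mulKg.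
apply: le_trans (_ : (\sum_(g <- E) #|` [fset h in F n | (g^-1 * h)%g \notin F n]%fset|)%:R <= _).
  by rewrite ler_nat.
rewrite natr_sum big_seq.
apply: le_trans (ler_sum _ (fun g gE => h g gE)) _.
rewrite -big_seq sum_fset_const mulrA ler_wpM2r //.
by rewrite mulrA ler_pdivrMr // mulrC ler_pM2l // lerDl.
Qed.

(** In Shearer's inequality every term is at most eta E, and there are |E^-1 F_n| terms, a number
    close to |F_n|. This gives the Ornstein-Weiss limit for submodular functions without
    quasi-tilings. *)
Lemma submod_folner_le (eta : {fset G} -> R) (E : {fset G}) (e : R) :
  eta fset0%fset = 0 -> (forall A B, (A `<=` B)%fset -> eta A <= eta B) ->
  (forall A B, eta (A `|` B)%fset + eta (A `&` B)%fset <= eta A + eta B) ->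
  (forall A g, eta (rtrans A g) = eta A) -> E != fset0%fset -> 0 < e ->
  \forall n \near \oo, #|` F n|%:R^-1 * eta (F n) <= eta E / #|` E|%:R + e.
Proof.
move=> h0 hm hs hi E0 e0.
have Ep : 0 < #|` E|%:R :> R by rewrite ltr0n cardfs_gt0.
have E1 : 0 <= eta E by rewrite -h0 hm.
have e1 : 0 < e / (eta E / #|` E|%:R + 1) by rewrite divr_gt0 // ltr_wpDl // divr_ge0.
have := folner_inv_prod E e1; apply: filterS => n hn.
have Fp := folner_card_gt0 n.
have sh := shearer h0 hm hs E (F n).
have le1 : \sum_(g <- inv_prod E (F n)) eta (rtrans E g `&` F n)%fset <=
   #|` inv_prod E (F n)|%:R * eta E.
  apply: le_trans (_ : \sum_(g <- inv_prod E (F n)) eta E <= _).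
    by apply: ler_sum => g _; rewrite -[leRHS](hi _ g) hm // fsubsetIl.
  by rewrite sum_fset_const.
have le2 : (#|` inv_prod E (F n)|%:R : R) <= #|` F n|%:R +
    #|` (inv_prod E (F n) `\` F n)%fset|%:R.
  rewrite -natrD ler_nat -(cardfsID (F n) (inv_prod E (F n))) leq_add2r.
  by apply: fsubset_leq_card; exact: fsubsetIr.
have le3 : #|` E|%:R * eta (F n) <=
    (#|` F n|%:R + e / (eta E / #|` E|%:R + 1) * #|` F n|%:R) * eta E.
  apply: le_trans sh _; apply: le_trans le1 _; rewrite ler_wpM2r //.
  by apply: le_trans le2 _; rewrite lerD2l.
rewrite mulrC ler_pdivrMr // -(ler_pM2l Ep); apply: le_trans le3 _.
set x := eta E / _; have Ex : eta E = #|` E|%:R * x by rewrite /x mulrCA divff ?mulr1 ?gt_eqF.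
have x0 : 0 <= x by rewrite divr_ge0.
have -> : (#|` F n|%:R + e / (x + 1) * #|` F n|%:R) * eta E =
    #|` E|%:R * ((x + e / (x + 1) * x) * #|` F n|%:R) by rewrite Ex; ring.
rewrite ler_pM2l // ler_pM2r // lerD2l mulrAC ler_pdivrMr ?ltr_wpDl //.
by rewrite ler_pM2l // lerDl.
Qed.

(** The limit is the infimum over all nonempty finite sets. The last clause lets an entropy rate be
    bounded through a window that is not a member of the sequence, for instance an inverse
    F_n^-1. *)
Lemma submod_folner_cvg (eta : {fset G} -> R) :
  eta fset0%fset = 0 -> (forall A B, (A `<=` B)%fset -> eta A <= eta B) ->
  (forall A B, eta (A `|` B)%fset + eta (A `&` B)%fset <= eta A + eta B) ->
  (forall A g, eta (rtrans A g) = eta A) ->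
  exists l : R, [/\ (fun n => #|` F n|%:R^-1 * eta (F n)) @ \oo --> l, 0 <= l &
     forall E, E != fset0%fset -> l <= eta E / #|` E|%:R].
Proof.
move=> h0 hm hs hi.
pose S := [set eta E / #|` E|%:R | E in [set E : {fset G} | E != fset0%fset]].
have S0 : S !=set0 by exists (eta (F 0%N) / #|` F 0%N|%:R); exists (F 0%N) => //; exact: F_folner.1.
have Slb : lbound S 0 by move=> _ [E _ <-]; rewrite divr_ge0 // -h0 hm.
have Si : has_inf S by split => //; exists 0.
exists (inf S); split.
- apply/cvgrPdist_le => e e0.
  have [_ [E /= E0 <-] hE] := inf_adherent (divr_gt0 e0 (ltr0n _ 2)) Si.
  have := submod_folner_le h0 hm hs hi E0 (divr_gt0 e0 (ltr0n _ 2)).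
  apply: filterS => n hn.
  have : inf S <= #|` F n|%:R^-1 * eta (F n).
    by apply: ge_inf; [exists 0|exists (F n); [exact: F_folner.1|rewrite mulrC]].
  rewrite ler_distlC => h; apply/andP; split; lra.
- exact: lb_le_inf.
- by move=> E E0; apply: ge_inf; [exists 0|exists E].
Qed.

End Folner.

(** * Names along finite windows and their entropy *)

Section Window.
Context {R : realType} {G : groupType} {X : Type} (act : G -> X -> X).
Hypothesis act_action : is_action act.

Definition win (T : finType) (f : X -> T) (A : {fset G}) (x : X) : {ffun A -> T} :=
  [ffun g : A => f (act (val g) x)].

Lemma win_eqP (T : finType) (f : X -> T) (A : {fset G}) x y :
  win f A x = win f A y <-> (forall g, g \in A -> f (act g x) = f (act g y)).
Proof.
split=> [/ffunP h g gA|h]; first by have := h [` gA]%fset; rewrite !ffunE.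
by apply/ffunP => g; rewrite !ffunE; apply: h; exact: valP.
Qed.

Variables (M : set (set X)) (m : set X -> R).
Hypothesis cm : charge M m.
Hypothesis M_act : forall g A, M A -> M (act g @^-1` A).

Lemma ofin_act (T : finType) (f : X -> T) g : ofin M f -> ofin M (f \o act g).
Proof. by move=> mf t; exact: (M_act g (mf t)). Qed.

Lemma ofin_win (T : finType) (f : X -> T) A : ofin M f -> ofin M (win f A).
Proof.
move=> mf c; rewrite (_ : [set x | _] =
   \big[setI/setT]_(g : A) [set x | f (act (val g) x) = c g]).
  by apply: (ch_bigI cm) => g; exact: ofin_act.
rewrite -bigcap_seq; apply/seteqP; split=> x /=.
  by move=> <- g _ /=; rewrite ffunE.
by move=> h; apply/ffunP => g; rewrite ffunE; apply: h; rewrite /= mem_index_enum.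
Qed.

Definition Hwin (T : finType) (f : X -> T) (A : {fset G}) := Hent m (win f A).

Section OneFun.
Variables (T : finType) (f : X -> T).
Hypothesis mf : ofin M f.

Lemma Hwin_le_ln (A : {fset G}) : Hwin f A <= #|` A|%:R * ln #|T|%:R.
Proof.
apply: le_trans (Hent_le_ln cm (ofin_win (A:=A) mf)) _.
rewrite card_ffun cardfE natrX.
have [->|T0] := posnP #|T|; last by rewrite lnXn ?ltr0n // mulr_natl.
(* The alphabet may be empty; the bound then rests on the convention ln 0 = 0. *)
have ln0X n : ln ((0 : R) ^+ n) = 0 by case: n => [|n]; rewrite ?expr0 ?ln1 // expr0n /= ln0.
by rewrite ln0X ln0 // mulr0.
Qed.

Lemma Hwin0 : Hwin f fset0 = 0.
Proof.
apply/eqP; rewrite eq_le (Hent_ge0 cm (ofin_win mf)) andbT.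
by apply: le_trans (Hwin_le_ln _) _; rewrite cardfs0 mul0r.
Qed.

Lemma Hwin_mono A B : (A `<=` B)%fset -> Hwin f A <= Hwin f B.
Proof.
move=> AB; apply: (Hent_mono cm); [exact: ofin_win|exact: ofin_win|].
by move=> x y /win_eqP h; apply/win_eqP => g /(fsubsetP AB); exact: h.
Qed.

Lemma Hwin_submod A B : Hwin f (A `|` B)%fset + Hwin f (A `&` B)%fset <= Hwin f A + Hwin f B.
Proof.
apply: (Hent_submod cm); try exact: ofin_win.
- by move=> x y /win_eqP h; apply/win_eqP => g; rewrite inE => /andP[gA _]; exact: h.
- by move=> x y /win_eqP h; apply/win_eqP => g; rewrite inE => /andP[_ gB]; exact: h.
- move=> x y /win_eqP h1 /win_eqP h2; apply/win_eqP => g.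
  by rewrite inE => /orP[]; [exact: h1|exact: h2].
Qed.

Lemma win_rtrans A g x y : win f (rtrans A g) x = win f (rtrans A g) y <->
  win f A (act g x) = win f A (act g y).
Proof.
split=> /win_eqP h; apply/win_eqP => k; last first.
  by rewrite mem_rtrans => kA; rewrite -[k](mulgVK g) !(act_action.2 (k / g)%g g); apply: h.
by move=> kA; rewrite -!act_action.2; apply: h; rewrite mem_rtrans mulgK.
Qed.

Lemma Hwin_rtransE A g : Hwin f (rtrans A g) = Hent m (win f A \o act g).
Proof.
apply: (Hent_eq cm); [apply: ofin_act; exact: ofin_win|exact: ofin_win|].
by move=> x y /=; have [? ?] := win_rtrans A g x y; split.
Qed.

Hypothesis m_inv : forall g A, M A -> m (act g @^-1` A) = m A.

Lemma Hwin_rtrans A g : Hwin f (rtrans A g) = Hwin f A.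
Proof.
rewrite Hwin_rtransE; apply: eq_bigr => c _; congr ent.
by rewrite -(m_inv g (ofin_win (A:=A) mf c)).
Qed.

(** Submodularity and invariance are all that is used, so the rate also exists for the conditional
    measures on almost invariant boxes, to which the lemma is applied later. *)
Lemma Hwin_cvg (F : nat -> {fset G}) : @folner R G F ->
  exists l : R, [/\ (fun n => #|` F n|%:R^-1 * Hwin f (F n)) @ \oo --> l, 0 <= l &
     forall E, E != fset0%fset -> l <= Hwin f E / #|` E|%:R].
Proof.
move=> hF; apply: submod_folner_cvg => //.
- exact: Hwin0.
- exact: Hwin_mono.
- exact: Hwin_submod.
- exact: Hwin_rtrans.
Qed.

End OneFun.
End Window.

(** * Translation between partitions and labels *)

Section Measure.
Context {R : realType} {G : groupType} {dX : measure_display}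
  {X : measurableType dX} (act : G -> X -> X) (d : X -> X -> R)
  (F : nat -> {fset G}).

Hypothesis mact : forall g A, measurable A -> measurable (act g @^-1` A).

Definition pm (mu : probability X R) (A : set X) : R := fine (mu A).

Lemma pmE (mu : probability X R) A : measurable A -> mu A = (pm mu A)%:E.
Proof. by move=> mA; rewrite /pm fineK // fin_num_measure. Qed.

Lemma charge_pm (mu : probability X R) : charge measurable (pm mu).
Proof.
split=> //.
- by move=> A B; exact: measurableI.
- by move=> A; exact: measurableC.
- by move=> A mA; rewrite /pm fine_ge0.
- by rewrite /pm probability_setT.
- move=> A B mA mB.
  have mAB : measurable (A `&` B) by exact: measurableI.
  have mAC : measurable (A `&` ~` B) by apply: measurableI => //; exact: measurableC.
  apply: EFin_inj; rewrite EFinD -!pmE // -measureU //.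
    by rewrite -setIUr setUCr setIT.
  by rewrite setIACA setICr setI0.
Qed.

Lemma partition_label k (alpha : 'I_k -> set X) : is_partition alpha ->
  exists a : X -> 'I_k, forall i, alpha i = [set x | a x = i].
Proof.
move=> [_ ad ac].
have h x : {i : 'I_k | alpha i x}.
  by apply: cid; have [i _ ai] := ac x I; exists i.
exists (fun x => sval (h x)) => i; apply/seteqP; split=> x /=.
  move=> ai; apply/eqP/negPn/negP => ne; have aj := svalP (h x).
  by have := ad _ _ ne; move/seteqP => [/(_ x) + _]; apply; split.
by move=> <-; exact: (svalP (h x)).
Qed.

Lemma H_joinE (mu : probability X R) k (alpha : 'I_k -> set X) (a : X -> 'I_k) A :
  (forall i, alpha i = [set x | a x = i]) -> H_join act mu alpha A = Hwin act (pm mu) a A.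
Proof.
move=> ha; apply: eq_bigr => c _; congr (ent (fine (mu _))).
apply/seteqP; split=> x /=; first by move=> h; apply/ffunP => g; rewrite ffunE; have := h g; rewrite ha.
by move=> /ffunP h g; rewrite ha /=; have := h g; rewrite ffunE.
Qed.

Lemma label_partition (T : finType) (f : X -> T) (mu : probability X R) :
  ofin measurable f -> exists k (alpha : 'I_k -> set X),
  [/\ is_partition alpha, (forall e : R, (forall x y, f x = f y -> d x y <= e) -> diam_le d alpha e) &
    forall A, H_join act mu alpha A = Hwin act (pm mu) f A].
Proof.
move=> mf; pose a x := enum_rank (f x).
have ha i : [set x | a x = i] = [set x | f x = enum_val i].
  by apply/seteqP; split=> x /=; rewrite /a; [move=> <-; rewrite enum_rankK|move=> ->; rewrite enum_valK].
exists #|T|, (fun i => [set x | a x = i]); split.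
- split.
  + by move=> i; rewrite ha.
  + by move=> i j ij; apply/seteqP; split=> x //= [e1 e2]; move: ij; rewrite -e1 -e2 eqxx.
  + by move=> x _; exists (a x).
- by move=> e he i x y /= <- /esym /enum_rank_inj exy; exact: he.
- have ma : ofin measurable a by move=> i; rewrite ha; exact: mf.
  move=> A; rewrite (@H_joinE _ _ _ a) //.
  have cm := charge_pm mu.
  apply: (Hent_eq cm (ofin_win cm mact mf) (ofin_win cm mact ma)) => x y.
  by split=> /win_eqP h; apply/win_eqP => g gA; have := h g gA; [rewrite /a => ->|move/enum_rank_inj].
Qed.

Hypothesis act_action : is_action act.
Hypothesis F_folner : @folner R G F.
Variable mu : probability X R.
Hypothesis mu_inv : invariant_measure act mu.

Lemma pm_inv g A : measurable A -> pm mu (act g @^-1` A) = pm mu A.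
Proof. by move=> mA; rewrite /pm mu_inv. Qed.

(** [h_part] is a [limn], which is informative only when the limit exists; [Hwin_cvg] supplies this
    for the partition into fibres of f. *)
Lemma label_entropy (T : finType) (f : X -> T) : ofin measurable f ->
  exists k (alpha : 'I_k -> set X),
  [/\ is_partition alpha, (forall e : R, (forall x y, f x = f y -> d x y <= e) -> diam_le d alpha e) &
    (fun n => #|` F n|%:R^-1 * Hwin act (pm mu) f (F n)) @ \oo --> h_part act F mu alpha].
Proof.
move=> mf; have [k [alpha [h1 h2 h3]]] := label_partition mu mf.
exists k, alpha; split=> //; rewrite /h_part.
have [l [hl _ _]] := Hwin_cvg act_action (charge_pm mu) mact mf pm_inv F_folner.
have -> : (fun n => #|` F n|%:R^-1 * H_join act mu alpha (F n)) =
   (fun n => #|` F n|%:R^-1 * Hwin act (pm mu) f (F n)) by apply/funext => n; rewrite h3.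
by rewrite (cvg_lim _ hl).
Qed.

Lemma partition_entropy k (alpha : 'I_k -> set X) : is_partition alpha ->
  exists a : X -> 'I_k, [/\ ofin measurable a, forall i, alpha i = [set x | a x = i],
    (fun n => #|` F n|%:R^-1 * Hwin act (pm mu) a (F n)) @ \oo --> h_part act F mu alpha,
    0 <= h_part act F mu alpha &
    forall E, E != fset0%fset -> h_part act F mu alpha <= Hwin act (pm mu) a E / #|` E|%:R].
Proof.
move=> pa; have [a ha] := partition_label pa.
have ma : ofin measurable a by move=> i; rewrite -ha; case: pa.
have [l [hl l0 lE]] := Hwin_cvg act_action (charge_pm mu) mact ma pm_inv F_folner.
have -> : h_part act F mu alpha = l.
  rewrite /h_part (_ : (fun n => _) = (fun n => #|` F n|%:R^-1 * Hwin act (pm mu) a (F n))).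
    exact: cvg_lim hl.
  by apply/funext => n; rewrite (H_joinE _ _ ha).
by exists a.
Qed.

End Measure.

(** * Continuous functions and expectations *)

Section Cont.
Context {R : realType} {X : choiceType} (d : X -> X -> R).
Hypothesis dm : is_metric d.

Local Notation cont := (@d_continuous_real R X d).

Lemma d_ge0 x y : 0 <= d x y. Proof. by case: dm. Qed.
Lemma d_xx x : d x x = 0. Proof. by case: dm => _ /(_ x x)[_ ->]. Qed.
Lemma d_sym x y : d x y = d y x. Proof. by case: dm. Qed.
Lemma d_tri y x z : d x z <= d x y + d y z. Proof. by case: dm. Qed.
Lemma d_gt0 x y : x <> y -> 0 < d x y.
Proof.
move=> xy; rewrite lt_def d_ge0 andbT; apply/eqP => e; apply: xy.
by case: dm => _ /(_ x y)[+ _] _ _; apply.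
Qed.

(** The metric is a bare function, not a topological structure on X. Its neighbourhood filters turn
    [d_continuous_real] into convergence, so that the limit theorems for sums, products and inverses
    apply. *)
Definition dnbhs (x : X) : set_system X :=
  filter_from [set r : R | 0 < r] (fun r => [set y | d x y < r]).

Global Instance dnbhs_filter x : ProperFilter (dnbhs x).
Proof.
apply: filter_from_proper; last by move=> r r0; exists x; rewrite /= d_xx.
apply: filter_from_filter; first by exists 1 => /=.
move=> i j i0 j0; exists (Num.min i j); first by rewrite /= lt_min i0.
by move=> y /=; rewrite lt_min => /andP[].
Qed.

Lemma contP (f : X -> R) : cont f <-> forall x, f @ dnbhs x --> f x.
Proof.
split=> [cf x|cf x e e0].
  apply/cvgrPdist_lt => e e0; have [r r0 h] := cf x e e0.
  by exists r => // y; exact: h.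
have /cvgrPdist_lt/(_ e e0)[r r0 h] := cf x.
by exists r => // y /h.
Qed.

Lemma cont_cst (c : R) : cont (fun=> c).
Proof. by move=> x e e0; exists 1 => // y _; rewrite subrr normr0. Qed.

Lemma contD f g : cont f -> cont g -> cont (fun x => f x + g x).
Proof. by move=> /contP cf /contP cg; apply/contP => x; apply: cvgD. Qed.

Lemma contN f : cont f -> cont (fun x => - f x).
Proof. by move=> /contP cf; apply/contP => x; apply: cvgN. Qed.

Lemma contB f g : cont f -> cont g -> cont (fun x => f x - g x).
Proof. by move=> cf cg; apply: contD => //; exact: contN. Qed.

Lemma contM f g : cont f -> cont g -> cont (fun x => f x * g x).
Proof. by move=> /contP cf /contP cg; apply/contP => x; apply: cvgM. Qed.

Lemma contV f : cont f -> (forall x, f x != 0) -> cont (fun x => (f x)^-1).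
Proof. by move=> /contP cf f0; apply/contP => x; apply: cvgV. Qed.

Lemma cont_norm f : cont f -> cont (fun x => `|f x|).
Proof. by move=> /contP cf; apply/contP => x; apply: cvg_norm. Qed.

Lemma cont_min f g : cont f -> cont g -> cont (fun x => Num.min (f x) (g x)).
Proof. move=> cf cg; rewrite (_ : (fun x => _) = fun x => (f x + g x - `|f x - g x|) * 2^-1).
  apply: contM; last exact: cont_cst.
  by apply: contB; [exact: contD|apply: cont_norm; exact: contB].
by apply/funext => x; rewrite minr_absE. Qed.

Lemma cont_max f g : cont f -> cont g -> cont (fun x => Num.max (f x) (g x)).
Proof. move=> cf cg; rewrite (_ : (fun x => _) = fun x => (f x + g x + `|f x - g x|) * 2^-1).
  apply: contM; last exact: cont_cst.
  by apply: contD; [exact: contD|apply: cont_norm; exact: contB].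
by apply/funext => x; rewrite maxr_absE. Qed.

Lemma cont_sum (I : Type) (s : seq I) (P : pred I) (f : I -> X -> R) :
  (forall i, cont (f i)) -> cont (fun x => \sum_(i <- s | P i) f i x).
Proof.
move=> cf; elim: s => [|i s IH].
  rewrite (_ : (fun x => _) = fun=> 0); first exact: cont_cst.
  by apply/funext => x; rewrite big_nil.
rewrite (_ : (fun x => _) = fun x => (if P i then f i x else 0) + \sum_(i <- s | P i) f i x).
  by apply: contD => //; case: (P i); [exact: cf|exact: cont_cst].
by apply/funext => x; rewrite big_cons; case: (P i); rewrite ?add0r.
Qed.

Lemma cont_prod (I : Type) (s : seq I) (P : pred I) (f : I -> X -> R) :
  (forall i, cont (f i)) -> cont (fun x => \prod_(i <- s | P i) f i x).
Proof.
move=> cf; elim: s => [|i s IH].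
  rewrite (_ : (fun x => _) = fun=> 1); first exact: cont_cst.
  by apply/funext => x; rewrite big_nil.
rewrite (_ : (fun x => _) = fun x => (if P i then f i x else 1) * \prod_(i <- s | P i) f i x).
  by apply: contM => //; case: (P i); [exact: cf|exact: cont_cst].
by apply/funext => x; rewrite big_cons; case: (P i); rewrite ?mul1r.
Qed.

Lemma cont_lip (f : X -> R) : (forall x y, f x <= f y + d x y) -> cont f.
Proof.
move=> h x e e0; exists e => // y xy; rewrite ltr_distl.
by have := h x y; have := h y x; rewrite (d_sym y x) => *; apply/andP; split; lra.
Qed.

Lemma cont_d z : cont (fun x => d x z).
Proof. by apply: cont_lip => x y; rewrite addrC; exact: d_tri. Qed.

Lemma cont_comp (h : X -> X) f : d_continuous d h -> cont f -> cont (f \o h).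
Proof.
move=> ch cf x e e0; have [r r0 hr] := cf (h x) e e0.
by have [s s0 hs] := ch x r r0; exists s => // y /hs/hr.
Qed.

Lemma cont_d2 (h : X -> X) : d_continuous d h -> cont (fun x => d (h x) x).
Proof.
move=> ch x e e0; have [r r0 hr] := ch x (e/2) (divr_gt0 e0 (ltr0n _ 2)).
exists (Num.min r (e/2)); first by rewrite lt_min r0 divr_gt0.
move=> y; rewrite lt_min => /andP[/hr h1 h2]; rewrite ltr_distl.
have := d_tri (h y) (h x) x; have := d_tri y (h y) x; have := d_tri (h x) (h y) y; have := d_tri x (h x) y.
by rewrite (d_sym (h y) (h x)) (d_sym y x) => *; apply/andP; split; lra.
Qed.

Lemma d_open_gt f (c : R) : cont f -> d_open d [set x | c < f x].
Proof.
move=> cf x /= cx; have [|r r0 h] := cf x (f x - c); first by rewrite subr_gt0.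
by exists r => // y /h; rewrite ltr_distl => /andP[_]; lra.
Qed.

Lemma d_open_ball z (r : R) : d_open d [set x | d x z < r].
Proof.
rewrite (_ : [set x | _] = [set x | - r < - d x z]); last first.
  by apply/seteqP; split=> x /=; rewrite ltrN2.
by apply: d_open_gt; apply: contN; exact: cont_d.
Qed.

Hypothesis X_compact : d_compact d.

Lemma compact_cover (I : choiceType) (U : I -> set X) : (forall i, d_open d (U i)) ->
  (forall x, exists i, U i x) -> exists s : seq I, forall x, exists2 i, i \in s & U i x.
Proof.
move=> oU cU; have [|s hs] := X_compact oU.
  by move=> x _; have [i] := cU x; exists i.
exists s => x; have [i [si Ui]] := hs x; exists i => //.
elim: s si {hs} => //= a s IH []; first by move=> ->; rewrite inE eqxx.
by move=> /IH h; rewrite inE h orbT.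
Qed.

Lemma cont_bounded f : cont f -> exists2 M : R, 0 <= M & forall x, `|f x| <= M.
Proof.
move=> cf; have [|x|s hs] := @compact_cover nat (fun n => [set x | n%:R > `|f x|]).
- move=> n; rewrite (_ : [set x | _] = [set x | - n%:R < - `|f x|]).
    by apply: d_open_gt; apply: contN; exact: cont_norm.
  by apply/seteqP; split=> x /=; rewrite ltrN2.
- by exists (Num.bound `|f x|); apply: archi_boundP.
- exists (\max_(n <- s) n)%:R; first by rewrite ler0n.
  move=> x; have [n ns /= /ltW h] := hs x; apply: le_trans h _.
  by rewrite ler_nat; exact: leq_bigmax_seq.
Qed.

(** Lebesgue number argument: f varies by less than e / 2 from the centre of a ball of radius 2 r,
    and two points closer than the least r of a finite subcover lie in one such doubled ball. *)
Lemma cont_unif f (e : R) : cont f -> 0 < e -> exists2 r : R, 0 < r &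
  forall x y, d x y < r -> `|f x - f y| < e.
Proof.
move=> cf e0; have e2 : 0 < e / 2 by rewrite divr_gt0.
have /choice[r hr] : forall x, exists r : R, 0 < r /\ forall y, d x y < 2 * r -> `|f x - f y| < e / 2.
  move=> x; have [r r0 h] := cf x _ e2; exists (r / 2); split; first exact: divr_gt0.
  by move=> y xy; apply: h; move: xy; rewrite mulrCA divff ?mulr1.
have [|x|s hs] := @compact_cover X (fun x => [set y | d y x < r x]).
- by move=> x; exact: d_open_ball.
- by exists x; rewrite /= d_xx; have [] := hr x.
exists (\big[Num.min/1]_(x <- s) r x).
  by apply: lt_bigmin => // x _; have [] := hr x.
move=> x y xy; have [c cs /= cx] := hs x.
have xyc : d x y < r c by apply: lt_le_trans xy _; exact: ge_bigmin_seq.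
have [rc0 h] := hr c.
have h1 : `|f c - f x| < e/2 by apply: h; rewrite d_sym; lra.
have h2 : `|f c - f y| < e/2 by apply: h; have := d_tri x c y; rewrite (d_sym c x); lra.
rewrite (_ : f x - f y = (f c - f y) - (f c - f x)); last by ring.
by apply: le_lt_trans (ler_normB _ _) _; lra.
Qed.

Lemma net (r : R) : 0 < r -> exists n (c : 'I_n -> X), forall x, exists i, d x (c i) < r.
Proof.
move=> r0; have [|x|s hs] := @compact_cover X (fun z => [set x | d x z < r]).
- by move=> z; exact: d_open_ball.
- by exists x => //=; rewrite d_xx.
exists (size s), (tnth (in_tuple s)) => x; have [c cs h] := hs x.
by have /tnthP[i ci] : c \in in_tuple s by []; exists i; rewrite -ci.
Qed.

(** By monotonicity the largest index of a finite subcover works everywhere. This is the compactness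
    input for the total mass of the Riesz measure. *)
Lemma cont_dini (f : nat -> X -> R) (c : R) : (forall n, cont (f n)) ->
  (forall m n x, (m <= n)%N -> f m x <= f n x) -> (forall x, exists n, c < f n x) ->
  exists n, forall x, c < f n x.
Proof.
move=> cf fm fc; have [|//|s hs] := @compact_cover nat (fun n => [set x | c < f n x]).
  by move=> n; exact: d_open_gt.
exists (\max_(n <- s) n) => x; have [n ns /= h] := hs x.
by apply: lt_le_trans h _; apply: fm; exact: leq_bigmax_seq.
Qed.

(* For each scale 1/(k+1), a partition of unity subordinate to a net; a continuous f is
   uniformly close to \sum_i f(c_i) phi_(k,i). *)
Lemma test_family : exists phi : nat -> X -> R,
  [/\ forall i, cont (phi i), forall i x, 0 <= phi i x <= 1 &
   forall f (e : R), cont f -> 0 < e -> exists n (a : nat -> R), forall x,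
     `|f x - \sum_(i < n) a i * phi i x| < e].
Proof.
have [w hw] : {w : forall k : nat, {n : nat & 'I_n -> X} &
    forall k x, exists i, d x (projT2 (w k) i) < k.+1%:R^-1}.
  have h k : {w : {n : nat & 'I_n -> X} | forall x, exists i, d x (projT2 w i) < k.+1%:R^-1}.
    apply: cid; have [|n [c hc]] := @net k.+1%:R^-1; first by rewrite invr_gt0.
    by exists (existT _ n c).
  by exists (fun k => sval (h k)) => k; exact: (svalP (h k)).
pose u k i x : R := Num.max 0 (k.+1%:R^-1 - d x (projT2 (w k) i)).
have u0 k i x : 0 <= u k i x by rewrite le_max lexx.
have cu k i : cont (u k i).
  by apply: cont_max; [exact: cont_cst|apply: contB; [exact: cont_cst|exact: cont_d]].
pose S k x := \sum_i u k i x.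
have S0 k x : 0 < S k x.
  have [i hi] := hw k x; rewrite /S (bigD1 i) //= ltr_pwDl ?sumr_ge0 //.
  by rewrite lt_max subr_gt0 hi orbT.
have cS k : cont (S k) by apply: cont_sum.
pose p k i x := u k i x / S k x.
have cp k i : cont (p k i).
  by apply: contM => //; apply: contV => // x; rewrite gt_eqF.
have p01 k i x : 0 <= p k i x <= 1.
  rewrite divr_ge0 ?(ltW (S0 _ _)) //= ler_pdivrMr // mul1r /S (bigD1 i) //= lerDl.
  exact: sumr_ge0.
have p1 k x : \sum_i p k i x = 1 by rewrite -mulr_suml -/(S k x) divff // gt_eqF ?S0.
(* All scales are merged into one sequence by coding pairs (scale, index); numbers that code no bump
   give the zero function. *)
pose phi (m : nat) (x : X) : R := if @choice.unpickle (nat * nat)%type m is Some (k, i) then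
   if insub i is Some i' then p k i' x else 0 else 0.
exists phi; split.
- move=> m; rewrite /phi; case: (@choice.unpickle (nat * nat)%type m) => [[k i]|]; last exact: cont_cst.
  by case: insub => [i'|]; [exact: cp|exact: cont_cst].
- move=> m x; rewrite /phi; case: (@choice.unpickle (nat * nat)%type m) => [[k i]|]; last by rewrite lexx ler01.
  by case: insub => [i'|]; [exact: p01|rewrite lexx ler01].
move=> f e cf e0; have [r r0 hr] := cont_unif cf e0.
have [k kr] : exists k : nat, k.+1%:R^-1 < r.
  exists (Num.bound r^-1); rewrite invf_plt ?posrE //.
  by apply: lt_trans (archi_boundP _) _; rewrite ?invr_ge0 ?ltW // ltr_nat.
set K := projT1 (w k).
pose idx (i : 'I_K) : nat := choice.pickle (k, val i).
have idx_inj : injective idx by move=> i j /(pcan_inj choice.pickleK)[] /val_inj.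
have phiE (i : 'I_K) x : phi (idx i) x = p k i x.
  by rewrite /phi /idx choice.pickleK; case: insubP => [i' _ /val_inj ->//|]; rewrite ltn_ord.
pose n := (\max_(i < K) idx i).+1.
pose a (m : nat) : R := \sum_(i < K | idx i == m) f (projT2 (w k) i).
exists n, a => x.
have -> : \sum_(m < n) a m * phi m x = \sum_(i < K) f (projT2 (w k) i) * p k i x.
  rewrite (eq_bigr (fun m : 'I_n => \sum_(i < K | idx i == m) f (projT2 (w k) i) * p k i x)).
    rewrite (exchange_big_dep xpredT) //=; apply: eq_bigr => i _.
    rewrite (big_pred1 (inord (idx i))) // => m /=.
    by rewrite -val_eqE /= inordK ?ltnS ?leq_bigmax // eq_sym.
  move=> m _; rewrite /a mulr_suml; apply: eq_bigr => i /eqP <-.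
  by rewrite phiE.
have -> : f x = \sum_(i < K) f x * p k i x by rewrite -mulr_sumr p1 mulr1.
rewrite -sumrB; apply: le_lt_trans (ler_norm_sum _ _ _) _.
have h (i : 'I_K) : `|f x * p k i x - f (projT2 (w k) i) * p k i x| <=
    `|f x - f (projT2 (w k) i)| * p k i x.
  by rewrite -mulrBl normrM (ger0_norm (x := p k i x)) //; case/andP: (p01 k i x).
have h2 (i : 'I_K) : `|f x - f (projT2 (w k) i)| * p k i x <= e * p k i x.
  have [|pn] := ltP (d x (projT2 (w k) i)) r.
    by move=> /hr/ltW ?; apply: ler_wpM2r => //; case/andP: (p01 k i x).
  suff -> : p k i x = 0 by rewrite !mulr0.
  rewrite /p /u; suff -> : Num.max 0 (k.+1%:R^-1 - d x (projT2 (w k) i)) = 0 by rewrite mul0r.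
  by apply/max_idPl; rewrite subr_le0; apply: le_trans pn; exact: ltW.
have [i0 hi0] := hw k x.
rewrite -[ltRHS]mulr1 -(p1 k x) mulr_sumr (bigD1 i0) //= [ltRHS](bigD1 i0) //=.
apply: ltr_leD; last by apply: ler_sum => i _; exact: le_trans (h i) (h2 i).
apply: le_lt_trans (h i0) _; rewrite ltr_pM2r; first by apply: hr; exact: lt_trans kr.
by rewrite divr_gt0 // lt_max subr_gt0 hi0 orbT.
Qed.

End Cont.

(** * Expectations of bounded measurable functions *)

Section Expectation.
Context {R : realType} {dX : measure_display} {X : measurableType dX}.
Implicit Types (f g : X -> R) (mu : probability X R).

Definition bm f := measurable_fun setT f /\ exists M : R, forall x, `|f x| <= M.

Definition Ex mu f : R := \int[mu]_x f x.

Lemma bm_int mu f : bm f -> mu.-integrable setT (EFin \o f).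
Proof.
move=> [mf [M fM]]; apply: measurable_bounded_integrable => //.
  by apply: le_lt_trans (ltry 1); rewrite le_eqVlt (_ : _ == _) //; apply/eqP; exact: probability_setT.
exists M; split; first exact: num_real.
by move=> N /ltW MN x _; apply: le_trans MN; exact: fM.
Qed.

Lemma bm_cst (c : R) : bm (fun=> c).
Proof. by split; [exact: measurable_cst|exists `|c|]. Qed.

Lemma bmD f g : bm f -> bm g -> bm (fun x => f x + g x).
Proof.
move=> [mf [M fM]] [mg [N gN]]; split; first exact: measurable_funD.
by exists (M + N) => x; apply: le_trans (ler_normD _ _) _; exact: lerD.
Qed.

Lemma bmN f : bm f -> bm (fun x => - f x).
Proof.
move=> [mf [M fM]]; split; last by exists M => x; rewrite normrN.
exact: measurableT_comp.
Qed.

Lemma bmB f g : bm f -> bm g -> bm (fun x => f x - g x).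
Proof. by move=> bf bg; apply: bmD => //; exact: bmN. Qed.

Lemma bmM f g : bm f -> bm g -> bm (fun x => f x * g x).
Proof.
move=> [mf [M fM]] [mg [N gN]]; split; first exact: measurable_funM.
by exists (M * N) => x; rewrite normrM ler_pM.
Qed.

Lemma bm_sum (I : Type) (s : seq I) (P : pred I) (f : I -> X -> R) :
  (forall i, bm (f i)) -> bm (fun x => \sum_(i <- s | P i) f i x).
Proof.
move=> cf; elim: s => [|i s IH].
  rewrite (_ : (fun x => _) = fun=> 0); first exact: bm_cst.
  by apply/funext => x; rewrite big_nil.
rewrite (_ : (fun x => _) = fun x => (if P i then f i x else 0) + \sum_(i <- s | P i) f i x).
  by apply: bmD => //; case: (P i); [exact: cf|exact: bm_cst].
by apply/funext => x; rewrite big_cons; case: (P i); rewrite ?add0r.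
Qed.

Lemma bm_norm f : bm f -> bm (fun x => `|f x|).
Proof.
move=> [mf [M fM]]; split; last by exists M => x; rewrite normr_id.
exact: measurableT_comp.
Qed.

Lemma bm_indic (A : set X) : measurable A -> bm (\1_A : X -> R).
Proof.
move=> mA; split; first exact: measurable_indic.
by exists 1 => x; rewrite indicE; case: (x \in A) => /=; rewrite ?normr1 ?normr0.
Qed.

Variable mu : probability X R.

Lemma ExE f : bm f -> (\int[mu]_x (f x)%:E)%E = (Ex mu f)%:E.
Proof. by move=> bf; rewrite /Ex /Rintegral fineK // integrable_fin_num //; exact: bm_int. Qed.

Lemma ExD f g : bm f -> bm g -> Ex mu (fun x => f x + g x) = Ex mu f + Ex mu g.
Proof. by move=> bf bg; rewrite /Ex RintegralD //; exact: bm_int. Qed.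

Lemma ExB f g : bm f -> bm g -> Ex mu (fun x => f x - g x) = Ex mu f - Ex mu g.
Proof. by move=> bf bg; rewrite /Ex RintegralB //; exact: bm_int. Qed.

Lemma ExZ (c : R) f : bm f -> Ex mu (fun x => c * f x) = c * Ex mu f.
Proof. by move=> bf; rewrite /Ex RintegralZl //; exact: bm_int. Qed.

Lemma Ex_cst (c : R) : Ex mu (fun=> c) = c.
Proof. rewrite /Ex Rintegral_cst // (_ : fine _ = 1) ?mulr1 //.
by rewrite -[RHS]/(fine 1%E); congr fine; exact: probability_setT. Qed.

Lemma Ex_le f g : bm f -> bm g -> (forall x, f x <= g x) -> Ex mu f <= Ex mu g.
Proof. by move=> bf bg fg; apply: le_Rintegral => //; exact: bm_int. Qed.

Lemma Ex_ge0 f : bm f -> (forall x, 0 <= f x) -> 0 <= Ex mu f.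
Proof. by move=> bf f0; rewrite -(Ex_cst 0); apply: Ex_le => //; exact: bm_cst. Qed.

Lemma Ex_sum (I : Type) (s : seq I) (P : pred I) (f : I -> X -> R) :
  (forall i, bm (f i)) -> Ex mu (fun x => \sum_(i <- s | P i) f i x) = \sum_(i <- s | P i) Ex mu (f i).
Proof.
move=> cf; elim: s => [|i s IH].
  rewrite big_nil (_ : (fun x => _) = fun=> 0) ?Ex_cst //.
  by apply/funext => x; rewrite big_nil.
rewrite (_ : (fun x => _) = fun x => (if P i then f i x else 0) + \sum_(i <- s | P i) f i x).
  rewrite ExD; [|by case: (P i); [exact: cf|exact: bm_cst]|exact: bm_sum].
  by rewrite IH big_cons; case: (P i) => //; rewrite Ex_cst add0r.
by apply/funext => x; rewrite big_cons; case: (P i); rewrite ?add0r.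
Qed.

Lemma Ex_indic A : measurable A -> Ex mu (\1_A) = pm mu A.
Proof.
move=> mA; apply: EFin_inj; rewrite -ExE; last exact: bm_indic.
by rewrite integral_indic // setIT; exact: pmE.
Qed.

Lemma Ex_norm f : bm f -> `|Ex mu f| <= Ex mu (fun x => `|f x|).
Proof.
move=> bf; rewrite ler_norml; have bn := bm_norm bf; apply/andP; split; last first.
  by apply: Ex_le => // x; exact: ler_norm.
rewrite -[Ex mu (fun x => `|f x|)]mul1r -mulNr -ExZ //; apply: Ex_le => //.
  by apply: bmM => //; exact: bm_cst.
by move=> x; rewrite mulN1r lerNl -normrN ler_norm.
Qed.

Lemma Ex_close f g (e : R) : bm f -> bm g -> (forall x, `|f x - g x| <= e) -> `|Ex mu f - Ex mu g| <= e.
Proof.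
move=> bf bg fg; rewrite -ExB //; apply: le_trans (Ex_norm (bmB bf bg)) _.
by rewrite -[leRHS]Ex_cst; apply: Ex_le => //; [exact: bm_norm (bmB bf bg)|exact: bm_cst].
Qed.

Lemma Ex_cvg_ae (f : nat -> X -> R) g (M : R) : (forall n, measurable_fun setT (f n)) -> bm g ->
  (forall n x, `|f n x| <= M) -> {ae mu, forall x, f n x @[n --> \oo] --> g x} ->
  Ex mu (f n) @[n --> \oo] --> Ex mu g.
Proof.
move=> mf bg fM fg.
have bf n : bm (f n) by split=> //; exists M.
have [] := @dominated_convergence _ _ _ mu setT measurableT (fun n x => (f n x)%:E)
   (fun x => (g x)%:E) (fun=> M%:E).
- by move=> n; exact/measurable_EFinP.
- by apply/measurable_EFinP; exact: bg.1.
- by apply: filterS fg => x h _; apply: cvg_EFin => //; near=> n.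
- exact: (bm_int _ (bm_cst M)).
- by apply: aeW => x n _; rewrite /= lee_fin.
move=> _ _; rewrite ExE // (_ : [sequence _]_n = fun n => (Ex mu (f n))%:E); last first.
  by apply/funext => n; rewrite /= ExE.
by move=> /fine_cvg.
Unshelve. all: end_near. Qed.

Lemma Ex_cvg (f : nat -> X -> R) g (M : R) : (forall n, measurable_fun setT (f n)) ->
  (forall n x, `|f n x| <= M) -> (forall x, f n x @[n --> \oo] --> g x) ->
  bm g /\ Ex mu (f n) @[n --> \oo] --> Ex mu g.
Proof.
move=> mf fM fg; have bg : bm g.
  split; first by apply: (measurable_fun_cvg mf) => // x _; exact: fg.
  exists M => x; have : `|f n x| @[n --> \oo] --> `|g x| by exact: cvg_norm (fg x).
  move=> h; rewrite -(cvg_lim (@Rhausdorff R) h); apply: limr_le; first by apply/cvg_ex; exists `|g x|.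
  by near=> n; exact: fM.
by split=> //; apply: Ex_cvg_ae mf bg fM _; exact: aeW.
Unshelve. all: end_near. Qed.

Lemma Ex_markov f (c : R) : bm f -> (forall x, 0 <= f x) -> 0 <= c ->
  c * pm mu [set x | c <= f x] <= Ex mu f.
Proof.
move=> bf f0 c0; have mA : measurable [set x | c <= f x].
  rewrite (_ : [set x | _] = f @^-1` `[c, +oo[).
    by rewrite -[_ @^-1` _]setTI; apply: bf.1.
  by apply/seteqP; split=> x /=; rewrite in_itv /= andbT.
rewrite -Ex_indic // -ExZ; last exact: bm_indic.
apply: Ex_le => //; first by apply: bmM; [exact: bm_cst|exact: bm_indic].
move=> x; rewrite indicE; have [|_] := boolP (x \in _); last by rewrite mulr0.
by rewrite in_setE /= mulr1.
Qed.

Lemma Ex_eq0 f : bm f -> (forall x, 0 <= f x) -> Ex mu f = 0 -> mu [set x | f x != 0] = 0%E.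
Proof.
move=> bf f0 ef; have mA (c : R) : measurable [set x | c <= f x].
  rewrite (_ : [set x | _] = f @^-1` `[c, +oo[).
    by rewrite -[_ @^-1` _]setTI; apply: bf.1.
  by apply/seteqP; split=> x /=; rewrite in_itv /= andbT.
have -> : [set x | f x != 0] = \bigcup_n [set x | n.+1%:R^-1 <= f x].
  apply/seteqP; split=> x /=; last first.
    by move=> [n _ /= h]; rewrite gt_eqF //; apply: lt_le_trans h; rewrite invr_gt0.
  move=> fx; have fp : 0 < f x by rewrite lt_def fx f0.
  exists (Num.bound (f x)^-1) => //=; rewrite invf_ple ?posrE //.
  by apply/ltW/(lt_trans (archi_boundP _)); rewrite ?invr_ge0 // ltr_nat.
apply/eqP; rewrite -measure_le0.
apply: le_trans (measure_sigma_subadditive _ _ _ (@subset_refl _ _)) _ => //.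
  by apply: bigcup_measurable => n _; exact: mA.
rewrite eseries0 // => n _ _ /=; rewrite pmE //; congr EFin.
have n0 : 0 < n.+1%:R^-1 :> R by rewrite invr_gt0.
have := Ex_markov bf f0 (ltW n0); rewrite ef pmulr_rle0 // => h.
by apply/eqP; rewrite eq_le h /= (ch_ge0 (charge_pm mu)).
Qed.

End Expectation.

(** * Approximation of Borel sets by continuous functions *)

Section Borel.
Context {R : realType} {dX : measure_display} {X : measurableType dX} (d : X -> X -> R).
Hypothesis dm : is_metric d.
Hypothesis X_compact : d_compact d.
Hypothesis X_borel : @measurable _ X = <<s [set A | d_open d A] >>.
Local Notation cont := (@d_continuous_real R X d).

Lemma open_meas A : d_open d A -> measurable A.
Proof. by move=> oA; rewrite X_borel; exact: sub_gen_smallest. Qed.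

Lemma cont_meas f : cont f -> measurable_fun setT f.
Proof.
move=> cf; apply: (measurability _ (RGenOInfty.measurableE R)) => //.
move=> _ [_ [a ->] <-]; rewrite setTI; apply: open_meas.
rewrite (_ : _ @^-1` _ = [set x | a < f x]); first exact: d_open_gt.
by apply/seteqP; split=> x /=; rewrite in_itv /= andbT.
Qed.

Lemma cont_bm f : cont f -> bm f.
Proof.
by move=> cf; split; [exact: cont_meas|have [M _ h] := cont_bounded dm X_compact cf; exists M].
Qed.

Lemma dcont_meas (h : X -> X) : d_continuous d h -> measurable_fun setT h.
Proof.
move=> ch; apply: (measurability _ X_borel) => _ [A oA <-]; rewrite setTI; apply: open_meas.
move=> x /= Ahx; have [r r0 hr] := oA _ Ahx; have [s s0 hs] := ch x r r0.
by exists s => // y /hs/hr.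
Qed.

(** v is the distance to the complement, cut off at 1. The case U = X is separate because that
    distance would be an infimum over the empty set. *)
Lemma open_fun U : d_open d U -> exists v : X -> R,
  [/\ cont v, forall x, 0 <= v x <= 1 & U = [set x | 0 < v x]].
Proof.
move=> oU; have [[z Uz]|nz] := pselect (exists z, ~ U z); last first.
  exists (fun=> 1); split; first exact: cont_cst; first by move=> x; rewrite ler01 lexx.
  apply/seteqP; split=> x //= _.
  by apply: contrapT => h; apply: nz; exists x.
pose D x := [set d x y | y in ~` U].
have D0 x : D x !=set0 by exists (d x z); exists z.
have Dlb x : lbound (D x) 0 by move=> _ [y _ <-]; exact: d_ge0.
have Di x : has_inf (D x) by split => //; exists 0.
pose w x := inf (D x).
have w0 x : 0 <= w x by exact: lb_le_inf.
have cw : cont w.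
  apply: cont_lip => // x y; rewrite -lerBlDr; apply: lb_le_inf => // _ [t Ut <-].
  rewrite lerBlDr addrC; apply: le_trans (d_tri dm y x t).
  by apply: ge_inf; [exists 0|exists t].
exists (fun x => Num.min 1 (w x)); split.
- by apply: (cont_min dm) => //; exact: cont_cst.
- by move=> x; rewrite le_min ler01 w0 ge_min lexx.
apply/seteqP; split=> x /=.
  move=> Ux; rewrite lt_min ltr01 /=; have [r r0 hr] := oU x Ux.
  apply: lt_le_trans r0 _; apply: lb_le_inf => // _ [y Uy <-].
  by rewrite leNgt; apply/negP => /hr.
rewrite lt_min ltr01 /= => wx; apply: contrapT => Ux.
have : w x <= d x x by apply: ge_inf; [exists 0|exists x].
by rewrite d_xx // leNgt wx.
Qed.

Lemma open_seq U : d_open d U -> exists f : nat -> X -> R,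
  [/\ forall n, cont (f n), forall n x, 0 <= f n x <= 1 & forall x, f n x @[n --> \oo] --> (\1_U x : R)].
Proof.
move=> oU; have [v [cv v01 Uv]] := open_fun oU.
pose f (n : nat) x := Num.min 1 (n%:R * v x).
exists f; split=> [n|n x|x].
- by apply: (cont_min dm); [exact: cont_cst|apply: contM => //; exact: cont_cst].
- by rewrite le_min ler01 mulr_ge0 ?ler0n ?ge_min ?lexx //; case/andP: (v01 x).
have [Ux|nU] := pselect (U x).
  have vx : 0 < v x by move: Ux; rewrite {1}Uv.
  apply: cvg_near_cst; exists (Num.bound (v x)^-1) => // n /= kn.
  rewrite indicE mem_set // /f; apply/min_idPl; rewrite -ler_pdivrMr // mul1r.
  apply/ltW/(lt_le_trans (archi_boundP _)); first by rewrite invr_ge0 ltW.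
  by rewrite ler_nat.
apply: cvg_near_cst; near=> n.
rewrite indicE memNset // /f; suff -> : v x = 0 by rewrite mulr0; apply/min_idPr; exact: ler01.
apply/eqP; rewrite eq_le; have /andP[-> _] := v01 x; rewrite andbT leNgt.
by apply/negP => h; apply: nU; rewrite Uv.
Unshelve. all: end_near. Qed.

(** The approximable sets form a lambda-system: proper differences are handled by max 0 (f - g),
    increasing unions by dominated convergence. It contains the open sets, which are stable under
    intersection and generate the Borel sets. *)
Lemma L1_dense (mu : probability X R) A (e : R) : measurable A -> 0 < e ->
  exists f, [/\ cont f, forall x, 0 <= f x <= 1 & Ex mu (fun x => `|\1_A x - f x|) <= e].
Proof.
pose H := [set A | measurable A /\ forall e : R, 0 < e ->
  exists f, [/\ cont f, forall x, 0 <= f x <= 1 & Ex mu (fun x => `|\1_A x - f x|) <= e]].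
suff HA : measurable `<=` H by move=> /HA[_]; apply.
have mo : setI_closed [set A | d_open d A].
  move=> A0 B oA oB x [Ax Bx]; have [r r0 hr] := oA _ Ax; have [s s0 hs] := oB _ Bx.
  exists (Num.min r s); first by rewrite lt_min r0.
  by move=> y; rewrite lt_min => /andP[/hr ? /hs ?]; split.
have HE : @measurable _ X `<=` H; last exact: HE.
rewrite X_borel; apply: (lambda_system_subset mo (D := setT)) => //.
- split => //.
  + split => // {}e e0; exists (fun=> 1); split; first exact: cont_cst.
      by move=> x; rewrite ler01 lexx.
    rewrite (_ : (fun x => _) = fun=> 0) ?Ex_cst ?ltW //.
    by apply/funext => x; rewrite indicT subrr normr0.
  + move=> A0 B BA [mA hA] [mB hB]; split; first exact: measurableD.
    move=> {}e e0; have e2 : 0 < e/2 by rewrite divr_gt0.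
    have [f [cf f01 hf]] := hA _ e2; have [g [cg g01 hg]] := hB _ e2.
    exists (fun x => Num.max 0 (f x - g x)); split.
    * by apply: (cont_max dm); [exact: cont_cst|exact: (contB dm)].
    * move=> x; rewrite le_max lexx /= ge_max ler01 /=.
      by have /andP[_ ?] := f01 x; have /andP[? _] := g01 x; lra.
    have bf := cont_bm cf; have bg := cont_bm cg.
    have b1 : bm (fun x => `|\1_A0 x - f x|) by apply/bm_norm/bmB => //; exact: bm_indic.
    have b2 : bm (fun x => `|\1_B x - g x|) by apply/bm_norm/bmB => //; exact: bm_indic.
    apply: le_trans (_ : Ex mu (fun x => `|\1_A0 x - f x| + `|\1_B x - g x|) <= _); last first.
      by rewrite ExD //; lra.
    apply: Ex_le => [||x]; last 1 first.
    * have fx := f01 x; have gx := g01 x; have : \1_B x <= \1_A0 x :> R.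
        rewrite !indicE; case: (boolP (x \in B)) => [|_]; last by rewrite ler0n.
        rewrite in_setE => /BA xA.
        by rewrite (mem_set xA).
      have -> : \1_(A0 `\` B) x = \1_A0 x - \1_B x :> R.
        rewrite !indicE in_setD; case: (boolP (x \in B)) => [|_]; last by rewrite andbT subr0.
        by rewrite in_setE => /BA xA; rewrite (mem_set xA) subrr.
      move=> h; have n1 := ler_norm (\1_A0 x - f x); have n2 := ler_norm (- (\1_B x - g x)).
      rewrite normrN in n2; have [h1|h1] := leP (f x - g x) 0.
        by rewrite subr0 ger0_norm ?subr_ge0 //; lra.
      rewrite (_ : _ - _ = (\1_A0 x - f x) - (\1_B x - g x)); last by ring.
      exact: ler_normB.
    * apply/bm_norm/bmB; first by apply: bm_indic; exact: measurableD.
      by apply/cont_bm/(cont_max dm); [exact: cont_cst|exact: (contB dm)].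
    * exact: bmD.
  + move=> B mono hB; have mB n : measurable (B n) by case: (hB n).
    split; first exact: bigcupT_measurable.
    move=> {}e e0; have e2 : 0 < e/2 by rewrite divr_gt0.
    pose A0 := \bigcup_n B n.
    have mA0 : measurable A0 by exact: bigcupT_measurable.
    have [_ cv] : bm (fun _ : X => 0 : R) /\ Ex mu (fun x => `|\1_A0 x - \1_(B n) x|) @[n --> \oo] --> Ex mu (fun=> 0).
      apply: (@Ex_cvg _ _ _ mu _ _ 1) => [n|n x|x].
      * by apply: (bm_norm (bmB (bm_indic mA0) (bm_indic (mB n)))).1.
      * rewrite !indicE normr_id; case: (x \in A0); case: (x \in B n);
        by rewrite ?subrr ?subr0 ?sub0r ?normrN ?normr1 ?normr0.
      * have [[k _ Bkx]|nA] := pselect (A0 x).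
          apply: cvg_near_cst; exists k => // n /= kn.
          have xB : x \in B n by apply/mem_set; move/subsetPset : (mono _ _ kn); exact.
          have xA : x \in A0 by apply/mem_set; exists k.
          by rewrite !indicE xB xA subrr normr0.
        apply: cvg_near_cst; near=> n.
        rewrite !indicE !memNset ?subrr ?normr0 //; move=> Bn; apply: nA; by exists n.
    rewrite Ex_cst in cv.
    have [n hn] : exists n, Ex mu (fun x => `|\1_A0 x - \1_(B n) x|) < e / 2.
      move/cvgrPdist_lt : cv => /(_ _ e2)[N _ /(_ N (leqnn _))/=].
      by rewrite sub0r normrN => /ltr_normlW h; exists N.
    have [f [cf f01 hf]] := (hB n).2 _ e2; exists f; split=> //.
    have b1 : bm (fun x => `|\1_A0 x - \1_(B n) x|) := bm_norm (bmB (bm_indic mA0) (bm_indic (mB n))).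
    have b2 : bm (fun x => `|\1_(B n) x - f x|) := bm_norm (bmB (bm_indic (mB n)) (cont_bm cf)).
    apply: le_trans (_ : Ex mu (fun x => `|\1_A0 x - \1_(B n) x| + `|\1_(B n) x - f x|) <= _); last first.
      by rewrite ExD //; lra.
    apply: Ex_le; [exact: (bm_norm (bmB (bm_indic mA0) (cont_bm cf)))|exact: bmD|].
    by move=> x; rewrite -[X in `|X - _|](subrK (\1_(B n) x)) -addrA; exact: ler_normD.
- move=> U oU; have mU := open_meas oU; split=> // {}e e0.
  have [f [cf f01 fU]] := open_seq oU.
  have [_ ] : bm (fun _ : X => 0 : R) /\ Ex mu (fun x => `|\1_U x - f n x|) @[n --> \oo] --> Ex mu (fun=> 0).
    apply: (@Ex_cvg _ _ _ mu _ _ 1) => [n|n x|x].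
    + by apply: (bm_norm (bmB (bm_indic mU) (cont_bm (cf n)))).1.
    + rewrite normr_id indicE; have /andP[? ?] := f01 n x.
      by case: (x \in U) => /=; rewrite ler_norml; apply/andP; split; lra.
    + rewrite -[0](@normr0 _ R) -(subrr (\1_U x)); apply: cvg_norm; apply: cvgB => //; exact: cvg_cst.
  rewrite Ex_cst => /cvgrPdist_lt/(_ _ e0)[N _ /(_ N (leqnn _))/=].
  by rewrite sub0r normrN => /ltr_normlW/ltW h; exists (f N).
Unshelve. all: end_near. Qed.

Lemma measure_ext_cont (mu nu : probability X R) :
  (forall f, cont f -> Ex mu f = Ex nu f) -> forall A, measurable A -> mu A = nu A.
Proof.
move=> h; apply: (measure_unique [set A | d_open d A] (fun=> setT)) => //.
- move=> A B oA oB x [Ax Bx]; have [r r0 hr] := oA _ Ax; have [s s0 hs] := oB _ Bx.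
  exists (Num.min r s); first by rewrite lt_min r0.
  by move=> y; rewrite lt_min => /andP[/hr ? /hs ?]; split.
- by move=> _ x _; exists 1 => //; exact: ltr01.
- by rewrite bigcup_const //; exists 0%N.
- move=> U oU; have mU := open_meas oU; apply: etrans (pmE mu mU) _.
  apply: etrans _ (esym (pmE nu mU)); rewrite -!Ex_indic //.
  have [f [cf f01 fU]] := open_seq oU.
  have cv (rho : probability X R) : Ex rho (f n) @[n --> \oo] --> Ex rho \1_U.
    have [//|n x|_ //] := @Ex_cvg _ _ _ rho f (\1_U) 1 _ _ fU.
      by move=> n; have [] := cont_bm (cf n).
    by have /andP[? ?] := f01 n x; rewrite ger0_norm.
  congr EFin; rewrite -(cvg_lim (@Rhausdorff R) (cv mu)) -(cvg_lim (@Rhausdorff R) (cv nu)).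
  by congr (lim (_ @ \oo)); apply/funext => n; exact: h.
- by move=> _; apply: le_lt_trans (probability_le1 _ _) (ltry _).
Qed.

End Borel.

(** The enumeration [e] is chosen before the series: in the covering argument one reordering must
    serve both the values at every point x and the values of L. *)
Lemma nneseries_nat2 {R : realType} : exists e : nat -> nat * nat,
  forall a : nat -> nat -> \bar R, (forall i j, 0 <= a i j)%E ->
   (\sum_(n <oo) a (e n).1 (e n).2 = \sum_(i <oo) \sum_(j <oo) a i j)%E.
Proof.
have /card_esym/ppcard_eqP[f] := card_nat2.
exists f => a a0.
have a0' x : (0 <= (uncurry a) x)%E by case: x.
transitivity (\esum_(p in setT) uncurry a p)%E.
  transitivity (\sum_(n <oo) uncurry a (f n))%E.
    by congr (limn _); apply/funext => n; apply: eq_bigr => i _; case: (f i).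
  rewrite -(esum_pred_image (uncurry a) _ xpredT) ?[fun=> _]set_true//.
  by rewrite image_eq.
rewrite nneseries_esumT; last by move=> i; apply: nneseries_ge0.
rewrite (_ : (fun i => _) = fun i => \esum_(j in setT) a i j)%E; last first.
  by apply/funext => i; rewrite nneseries_esumT.
rewrite esum_esum // (_ : [set: nat] `*`` _ = setT); last by apply/seteqP; split.
by apply: eq_esum => -[i j].
Qed.

(** * The Riesz representation theorem *)

Section Riesz.
Context {R : realType} {dX : measure_display} {X : measurableType dX} (d : X -> X -> R).
Hypothesis dm : is_metric d.
Hypothesis X_compact : d_compact d.
Hypothesis X_borel : @measurable _ X = <<s [set A | d_open d A] >>.
Local Notation cont := (@d_continuous_real R X d).

Variable L : (X -> R) -> R.
Hypothesis LD : forall f g, cont f -> cont g -> L (fun x => f x + g x) = L f + L g.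
Hypothesis LZ : forall c f, cont f -> L (fun x => c * f x) = c * L f.
Hypothesis L_mono : forall f g, cont f -> cont g -> (forall x, f x <= g x) -> L f <= L g.
Hypothesis L1 : L (fun=> 1) = 1.

Lemma L_cst c : L (fun=> c) = c.
Proof.
rewrite (_ : (fun=> c) = fun x : X => c * 1); last by apply/funext => x; rewrite mulr1.
by rewrite LZ ?L1 ?mulr1 //; exact: cont_cst.
Qed.

Lemma LB f g : cont f -> cont g -> L (fun x => f x - g x) = L f - L g.
Proof.
move=> cf cg; rewrite (_ : (fun x => _) = fun x : X => f x + (-1) * g x); last first.
  by apply/funext => x; rewrite mulN1r.
by rewrite LD // ?LZ // ?mulN1r //; apply: contM => //; exact: cont_cst.
Qed.

Lemma L_sum n (f : nat -> X -> R) : (forall i, cont (f i)) ->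
  L (fun x => \sum_(i < n) f i x) = \sum_(i < n) L (f i).
Proof.
move=> cf; elim: n => [|n IH].
  by rewrite big_ord0 (_ : (fun x => _) = fun=> 0) ?L_cst //; apply/funext => x; rewrite big_ord0.
rewrite big_ord_recr /= -IH -LD //; last exact: (cont_sum dm).
by congr L; apply/funext => x; rewrite big_ord_recr.
Qed.

Lemma L_ge0 f : cont f -> (forall x, 0 <= f x) -> 0 <= L f.
Proof. by move=> cf f0; rewrite -(L_cst 0); apply: L_mono => //; exact: cont_cst. Qed.

(* Covering A by a series of nonnegative continuous functions, rather than by open sets, makes
   countable subadditivity and the Caratheodory property of open sets immediate. *)
Definition fcover (A : set X) : set (nat -> X -> R) :=
  [set f | [/\ forall n, cont (f n), forall n x, 0 <= f n x &
     forall x, A x -> (1 <= \sum_(n <oo) (f n x)%:E)%E]].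

Definition rmeas (A : set X) : \bar R :=
  ereal_inf [set (\sum_(n <oo) (L (f n))%:E)%E | f in fcover A].

Lemma fcover_ge0 A f n : fcover A f -> (0 <= (L (f n))%:E)%E.
Proof. by move=> [cf f0 _]; rewrite lee_fin L_ge0. Qed.

Lemma rmeas_ge0 A : (0 <= rmeas A)%E.
Proof.
apply: le_ereal_inf_tmp => _ [f fA <-]; apply: nneseries_ge0 => n _ _; exact: fcover_ge0 fA.
Qed.

Lemma rmeas_mono A B : A `<=` B -> (rmeas A <= rmeas B)%E.
Proof.
move=> AB; apply: ereal_inf_le_tmp => _ [f [cf f0 fB] <-]; exists f => //.
by split=> // x /AB; exact: fB.
Qed.

Lemma rmeas0 : rmeas set0 = 0%E.
Proof.
apply/eqP; rewrite eq_le rmeas_ge0 andbT; apply: ereal_inf_lbound; exists (fun _ _ => 0).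
  by split=> // n; exact: cont_cst.
by rewrite eseries0 // => n _ _; rewrite L_cst.
Qed.

Lemma rmeas_cover2 A (f : nat -> nat -> X -> R) : (forall i j, cont (f i j)) ->
  (forall i j x, 0 <= f i j x) ->
  (forall x, A x -> (1 <= \sum_(i <oo) \sum_(j <oo) (f i j x)%:E)%E) ->
  (rmeas A <= \sum_(i <oo) \sum_(j <oo) (L (f i j))%:E)%E.
Proof.
move=> cf f0 fA.
have [e eE] := @nneseries_nat2 R.
rewrite -eE; last by move=> i j; rewrite lee_fin L_ge0.
apply: ereal_inf_lbound; exists (fun n => f (e n).1 (e n).2) => //; split=> // x Ax.
by rewrite (eE (fun i j => (f i j x)%:E)) ?fA // => i j; rewrite lee_fin.
Qed.

Lemma rmeas_sub : sigma_subadditive rmeas.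
Proof.
move=> A; have [[i ioo]|] := pselect (exists i, rmeas (A i) = +oo%E).
  by rewrite (eseries_pinfty _ _ ioo) ?leey// => n _; rewrite -ltNye (lt_le_trans _ (rmeas_ge0 _)).
rewrite -forallNE => Aoo.
apply/lee_addgt0Pr => e e0.
apply: le_trans (epsilon_trick (e := e) _ _ _); last 2 first.
- by move=> n; exact: rmeas_ge0.
- exact: ltW.
have /choice[g gP] : forall n, exists g, fcover (A n) g /\
   (\sum_(k <oo) (L (g k))%:E <= rmeas (A n) + (e / (2 ^ n.+1)%:R)%:E)%E.
  move=> n; have en : 0 < e / (2 ^ n.+1)%:R by rewrite divr_gt0 // ltr0n expn_gt0.
  have fn : rmeas (A n) \is a fin_num by rewrite ge0_fin_numE ?rmeas_ge0 // ltey; apply/eqP.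
  have [_ [g gA <-] /ltW h] := lb_ereal_inf_adherent en fn.
  by exists g.
apply: le_trans (_ : \sum_(n <oo) \sum_(k <oo) (L (g n k))%:E <= _)%E; last first.
  apply: lee_nneseries => [n _ _|n _]; last by case: (gP n).
  by apply: nneseries_ge0 => k _ _; have [h _] := gP n; exact: fcover_ge0 h.
apply: rmeas_cover2 => [i j|i j x|x [n _ Anx]].
- by have [[]] := gP i.
- by have [[]] := gP i.
have [[_ g0 /(_ x Anx) h] _] := gP n.
apply: le_trans h _; have s0 k : (0 <= \sum_(l <oo) (g k l x)%:E)%E.
  by apply: nneseries_ge0 => l _ _; rewrite lee_fin; have [[]] := gP k.
rewrite [leRHS](nneseries_split 0 n.+1); last by move=> k _; exact: s0.
rewrite add0n big_mkord big_ord_recr /=.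
apply: le_trans (leeDl _ _); first by rewrite leeDr // sume_ge0.
by apply: nneseries_ge0 => k _ _.
Qed.

HB.instance Definition _ := isOuterMeasure.Build R X rmeas rmeas0 rmeas_ge0
  rmeas_mono rmeas_sub.

(** With g_k increasing to the indicator of U, a cover f_n of A splits into the parts f_n g_k, which
    in the limit cover A inside U, and f_n (1 - g_k), which cover A outside U. Linearity of L makes
    the two costs add up to that of f_n. *)
Lemma rmeas_open U : d_open d U -> rmeas.-caratheodory U.
Proof.
move=> oU; have [v [cv v01 Uv]] := open_fun dm oU.
apply: le_caratheodory_measurable => A.
apply: le_ereal_inf_tmp => _ [f [cf f0 fA] <-].
apply/lee_addgt0Pr => e e0.
pose g (k : nat) x := Num.min 1 (k%:R * v x).
have cg k : cont (g k).
  by apply: (cont_min dm); [exact: cont_cst|apply: (contM dm) => //; exact: cont_cst].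
have v0 x : 0 <= v x by case/andP: (v01 x).
have g01 k x : 0 <= g k x <= 1 by rewrite le_min ler01 mulr_ge0 ?ler0n ?ge_min ?lexx.
have gm k x : g k x <= g k.+1 x.
  by rewrite /g le_min !ge_min lexx /= orbC ler_wpM2r ?orbT // ler_nat.
have g00 x : g 0%N x = 0 by rewrite /g mul0r minElt ltr10.
have gU x : U x -> exists N, forall k, (N <= k)%N -> g k x = 1.
  rewrite {1}Uv /= => vx; exists (Num.bound (v x)^-1) => k kn.
  apply/min_idPl; rewrite -ler_pdivrMr // mul1r.
  apply/ltW/(lt_le_trans (archi_boundP _)); first by rewrite invr_ge0 ltW.
  by rewrite ler_nat.
have gN x k : ~ U x -> g k x = 0.
  move=> nU; rewrite /g (_ : v x = 0) ?mulr0 ?minElt ?ltr10 //.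
  by apply/eqP; rewrite eq_le v0 andbT leNgt; apply/negP => h; apply: nU; rewrite Uv.
have cfg n k : cont (fun x => f n x * g k x) by exact: (contM dm).
pose a n k := L (fun x => f n x * g k x).
have a_le n k : a n k <= L (f n).
  apply: L_mono => // x; have /andP[_ h] := g01 k x.
  by rewrite ler_piMr.
have a_mono n : {homo a n : i j / (i <= j)%N >-> i <= j}.
  apply: homo_leq => [//||k]; first exact: le_trans.
  by apply: L_mono => // x; rewrite ler_wpM2l.
have a_sup n : has_sup (range (a n)).
  by split; [exists (a n 0%N); exists 0%N|exists (L (f n)) => _ [k _ <-]].
pose l n := sup (range (a n)).
have acv n : a n k @[k --> \oo] --> l n by apply: nondecreasing_cvgn => //; case: (a_sup n).
have l_le n : l n <= L (f n) by apply: ge_sup; [case: (a_sup n)|move=> _ [k _ <-]].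
have a_l n k : a n k <= l n by apply: ub_le_sup; [case: (a_sup n)|exists k].
have a0 n k : 0 <= a n k.
  by apply: L_ge0 => // x; rewrite mulr_ge0 //; case/andP: (g01 k x).
have l0 n : 0 <= l n := le_trans (a0 n 0%N) (a_l n 0%N).
(* inside U: telescope f_n 1_U = sum_k f_n (g_(k+1) - g_k) *)
have h1 : (rmeas (A `&` U) <= \sum_(n <oo) (l n)%:E)%E.
  have cD n k : cont (fun x => f n x * g k.+1 x - f n x * g k x) by exact: (contB dm).
  apply: le_trans (rmeas_cover2 (A := A `&` U) (f := fun n k x => f n x * g k.+1 x - f n x * g k x) _ _ _) _.
  - by move=> n k; exact: cD.
  - by move=> n k x; rewrite subr_ge0 ler_wpM2l.
  - move=> x [Ax Ux]; apply: le_trans (fA x Ax) _; apply: lee_nneseries => [n _ _|n _].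
      by rewrite lee_fin.
    have [N hN] := gU x Ux.
    rewrite (_ : (\sum_(j <oo) _)%E = (f n x)%:E) //.
    apply: cvg_lim => //; apply: cvg_near_cst; exists N => // m /= Nm.
    rewrite sumEFin (telescope_sumr (fun j => f n x * g j x) (leq0n m)).
    by rewrite hN // g00 mulr0 subr0 mulr1.
  apply: lee_nneseries => [n _ _|n _].
    by apply: nneseries_ge0 => k _ _; rewrite lee_fin LB // subr_ge0 a_mono.
  rewrite le_eqVlt; apply/orP; left; apply/eqP; apply: cvg_lim => //.
  rewrite (_ : (fun m => _) = fun m => (a n m)%:E); first by apply: cvg_EFin; [near=> m|exact: acv].
  apply/funext => m; rewrite sumEFin; congr EFin.
  rewrite (eq_bigr (fun k => a n k.+1 - a n k)); last by move=> k _; rewrite LB.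
  rewrite (telescope_sumr (a n) (leq0n m)); suff -> : a n 0%N = 0 by rewrite subr0.
  rewrite /a (_ : (fun x => _) = fun=> 0) ?L_cst //.
  by apply/funext => x; rewrite g00 mulr0.
(* The index k may depend on n, with geometric errors: all g_k vanish outside U, so any choice still
   gives a cover of A outside U. *)
have /choice[k hk] : forall n, exists k, l n - e / (2 ^ n.+1)%:R <= a n k.
  move=> n; have en : 0 < e / (2 ^ n.+1)%:R by rewrite divr_gt0 // ltr0n expn_gt0.
  have [_ [k _ <-] h] := sup_adherent en (a_sup n).
  by exists k; exact: ltW.
have h2 : (rmeas (A `&` ~` U) <= \sum_(n <oo) (L (f n) - a n (k n))%:E)%E.
  apply: ereal_inf_lbound; exists (fun n x => f n x - f n x * g (k n) x).
    split.
    - by move=> n; exact: (contB dm).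
    - by move=> n x; rewrite subr_ge0 ler_piMr //; case/andP: (g01 (k n) x).
    - move=> x [Ax nUx]; rewrite (eq_eseriesr (g := fun n => (f n x)%:E)); first exact: fA.
      by move=> n _; rewrite gN // mulr0 subr0.
  by apply: eq_eseriesr => n _; rewrite LB.
apply: le_trans (leeD h1 h2) _; rewrite -nneseriesD; last 2 first.
- by move=> n _ _; rewrite lee_fin.
- by move=> n _ _; rewrite lee_fin subr_ge0.
apply: le_trans (epsilon_trick (e := e) _ _ _); last 2 first.
- by move=> n; rewrite lee_fin L_ge0.
- exact: ltW.
apply: lee_nneseries => n _.
  by move=> _; rewrite -EFinD lee_fin addr_ge0 // subr_ge0.
by rewrite -!EFinD lee_fin; have := hk n; lra.
Unshelve. all: end_near. Qed.

Lemma rmeas_measurable A : measurable A -> rmeas.-caratheodory A.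
Proof.
rewrite X_borel; apply: smallest_sub; last by move=> U; exact: rmeas_open.
have := @sigma_algebra_measurable _ (caratheodory_type (R := R) rmeas).
by [].
Qed.

(** The constant 1 is a cover of cost 1. Conversely some partial sum of any cover exceeds 1 - e
    everywhere, by [cont_dini], and then so does its value under L. *)
Lemma rmeasT : rmeas setT = 1%E.
Proof.
apply/eqP; rewrite eq_le; apply/andP; split.
  apply: ereal_inf_lbound; exists (fun n => if n == 0%N then fun=> 1 else fun=> 0).
    split=> [[|n]|[|n] x|x _] /=; try exact: cont_cst; rewrite ?ler01 //.
    rewrite (nneseries_split 0 1); last by move=> [|k] _ /=; rewrite lee_fin ?ler01.
    rewrite add0n big_nat1 /= leeDl // nneseries_ge0 // => -[|k] _ _ /=; rewrite lee_fin //.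
  rewrite (nneseries_split 0 1); last by move=> [|k] _ /=; rewrite L_cst lee_fin ?ler01.
  by rewrite add0n big_nat1 /= L1 eseries0 ?adde0 // => -[|k] //= _ _; rewrite L_cst.
apply: le_ereal_inf_tmp => _ [f [cf f0 fA] <-].
apply/lee_addgt0Pr => e e0.
have cS n : cont (fun x => \sum_(i < n) f i x) by exact: cont_sum.
have [||x|n hn] := cont_dini X_compact (c := 1 - e) (f := fun n x => \sum_(i < n) f i x).
- by [].
- move=> m n x mn; rewrite -(subnKC mn) big_split_ord /= lerDl sumr_ge0 //.
- apply: contrapT => /forallNP h; have := fA x I.
  have : (\sum_(n <oo) (f n x)%:E <= (1 - e)%:E)%E.
    apply: lime_le; first by apply: is_cvg_nneseries => n _ _; rewrite lee_fin.
    near=> n; rewrite big_mkord sumEFin lee_fin leNgt; apply/negP; exact: h.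
  by move=> h1 h2; have := le_trans h2 h1; rewrite lee_fin; lra.
have h : 1 - e <= \sum_(i < n) L (f i).
  rewrite -L_sum // -(L_cst (1 - e)); apply: L_mono => //; first exact: cont_cst.
  by move=> x; exact: ltW.
rewrite (nneseries_split 0 n); last by move=> k _; rewrite lee_fin L_ge0.
apply: le_trans (leeD (leeDl _ _) (lexx _)); last first.
  by apply: nneseries_ge0 => k _ _; rewrite lee_fin L_ge0.
by rewrite add0n big_mkord sumEFin -EFinD lee_fin; lra.
Unshelve. all: end_near. Qed.

(** A second name for [rmeas], which already carries the outer measure structure; this one receives
    the measure structure. *)
Let mrmeas : set X -> \bar R := rmeas.

Let mrmeas0 : mrmeas set0 = 0%E. Proof. exact: rmeas0. Qed.
Let mrmeas_ge0 A : (0 <= mrmeas A)%E. Proof. exact: rmeas_ge0. Qed.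
Let mrmeas_sadd : semi_sigma_additive mrmeas.
Proof.
move=> A mA tA mU; apply: (caratheodory_measure_sigma_additive (mu := rmeas)) => //.
  by move=> n; apply: rmeas_measurable.
exact: rmeas_measurable.
Qed.

HB.instance Definition _ := isMeasure.Build _ X R mrmeas mrmeas0 mrmeas_ge0 mrmeas_sadd.

Let mrmeasT : mrmeas setT = 1%E. Proof. exact: rmeasT. Qed.

HB.instance Definition _ := Measure_isProbability.Build _ X R mrmeas mrmeasT.

(** It is enough to show Ex f <= L f for f with values in [0,1]: the same inequality for 1 - f gives
    equality, and an affine rescaling reaches all continuous functions. *)
Lemma riesz : exists mu : probability X R, forall f, cont f -> Ex mu f = L f.
Proof.
exists mrmeas.
have le1 f : cont f -> (forall x, 0 <= f x <= 1) -> Ex mrmeas f <= L f.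
  move=> cf f01; apply/ler_addgt0Pr => e e0.
  pose n := (Num.bound e^-1).+1; have n0 : 0 < n%:R :> R by rewrite ltr0n.
  have ne : n%:R^-1 <= e.
    rewrite invf_ple ?posrE //; apply/ltW/(lt_le_trans (archi_boundP _)).
      by rewrite invr_ge0 ltW.
    by rewrite ler_nat.
  (* f is cut into n layers of height 1/n. The layer g_i lies between 1/n times the indicator of f >
     (i+1)/n and 1/n times the indicator of f > i/n. *)
  pose g (i : nat) x := Num.min (f x) (i.+1%:R / n%:R) - Num.min (f x) (i%:R / n%:R).
  have cg i : cont (g i).
    by apply: contB => //; apply: cont_min => //; exact: cont_cst.
  have gE : f = fun x => \sum_(i < n) g i x.
    apply/funext => x; rewrite -(big_mkord xpredT (fun i => g i x)).
    rewrite (telescope_sumr (fun i => Num.min (f x) (i%:R / n%:R)) (leq0n n)).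
    rewrite mul0r divff ?gt_eqF // (min_idPl _) ?(min_idPr _) ?subr0 //; by case/andP: (f01 x).
  have bg i : bm (g i) := cont_bm dm X_compact X_borel (cg i).
  have i1 (i : nat) : i%:R / n%:R <= i.+1%:R / n%:R :> R by rewrite ler_pM2r ?invr_gt0 // ler_nat.
  have g0 i x : 0 <= g i x.
    by rewrite subr_ge0 le_min !ge_min lexx i1 orbT.
  pose A (i : nat) := [set x | i%:R / n%:R < f x].
  have mA i : measurable (A i) by apply: (open_meas X_borel); exact: d_open_gt.
  have g_le i : Ex mrmeas (g i) <= n%:R^-1 * pm mrmeas (A i).
    rewrite -Ex_indic // -ExZ; last exact: bm_indic.
    apply: Ex_le => //; first by apply: bmM; [exact: bm_cst|exact: bm_indic].
    move=> x; rewrite indicE; have [Ax|nA] := pselect (A i x).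
      rewrite mem_set // mulr1 /g lerBlDr.
      rewrite (_ : n%:R^-1 + _ = i.+1%:R / n%:R) ?ge_min ?lexx ?orbT //.
      by rewrite (min_idPr _) ?ltW // -[X in X + _]mul1r -mulrDl -natr1 addrC.
    rewrite memNset // mulr0 /g; move/negP: nA; rewrite -leNgt => fi.
    rewrite !(min_idPl _) ?subrr //; exact: le_trans fi (i1 i).
  (* The single function n g_i is at least 1 where f > (i+1)/n, so it is by itself an admissible
     cover of that set. *)
  have A_le i : n%:R^-1 * pm mrmeas (A i.+1) <= L (g i).
    rewrite mulrC ler_pdivrMr // mulrC -lee_fin -pmE //.
    apply: ereal_inf_lbound; exists (fun k => if k == 0%N then fun x => n%:R * g i x else fun=> 0).
      split=> [[|k]|[|k] x|x Ax] /=.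
      - by apply: contM => //; exact: cont_cst.
      - exact: cont_cst.
      - by rewrite mulr_ge0.
      - by [].
      rewrite (nneseries_split 0 1); last by move=> [|k] _ /=; rewrite lee_fin ?mulr_ge0.
      rewrite add0n big_nat1 /= eseries0 ?adde0; last by case.
      rewrite lee_fin /g (min_idPr _); last exact: ltW.
      rewrite (min_idPr _); last first.
        exact: le_trans (i1 i) (ltW Ax).
      by rewrite -mulrBl -natr1 addrAC subrr add0r mul1r divff ?gt_eqF.
    rewrite (nneseries_split 0 1); last first.
      move=> [|k] _ /=; rewrite lee_fin ?L_cst // LZ // mulr_ge0 // L_ge0 //.
    by rewrite add0n big_nat1 /= LZ // eseries0 ?adde0 // => -[|k] //= _ _; rewrite L_cst.
  rewrite {1}gE Ex_sum // [X in L X]gE L_sum //.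
  (* The upper and lower bounds on layers are off by one index: the bottom layer costs at most 1/n
     <= e, and every other layer is compared with the one below it. *)
  have -> : n = (n.-1).+1 by [].
  rewrite big_ord_recl [leRHS]addrC; apply: lerD.
    apply: le_trans (g_le _) _; apply: le_trans ne.
    by rewrite -[leRHS]mulr1 ler_pM2l ?invr_gt0 //; exact: (ch_le1 (charge_pm mrmeas)).
  rewrite [leRHS]big_ord_recr /=.
  apply: le_trans (_ : \sum_(i < n.-1) L (g i) <= _); last by rewrite lerDl L_ge0.
  by apply: ler_sum => i _; apply: le_trans (g_le _) (A_le _).
have eq1 f : cont f -> (forall x, 0 <= f x <= 1) -> Ex mrmeas f = L f.
  move=> cf f01; apply/eqP; rewrite eq_le le1 //=.
  have c1 : cont (fun=> 1) by exact: cont_cst.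
  have h : Ex mrmeas (fun x => 1 - f x) <= L (fun x => 1 - f x).
    apply: le1; first exact: (contB dm c1 cf).
    by move=> x; have /andP[? ?] := f01 x; apply/andP; split; lra.
  have bf := cont_bm dm X_compact X_borel cf.
  have b1 : bm (fun _ : X => 1 : R) := bm_cst 1.
  by move: h; rewrite LB // L1 ExB // Ex_cst; lra.
move=> f cf; have [M M0 fM] := cont_bounded dm X_compact cf.
pose K := 2 * (M + 1); have K0 : 0 < K by rewrite /K; lra.
pose g x := K^-1 * (f x + M).
have cfM : cont (fun x => f x + M) by apply: contD => //; exact: cont_cst.
have cg : cont g by apply: contM => //; exact: cont_cst.
have bf := cont_bm dm X_compact X_borel cf.
have h : Ex mrmeas g = L g.
  apply: eq1 => // x; have := fM x; rewrite ler_norml => /andP[? ?].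
  by rewrite /g mulrC divr_ge0 ?(ltW K0) //= ?ler_pdivrMr // /K; lra.
have bM : bm (fun _ : X => M) := bm_cst M.
have cM : cont (fun=> M) by exact: cont_cst.
move: h; rewrite /g LZ // ExZ; last exact: cont_bm cfM.
rewrite LD // ExD // L_cst Ex_cst => h; apply: (addIr M); apply: (mulfI (x := K^-1)) => //.
by rewrite invr_neq0 // gt_eqF.
Qed.

End Riesz.

(** * Ergodic decomposition *)

Section UltraLimit.
Context {R : realType}.

Lemma ultra_fmap (T S : Type) (U : set_system T) (u : T -> S) : UltraFilter U -> UltraFilter (u @ U).
Proof.
move=> UF; split; first exact: fmap_proper_filter.
move=> G GF uG; apply/seteqP; split=> // A GA.
have [//|UA] := in_ultra_setVsetC (u @^-1` A) UF.
have : G (~` A) by apply: uG.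
by move=> GC; have := @filter_ex _ G _ _ (filterI GA GC); case=> x [].
Qed.

(** Along an ultrafilter all bounded sequences converge at once, so weak limits can be formed
    without extracting subsequences. *)
Lemma ulim_ex (U : set_system nat) (u : nat -> R) (M : R) : UltraFilter U ->
  (forall n, `|u n| <= M) -> exists l : R, u @ U --> l.
Proof.
move=> UF uM; have := @segment_compact R (- M) M; rewrite compact_ultra.
move=> /(_ (u @ U) (ultra_fmap _ UF)) [|l [_ ul]]; last by exists l.
by apply: (@filterE _ U) => n /=; rewrite in_itv /= -ler_norml.
Qed.

End UltraLimit.

Section Pushforward.
Context {R : realType} {dX : measure_display} {X : measurableType dX}.

Lemma pushforward_prob (mu : probability X R) (h : X -> X) : measurable_fun setT h ->
  exists nu : probability X R, (forall A, nu A = mu (h @^-1` A)) /\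
    forall f, bm f -> Ex nu f = Ex mu (f \o h).
Proof.
move=> mh; pose H : {mfun X >-> X} := HB.pack h (isMeasurableFun.Build _ _ _ _ h mh).
exists (distribution mu H); split=> // f bf.
have bfh : bm (f \o h).
  by split; [apply: measurableT_comp => //; exact: bf.1|have [_ [M fM]] := bf; exists M => x; exact: fM].
apply: EFin_inj; rewrite -!ExE //.
rewrite integral_distribution //; last exact: bm_int.
by apply/measurable_EFinP; exact: bf.1.
Qed.

End Pushforward.

(** * States, invariance and orbit averages *)

Section Dynamics.
Context {R : realType} {G : groupType} {dX : measure_display} {X : measurableType dX}
  (d : X -> X -> R) (act : G -> X -> X).
Hypothesis d_metric : is_metric d.
Hypothesis X_compact : d_compact d.
Hypothesis X_borel : @measurable _ X = <<s [set A | d_open d A] >>.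
Hypothesis act_action : is_action act.
Hypothesis act_cont : forall g, d_continuous d (act g).
Local Notation cont := (@d_continuous_real R X d).

(** Positive normalized linear functionals on C(X). The laws are required for continuous arguments
    only, while the functional is defined on all functions; orbit averages and expectations are of
    this kind. *)
Record state (L : (X -> R) -> R) : Prop := {
  stD : forall f g, cont f -> cont g -> L (fun x => f x + g x) = L f + L g;
  stZ : forall c f, cont f -> L (fun x => c * f x) = c * L f;
  st_le : forall f g, cont f -> cont g -> (forall x, f x <= g x) -> L f <= L g;
  st1 : L (fun=> 1) = 1 }.

Lemma st_cst L c : state L -> L (fun=> c) = c.
Proof.
move=> sL; rewrite (_ : (fun=> c) = fun x : X => c * 1); last by apply/funext => x; rewrite mulr1.
by rewrite (stZ sL) ?(st1 sL) ?mulr1 //; exact: cont_cst.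
Qed.

Lemma st_bound L f (M : R) : state L -> cont f -> (forall x, `|f x| <= M) -> `|L f| <= M.
Proof.
move=> sL cf fM; have cM c : cont (fun=> c) by exact: cont_cst.
rewrite ler_norml -{1}(st_cst (- M) sL) -{2}(st_cst M sL); apply/andP; split;
by apply: (st_le sL) => // x; have := fM x; rewrite ler_norml => /andP[].
Qed.

(** Weak compactness of the set of probabilities: the Riesz theorem is applied to the pointwise
    ultralimit of the states. *)
Lemma state_ulim (U : set_system nat) (L : nat -> (X -> R) -> R) : UltraFilter U ->
  (forall n, state (L n)) ->
  exists mu : probability X R, forall f, cont f -> L n f @[n --> U] --> Ex mu f.
Proof.
move=> UF sL.
have cv f : cont f -> exists l : R, L n f @[n --> U] --> l.
  move=> cf; have [M _ fM] := cont_bounded d_metric X_compact cf.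
  by apply: (@ulim_ex _ _ _ M) => n; exact: st_bound.
pose Lu f := lim (L n f @[n --> U]).
have LuP f : cont f -> L n f @[n --> U] --> Lu f.
  by move=> /cv[l hl]; rewrite /Lu (cvg_lim (@Rhausdorff R) hl).
have LuE f l : L n f @[n --> U] --> l -> Lu f = l by move=> /(cvg_lim (@Rhausdorff R)).
have [|||| mu hmu] := @riesz _ _ _ _ d_metric X_compact X_borel Lu.
- move=> f g cf cg; apply: LuE.
  rewrite (_ : (fun n => _) = fun n => L n f + L n g); first by apply: cvgD; exact: LuP.
  by apply/funext => n; rewrite (stD (sL n)).
- move=> c f cf; apply: LuE.
  rewrite (_ : (fun n => _) = fun n => c * L n f); first by apply: cvgMr; exact: LuP.
  by apply/funext => n; rewrite (stZ (sL n)).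
- move=> f g cf cg fg; rewrite -subr_ge0.
  have h : L n g - L n f @[n --> U] --> Lu g - Lu f by apply: cvgB; exact: LuP.
  rewrite -(cvg_lim (@Rhausdorff R) h); apply: limr_ge; first by apply/cvg_ex; exists (Lu g - Lu f).
  by apply: filterE => n; rewrite subr_ge0 (st_le (sL n)).
- apply: LuE; rewrite (_ : (fun n => _) = fun=> 1); first exact: cvg_cst.
  by apply/funext => n; rewrite (st1 (sL n)).
by exists mu => f cf; rewrite hmu //; exact: LuP.
Qed.

Lemma state_Ex (mu : probability X R) : state (Ex mu).
Proof.
split=> [f g cf cg|c f cf|f g cf cg fg|].
- by rewrite ExD //; apply: (cont_bm d_metric X_compact X_borel).
- by rewrite ExZ //; apply: (cont_bm d_metric X_compact X_borel).
- by apply: Ex_le => //; apply: (cont_bm d_metric X_compact X_borel).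
- by rewrite Ex_cst.
Qed.

Lemma act_meas g : measurable_fun setT (act g).
Proof. exact: (dcont_meas X_borel (act_cont g)). Qed.

Lemma act_pre g A : measurable A -> measurable (act g @^-1` A).
Proof. by move=> mA; rewrite -[_ @^-1` _]setTI; exact: act_meas. Qed.

Lemma bm_act g (f : X -> R) : bm f -> bm (f \o act g).
Proof.
move=> [mf [M fM]]; split; last by exists M => x; exact: fM.
by apply: measurableT_comp => //; exact: act_meas.
Qed.

Lemma cont_act g f : cont f -> cont (f \o act g).
Proof. by move=> cf; apply: (cont_comp (act_cont g)). Qed.

Lemma Ex_act (mu : probability X R) g f : invariant_measure act mu -> bm f ->
  Ex mu (f \o act g) = Ex mu f.
Proof.
move=> im bf; have [nu [nuE <- //]] := pushforward_prob mu (act_meas g).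
rewrite /Ex /Rintegral; congr fine; apply: eq_measure_integral => A mA _.
by apply: etrans (nuE A) (im g A mA).
Qed.

Lemma inv_measureP (mu : probability X R) :
  (forall g f, cont f -> Ex mu (f \o act g) = Ex mu f) -> invariant_measure act mu.
Proof.
move=> h g A mA; have [nu [nuE nuEx]] := pushforward_prob mu (act_meas g).
rewrite -nuE; apply: (measure_ext_cont d_metric X_compact X_borel) => // f cf.
by rewrite nuEx ?h //; apply: (cont_bm d_metric X_compact X_borel).
Qed.

Definition orbit_avg (A : {fset G}) (f : X -> R) (x : X) : R :=
  #|` A|%:R^-1 * \sum_(g <- A) f (act g x).

Lemma cont_avg A f : cont f -> cont (orbit_avg A f).
Proof.
move=> cf; apply: (contM d_metric); first exact: cont_cst.
by apply: (cont_sum d_metric) => g; exact: cont_act.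
Qed.

Lemma bm_avg A f : bm f -> bm (orbit_avg A f).
Proof. by move=> bf; apply: bmM; [exact: bm_cst|apply: bm_sum => g; exact: bm_act]. Qed.

Lemma Ex_avg (mu : probability X R) A f : invariant_measure act mu -> bm f -> A != fset0%fset ->
  Ex mu (orbit_avg A f) = Ex mu f.
Proof.
move=> im bf A0; rewrite /orbit_avg ExZ; last by apply: bm_sum => g; exact: bm_act.
rewrite (Ex_sum mu _ _ (f := fun g x => f (act g x))); last by move=> g; exact: bm_act.
rewrite (eq_bigr (fun=> Ex mu f)); last by move=> g _; exact: Ex_act.
by rewrite sum_fset_const mulrA mulVf ?mul1r // pnatr_eq0 cardfs_eq0.
Qed.

Lemma avgD A f g x : orbit_avg A (fun x => f x + g x) x = orbit_avg A f x + orbit_avg A g x.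
Proof. by rewrite /orbit_avg big_split mulrDr. Qed.

Lemma avgZ A c f x : orbit_avg A (fun x => c * f x) x = c * orbit_avg A f x.
Proof. by rewrite /orbit_avg -mulr_sumr mulrCA. Qed.

Lemma avg_cst (A : {fset G}) c x : A != fset0%fset -> orbit_avg A (fun=> c) x = c.
Proof. by move=> A0; rewrite /orbit_avg sum_fset_const mulrA mulVf ?mul1r // pnatr_eq0 cardfs_eq0. Qed.

Lemma avg_le A f g x : (forall x, f x <= g x) -> orbit_avg A f x <= orbit_avg A g x.
Proof. by move=> fg; rewrite /orbit_avg ler_wpM2l ?invr_ge0 //; apply: ler_sum. Qed.

Lemma avg_bound A f (M : R) x : A != fset0%fset -> (forall x, `|f x| <= M) -> `|orbit_avg A f x| <= M.
Proof.
move=> A0 fM; rewrite ler_norml -{1}(avg_cst (- M) x A0) -{2}(avg_cst M x A0); apply/andP; split;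
by apply: avg_le => y; have := fM y; rewrite ler_norml => /andP[].
Qed.

Lemma state_avg A x : A != fset0%fset -> state (fun f => orbit_avg A f x).
Proof.
move=> A0; split=> [f g _ _|c f _|f g _ _|].
- exact: avgD.
- exact: avgZ.
- exact: avg_le.
- exact: avg_cst.
Qed.

(** Composing f with g moves the index set from A to g A, and the indices common to both cancel. The
    bound does not depend on x, which gives uniform estimates later. *)
Lemma avg_shift A f g (M : R) x : (forall x, `|f x| <= M) ->
  `|orbit_avg A (f \o act g) x - orbit_avg A f x| <= M * (#|` fsym_diff (translate g A) A|%:R / #|` A|%:R).
Proof.
move=> fM; have M0 : 0 <= M := le_trans (normr_ge0 _) (fM x).
rewrite /orbit_avg -mulrBr normrM ger0_norm ?invr_ge0 // mulrA mulrC ler_wpM2r ?invr_ge0 //.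
have -> : \sum_(h <- A) (f \o act g) (act h x) = \sum_(h <- translate g A) f (act h x).
  rewrite big_imfset /=; last by move=> a b _ _; exact: mulgI.
  by apply: eq_bigr => h _; rewrite -act_action.2.
rewrite (big_fsetID _ (mem A)) /= [X in _ - X](big_fsetID _ (mem (translate g A))) /=.
rewrite (_ : [fset x in translate g A | x \in A]%fset = [fset x in A | x \in translate g A]%fset); last first.
  by apply/fsetP => h; rewrite !inE andbC.
rewrite opprD addrACA subrr add0r.
apply: le_trans (ler_normB _ _) _.
have le1 (B : {fset G}) : `|\sum_(h <- B) f (act h x)| <= M * #|` B|%:R.
  apply: le_trans (ler_norm_sum _ _ _) _; rewrite mulrC -sum_fset_const.
  by apply: ler_sum => h _; exact: fM.
apply: le_trans (lerD (le1 _) (le1 _)) _; rewrite -mulrDr -natrD ler_wpM2l // ler_nat.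
rewrite /fsym_diff cardfsU (_ : (_ `&` _)%fset = fset0) ?cardfs0 ?subn0; last first.
  by apply/fsetP => h; rewrite !inE; case: (h \in A); rewrite ?andbF.
apply: leq_add; apply: fsubset_leq_card; apply/fsubsetP => h; rewrite !inE.
  by move=> /andP[-> ->].
by move=> /andP[-> ->].
Qed.

End Dynamics.

(** * The mean ergodic theorem in L2 and almost everywhere limits *)

Section MeanErgodic.
Context {R : realType} {G : groupType} {dX : measure_display} {X : measurableType dX}
  (d : X -> X -> R) (act : G -> X -> X) (F : nat -> {fset G}).
Hypothesis d_metric : is_metric d.
Hypothesis X_compact : d_compact d.
Hypothesis X_borel : @measurable _ X = <<s [set A | d_open d A] >>.
Hypothesis act_action : is_action act.
Hypothesis act_cont : forall g, d_continuous d (act g).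
Hypothesis F_folner : @folner R G F.
Local Notation cont := (@d_continuous_real R X d).
Local Notation avg := (@orbit_avg R G dX X act).
Variable mu : probability X R.
Hypothesis mu_inv : invariant_measure act mu.

Let F0 n : F n != fset0%fset := F_folner.1 n.
Let bma := (bm_act X_borel act_cont).

(** The convex hull of the orbit of f, presented inductively: boundedness, stability under G and
    closeness of averages to those of f are all proved by induction on it. *)
Inductive hull (f : X -> R) : (X -> R) -> Prop :=
| hull_act g : hull f (f \o act g)
| hull_conv (t : R) u v : 0 <= t <= 1 -> hull f u -> hull f v ->
    hull f (fun x => t * u x + (1 - t) * v x).

Lemma bm_sq (f : X -> R) : bm f -> bm (fun x => f x ^+ 2).
Proof.
by move=> bf; rewrite (_ : (fun x => _) = fun x => f x * f x); [exact: bmM|apply/funext => x; rewrite expr2].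
Qed.

Lemma bmZ (c : R) (f : X -> R) : bm f -> bm (fun x => c * f x).
Proof. by move=> bf; apply: bmM => //; exact: bm_cst. Qed.

Lemma hull_comp f u g : hull f u -> hull f (u \o act g).
Proof.
elim=> [h|t u' v' t01 _ IHu _ IHv]; last exact: (hull_conv t01 IHu IHv).
rewrite (_ : _ \o _ = f \o act (h * g)%g); first exact: hull_act.
by apply/funext => x /=; rewrite act_action.2.
Qed.

Lemma hull_bm f u : bm f -> hull f u -> bm u.
Proof.
move=> bf; elim=> [h|t u' v' t01 _ IHu _ IHv]; first exact: bma.
by apply: bmD; apply: bmZ.
Qed.

Lemma hull_bound f u (M : R) : (forall x, `|f x| <= M) -> hull f u -> forall x, `|u x| <= M.
Proof.
move=> fM; elim=> [h x|t u' v' /andP[t0 t1] _ IHu _ IHv x]; first exact: fM.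
have t1' : 0 <= 1 - t by rewrite subr_ge0.
apply: le_trans (ler_normD _ _) _; rewrite !normrM (ger0_norm t0) (ger0_norm t1').
by have := ler_wpM2l t0 (IHu x); have := ler_wpM2l t1' (IHv x); lra.
Qed.

Lemma hull_avg f (A : {fset G}) : A != fset0%fset -> hull f (avg A f).
Proof.
elim/fset1U_rect: A => [|g A gA IH _]; first by rewrite eqxx.
have [->|A0] := eqVneq (A : {fset G}) fset0%fset.
  rewrite fsetU0 (_ : avg _ _ = f \o act g); first exact: hull_act.
  by apply/funext => x; rewrite /avg cardfs1 invr1 mul1r big_seq_fset1.
pose t : R := (#|` A|%:R + 1)^-1.
have c0 : (0 : R) < #|` A|%:R by rewrite ltr0n cardfs_gt0.
have t01 : 0 <= t <= 1.
  by rewrite invr_ge0 addr_ge0 ?ler0n //= invf_le1 ?lerDr ?ler0n // addr_gt0.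
have := hull_conv t01 (hull_act f g) (IH A0); congr hull; apply/funext => x.
rewrite /avg cardfsU1 gA natrD big_fsetU1 //= mulrDr; congr (_ + _).
  by rewrite /t [(1%:R : R) + _]addrC.
rewrite mulrA; congr (_ * _); rewrite /t; field.
by apply/andP; split; rewrite gt_eqF // addr_gt0.
Qed.

Lemma avg_hull_near f u (e : R) : bm f -> hull f u -> 0 < e ->
  \forall n \near \oo, forall x, `|avg (F n) u x - avg (F n) f x| <= e.
Proof.
move=> [mf [M fM]] hu e0; have M0 : 0 <= M := le_trans (normr_ge0 _) (fM point).
elim: hu => [h|t u' v' /andP[t0 t1] _ IHu _ IHv].
  have e1 : 0 < e / (M + 1) by rewrite divr_gt0 // ltr_wpDl.
  have := folner_near F_folner h e1; apply: filterS => n hn x.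
  apply: le_trans (avg_shift act_action _ _ _ fM) _.
  have Fp := folner_card_gt0 F_folner n.
  apply: le_trans (_ : M * (e / (M + 1)) <= _).
    by rewrite ler_wpM2l // ler_pdivrMr.
  by rewrite mulrA ler_pdivrMr ?ltr_wpDl // mulrC ler_pM2l // lerDl.
have t1' : 0 <= 1 - t by rewrite subr_ge0.
apply: filterS2 IHu IHv => n hu hv x.
rewrite avgD !avgZ (_ : _ - _ = t * (avg (F n) u' x - avg (F n) f x) +
   (1 - t) * (avg (F n) v' x - avg (F n) f x)); last by ring.
apply: le_trans (ler_normD _ _) _; rewrite !normrM (ger0_norm t0) (ger0_norm t1').
by have := ler_wpM2l t0 (hu x); have := ler_wpM2l t1' (hv x); lra.
Qed.

Lemma avg_sq A f x : A != fset0%fset -> avg A f x ^+ 2 <= avg A (fun y => f y ^+ 2) x.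
Proof.
move=> A0; set c := avg A f x.
have : avg A (fun y => 2 * c * f y + - c ^+ 2) x <= avg A (fun y => f y ^+ 2) x.
  by apply: avg_le => y; have := sqr_ge0 (f y - c); rewrite sqrrB; lra.
by rewrite avgD avgZ avg_cst // -/c; lra.
Qed.

Lemma Ex_avg_sq A f : bm f -> A != fset0%fset ->
  Ex mu (fun x => avg A f x ^+ 2) <= Ex mu (fun x => f x ^+ 2).
Proof.
move=> bf A0; rewrite -(Ex_avg X_borel act_cont mu_inv (bm_sq bf) A0); apply: Ex_le.
- exact/bm_sq/(bm_avg X_borel act_cont).
- exact/(bm_avg X_borel act_cont)/bm_sq.
- by move=> x; exact: avg_sq.
Qed.

(* Elements of nearly minimal norm in the convex hull of the orbit are close by the parallelogram
   identity, and Folner averages of f are asymptotically as short as any hull element. *)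
Lemma hull_L2_cauchy f (e : R) : bm f -> 0 < e -> \forall N \near \oo,
  forall n m g, (N <= n)%N -> (N <= m)%N ->
  Ex mu (fun x => (avg (F n) f x - avg (F m) f x) ^+ 2) <= e /\
  Ex mu (fun x => (avg (F n) f x - avg (F n) f (act g x)) ^+ 2) <= e.
Proof.
move=> bf e0; have [mf [M fM]] := bf.
have M0 : 0 <= M := le_trans (normr_ge0 _) (fM point).
pose S := [set Ex mu (fun x => u x ^+ 2) | u in hull f].
have hf : hull f f.
  have := hull_act f 1%g; congr hull; apply/funext => x /=; by rewrite act_action.1.
have S0 : S !=set0 by exists (Ex mu (fun x => f x ^+ 2)); exists f.
have Slb : lbound S 0.
  move=> _ [u hu <-]; apply: Ex_ge0; first exact/bm_sq/(hull_bm bf hu).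
  by move=> x; exact: sqr_ge0.
have Si : has_inf S by split=> //; exists 0.
pose c := inf S.
have cl u : hull f u -> c <= Ex mu (fun x => u x ^+ 2).
  by move=> hu; apply: ge_inf; [exists 0|exists u].
have e8 : 0 < e / 8 by rewrite divr_gt0.
have [_ [u hu <-] ule] := inf_adherent e8 Si.
have bu := hull_bm bf hu.
have uM := hull_bound fM hu.
(* A uniform error s on functions bounded by M changes squares by at most 2 M s + s^2. This is made
   at most e / 8, so that late averages of f have squared norm at most c + e / 4; the parallelogram
   identity then bounds squared distances by e. *)
pose s := Num.min 1 (e / (8 * (2 * M + 1))).
have s0 : 0 < s by rewrite lt_min ltr01 divr_gt0 // mulr_gt0 // ltr_wpDl // mulr_ge0.
have sle : 2 * M * s + s ^+ 2 <= e / 8.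
  have s1 : s <= 1 by rewrite ge_min lexx.
  have s2 : s * (2 * M + 1) <= e / 8.
    rewrite -ler_pdivlMr ?ltr_wpDl ?mulr_ge0 // ge_min orbC.
    by rewrite invfM mulrA lexx.
  apply: le_trans s2; rewrite mulrDr mulr1 [2 * M * s]mulrC lerD2l.
  by rewrite expr2 ler_piMl // ltW.
have near1 := avg_hull_near bf hu s0.
have [N _ hN] := near1.
have small n : (N <= n)%N -> Ex mu (fun x => avg (F n) f x ^+ 2) <= c + e / 4.
  move=> Nn; have h := hN n Nn.
  have bA : bm (avg (F n) u) := bm_avg X_borel act_cont (F n) bu.
  have bf' : bm (avg (F n) f) := bm_avg X_borel act_cont (F n) bf.
  have AM x : `|avg (F n) u x| <= M by apply: avg_bound.
  have : Ex mu (fun x => avg (F n) f x ^+ 2) <= Ex mu (fun x => avg (F n) u x ^+ 2 + (2 * M * s + s ^+ 2)).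
    apply: Ex_le; [exact: bm_sq|by apply: bmD; [exact: bm_sq|exact: bm_cst]|move=> x].
    set a := avg (F n) f x; set b := avg (F n) u x.
    have ab : `|b - a| <= s := h x. have bM : `|b| <= M := AM x.
    have -> : a ^+ 2 = b ^+ 2 - 2 * b * (b - a) + (b - a) ^+ 2 by ring.
    rewrite -addrA lerD2l lerD //.
      apply: le_trans (ler_norm _) _; rewrite normrN normrM.
      by apply: ler_pM => //; rewrite normrM ger0_norm // ler_wpM2l.
    by rewrite -real_normK ?num_real // ler_pXn2r ?nnegrE // ltW.
  rewrite ExD; [|exact: bm_sq|exact: bm_cst].
  rewrite Ex_cst; have := Ex_avg_sq bu (F0 n); lra.
have par v w : hull f v -> hull f w -> Ex mu (fun x => v x ^+ 2) <= c + e/4 ->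
    Ex mu (fun x => w x ^+ 2) <= c + e/4 -> Ex mu (fun x => (v x - w x) ^+ 2) <= e.
  move=> hv hw vl wl; have bv := hull_bm bf hv; have bw := hull_bm bf hw.
  have t01 : 0 <= (2^-1 : R) <= 1 by apply/andP; split; lra.
  have hm := hull_conv t01 hv hw; have bm' := hull_bm bf hm.
  have := cl _ hm.
  have E : (fun x => (v x - w x) ^+ 2) = fun x => (2 * v x ^+ 2 + 2 * w x ^+ 2) -
       4 * (2^-1 * v x + (1 - 2^-1) * w x) ^+ 2.
    by apply/funext => x; field.
  rewrite E ExB; [|by apply: bmD; apply/bmZ/bm_sq|by apply/bmZ/bm_sq].
  rewrite ExD; [|by apply/bmZ/bm_sq|by apply/bmZ/bm_sq].
  rewrite !ExZ; [|exact/bm_sq|exact/bm_sq|exact/bm_sq].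
  lra.
exists N => // k /= Nk n m g kn km.
have hn := hull_avg f (F0 n); have hm := hull_avg f (F0 m).
have sn := small n (leq_trans Nk kn); have sm := small m (leq_trans Nk km).
split; first exact: par.
(* A translate of an average is again a hull element, with the same norm by invariance. *)
apply: (par _ (avg (F n) f \o act g)) => //; first exact: hull_comp.
have := @Ex_act _ _ _ _ _ _ X_borel act_cont mu g (fun x => avg (F n) f x ^+ 2) mu_inv.
rewrite /comp => -> //; exact/bm_sq/(bm_avg X_borel act_cont).
Qed.

(** The first moments of the increments are summable: |a| <= (2^k a^2 + 2^-k) / 2 takes the place of
    the Cauchy-Schwarz inequality. Hence the telescoping series converges absolutely almost
    everywhere. *)
Lemma small_diff_sum (h : nat -> X -> R) (M : R) : (forall k, bm (h k)) -> (forall k x, `|h k x| <= M) ->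
  (forall k, Ex mu (fun x => (h k x - h k.+1 x) ^+ 2) <= (2 ^ k)%:R^-1 ^+ 2) ->
  {ae mu, forall x, cvg (h k x @[k --> \oo])}.
Proof.
move=> bh hM hd.
pose g k x : R := `|h k.+1 x - h k x|.
have bg k : bm (g k) by apply/bm_norm/bmB.
have g0 k x : 0 <= g k x by exact: normr_ge0.
have gle k : Ex mu (g k) <= (2 ^ k)%:R^-1.
  pose s : R := (2 ^ k)%:R; have s0 : 0 < s by rewrite ltr0n expn_gt0.
  have bq : bm (fun x => (h k x - h k.+1 x) ^+ 2) by apply/bm_sq/bmB.
  have -> : (2 ^ k)%:R^-1 = 2^-1 * (s * s^-1 ^+ 2 + s^-1).
    by rewrite -/s; field; rewrite gt_eqF.
  apply: le_trans (_ : Ex mu (fun x => 2^-1 * (s * (h k x - h k.+1 x) ^+ 2 + s^-1)) <= _).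
    apply: Ex_le => //; first by apply/bmZ/bmD; [exact: bmZ|exact: bm_cst].
    move=> x; rewrite /g; set a := h k.+1 x - h k x.
    have -> : (h k x - h k.+1 x) ^+ 2 = `|a| ^+ 2 by rewrite real_normK ?num_real // /a; ring.
    have : 0 <= s * (`|a| - s^-1) ^+ 2 by rewrite mulr_ge0 ?sqr_ge0 ?ltW.
    have -> : s * (`|a| - s^-1) ^+ 2 = s * `|a| ^+ 2 + s^-1 - 2 * `|a| by field; rewrite gt_eqF.
    lra.
  rewrite ExZ; last by apply: bmD; [exact: bmZ|exact: bm_cst].
  rewrite ler_pM2l // ExD; [|exact: bmZ|exact: bm_cst].
  by rewrite Ex_cst ExZ // lerD2r ler_pM2l //; exact: hd.
have mg k : measurable_fun setT (fun x => (g k x)%:E) by apply/measurable_EFinP; exact: (bg k).1.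
have sum2 n : \sum_(k < n) (2 ^ k)%:R^-1 <= 2 :> R.
  suff : \sum_(k < n) (2 ^ k)%:R^-1 <= 2 - 2 * (2 ^ n)%:R^-1 :> R.
    by move/le_trans; apply; rewrite lerBlDr lerDl mulr_ge0.
  elim: n => [|n IH]; first by rewrite big_ord0 expn0; lra.
  rewrite big_ord_recr /= expnS natrM invfM mulrA divff // mul1r; lra.
have mS : measurable_fun setT (fun x => \sum_(k <oo) (g k x)%:E)%E.
  by apply: ge0_emeasurable_sum => [k x _ _|k _]; [rewrite lee_fin|exact: mg].
have S0 x : (0 <= \sum_(k <oo) (g k x)%:E)%E by apply: nneseries_ge0 => k _ _; rewrite lee_fin.
have intS : (\int[mu]_x (\sum_(k <oo) (g k x)%:E) < +oo)%E.
  rewrite integral_nneseries //; last by move=> k x _; rewrite lee_fin.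
  apply: le_lt_trans (_ : 2%:E < +oo)%E; last exact: ltry.
  apply: lime_le.
    by apply: is_cvg_nneseries => k _ _; apply: integral_ge0 => x _; rewrite lee_fin.
  near=> n; rewrite big_mkord; apply: le_trans (_ : \sum_(k < n) ((2 ^ k)%:R^-1)%:E <= _)%E.
    by apply: lee_sum => k _; rewrite ExE // lee_fin.
  by rewrite sumEFin lee_fin.
have : mu.-integrable setT (fun x => \sum_(k <oo) (g k x)%:E)%E.
  apply/integrableP; split=> //.
  by rewrite (eq_integral (fun x => \sum_(k <oo) (g k x)%:E)%E) // => x _; rewrite gee0_abs.
move=> /integrable_ae -/(_ measurableT); apply: filterS => x /(_ I) fx.
have gx n : \sum_(k < n) g k x <= fine (\sum_(k <oo) (g k x)%:E)%E.
  rewrite -lee_fin fineK // -sumEFin.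
  have := @nneseries_lim_ge R (fun k => (g k x)%:E) xpredT 0 n.
  by rewrite big_mkord; apply => k _ _; rewrite lee_fin.
have cs : cvg (series (telescope (h^~ x)) n @[n --> \oo]).
  apply: normed_cvg; apply: nondecreasing_is_cvgn.
    by apply/nondecreasing_seqP => n; rewrite /normed_series_of /= /series /= big_nat_recr //= lerDl.
  exists (fine (\sum_(k <oo) (g k x)%:E)%E) => _ [n _ <-].
  apply: le_trans (gx n).
  change (\sum_(0 <= k < n) `|telescope (h^~ x) k| <= \sum_(k < n) g k x).
  by rewrite big_mkord.
have -> : (fun k => h k x) = (fun k => h 0%N x + series (telescope (h^~ x)) k).
  by apply/funext => k; rewrite [LHS](eq_sum_telescope (h^~ x)).
by apply: is_cvgD => //; exact: is_cvg_cst.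
Unshelve. all: end_near. Qed.

Lemma Ex_ae_eq f g : bm f -> bm g -> {ae mu, forall x, f x = g x} -> Ex mu f = Ex mu g.
Proof.
move=> bf bg fg; have [M fM] := bf.2.
have := @Ex_cvg_ae _ _ _ mu (fun=> f) g M (fun=> bf.1) bg (fun=> fM).
move=> /(_ _)/(cvg_lim (@Rhausdorff R)) <-; last first.
  by apply: filterS fg => x ->; exact: cvg_cst.
by apply/esym/(cvg_lim (@Rhausdorff R)); exact: cvg_cst.
Qed.

Lemma ae_act g (P : X -> Prop) : {ae mu, forall x, P x} -> {ae mu, forall x, P (act g x)}.
Proof.
move=> [A [mA A0 PA]]; exists (act g @^-1` A); split.
- exact: (act_pre X_borel act_cont).
- by apply: etrans A0; exact: mu_inv.
- by move=> x nP; apply: PA.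
Qed.

Lemma ae_ex (P : X -> Prop) : {ae mu, forall x, P x} -> exists x, P x.
Proof.
move=> [A [mA A0 PA]]; apply: contrapT => nP.
have : mu setT = 0%E.
  by rewrite -A0; congr (mu _); apply/seteqP; split=> // x _; apply: PA => Px; apply: nP; exists x.
by rewrite probability_setT => /eqP; rewrite onee_eq0.
Qed.

Lemma Ex_eq0_ae f : bm f -> Ex mu (fun x => f x ^+ 2) = 0 -> {ae mu, forall x, f x = 0}.
Proof.
move=> bf /(Ex_eq0 (bm_sq bf) (fun x => sqr_ge0 (f x))) f0.
exists [set x | f x ^+ 2 != 0]; split=> //.
  rewrite (_ : [set x | _] = (fun x => f x ^+ 2) @^-1` (~` [set 0])).
    by rewrite -[_ @^-1` _]setTI; apply: (bm_sq bf).1 => //; exact: measurableC.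
  by apply/seteqP; split=> x /= /eqP.
by move=> x /= fx; rewrite sqrf_eq0; apply/eqP.
Qed.

(** The limit function has to be measurable and bounded on all of X, also where the sequence
    diverges; the upper limit clamped to [0,1] serves. *)
Lemma bounded_limit (h : nat -> X -> R) : (forall k, bm (h k)) -> (forall k x, 0 <= h k x <= 1) ->
  exists g, [/\ bm g, forall x, 0 <= g x <= 1 &
    forall x, cvg (h k x @[k --> \oo]) -> h k x @[k --> \oo] --> g x].
Proof.
move=> bh h01; pose l x : R := limn_sup (h^~ x); pose g x := Num.max 0 (Num.min 1 (l x)).
have g01 x : 0 <= g x <= 1.
  by rewrite /g le_max lexx /= ge_max ler01 ge_min lexx.
exists g; split=> //.
- split; last by exists 1 => x; have /andP[g0 g1] := g01 x; rewrite ger0_norm.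
  apply: measurable_maxr; first exact: measurable_cst.
  apply: measurable_minr; first exact: measurable_cst.
  apply: measurable_fun_limn_sup => [x _|x _|k]; last exact: (bh k).1.
    by exists 1 => _ [k _ <-]; have /andP[] := h01 k x.
  by exists 0 => _ [k _ <-]; have /andP[] := h01 k x.
- move=> x cx; have := cx; rewrite /g /l (cvg_limn_supE cx) => hc.
  rewrite (_ : Num.max _ _ = limn (h^~ x)) //.
  have l0 : 0 <= limn (h^~ x) by apply: limr_ge => //; near=> k; have /andP[] := h01 k x.
  have l1 : limn (h^~ x) <= 1 by apply: limr_le => //; near=> k; have /andP[] := h01 k x.
  by rewrite min_r // max_r.
Unshelve. all: end_near. Qed.

Lemma bounded01 f : (forall x, 0 <= f x <= 1) -> forall x : X, `|f x| <= (1 : R).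
Proof. by move=> f01 x; have /andP[f0 f1] := f01 x; rewrite ger0_norm. Qed.

Lemma avg01 (A : {fset G}) f x : A != fset0%fset -> (forall x, 0 <= f x <= 1) -> 0 <= avg A f x <= 1.
Proof.
move=> A0 f01; have e (c : R) := avg_cst act c x A0.
apply/andP; split; [rewrite -(e 0)|rewrite -[leRHS](e 1)]; apply: avg_le => y; by have /andP[] := f01 y.
Qed.

Lemma erg_limit (th : nat -> X -> R) : (forall i, cont (th i)) -> (forall i x, 0 <= th i x <= 1) ->
  exists (n : nat -> nat) (ths : nat -> X -> R),
  [/\ forall k, (k <= n k)%N, forall i, bm (ths i), forall i x, 0 <= ths i x <= 1,
    {ae mu, forall x, forall i, avg (F (n k)) (th i) x @[k --> \oo] --> ths i x} &
    forall g, {ae mu, forall x, forall i, ths i (act g x) = ths i x}].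
Proof.
move=> cth th01.
have bth i : bm (th i) := cont_bm d_metric X_compact X_borel (cth i).
have th1 i := bounded01 (th01 i).
have H i j : exists N, forall n m g, (N <= n)%N -> (N <= m)%N ->
  Ex mu (fun x => (avg (F n) (th i) x - avg (F m) (th i) x) ^+ 2) <= (2 ^ j)%:R^-1 ^+ 2 /\
  Ex mu (fun x => (avg (F n) (th i) x - avg (F n) (th i) (act g x)) ^+ 2) <= (2 ^ j)%:R^-1 ^+ 2.
  have e0 : 0 < (2 ^ j)%:R^-1 ^+ 2 :> R by rewrite exprn_gt0 // invr_gt0 ltr0n expn_gt0.
  by have [N _ hN] := hull_L2_cauchy (bth i) e0; exists N; exact: (hN N (leqnn N)).
have /choice[N hN] : forall ij : nat * nat, exists N, forall n m g, (N <= n)%N -> (N <= m)%N ->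
  Ex mu (fun x => (avg (F n) (th ij.1) x - avg (F m) (th ij.1) x) ^+ 2) <= (2 ^ ij.2)%:R^-1 ^+ 2 /\
  Ex mu (fun x => (avg (F n) (th ij.1) x - avg (F n) (th ij.1) (act g x)) ^+ 2) <= (2 ^ ij.2)%:R^-1 ^+ 2.
  by move=> [i j]; exact: H.
(* n k dominates all thresholds N (i, j) with i, j <= k, so one subsequence works for every th i;
   the added k ensures n k >= k. *)
pose n k := (\sum_(j < k.+1) (\sum_(i < k.+1) N (i : nat, j : nat)) + k)%N.
have nN i j k : (i <= k)%N -> (j <= k)%N -> (N (i, j) <= n k)%N.
  rewrite -(ltnS i) -(ltnS j) => ik jk; apply: leq_trans (leq_addr _ _).
  rewrite (bigD1 (Ordinal jk)) //= (bigD1 (Ordinal ik)) //= -addnA; exact: leq_addr.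
pose h i k := avg (F (n k)) (th i).
have bh i k : bm (h i k) by apply: (bm_avg X_borel act_cont).
have h01 i k x : 0 <= h i k x <= 1.
  exact: avg01.
have h1 i k := bounded01 (h01 i k).
have /choice[ths hths] := fun i => bounded_limit (bh i) (h01 i).
have bs i : bm (ths i) by case: (hths i).
have cv : {ae mu, forall x, forall i, h i k x @[k --> \oo] --> ths i x}.
  apply: ae_foralln => i; have [_ _ hc] := hths i.
  (* The start is shifted by i because the thresholds of th i are dominated only from k = i on. *)
  have : {ae mu, forall x, cvg (h i (k + i)%N x @[k --> \oo])}.
    apply: (small_diff_sum (fun k => bh i (k + i)%N) (fun k => h1 i (k + i)%N)) => k.
    apply: (hN (i, k) _ _ 1%g _ _).1 => /=; apply: nN; lia.
  apply: filterS => x /cvg_ex[l hl]; apply: hc; apply/cvg_ex; exists l.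
  by rewrite -(cvg_shiftn i).
exists n, ths; split=> //.
- by move=> k; rewrite leq_addl.
- by move=> i; case: (hths i).
move=> g; apply: ae_foralln => i.
have bd : bm (fun x => ths i x - ths i (act g x)) by apply: bmB => //; exact: bma.
suff E0 : Ex mu (fun x => (ths i x - ths i (act g x)) ^+ 2) = 0.
  by apply: filterS (Ex_eq0_ae bd E0) => x /eqP; rewrite subr_eq0 => /eqP ->.
have bhd k : bm (fun x => (h i k x - h i k (act g x)) ^+ 2).
  by apply: bm_sq; apply: bmB => //; exact: bma.
have cE : Ex mu (fun x => (h i k x - h i k (act g x)) ^+ 2) @[k --> \oo] --> Ex mu (fun x => (ths i x - ths i (act g x)) ^+ 2).
  apply: (@Ex_cvg_ae _ _ _ _ _ _ (2 ^+ 2)) => [k||k x|]; first exact: (bhd k).1.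
  - exact: bm_sq.
  - rewrite ger0_norm ?sqr_ge0 // -real_normK ?num_real // ler_pXn2r ?nnegrE //.
    apply: le_trans (ler_normB _ _) _; have := h1 i k x; have := h1 i k (act g x); lra.
  - apply: filterS2 cv (ae_act g cv) => x /(_ i) c1 /(_ i) c2.
    by apply: cvgM; apply: cvgB.
apply: (@cvg_unique _ (@Rhausdorff R) _ _ _ _ cE).
apply: (squeeze_cvgr _ (cvg_cst 0) (cvg_geometric 1 (_ : `|2^-1| < 1))); last by rewrite ger0_norm; lra.
near=> k; apply/andP; split; first by apply: Ex_ge0 => // x; exact: sqr_ge0.
apply: le_trans (hN (i, k) _ (n k) g _ _).2 _ => //=; try by apply: nN => //; near: k; exists i.
rewrite /geometric /= mul1r natrX (exprVn 2 k).
have : (2 : R) ^- k <= 1 by rewrite invf_le1 ?exprn_gt0 // exprn_ege1 //; lra.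
have : 0 <= (2 : R) ^- k by rewrite invr_ge0 exprn_ge0.
set a := (_ ^- k); move=> a0 a1; by rewrite expr2 ler_piMl.
Unshelve. all: end_near. Qed.

(** A is invariant only up to a null set for each g, as is the case for level sets of almost
    invariant functions. This suffices to replace each translate of f by f under the integral over
    A. *)
Lemma Ex_mul_avg A f (n : nat) : measurable A -> bm f ->
  (forall g, {ae mu, forall x, A (act g x) <-> A x}) ->
  Ex mu (fun x => \1_A x * avg (F n) f x) = Ex mu (fun x => \1_A x * f x).
Proof.
move=> mA bf hA; have bA := bm_indic mA (R := R).
rewrite (_ : (fun x => _) = fun x => #|` F n|%:R^-1 * \sum_(g <- F n) (\1_A x * f (act g x))); last first.
  by apply/funext => x; rewrite /orbit_avg mulrCA mulr_sumr.
have bg g : bm (fun x => \1_A x * f (act g x)) by apply: bmM => //; exact: bma.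
rewrite ExZ; last exact: bm_sum.
rewrite (Ex_sum mu _ _ bg) (eq_bigr (fun=> Ex mu (fun x => \1_A x * f x))).
  by rewrite sum_fset_const mulrA mulVf ?mul1r // pnatr_eq0 cardfs_eq0.
move=> g _; rewrite -[RHS](Ex_act X_borel act_cont g mu_inv); last exact: bmM.
apply: Ex_ae_eq => //; first by apply: (bma g); exact: bmM.
apply: filterS (hA g) => x hx /=; congr (_ * _); rewrite !indicE; congr ((_ : bool)%:R).
by apply/idP/idP; rewrite !in_setE => /hx.
Qed.

End MeanErgodic.

(** * Ergodic measures from typical orbits *)

Section Decomposition.
Context {R : realType} {G : groupType} {dX : measure_display} {X : measurableType dX}
  (d : X -> X -> R) (act : G -> X -> X) (F : nat -> {fset G}).
Hypothesis d_metric : is_metric d.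
Hypothesis X_compact : d_compact d.
Hypothesis X_borel : @measurable _ X = <<s [set A | d_open d A] >>.
Hypothesis act_action : is_action act.
Hypothesis act_cont : forall g, d_continuous d (act g).
Hypothesis F_folner : @folner R G F.
Local Notation cont := (@d_continuous_real R X d).
Local Notation avg := (@orbit_avg R G dX X act).
Let F0 n : F n != fset0%fset := F_folner.1 n.
Let cbm := cont_bm d_metric X_compact X_borel.

Lemma Ex_sq (nu : probability X R) f : bm f -> Ex nu f ^+ 2 <= Ex nu (fun x => f x ^+ 2).
Proof.
move=> bf; set c := Ex nu f.
have : Ex nu (fun x => 2 * c * f x + - c ^+ 2) <= Ex nu (fun x => f x ^+ 2).
  apply: Ex_le; [|exact: bm_sq|]; first by apply: bmD; [exact: bmZ|exact: bm_cst].
  by move=> x; have := sqr_ge0 (f x - c); rewrite sqrrB; lra.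
rewrite ExD; [|exact: bmZ|exact: bm_cst].
by rewrite ExZ // Ex_cst -/c; lra.
Qed.

(** The hypothesis says that orbit averages of each phi i have arbitrarily small variance. Integrals
    over an invariant set A do not change under averaging, so A is independent of each phi i, hence
    of every continuous function, hence of itself. *)
Lemma ergodic_crit (phi : nat -> X -> R) (nu : probability X R) : (forall i, cont (phi i)) ->
  (forall f (e : R), cont f -> 0 < e -> exists n (a : nat -> R), forall x,
     `|f x - \sum_(i < n) a i * phi i x| < e) ->
  invariant_measure act nu ->
  (forall i (e : R), 0 < e -> exists n, Ex nu (fun x => avg (F n) (phi i) x ^+ 2) <= Ex nu (phi i) ^+ 2 + e) ->
  ergodic_measure act nu.
Proof.
move=> cphi dphi nui H; split=> // A mA iA.
have bA : bm (\1_A : X -> R) := bm_indic mA.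
have A01 x : 0 <= (\1_A x : R) <= 1 by rewrite indicE; case: (x \in A); rewrite /= ?lexx ?ler01.
have A1 := bounded01 A01.
set a := pm nu A; have a01 : 0 <= a <= 1.
  rewrite /a -(Ex_indic nu mA) -[X in _ <= _ <= X](Ex_cst nu 1); apply/andP; split.
    by apply: Ex_ge0 => // x; have /andP[] := A01 x.
  by apply: Ex_le; [exact: bA|exact: bm_cst|move=> x; have /andP[] := A01 x].
have indep i : Ex nu (fun x => \1_A x * phi i x) = a * Ex nu (phi i).
  set c := Ex nu (phi i).
  apply/eqP; rewrite -subr_eq0 -sqrf_eq0 eq_le sqr_ge0 andbT.
  apply/ler_addgt0Pr => e e0; rewrite add0r; have [n hn] := H i e e0.
  have bphi := cbm (cphi i).
  have bav : bm (avg (F n) (phi i)) := bm_avg X_borel act_cont (F n) bphi.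
  have ia g : {ae nu, forall x, A (act g x) <-> A x}.
    by apply: aeW => x; rewrite -[X in _ <-> X x](iA g).
  rewrite -(Ex_mul_avg X_borel act_cont F_folner nui n mA bphi ia).
  have -> : Ex nu (fun x => \1_A x * avg (F n) (phi i) x) - a * c =
      Ex nu (fun x => \1_A x * (avg (F n) (phi i) x - c)).
    rewrite (_ : (fun x => \1_A x * (_ - c)) = fun x => \1_A x * avg (F n) (phi i) x - c * \1_A x); last first.
      by apply/funext => x; rewrite mulrBr [c * _]mulrC.
    rewrite ExB; [|exact: bmM|exact: bmZ].
    by rewrite ExZ // (Ex_indic nu mA) [c * _]mulrC.
  have bd : bm (fun x => avg (F n) (phi i) x - c) by apply: bmB => //; exact: bm_cst.
  apply: le_trans (Ex_sq nu (bmM bA bd)) _.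
  apply: le_trans (_ : Ex nu (fun x => avg (F n) (phi i) x ^+ 2 + (- (2 * c)) * avg (F n) (phi i) x + c ^+ 2) <= _).
    apply: Ex_le.
    - exact/bm_sq/bmM.
    - by apply: bmD; [apply: bmD; [exact: bm_sq|exact: bmZ]|exact: bm_cst].
    - move=> x; rewrite exprMn; have -> : avg (F n) (phi i) x ^+ 2 + - (2 * c) * avg (F n) (phi i) x + c ^+ 2 =
        (avg (F n) (phi i) x - c) ^+ 2 by ring.
      by rewrite ler_piMl ?sqr_ge0 // indicE; case: (x \in A); rewrite /= ?expr1n ?expr0n.
  rewrite ExD; [|by apply: bmD; [exact: bm_sq|exact: bmZ]|exact: bm_cst].
  rewrite ExD; [|exact: bm_sq|exact: bmZ].
  rewrite ExZ // Ex_cst (Ex_avg X_borel act_cont nui bphi (F0 n)) -/c.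
  by move: hn; rewrite -/c; set q := Ex _ _; lra.
have indepf f : cont f -> Ex nu (fun x => \1_A x * f x) = a * Ex nu f.
  move=> cf; apply/eqP; rewrite -subr_eq0 -normr_eq0 eq_le normr_ge0 andbT.
  apply/ler_addgt0Pr => e e0; rewrite add0r.
  have e2 : 0 < e / 2 by rewrite divr_gt0.
  have [n [b hb]] := dphi f _ cf e2.
  pose s x := \sum_(i < n) b i * phi i x.
  have bs : bm s by apply: bm_sum => i; apply: bmZ; exact: cbm.
  have es : Ex nu (fun x => \1_A x * s x) = a * Ex nu s.
    have bbp (i : 'I_n) : bm (fun x => b i * phi i x) by apply: bmZ; exact: cbm.
    have bbA (i : 'I_n) : bm (fun x => b i * (\1_A x * phi i x)) by apply/bmZ/bmM => //; exact: cbm.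
    rewrite /s (Ex_sum nu _ _ bbp).
    rewrite (_ : (fun x => \1_A x * _) = fun x => \sum_(i < n) b i * (\1_A x * phi i x)); last first.
      by apply/funext => x; rewrite mulr_sumr; apply: eq_bigr => i _; rewrite mulrCA.
    rewrite (Ex_sum nu _ _ bbA).
    rewrite mulr_sumr; apply: eq_bigr => i _; by rewrite (ExZ nu _ (cbm (cphi i))) (ExZ nu _ (bmM bA (cbm (cphi i)))) indep mulrCA.
  have bf := cbm cf.
  have h1 : `|Ex nu (fun x => \1_A x * f x) - Ex nu (fun x => \1_A x * s x)| <= e / 2.
    apply: Ex_close; [exact: bmM|exact: bmM|move=> x]; rewrite -mulrBr normrM.
    apply: le_trans (ltW (hb x)); rewrite ler_piMl //.
  have h2 : `|Ex nu f - Ex nu s| <= e / 2 by apply: Ex_close => // x; exact/ltW/hb.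
  rewrite (_ : _ - _ = (Ex nu (fun x => \1_A x * f x) - Ex nu (fun x => \1_A x * s x)) - a * (Ex nu f - Ex nu s)); last first.
    by rewrite es; ring.
  apply: le_trans (ler_normB _ _) _; rewrite normrM.
  have : `|a| * `|Ex nu f - Ex nu s| <= `|Ex nu f - Ex nu s|.
    by rewrite ler_piMl // ger0_norm; case/andP: a01.
  lra.
have aa : a = a ^+ 2.
  apply/eqP; rewrite -subr_eq0 -normr_eq0 eq_le normr_ge0 andbT.
  apply/ler_addgt0Pr => e e0; rewrite add0r.
  have e2 : 0 < e / 2 by rewrite divr_gt0.
  have [f [cf f01 fe]] := L1_dense d_metric X_compact X_borel nu mA e2.
  have bf := cbm cf.
  have bn : bm (fun x => `|\1_A x - f x|) by apply/bm_norm/bmB.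
  have h1 : `|a - Ex nu (fun x => \1_A x * f x)| <= e / 2.
    rewrite /a -(Ex_indic nu mA) -ExB //; last exact: bmM.
    apply: le_trans (Ex_norm _ _) _; first by apply: bmB => //; exact: bmM.
    apply: le_trans fe; apply: Ex_le => //; first by apply/bm_norm/bmB => //; exact: bmM.
    move=> x; rewrite indicE; case: (x \in A); rewrite /= ?mul1r // mul0r subrr normr0; exact: normr_ge0.
  have h2 : `|a - Ex nu f| <= e / 2.
    rewrite /a -(Ex_indic nu mA) -ExB //.
    by apply: le_trans (Ex_norm _ (bmB bA bf)) _; exact: fe.
  rewrite (_ : _ - _ = (a - Ex nu (fun x => \1_A x * f x)) - a * (a - Ex nu f)); last first.
    by rewrite indepf //; ring.
  apply: le_trans (ler_normB _ _) _; rewrite normrM.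
  have : `|a| * `|a - Ex nu f| <= `|a - Ex nu f|.
    by rewrite ler_piMl // ger0_norm; case/andP: a01.
  lra.
suff : a = 0 \/ a = 1 by case=> h; [left|right]; apply: etrans (pmE nu mA) _; rewrite -/a h.
have : a * (a - 1) = 0 by rewrite mulrBr mulr1 -expr2 -aa subrr.
move/eqP; rewrite mulf_eq0 subr_eq0 => /orP[/eqP ->|/eqP ->]; [by left|by right].
Qed.

(** The limit is taken along an ultrafilter finer than convergence to infinity: it agrees with the
    known limits of the averages of th i, and the Folner property makes the limit measure
    invariant. *)
Lemma limit_state (n : nat -> nat) (th ths : nat -> X -> R) x : (forall k, (k <= n k)%N) ->
  (forall i, cont (th i)) -> (forall i, avg (F (n k)) (th i) x @[k --> \oo] --> ths i x) ->
  exists nu : probability X R, invariant_measure act nu /\ forall i, Ex nu (th i) = ths i x.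
Proof.
move=> kn cth cv.
have [U [UU Uo]] := @ultraFilterLemma nat \oo _.
have sL k : state d (fun f => avg (F (n k)) f x) by exact: state_avg.
have [nu hnu] := state_ulim d_metric X_compact X_borel UU sL.
have UE f l : cont f -> avg (F (n k)) f x @[k --> \oo] --> l -> Ex nu f = l.
  move=> cf h; have h' : avg (F (n k)) f x @[k --> U] --> l.
    by move=> B /h; exact: Uo.
  by rewrite -(cvg_lim (@Rhausdorff R) (hnu f cf)) -(cvg_lim (@Rhausdorff R) h').
exists nu; split; last by move=> i; exact: UE.
apply: (inv_measureP d_metric X_compact X_borel act_cont) => g f cf.
have [M M0 fM] := cont_bounded d_metric X_compact cf.
have h1 := hnu _ cf; have h2 := hnu _ (cont_act act_cont g cf).
have h3 : avg (F (n k)) (f \o act g) x - avg (F (n k)) f x @[k --> U] --> Ex nu (f \o act g) - Ex nu f.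
  exact: cvgB.
have h4 : avg (F (n k)) (f \o act g) x - avg (F (n k)) f x @[k --> U] --> (0 : R).
  move=> B hB; apply: Uo; move: B hB.
  change (avg (F (n k)) (f \o act g) x - avg (F (n k)) f x @[k --> \oo] --> (0 : R)).
  apply/cvgrPdist_le => e e0; have e1 : 0 < e / (M + 1) by rewrite divr_gt0 // ltr_wpDl.
  have [N _ hN] := folner_near F_folner g e1.
  exists N => // k /= Nk; rewrite sub0r normrN.
  apply: le_trans (avg_shift act_action _ _ _ fM) _.
  have := hN (n k) (leq_trans Nk (kn k)).
  rewrite /= => h5; have Fp := folner_card_gt0 F_folner (n k).
  apply: le_trans (_ : M * (e / (M + 1)) <= _).
    by rewrite ler_wpM2l // ler_pdivrMr.
  by rewrite mulrA ler_pdivrMr ?ltr_wpDl // mulrC ler_pM2l // lerDl.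
apply/eqP; rewrite -subr_eq0; apply/eqP.
exact: (cvg_unique (@Rhausdorff R) h3 h4).
Qed.

(* nu is a limit of empirical measures along the orbit of a typical x. Including the squares of the
   averages of phi_i among the test functions shows that these averages become constant in L2(nu),
   which gives ergodicity. *)
Theorem erg_decomp (phi : nat -> X -> R) (mu : probability X R) : (forall i, cont (phi i)) ->
  (forall i x, 0 <= phi i x <= 1) ->
  (forall f (e : R), cont f -> 0 < e -> exists n (a : nat -> R), forall x,
     `|f x - \sum_(i < n) a i * phi i x| < e) ->
  invariant_measure act mu ->
  exists phis : nat -> X -> R, [/\ forall i, bm (phis i), forall i x, 0 <= phis i x <= 1,
   forall g, {ae mu, forall x, forall i, phis i (act g x) = phis i x},
   {ae mu, forall x, exists nu : probability X R, ergodic_measure act nu /\ forall i, Ex nu (phi i) = phis i x} &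
   forall A i, measurable A -> (forall g, {ae mu, forall x, A (act g x) <-> A x}) ->
     Ex mu (fun x => \1_A x * phi i x) = Ex mu (fun x => \1_A x * phis i x)].
Proof.
move=> cphi phi01 dphi mui.
pose th j : X -> R := match @choice.unpickle (nat + nat * nat)%type j with
  | Some (inl i) => phi i | Some (inr (n, i)) => fun x => avg (F n) (phi i) x ^+ 2 | None => fun=> 0 end.
have cth j : cont (th j).
  rewrite /th; case: choice.unpickle => [[i|[n i]]|]; [exact: cphi| |exact: cont_cst].
  rewrite (_ : (fun x => _) = fun x => avg (F n) (phi i) x * avg (F n) (phi i) x).
    by apply: (contM d_metric); exact: cont_avg.
  by apply/funext => x; rewrite expr2.
have av01 n i x : 0 <= avg (F n) (phi i) x <= 1 by exact: avg01.
have th01 j x : 0 <= th j x <= 1.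
  rewrite /th; case: choice.unpickle => [[i|[n i]]|]; [exact: phi01| |by rewrite lexx ler01].
  by have /andP[h0 h1] := av01 n i x; rewrite exprn_ge0 //= exprn_ile1.
have [n [ths [kn bths ths01 cv inv]]] := erg_limit d_metric X_compact X_borel act_action act_cont F_folner mui cth th01.
pose p i := choice.pickle (inl i : nat + nat * nat).
pose q m i := choice.pickle (inr (m, i) : nat + nat * nat).
have thp i : th (p i) = phi i by rewrite /th /p choice.pickleK.
have thq m i : th (q m i) = fun x => avg (F m) (phi i) x ^+ 2 by rewrite /th /q choice.pickleK.
pose phis i := ths (p i).
have bphi i := cbm (cphi i).
have bav m i : bm (avg (F m) (phi i)) by exact: (bm_avg X_borel act_cont).
(* For typical x this is the variance of the average of phi i over F (n k) under the limit measure
   of x. Hence it is nonnegative almost everywhere, and its mean under mu tends to 0 because both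
   terms have the same limiting integral. *)
pose D i k x := ths (q (n k) i) x - phis i x ^+ 2.
have bD i k : bm (D i k) by apply: bmB; [exact: bths|exact/bm_sq/bths].
have st : {ae mu, forall x, exists nu : probability X R, invariant_measure act nu /\ forall j, Ex nu (th j) = ths j x}.
  by apply: filterS cv => x; exact: limit_state.
have D0 : {ae mu, forall x, forall i k, 0 <= D i k x}.
  apply: filterS st => x [nu [nui nuE]] i k; rewrite /D /phis -!nuE thp thq subr_ge0.
  rewrite -(Ex_avg X_borel act_cont nui (bphi i) (F0 (n k))); exact: Ex_sq.
have EDc i : Ex mu (D i k) @[k --> \oo] --> (0 : R).
  have E k : Ex mu (D i k) = Ex mu (fun x => avg (F (n k)) (phi i) x ^+ 2) - Ex mu (fun x => phis i x ^+ 2).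
    rewrite /D (ExB mu (bths _) (bm_sq (bths _))).
    congr (_ - _); rewrite -thq.
    have h : Ex mu (avg (F (n l)) (th (q (n k) i))) @[l --> \oo] --> Ex mu (ths (q (n k) i)).
      apply: (@Ex_cvg_ae _ _ _ _ _ _ 1) => //.
      - by move=> l; apply: (bm_avg X_borel act_cont (F (n l)) (cbm (cth _))).1.
      - by move=> l; apply: bounded01 => x; exact: avg01.
      - by apply: filterS cv => x; exact.
    rewrite -(cvg_lim (@Rhausdorff R) h).
    rewrite (_ : (fun l => _) = fun=> Ex mu (th (q (n k) i))).
      by apply: (cvg_lim (@Rhausdorff R)); exact: cvg_cst.
    by apply/funext => l; exact: (Ex_avg X_borel act_cont mui (cbm (cth _)) (F0 _)).
  rewrite (_ : (fun k => _) = fun k => Ex mu (fun x => avg (F (n k)) (phi i) x ^+ 2) - Ex mu (fun x => phis i x ^+ 2)); last exact/funext.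
  rewrite -(subrr (Ex mu (fun x => phis i x ^+ 2))); apply: cvgB; last exact: cvg_cst.
  apply: (@Ex_cvg_ae _ _ _ _ _ _ 1).
  - by move=> k; apply: (bm_sq (bav _ _)).1.
  - exact/bm_sq/bths.
  - by move=> k x; have := th01 (q (n k) i) x; rewrite thq => /andP[h0 h1]; rewrite ger0_norm.
  - by apply: filterS cv => x /(_ (p i)); rewrite thp => h; rewrite expr2; under eq_fun do rewrite expr2; exact: cvgM.
(* By Markov's inequality, the points where D exceeds 1/(j+1) for every k lie in sets of measure at
   most (j+1) times the mean of D i k. D is truncated at 0 because its sign is known only almost
   everywhere. *)
have Dsmall : {ae mu, forall x, forall i j, exists k, D i k x <= j.+1%:R^-1}.
  apply: ae_foralln => i; apply: ae_foralln => j.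
  pose D' k x := Num.max 0 (D i k x).
  have bD' k : bm (D' k).
    split; first by apply: measurable_maxr; [exact: measurable_cst|exact: (bD i k).1].
    have [_ [M hM]] := bD i k; exists M => x; rewrite ger0_norm ?le_max ?lexx //.
    by rewrite ge_max (le_trans _ (hM x)) //= (le_trans (ler_norm _) (hM x)).
  have ED' k : Ex mu (D' k) = Ex mu (D i k).
    by apply: Ex_ae_eq => //; apply: filterS D0 => x /(_ i k) h; rewrite /D' max_r.
  have D'0 k x : 0 <= D' k x by rewrite le_max lexx.
  pose c : R := j.+1%:R^-1; have c0 : 0 < c by rewrite invr_gt0.
  pose B k := [set x | c <= D' k x].
  have mB k : measurable (B k).
    rewrite (_ : B k = D' k @^-1` `[c, +oo[).
      by rewrite -[_ @^-1` _]setTI; apply: (bD' k).1.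
    by apply/seteqP; split=> x /=; rewrite in_itv /= andbT.
  have mBI : measurable (\bigcap_k B k) by apply: bigcapT_measurable.
  exists (\bigcap_k B k); split=> //; last first.
    move=> x /= nx k _; rewrite /B /=; apply: contrapT => h; apply: nx; exists k.
    by move/negP: h; rewrite -ltNge => /ltW; apply: le_trans; rewrite le_max lexx orbT.
  apply: etrans (pmE mu mBI) _; congr (_%:E); apply/eqP; rewrite eq_le; apply/andP; split; last first.
    by rewrite -(Ex_indic mu mBI); apply: Ex_ge0; [exact: bm_indic|move=> x; rewrite indicE].
  rewrite -(pmulr_rle0 _ c0); apply: (ler_cvg_to (cvg_cst _) (EDc i)); near=> k.
  rewrite -ED'; apply: le_trans (Ex_markov mu (bD' k) (D'0 k) (ltW c0)).
  rewrite ler_pM2l //; apply: (ch_mono (charge_pm mu) mBI (mB k)).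
  by move=> x /(_ k); apply.
exists phis; split=> //.
- by move=> i; exact: bths.
- by move=> i; exact: ths01.
- by move=> g; apply: filterS (inv g) => x h i; exact: h.
- apply: filterS2 st Dsmall => x [nu [nui nuE]] hD; exists nu; split; last first.
    by move=> i; rewrite -thp nuE.
  apply: (ergodic_crit cphi dphi nui) => i e e0.
  have [j je] : exists j, j.+1%:R^-1 < e.
    by have [j _ hj] := near_infty_natSinv_lt (PosNum e0); exists j; exact: (hj j (leqnn j)).
  have [k hk] := hD i j; exists (n k).
  rewrite -thq -thp !nuE -lerBlDl; exact: le_trans hk (ltW je).
- move=> A i mA iA.
  have h : Ex mu (fun x => \1_A x * avg (F (n k)) (phi i) x) @[k --> \oo] --> Ex mu (fun x => \1_A x * phis i x).
    apply: (@Ex_cvg_ae _ _ _ _ _ _ 1).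
    - by move=> k; apply: (bmM (bm_indic mA) (bav _ _)).1.
    - by apply: bmM; [exact: bm_indic|exact: bths].
    - move=> k x; rewrite normrM; have /andP[h0 h1] := av01 (n k) i x.
      by rewrite (ger0_norm h0) indicE; case: (x \in A); rewrite /= ?normr1 ?normr0 ?mul1r ?mul0r.
    - by apply: filterS cv => x /(_ (p i)); rewrite thp => h; apply: cvgM => //; exact: cvg_cst.
  have E : (fun k => Ex mu (fun x => \1_A x * avg (F (n k)) (phi i) x)) = fun=> Ex mu (fun x => \1_A x * phi i x).
    by apply/funext => k; exact: (Ex_mul_avg X_borel act_cont F_folner mui _ mA (bphi i) iA).
  by apply: (cvg_unique (@Rhausdorff R) _ h); rewrite E; exact: cvg_cst.
Unshelve. all: end_near. Qed.

End Decomposition.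

(** * Entropy and stabilizers *)

Section Conditional.
Context {R : realType} {X : Type}.
Variables (M : set (set X)) (m : set X -> R).
Hypothesis cm : charge M m.

Definition cond (A : set X) (B : set X) : R := m (B `&` A) / m A.

Lemma charge_cond A : M A -> 0 < m A -> charge M (cond A).
Proof.
move=> mA A0; split; [exact: chT cm|exact: chI cm|exact: chC cm| | |].
- by move=> B mB; rewrite divr_ge0 ?(ch_ge0 cm) //; exact: chI cm _ _ _ _.
- by rewrite /cond setTI divff // gt_eqF.
- move=> B C mB mC; rewrite /cond -mulrDl (ch_split cm (chI cm mB mA) mC).
  by congr ((m _ + m _) / _); apply/seteqP; split=> x /= [[]].
Qed.

Lemma Hent_chain (S T : finType) (s : X -> S) (f : X -> T) : ofin M s -> ofin M f ->
  Hent m (fun x => (s x, f x)) =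
  Hent m s + \sum_t m [set x | s x = t] * Hent (cond [set x | s x = t]) f.
Proof.
move=> ms mf; rewrite Hent_pairE /Hent -big_split; apply: eq_bigr => t _ /=.
set A := [set x | s x = t]; have mA : M A := ms t.
have mAf u : M (A `&` [set x | f x = u]) := chI cm mA (mf u).
have := ch_ge0 cm mA; rewrite le_eqVlt => /orP[/eqP A0|A0].
  rewrite -A0 mul0r addr0 ent0 big1 // => u _.
  have : m (A `&` [set x | f x = u]) <= 0 by rewrite A0; apply: (ch_mono cm (mAf u) mA) => x [].
  have := ch_ge0 cm (mAf u) => h1 h2.
  have -> : m (A `&` [set x | f x = u]) = 0 by lra.
  exact: ent0.
have cc := charge_cond mA A0.
rewrite -[ent (m A)]mul1r -(ch_sum1 cc mf) mulr_suml mulr_sumr -big_split.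
apply: eq_bigr => u _ /=.
rewrite /cond [_ `&` A]setIC; set p := m _ / m A.
have -> : m (A `&` [set x | f x = u]) = m A * p by rewrite /p mulrCA divff ?mulr1 // gt_eqF.
have : 0 <= p by rewrite divr_ge0 // (ch_ge0 cm).
rewrite le_eqVlt => /orP[/eqP <-|p0]; first by rewrite !mulr0 !mul0r ent0 mulr0 addr0.
by rewrite /ent lnM ?posrE //; ring.
Qed.

Lemma Hent_cond_le (S T : finType) (s : X -> S) (f : X -> T) : ofin M s -> ofin M f ->
  \sum_t m [set x | s x = t] * Hent (cond [set x | s x = t]) f <= Hent m f.
Proof.
by move=> ms mf; have := Hent_le_pair cm ms mf; rewrite Hent_chain // lerD2l.
Qed.

Lemma Hent_le_chain (S T : finType) (s : X -> S) (f : X -> T) : ofin M s -> ofin M f ->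
  Hent m f <= Hent m s + \sum_t m [set x | s x = t] * Hent (cond [set x | s x = t]) f.
Proof.
move=> ms mf; rewrite -Hent_chain //.
by apply: (Hent_mono cm) => //; [exact: (ofin_pair cm ms mf)|move=> x y []].
Qed.

(** The factor relation is known on A only. Labels are replaced by [None] off A, where the
    conditional measure vanishes; the relation then holds everywhere. *)
Lemma Hent_cond_mono A (S T : finType) (f : X -> T) (g : X -> S) : M A -> 0 < m A ->
  ofin M f -> ofin M g -> (forall x y, A x -> A y -> f x = f y -> g x = g y) ->
  Hent (cond A) g <= Hent (cond A) f.
Proof.
move=> mA A0 mf mg fg; have cc := charge_cond mA A0.
pose on (U : finType) (h : X -> U) x := if x \in A then Some (h x) else None.
have onN (U : finType) (h : X -> U) : [set x | on U h x = None] = ~` A.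
  apply/seteqP; split=> x; rewrite /on /=; first by case: ifP => // /negbT/negP + _; rewrite in_setE.
  by move=> nA; case: ifP => //; rewrite in_setE.
have onS (U : finType) (h : X -> U) u : [set x | on U h x = Some u] = A `&` [set x | h x = u].
  apply/seteqP; split=> x; rewrite /on /=; first by case: ifP => //; rewrite in_setE => ? [].
  by move=> [Ax <-]; rewrite ifT // in_setE.
have mon (U : finType) (h : X -> U) : ofin M h -> ofin M (on U h).
  by move=> mh [u|]; rewrite ?onS ?onN; [exact: chI cm _ _ _ _|exact: chC cm _ _].
have onE (U : finType) (h : X -> U) : Hent (cond A) (on U h) = Hent (cond A) h.
  have opt (F : option U -> R) : \sum_t F t = F None + \sum_u F (Some u).
    rewrite (bigD1 None) //=; congr (_ + _).
    rewrite (reindex_omap Some id) //=; first by apply: eq_bigl => u; rewrite eqxx.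
    by case.
  rewrite /Hent opt onN {1}/cond setICl (ch0 cm) mul0r ent0 add0r; apply: eq_bigr => u _.
  by rewrite onS /cond setIAC setIid setIC.
rewrite -(onE _ g) -(onE _ f); apply: (Hent_mono cc); [exact: mon|exact: mon|].
move=> x y; rewrite /on; case: ifPn => // xA; case: ifPn => // yA [] /fg -> //.
- by move: xA; rewrite in_setE.
- by move: yA; rewrite in_setE.
Qed.

End Conditional.

Lemma Hent_ffun_le {R : realType} {X : Type} (M : set (set X)) (m : set X -> R) (I T : finType) (f : I -> X -> T) :
  charge M m -> (forall i, ofin M (f i)) ->
  ofin M (fun x => [ffun i => f i x]) /\ Hent m (fun x => [ffun i => f i x]) <= \sum_i Hent m (f i).
Proof.
move=> cm mf.
(* For an induction over the revealed coordinates, the hidden ones carry [None], which keeps the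
   codomain fixed. *)
have mF (s : seq I) : ofin M (fun x => [ffun i => if i \in s then Some (f i x) else None]).
  move=> c; rewrite (_ : [set x | _] = \big[setI/setT]_(i : I)
     (if i \in s then if c i is Some t then [set x | f i x = t] else set0 else [set x | c i = None])).
    apply: (ch_bigI cm) => i; case: ifP => _.
      by case: (c i) => [t|]; [exact: mf|exact: (chM0 cm)].
    case: (c i) => [t|]; first by rewrite (_ : [set x | _] = set0); [exact: chM0 cm|apply/seteqP; split].
    by rewrite (_ : [set x | _] = setT); [exact: chT cm|apply/seteqP; split].
  rewrite -bigcap_seq; apply/seteqP; split=> x /=.
    by move=> <- i _ /=; rewrite ffunE; case: (i \in s).
  move=> h; apply/ffunP => i; rewrite ffunE; have := h i; rewrite /= mem_index_enum => /(_ isT).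
  by case: ifP => _; [case: (c i) => // t /= -> |move=> /= ->].
have H (s : seq I) : uniq s -> Hent m (fun x => [ffun i => if i \in s then Some (f i x) else None]) <= \sum_(i <- s) Hent m (f i).
  elim: s => [_|i s IH /= /andP[_ us]].
    have mt : ofin M (fun _ : X => tt).
      by case; rewrite (_ : [set x | _] = setT); [exact: chT cm|apply/seteqP; split].
    rewrite big_nil; apply: le_trans (_ : Hent m (fun=> tt) <= _).
      by apply: (Hent_mono cm mt (mF [::])) => x y _; apply/ffunP => i; rewrite !ffunE.
    by apply: le_trans (Hent_le_ln cm mt) _; rewrite card_unit ln1.
  rewrite big_cons; apply: le_trans (lerD (lexx _) (IH us)).
  apply: le_trans (Hent_le_pair cm (mf i) (mF s)).
  apply: (Hent_mono cm); [exact: (ofin_pair cm (mf i) (mF s))|exact: mF|] => x y [e1 /ffunP e2].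
  apply/ffunP => j; rewrite !ffunE inE; have [->|_] := eqVneq j i; first by rewrite /= e1.
  by have := e2 j; rewrite !ffunE.
have mf' : ofin M (fun x => [ffun i => f i x]).
  move=> c; rewrite (_ : [set x | _] = [set x | [ffun i => if i \in index_enum I then Some (f i x) else None] = [ffun i => Some (c i)]]); first exact: mF.
  apply/seteqP; split=> x /=; first by move=> <-; apply/ffunP => i; rewrite !ffunE mem_index_enum.
  by move=> /ffunP h; apply/ffunP => i; have := h i; rewrite !ffunE mem_index_enum => -[].
split=> //; apply: le_trans (H _ (index_enum_uniq I)); apply: (Hent_mono cm) => // x y /ffunP h.
by apply/ffunP => i; have := h i; rewrite !ffunE mem_index_enum => -[].
Qed.

(** Greedy choice: a new point e enters D unless B e meets the set of a point already chosen. *)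
Lemma disjoint_transversal (T S : choiceType) (B : T -> {fset S}) (E : {fset T}) :
  exists D : {fset T}, [/\ (D `<=` E)%fset,
    forall t u h, t \in D -> u \in D -> h \in B t -> h \in B u -> t = u &
    forall e, e \in E -> exists2 t, t \in D & t = e \/ exists2 h, h \in B e & h \in B t].
Proof.
elim/fset1U_rect: E => [|e E eE [D [DE Dd Dc]]]; first by exists fset0; split.
have [[t tD [h hE ht]]|no] := pselect (exists2 t, t \in D & exists2 h, h \in B e & h \in B t).
  exists D; split=> //; first exact: fsubset_trans DE (fsubsetU1 _ _).
  move=> u; rewrite !inE => /orP[/eqP ->|/Dc//].
  by exists t => //; right; exists h.
have no' t h : t \in D -> h \in B e -> h \in B t -> False.
  by move=> tD he ht; apply: no; exists t => //; exists h.
exists (e |` D)%fset; split; first exact: fsetUS.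
  move=> t u h; rewrite !inE => /orP[/eqP ->|tD] /orP[/eqP ->|uD] // h1 h2.
  - by case: (no' u h uD).
  - by case: (no' t h tD).
  - exact: Dd h1 h2.
move=> u; rewrite !inE => /orP[/eqP ->|/Dc[t tD ht]].
  by exists e; [rewrite !inE eqxx|left].
by exists t; [rewrite !inE tD orbT|].
Qed.

(** * Window entropy in the presence of stabilizers *)

Section Stabilizer.
Context {R : realType} {G : groupType} {X : Type} (act : G -> X -> X).
Hypothesis act_action : is_action act.
Variables (M : set (set X)) (m : set X -> R).
Hypothesis cm : charge M m.
Hypothesis M_act : forall g A, M A -> M (act g @^-1` A).
Hypothesis m_inv : forall g A, M A -> m (act g @^-1` A) = m A.
Hypothesis M_fix : forall g, M [set x | act g x = x].
Variables (T : finType) (f : X -> T).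
Hypothesis mf : ofin M f.
Variable K : {fset G}.

Definition stab_in (x : X) : {set K} := [set u : K | `[< act (val u) x = x >]]%SET.

Lemma ofin_stab : ofin M stab_in.
Proof.
move=> c; rewrite (_ : [set x | _] = \big[setI/setT]_(u : K)
   (if u \in c then [set x | act (val u) x = x] else ~` [set x | act (val u) x = x])).
  by apply: (ch_bigI cm) => u; case: ifP => _; [exact: M_fix|exact: chC cm _ (M_fix _)].
rewrite -bigcap_seq; apply/seteqP; split=> x /=.
  by move=> <- u _ /=; rewrite inE; case: asboolP.
move=> h; apply/setP => u; rewrite inE; have := h u; rewrite /= mem_index_enum => /(_ isT).
by case: ifP => _ /= hu; [apply/asboolP|apply/asboolP].
Qed.

Lemma Hent_act g : Hent m (f \o act g) = Hent m f.
Proof. by apply: eq_bigr => t _; congr ent; rewrite -(m_inv g (mf t)). Qed.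

(* The coordinates e and e u of a window agree wherever u fixes x, so only about #|E| / k of them matter. *)
Lemma Hwin_cond_stab (E : {fset G}) (k : nat) (c : {set K}) : (0 < k)%N -> (k <= #|c|)%N ->
  let A := [set x | stab_in x = c] in 0 < m A ->
  Hent (cond m A) (win act f E) <= k%:R^-1 * \sum_(e <- E) Hent (cond m A) (f \o act e) +
    #|` [fset e in E | ~~ [forall u : K, (e * val u)%g \in E]]%fset|%:R * ln #|T|%:R.
Proof.
move=> k0 kc A A0; have mA : M A by exact: ofin_stab.
have cc := charge_cond cm mA A0.
have mfg g : ofin M (f \o act g) by exact: ofin_act.
have H0 g : 0 <= Hent (cond m A) (f \o act g) by exact: Hent_ge0 cc _ _ _.
(* If e u = t v with u and v fixing x, then e x = t x: coordinates whose cells meet carry the same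
   letter. A maximal family D of disjoint cells therefore determines the whole name on A. *)
pose B e := [fset (e * val u)%g | u in c]%fset.
have [D [DE Dd Dc]] := disjoint_transversal B E.
have le1 : Hent (cond m A) (win act f E) <= Hent (cond m A) (win act f D).
  apply: (Hent_cond_mono cm) => //; try exact: (ofin_win cm).
  move=> x y xA yA /win_eqP h; apply/win_eqP => e /Dc[t tD [<-|[g]]]; first exact: h.
  move=> /imfsetP[u /= uc ->] /imfsetP[v /= vc ev].
  have fx z w : A z -> w \in c -> act (val w) z = z.
    by move=> Az wc; move: wc; rewrite -Az inE => /asboolP.
  have E1 z : A z -> act e z = act t z.
    by move=> Az; rewrite -{1}(fx z u Az uc) -act_action.2 ev act_action.2 fx.
  by rewrite !E1 //; exact: h.
apply: le_trans le1 _; apply: le_trans (Hent_ffun_le cc (fun t => mfg (val t))).2 _.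
rewrite -(big_seq_fsetE _ D xpredT (fun t => Hent (cond m A) (f \o act t))) /=.
pose good e := [forall u : K, (e * val u)%g \in E].
rewrite (bigID good) /=; apply: lerD; last first.
  apply: le_trans (_ : \sum_(i <- D | ~~ good i) ln #|T|%:R <= _).
    by apply: ler_sum => t _; exact: (Hent_le_ln cc).
  rewrite big_fset_condE /= sum_fset_const ler_wpM2r //.
    exact: ln_card_ge0.
  rewrite ler_nat; apply/fsubset_leq_card/fsubsetP => e; rewrite !inE /= => /andP[/(fsubsetP DE) -> ->] //.
(* The entropy at a good t in D is spread over the points of its cell, at least k in number, all
   inside E and with equal conditional entropy. The cells are disjoint, so the sum over E bounds k
   times the sum over good t. *)
rewrite ler_pdivlMl ?ltr0n // mulr_sumr.
apply: le_trans (_ : \sum_(t <- D | good t) \sum_(h <- B t) Hent (cond m A) (f \o act h) <= _).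
  apply: ler_sum => t _; rewrite big_imfset /=; last by move=> u v _ _ /mulgI/val_inj.
  rewrite (eq_big_seq (fun=> Hent (cond m A) (f \o act t))); last first.
    move=> u uc; apply/eqP; rewrite eq_le; apply/andP; split; apply: (Hent_cond_mono cm) => // x y xA yA /=;
    (have fx z : A z -> act (t * val u)%g z = act t z by
      move=> Az; rewrite act_action.2; congr act; move: uc; rewrite mem_enum -Az inE => /asboolP);
    by rewrite !fx.
  rewrite big_const_seq count_predT -cardE iter_addr_0 -[leRHS]mulr_natl.
  by rewrite ler_wpM2r // ler_nat.
apply: le_trans (_ : \sum_(t <- D | good t) \sum_(h <- E | h \in B t) Hent (cond m A) (f \o act h) <= _).
  rewrite big_seq_cond [leRHS]big_seq_cond; apply: ler_sum => t /andP[tD gt].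
  rewrite [leRHS]big_fset_condE /= le_eqVlt; apply/orP; left; apply/eqP; apply: eq_fbigl => h.
  rewrite !inE /=; have [hB|//] := boolP (h \in B t); last by rewrite andbF.
  by rewrite andbT; move: hB => /imfsetP[u /= uc ->]; apply/esym; exact: (forallP gt u).
rewrite (exchange_big_dep xpredT) //= big_seq [leRHS]big_seq; apply: ler_sum => h hE.
rewrite big_fset_condE /= sum_fset_const ler_piMl // -[leRHS]/(1%:R) ler_nat.
set S := [fset _ in D | _]%fset.
have [->|[t]] := fset_0Vmem S; first by rewrite cardfs0.
rewrite !inE /= => /andP[tD /andP[_ ht]]; rewrite -(cardfs1 t); apply/fsubset_leq_card/fsubsetP => u.
by rewrite !inE /= => /andP[uD /andP[_ hu]]; apply/eqP; exact: Dd hu ht.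
Qed.

(** [Hwin_cond_stab] is averaged over the pattern of stabilizer elements inside K. The pattern costs
    at most the logarithm of the number of subsets of K, and patterns with fewer than k elements are
    charged the trivial bound |E| ln |T|. *)
Lemma Hwin_stab (E : {fset G}) (k : nat) : (0 < k)%N ->
  Hwin act m f E <= ln #|{set K}|%:R + #|` E|%:R / k%:R * Hent m f +
   (#|` [fset e in E | ~~ [forall u : K, (e * val u)%g \in E]]%fset|%:R +
    m [set x | (#|stab_in x| < k)%N] * #|` E|%:R) * ln #|T|%:R.
Proof.
move=> k0; have ms := ofin_stab; have mw := ofin_win cm M_act (A:=E) mf.
apply: le_trans (Hent_le_chain cm ms mw) _.
rewrite -addrA; apply: lerD; first exact: (Hent_le_ln cm).
set bad : R := #|` [fset e in E | _]%fset|%:R; set L := ln _.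
have L0 : 0 <= L := ln_card_ge0 _.
have mge c : 0 <= m [set x | stab_in x = c] by exact: ch_ge0 cm _ (ms c).
have cge0 c g : 0 <= m [set x | stab_in x = c] * Hent (cond m [set x | stab_in x = c]) (f \o act g).
  have := mge c; rewrite le_eqVlt => /orP[/eqP <-|c0]; first by rewrite mul0r.
  by rewrite mulr_ge0 // (Hent_ge0 (charge_cond cm (ms c) c0)) //; exact: ofin_act.
have h c : m [set x | stab_in x = c] * Hent (cond m [set x | stab_in x = c]) (win act f E) <=
   k%:R^-1 * (\sum_(e <- E) m [set x | stab_in x = c] * Hent (cond m [set x | stab_in x = c]) (f \o act e)) +
   (m [set x | stab_in x = c] * bad + (if (#|c| < k)%N then m [set x | stab_in x = c] else 0) * #|` E|%:R) * L.
  have := mge c; rewrite le_eqVlt => /orP[/eqP <-|c0].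
    rewrite mul0r mul0r if_same mul0r addr0 mul0r addr0 mulr_ge0 // ?invr_ge0 //.
    by apply: sumr_ge0 => e _; rewrite mul0r.
  have cc := charge_cond cm (ms c) c0.
  case: ltnP => ck.
    apply: le_trans (_ : m [set x | stab_in x = c] * (#|` E|%:R * L) <= _).
      by rewrite ler_wpM2l //; exact: (Hwin_le_ln cc M_act mf).
    have : 0 <= k%:R^-1 * (\sum_(e <- E) m [set x | stab_in x = c] * Hent (cond m [set x | stab_in x = c]) (f \o act e)).
      by rewrite mulr_ge0 ?invr_ge0 //; apply: sumr_ge0.
    have : 0 <= m [set x | stab_in x = c] * bad * L by rewrite !mulr_ge0.
    rewrite mulrDl mulrA; lra.
  rewrite mul0r addr0 -mulr_sumr mulrCA -mulrA -mulrDr ler_pM2l //.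
  exact: (Hwin_cond_stab E k0 ck c0).
apply: le_trans (ler_sum _ (fun c _ => h c)) _.
rewrite big_split /= -mulr_sumr -mulr_suml big_split /= -mulr_suml -[X in _ + (_ + X) * _]mulr_suml.
rewrite (ch_sum1 cm ms) mul1r exchange_big /=; apply: lerD.
  rewrite [_ / k%:R]mulrC -mulrA ler_wpM2l ?invr_ge0 // -sum_fset_const.
  apply: ler_sum => e _; rewrite -(Hent_act e).
  by apply: (Hent_cond_le cm) => //; exact: ofin_act.
rewrite ler_wpM2r // lerD2l ler_wpM2r //.
rewrite [leRHS](ch_sum cm ms (ofin_pred cm (fun c : {set K} => #|c| < k)%N ms)).
apply: ler_sum => c _; case: ifP => ck; last first.
  by apply: (ch_ge0 cm); apply: (chI cm); [exact: (ofin_pred cm (fun c : {set K} => #|c| < k)%N ms)|exact: ms].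
rewrite le_eqVlt; apply/orP; left; apply/eqP; congr m.
by apply/seteqP; split=> x /=; [move=> ->|case].
Qed.

End Stabilizer.

(** * Quasi-tilings *)

Section Tower.
Context {R : realType} {G : groupType} {dX : measure_display} {X : measurableType dX}
  (d : X -> X -> R) (act : G -> X -> X) (F : nat -> {fset G}).
Hypothesis d_metric : is_metric d.
Hypothesis X_compact : d_compact d.
Hypothesis X_borel : @measurable _ X = <<s [set A | d_open d A] >>.
Hypothesis act_action : is_action act.
Hypothesis act_cont : forall g, d_continuous d (act g).
Hypothesis F_folner : @folner R G F.
Variable nu : probability X R.
Hypothesis nu_inv : invariant_measure act nu.
Let mact := act_pre X_borel act_cont.
Let cm := charge_pm nu.

Lemma meas_fix g : measurable [set x | act g x = x].
Proof.
have cd : d_continuous_real d (fun x => d (act g x) x) by exact: (cont_d2 d_metric).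
rewrite (_ : [set x | _] = ~` [set x | 0 < d (act g x) x]).
  by apply/measurableC/(open_meas X_borel)/d_open_gt.
apply/seteqP; split=> x /=; first by move=> ->; rewrite (d_xx d_metric) ltxx.
by move=> h; apply: contrapT => n; apply: h; exact: (d_gt0 d_metric).
Qed.

Lemma act_KV g x : act g^-1%g (act g x) = x.
Proof. by rewrite -act_action.2 mulVg act_action.1. Qed.

Lemma act_VK g x : act g (act g^-1%g x) = x.
Proof. by rewrite -act_action.2 mulgV act_action.1. Qed.

Lemma ind01 (A : set X) x : 0 <= (\1_A x : R) <= 1.
Proof. by rewrite indicE; case: (x \in A); rewrite /= ?lexx ler01. Qed.

Lemma ind1 (A : set X) x : A x -> \1_A x = 1 :> R.
Proof. by move=> Ax; rewrite indicE mem_set. Qed.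

Lemma ind0 (A : set X) x : ~ A x -> \1_A x = 0 :> R.
Proof. by move=> Ax; rewrite indicE memNset. Qed.

Lemma bm_ind (A : set X) g : measurable A -> bm (fun x => \1_A (act g x) : R).
Proof. by move=> mA; exact: (bm_act X_borel act_cont g (bm_indic mA)). Qed.

Lemma Ex_ind g (A : set X) : measurable A -> Ex nu (fun x => \1_A (act g x)) = pm nu A.
Proof.
move=> mA; rewrite -(Ex_indic nu mA).
exact: (Ex_act X_borel act_cont g nu_inv (bm_indic mA)).
Qed.

Definition sweep (S : {fset G}) (B : set X) : set X :=
  [set x | exists2 s, s \in S & B (act s^-1%g x)].

Lemma meas_sweep S B : measurable B -> measurable (sweep S B).
Proof.
move=> mB; rewrite (_ : sweep S B = \big[setU/set0]_(s <- S) (act s^-1%g @^-1` B)).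
  by apply: bigsetU_measurable => s _; exact: mact.
rewrite -bigcup_fset; apply/seteqP; split=> x /= [s sS h]; by exists s.
Qed.

Lemma pm_setD A B : measurable A -> measurable B -> A `<=` B -> pm nu (B `\` A) = pm nu B - pm nu A.
Proof.
move=> mA mB AB; rewrite (ch_split cm mB mA) setDE (setIidr AB); ring.
Qed.

(* Tiles are counted with multiplicity: z lies in S y for at most k pairs (s, y) since two centres
   y in A with a common tile point coincide. *)
Lemma greedy_round (S : {fset G}) (k : nat) (A U : set X) : measurable A -> measurable U ->
  (forall y e, A y -> e \in inv_prod S S -> A (act e y) -> act e y = y) ->
  (forall y, A y -> (#|stab_in act (inv_prod S S) y| <= k)%N) ->
  let B := [set y | A y /\ 2 * \sum_(s <- S) \1_U (act s y) < #|` S|%:R :> R] in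
  measurable B /\ #|` S|%:R * pm nu B <= 2 * k%:R * (pm nu (U `|` sweep S B) - pm nu U).
Proof.
move=> mA mU Aloc Ast B.
have bU : bm (fun y => 2 * \sum_(s <- S) \1_U (act s y) : R) by apply/bmZ/bm_sum => s; exact: bm_ind.
have mB : measurable B.
  rewrite (_ : B = A `&` (fun y => 2 * \sum_(s <- S) \1_U (act s y) : R) @^-1` `]-oo, #|` S|%:R[).
    by apply: measurableI => //; rewrite -[_ @^-1` _]setTI; apply: bU.1.
  by apply/seteqP; split=> x /=; rewrite /B /= in_itv.
split=> //.
have mV := measurableU _ _ mU (meas_sweep S mB).
set V := U `|` sweep S B in mV *.
rewrite -pm_setD //; last by move=> x; left.
have mVU : measurable (V `\` U) by exact: measurableD.
rewrite -(Ex_indic nu mB) -(Ex_indic nu mVU).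
have bBU s : bm (fun y => \1_B y * (1 - \1_U (act s y)) : R).
  by apply: bmM; [exact: bm_indic|apply: bmB; [exact: bm_cst|exact: bm_ind]].
have bBU' s : bm (fun z => \1_B (act s^-1%g z) * (1 - \1_U z) : R).
  by apply: bmM; [exact: bm_ind|apply: bmB; [exact: bm_cst|exact: bm_indic]].
rewrite -ExZ; last exact: bm_indic.
rewrite -ExZ; last exact: bm_indic.
apply: le_trans (_ : Ex nu (fun y => 2 * \sum_(s <- S) (\1_B y * (1 - \1_U (act s y)))) <= _).
  apply: Ex_le; [exact/bmZ/bm_indic|by apply/bmZ/bm_sum|] => y.
  rewrite -mulr_sumr sumrB sum_fset_const mulr1.
  have [By|nB] := pselect (B y); last by rewrite ind0 // mulr0 mul0r mulr0.
  by rewrite ind1 // mulr1 mul1r; have [_] := By; lra.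
rewrite (ExZ nu 2 (bm_sum _ _ bBU)).
rewrite (Ex_sum nu _ _ bBU) (eq_bigr (fun s => Ex nu (fun z => \1_B (act s^-1%g z) * (1 - \1_U z)))); last first.
  move=> s _; rewrite -(Ex_act X_borel act_cont s nu_inv (bBU' s)).
  by congr Ex; apply/funext => y /=; rewrite act_KV.
rewrite -(Ex_sum nu _ _ bBU') -(ExZ nu 2 (bm_sum _ _ bBU')).
apply: Ex_le; [by apply/bmZ/bm_sum|exact/bmZ/bm_indic|] => z.
rewrite -mulr_suml -mulrA ler_pM2l //.
have [Uz|nU] := pselect (U z).
  by rewrite (ind1 Uz) subrr mulr0 mulr_ge0 //; have /andP[] := ind01 (V `\` U) z.
rewrite (ind0 nU) subr0 mulr1.
have [[t tS Bt]|nBz] := pselect (sweep S B z); last first.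
  rewrite big_seq big1 ?mulr_ge0 //.
  by move=> s sS; rewrite ind0 // => h; apply: nBz; exists s.
rewrite (ind1 (A := V `\` U)); last by split=> //; right; exists t.
rewrite mulr1.
rewrite (eq_bigr (fun s => if `[< B (act s^-1%g z) >] then 1 else 0)); last first.
  by move=> s _; case: asboolP => h; [rewrite ind1|rewrite ind0].
rewrite -big_mkcond /= big_fset_condE /= sum_fset_const mulr1 ler_nat.
set y := act t^-1%g z in Bt.
apply: leq_trans (Ast y Bt.1).
pose E := [fset (s^-1 * t)%g | s in [fset i in S | `[< B (act i^-1%g z) >]]]%fset.
have -> : #|` [fset i in S | `[< B (act i^-1%g z) >]]%fset| = #|` E|.
  by rewrite [RHS]card_imfset //= => s u /mulIg /invg_inj.
have Ein e : e \in E -> e \in inv_prod S S /\ act e y = y.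
  move=> /imfsetP[s /=]; rewrite !inE /= => /andP[sS /asboolP Bs] ->.
  have eI : (s^-1 * t)%g \in inv_prod S S by apply/mem_inv_prod; exists s => //; rewrite mulVKg.
  split=> //; apply: Aloc => //; first exact: Bt.1.
  by rewrite /y act_action.2 act_VK; exact: Bs.1.
rewrite cardfE -(card_imset _ (f := fun e : E => (Sub (val e) (proj1 (Ein _ (valP e))) : inv_prod S S))); last first.
  by move=> e f /(congr1 val) /= /val_inj.
apply/subset_leq_card/fintype.subsetP => u /imsetP[e _ ->]; rewrite inE /=; apply/asboolP.
exact: (Ein _ (valP e)).2.
Qed.

Lemma pm_bigcup_le (A : nat -> set X) (c : R) : (forall n, measurable (A n)) ->
  (forall n, A n `<=` A n.+1) -> (forall n, pm nu (A n) <= c) -> pm nu (\bigcup_n A n) <= c.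
Proof.
move=> mA An Ac; have mU : measurable (\bigcup_n A n) by exact: bigcup_measurable.
rewrite -lee_fin -pmE //.
have h' : nu (A n) @[n --> \oo] --> nu (\bigcup_n A n).
  apply: nondecreasing_cvg_mu => // m n mn; apply/subsetPset; elim: n mn => [|n IH]; first by rewrite leqn0 => /eqP ->.
  by rewrite leq_eqVlt => /orP[/eqP ->//|/IH]; move/subset_trans; apply; exact: An.
rewrite -(cvg_lim (@ereal_hausdorff R) h'); apply: lime_le; first by apply/cvg_ex; eexists; exact: h'.
by near=> n; apply: le_trans (_ : (pm nu (A n))%:E <= _)%E; rewrite ?pmE // lee_fin.
Unshelve. all: end_near. Qed.

Lemma local_cover (E : {fset G}) : exists A : nat -> set X,
  [/\ forall m, measurable (A m), forall m y e, A m y -> e \in E -> A m (act e y) -> act e y = y &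
    forall y, exists m, A m y].
Proof.
have r0 (n : nat) : (0 : R) < n.+1%:R^-1 by rewrite invr_gt0.
have /choice[c hc] : forall n : nat, exists c : nat -> X, forall x, exists i, d x (c i) < n.+1%:R^-1.
  move=> n; have [N [c hc]] := net d_metric X_compact (r0 n).
  exists (fun i => if insub i is Some j then c j else point) => x.
  by have [i hi] := hc x; exists i; rewrite valK.
pose B n i : set X := [set y | d y (c n i) < n.+1%:R^-1] `&`
  \big[setI/setT]_(e <- E) ([set y | act e y = y] `|` ~` [set y | d (act e y) y < 2 * n.+1%:R^-1]).
pose A m : set X := match @choice.unpickle (nat * nat)%type m with Some (n, i) => B n i | None => set0 end.
have cd e : d_continuous_real d (fun y => - d (act e y) y).
  exact: (contN d_metric (cont_d2 d_metric (act_cont e))).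
have mB n i : measurable (B n i).
  apply: measurableI; first by apply/(open_meas X_borel)/(d_open_ball d_metric).
  apply: bigsetI_measurable => e _; apply: measurableU; first exact: meas_fix.
  apply: measurableC; apply: (open_meas X_borel).
  rewrite (_ : [set y | _] = [set y | - (2 * n.+1%:R^-1) < - d (act e y) y]); first exact: d_open_gt.
  by apply/seteqP; split=> y /=; rewrite ltrN2.
exists A; split.
- by move=> m; rewrite /A; case: choice.unpickle => [[n i]|//]; exact: mB.
- move=> m y e; rewrite /A; case: choice.unpickle => [[n i]|//] [h1 h2] eE [h3 _].
  move: h2; rewrite -bigcap_fset => /(_ e eE) [//|/= h2]; exfalso; apply: h2.
  apply: le_lt_trans (d_tri d_metric (c n i) _ _) _.
  rewrite mulrDl mul1r; apply: ltrD; first exact: h3.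
  by rewrite d_sym //; exact: h1.
- move=> y.
  have : \forall n \near \oo, forall e, e \in E -> act e y = y \/ 2 * n.+1%:R^-1 <= d (act e y) y.
    apply: near_fset => e _; have [ey|ey] := pselect (act e y = y).
      by near=> n; left.
    have e0 : 0 < d (act e y) y / 2 by rewrite divr_gt0 // (d_gt0 d_metric).
    have := near_infty_natSinv_lt (PosNum e0); apply: filterS => n /= hn; right.
      by rewrite mulrC -ler_pdivlMr //; exact: ltW hn.
  move=> [n _ /(_ n (leqnn n)) hn]; have [i hi] := hc n y.
  exists (choice.pickle (n, i)); rewrite /A choice.pickleK; split=> //.
  rewrite -bigcap_fset => e eE; have [h|h] := hn e eE; first by left.
  by right => /=; rewrite ltNge h.
Unshelve. all: end_near. Qed.

(** Greedy rounds run over the countably many pieces of [local_cover]. When a piece containing y is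
    processed, either half of S y is already covered, or y becomes a centre and S y is covered
    entirely. *)
Lemma tower_step (S : {fset G}) (k : nat) (U : set X) : measurable U ->
  nu [set y | (k < #|stab_in act (inv_prod S S) y|)%N] = 0%E ->
  exists B, [/\ measurable B,
    #|` S|%:R * pm nu B <= 2 * k%:R * (pm nu (U `|` sweep S B) - pm nu U) &
    {ae nu, forall y, #|` S|%:R <= 2 * \sum_(s <- S) \1_(U `|` sweep S B) (act s y) :> R}].
Proof.
move=> mU nuk; have [A [mA Aloc Acov]] := local_cover (inv_prod S S).
have mst : ofin measurable (stab_in act (inv_prod S S)) by exact: (ofin_stab cm meas_fix).
have mk : measurable [set y | (#|stab_in act (inv_prod S S) y| <= k)%N].
  exact: (ofin_pred cm (fun c : {set inv_prod S S} => #|c| <= k)%N mst).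
pose A' m := A m `&` [set y | (#|stab_in act (inv_prod S S) y| <= k)%N].
have mA' m : measurable (A' m) by exact: measurableI.
pose Bf m (V : set X) := [set y | A' m y /\ 2 * \sum_(s <- S) \1_V (act s y) < #|` S|%:R :> R].
pose V := fix V m := if m is m'.+1 then V m' `|` sweep S (Bf m' (V m')) else U.
have rd m W : measurable W -> measurable (Bf m W) /\
    #|` S|%:R * pm nu (Bf m W) <= 2 * k%:R * (pm nu (W `|` sweep S (Bf m W)) - pm nu W).
  move=> mW; apply: greedy_round => //; last by move=> y [].
  by move=> y e [Ay _] eE [Aey _]; exact: Aloc Ay eE Aey.
have mV m : measurable (V m).
  by elim: m => // m IH /=; apply: measurableU => //; apply/meas_sweep/(rd _ _ IH).1.
pose B := \bigcup_m Bf m (V m).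
have mBm m : measurable (Bf m (V m)) := (rd m _ (mV m)).1.
have mB : measurable B by exact: bigcup_measurable.
have VE m x : V m x <-> U x \/ exists2 i, (i < m)%N & sweep S (Bf i (V i)) x.
  elim: m => [|m IH]; first by split; [left|case=> // -[]].
  split=> [/= [/IH[|[i im h]]|h]|[Ux|[i im h]]].
  - by left.
  - by right; exists i => //; exact: ltnW.
  - by right; exists m.
  - by left; apply/IH; left.
  - move: im; rewrite ltnS leq_eqVlt => /orP[/eqP im|im]; first by right; rewrite -im.
    by left; apply/IH; right; exists i.
have Vsub m : V m `<=` U `|` sweep S B.
  move=> x /VE[|[i _ [s sS h]]]; first by left.
  by right; exists s => //; exists i.
have mVB : measurable (U `|` sweep S B) by apply: measurableU => //; exact: meas_sweep.
exists B; split=> //.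
  have [->|S0] := eqVneq S fset0%fset.
    rewrite cardfs0 mul0r mulr_ge0 // subr_ge0; apply: (ch_mono cm mU); last by left.
    by apply: measurableU => //; exact: meas_sweep.
  have Sp : (0 : R) < #|` S|%:R by rewrite ltr0n cardfs_gt0.
  rewrite mulrC -ler_pdivlMr //.
  pose BB m := \big[setU/set0]_(i < m) Bf i (V i).
  have BE : B = \bigcup_m BB m.
    apply/seteqP; split=> x; rewrite /B /BB.
      by move=> [m _ h]; exists m.+1 => //; rewrite big_ord_recr; right.
    by move=> [m _]; rewrite -(bigcup_mkord m (fun i => Bf i (V i))) => -[i _ h]; exists i.
  have mBB m : measurable (BB m) by apply: bigsetU_measurable => i _; exact: mBm.
  rewrite {1}BE; apply: pm_bigcup_le => // m; first by rewrite /BB big_ord_recr => x; left.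
  rewrite ler_pdivlMr // mulrC.
  apply: le_trans (_ : 2 * k%:R * (pm nu (V m) - pm nu U) <= _); last first.
    by rewrite ler_wpM2l ?mulr_ge0 // lerD2r; exact: (ch_mono cm).
  elim: m => [|m IH]; first by rewrite /BB big_ord0 (ch0 cm) subrr !mulr0.
  have le1 : pm nu (BB m.+1) <= pm nu (BB m) + pm nu (Bf m (V m)).
    rewrite {1}/BB big_ord_recr /= -/(BB m).
    rewrite (ch_split cm (measurableU _ _ (mBB m) (mBm m)) (mBB m)); apply: lerD; apply: (ch_mono cm) => //.
    - by apply: measurableI => //; exact: measurableU.
    - by apply: measurableI; [exact: measurableU|exact: measurableC].
    - by move=> x [[]].
  have := (rd m _ (mV m)).2; have := ler_wpM2l (ltW Sp) le1; rewrite mulrDr /=; lra.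
exists [set y | (k < #|stab_in act (inv_prod S S) y|)%N]; split=> //.
  exact: (ofin_pred cm (fun c : {set inv_prod S S} => k < #|c|)%N mst).
move=> y /= h; rewrite ltnNge; apply/negP => yk; apply: h.
have [m Am] := Acov y.
have mono (W : set X) s : W `<=` U `|` sweep S B -> \1_W (act s y) <= (\1_(U `|` sweep S B) (act s y) : R).
  move=> WU; have [Wy|nW] := pselect (W (act s y)); first by rewrite !ind1 //; exact: WU.
  by rewrite (ind0 nW); have /andP[] := ind01 (U `|` sweep S B) (act s y).
have [le|gt] := leP #|` S|%:R (2 * \sum_(s <- S) \1_(V m) (act s y) : R).
  by apply: le_trans le _; rewrite ler_pM2l //; apply: ler_sum => s _; exact: mono.
rewrite (eq_big_seq (fun=> 1)); last first.
  by move=> s sS; rewrite ind1 //; right; exists s => //; exists m => //; rewrite act_KV.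
by rewrite sum_fset_const mulr1 ler_peMl // ler1n.
Qed.

(* Each shape at least halves the uncovered mass, up to the boundary error 2 k eta; the shapes must
   come in decreasing order of invariance. *)
Lemma tower (J k : nat) (S : nat -> {fset G}) (eta : R) :
  (forall i, S i != fset0%fset) ->
  (forall i, nu [set y | (k < #|stab_in act (inv_prod (S i) (S i)) y|)%N] = 0%E) ->
  0 <= eta ->
  (forall l i s, (l < i)%N -> (i < J)%N -> s \in S i ->
     #|` [fset t in S l | (s^-1 * t)%g \notin S l]%fset|%:R <= eta * #|` S l|%:R) ->
  exists B : nat -> set X, [/\ forall l, measurable (B l),
    \sum_(l < J) #|` S l|%:R * pm nu (B l) <= 2 * k%:R &
    pm nu (~` [set x | exists2 l, (l < J)%N & sweep (S l) (B l) x]) <= 2^-1 ^+ J + 4 * k%:R * eta].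
Proof.
move=> S0 stk eta0 Sinv.
have Sp i : (0 : R) < #|` S i|%:R by rewrite ltr0n cardfs_gt0.
have /choice[b hb] : forall Ui : set X * nat, exists B, measurable Ui.1 -> [/\ measurable B,
    #|` S Ui.2|%:R * pm nu B <= 2 * k%:R * (pm nu (Ui.1 `|` sweep (S Ui.2) B) - pm nu Ui.1) &
    {ae nu, forall y, #|` S Ui.2|%:R <= 2 * \sum_(s <- S Ui.2) \1_(Ui.1 `|` sweep (S Ui.2) B) (act s y) :> R}].
  move=> [U i] /=; have [mU|] := pselect (measurable U); last by exists set0.
  by have [B hB] := tower_step mU (stk i); exists B.
pose U := fix U i := if i is i'.+1 then U i' `|` sweep (S i') (b (U i', i')) else set0.
pose B i := b (U i, i).
have mU i : measurable (U i).
  by elim: i => [|i IH] /=; [exact: measurable0|apply: measurableU => //; apply: meas_sweep; case: (hb (U i, i) IH)].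
have mB i : measurable (B i) by case: (hb (U i, i) (mU i)).
have hB i : #|` S i|%:R * pm nu (B i) <= 2 * k%:R * (pm nu (U i.+1) - pm nu (U i)) by case: (hb (U i, i) (mU i)).
have UE m x : U m x <-> exists2 i, (i < m)%N & sweep (S i) (B i) x.
  elim: m => [|m IH]; first by split=> // -[].
  split=> [/= [/IH[i im h]|h]|[i im h]].
  - by exists i => //; exact: ltnW.
  - by exists m.
  - move: im; rewrite ltnS leq_eqVlt => /orP[/eqP im|im]; first by right; rewrite -im.
    by left; apply/IH; exists i.
have sumB m : \sum_(l < m) #|` S l|%:R * pm nu (B l) <= 2 * k%:R * pm nu (U m).
  elim: m => [|m IH]; first by rewrite big_ord0 /= (ch0 cm) mulr0.
  by rewrite big_ord_recr /=; have := hB m; move: IH => /=; lra.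
have sumB2 m : \sum_(l < m) #|` S l|%:R * pm nu (B l) <= 2 * k%:R.
  by apply: le_trans (sumB m) _; rewrite ler_piMr ?mulr_ge0 // (ch_le1 cm).
have bsU m s : bm (fun y => (1 - \1_(U m) y) * \1_(U m) (act s y) : R).
  by apply: bmM; [apply: bmB; [exact: bm_cst|exact: bm_indic]|exact: bm_ind].
(* If y is uncovered but s y is covered, then s y sits at a tile position t with s^-1 t outside the
   shape; the earlier shapes are nearly invariant under s, so such positions are rare. *)
have nearinv i s : (i < J)%N -> s \in S i ->
    Ex nu (fun y => (1 - \1_(U i) y) * \1_(U i) (act s y)) <= 2 * k%:R * eta.
  move=> iJ sS.
  pose bad l := [fset t in S l | (s^-1 * t)%g \notin S l]%fset.
  have bI l : bm (fun y => \sum_(t <- bad l) \1_(B l) (act (t^-1 * s)%g y) : R) by apply: bm_sum => t; exact: bm_ind.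
  apply: le_trans (_ : Ex nu (fun y => \sum_(l < i) \sum_(t <- bad l) \1_(B l) (act (t^-1 * s)%g y)) <= _).
    apply: Ex_le => //; first by apply: bm_sum => l; exact: bI.
    move=> y; have s0 : 0 <= \sum_(l < i) \sum_(t <- bad l) (\1_(B l) (act (t^-1 * s)%g y) : R).
      by apply: sumr_ge0 => l _; apply: sumr_ge0 => t _; have /andP[] := ind01 (B l) (act (t^-1 * s)%g y).
    have [Uy|nUy] := pselect (U i y); first by rewrite (ind1 Uy) subrr mul0r.
    have [Us|nUs] := pselect (U i (act s y)); last by rewrite (ind0 nUs) mulr0.
    rewrite (ind0 nUy) (ind1 Us) subr0 mulr1.
    have [l li [t tS Bt]] := (UE _ _).1 Us.
    have tbad : t \in bad l.
      rewrite !inE tS /=; apply/negP => stS; apply: nUy; apply/UE; exists l => //.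
      by exists (s^-1 * t)%g => //; rewrite invgM invgK act_action.2.
    rewrite (bigD1 (Ordinal li)) //= (big_fsetD1 t) //= ind1 ?act_action.2 // -addrA lerDl addr_ge0 //.
      by apply: sumr_ge0 => u _; have /andP[] := ind01 (B l) (act (u^-1 * s)%g y).
    by apply: sumr_ge0 => j _; apply: sumr_ge0 => u _; have /andP[] := ind01 (B j) (act (u^-1 * s)%g y).
  rewrite (Ex_sum nu _ _ (fun l : 'I_i => bI l)).
  apply: le_trans (_ : \sum_(l < i) #|` S l|%:R * pm nu (B l) * eta <= _); last first.
    by rewrite -mulr_suml ler_wpM2r.
  apply: ler_sum => l _; rewrite (Ex_sum nu _ _ (fun t => bm_ind (t^-1 * s)%g (mB l))).
  rewrite (eq_bigr (fun=> pm nu (B l))); last by move=> t _; exact: Ex_ind.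
  rewrite sum_fset_const mulrAC [_ * eta]mulrC ler_wpM2r //; first exact: (ch_ge0 cm (mB l)).
  exact: Sinv (ltn_ord l) iJ sS.
pose c i := 1 - pm nu (U i).
(* Almost every uncovered y has half of S_i y covered after this round. Positions covered before are
   rare by [nearinv], so the rest is newly covered mass; integrating and dividing by |S_i| gives a
   recursion with fixed point 4 k eta. *)
have step i : (i < J)%N -> c i.+1 <= c i / 2 + 2 * k%:R * eta.
  move=> iJ; have [_ _ ae] := hb (U i, i) (mU i); rewrite /= in ae.
  have mD : measurable (U i.+1 `\` U i) by exact: measurableD.
  have bD s : bm (fun y => \1_(U i.+1 `\` U i) (act s y) : R) by exact: bm_ind.
  have bc : bm (fun y => 1 - \1_(U i) y : R) by apply: bmB; [exact: bm_cst|exact: bm_indic].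
  pose f y : R := (#|` S i|%:R / 2) * (1 - \1_(U i) y).
  pose g y : R := \sum_(s <- S i) ((1 - \1_(U i) y) * \1_(U i) (act s y) + \1_(U i.+1 `\` U i) (act s y)).
  have bs s : bm (fun y => (1 - \1_(U i) y) * \1_(U i) (act s y) + \1_(U i.+1 `\` U i) (act s y) : R).
    exact: bmD.
  have bg : bm g by exact: bm_sum.
  have bf : bm f by exact: bmZ.
  have fg : Ex nu f <= Ex nu g.
    have bfg : bm (fun x => Num.max (f x) (g x)).
      split; first by apply: measurable_maxr; [exact: bf.1|exact: bg.1].
      have [_ [M1 h1]] := bf; have [_ [M2 h2]] := bg; exists (Num.max M1 M2) => x.
      by rewrite maxEle; case: ifP => _; rewrite le_max ?h1 ?h2 ?orbT.
    rewrite (Ex_ae_eq (g := fun x => Num.max (f x) (g x)) bg bfg).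
      by apply: Ex_le => // x; rewrite le_max lexx.
    apply: filterS ae => y hy; rewrite max_r // /f /g.
    have [Uy|nUy] := pselect (U i y).
      rewrite (ind1 Uy) subrr mulr0; apply: sumr_ge0 => s _; rewrite mul0r add0r.
      by have /andP[] := ind01 (U i.+1 `\` U i) (act s y).
    rewrite (ind0 nUy) subr0 mulr1 ler_pdivrMr // mulrC; apply: le_trans hy _.
    rewrite ler_pM2l //; apply: ler_sum => s _; rewrite mul1r.
    have [Us|nUs] := pselect (U i (act s y)).
      by rewrite (ind1 Us) ind1 ?lerDl; [have /andP[] := ind01 (U i.+1 `\` U i) (act s y)|left].
    rewrite (ind0 nUs) add0r.
    have [Vs|nVs] := pselect (U i.+1 (act s y)); first by rewrite !ind1.
    by rewrite ind0 //; have /andP[] := ind01 (U i.+1 `\` U i) (act s y).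
  move: fg; rewrite /f /g ExZ // ExB; [|exact: bm_cst|exact: bm_indic].
  rewrite Ex_cst (Ex_indic nu (mU i)) -/(c i) (Ex_sum nu _ _ bs).
  have le2 : \sum_(s <- S i) Ex nu (fun y => (1 - \1_(U i) y) * \1_(U i) (act s y) + \1_(U i.+1 `\` U i) (act s y)) <=
     #|` S i|%:R * (2 * k%:R * eta + (pm nu (U i.+1) - pm nu (U i))).
    rewrite -sum_fset_const big_seq [leRHS]big_seq; apply: ler_sum => s sS.
    rewrite ExD // lerD ?nearinv // Ex_ind // pm_setD //; by left.
  move=> /le_trans /(_ le2); rewrite -[X in X <= _]mulrA ler_pM2l // /c; lra.
have cJ i : (i <= J)%N -> c i <= 2^-1 ^+ i + 4 * k%:R * eta.
  elim: i => [_|i IH iJ]; first by rewrite /c /= (ch0 cm) subr0 expr0 lerDl !mulr_ge0.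
  by have := IH (ltnW iJ); have := step i iJ; rewrite exprS; lra.
exists B; split=> //.
rewrite (_ : [set x | _] = U J); last by apply/seteqP; split=> x /UE.
have mUC : measurable (~` U J) by exact: measurableC.
apply: le_trans (cJ J (leqnn J)).
have := ch_split cm (chT cm) (mU J); rewrite (ch_1 cm) !setTI /c; lra.
Qed.

End Tower.

(** * Choice of the tile shapes *)

Section Shapes.
Context {R : realType} {G : groupType} (F : nat -> {fset G}).
Hypothesis F_folner : @folner R G F.

(** If F_n had fewer than N elements, a proportion 1/(N+1) of it would be less than one element; F_n
    would then be stable under all of A and contain a translate A h with N elements. *)
Lemma folner_card_infty : (exists e : nat -> G, injective e) -> forall N, \forall n \near \oo, (N <= #|` F n|)%N.
Proof.
move=> [e ei] N.
pose A := [fset e (val i) | i in 'I_N]%fset.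
have cA : #|` A| = N.
  by rewrite card_imfset /= ?size_enum_ord // => i j /ei/val_inj.
have e0 : (0 : R) < N.+1%:R^-1 by rewrite invr_gt0.
have := near_fset (A := A) (fun g _ => folner_in F_folner g e0); apply: filterS => n hn.
rewrite leqNgt; apply/negP => Fn.
have [h hF] := fset0Pn _ (F_folner.1 n).
suff : (#|` A| <= #|` F n|)%N by rewrite cA leqNgt Fn.
have -> : #|` A| = #|` [fset (g * h)%g | g in A]%fset| by rewrite [RHS]card_imfset //= => x y /mulIg.
apply/fsubset_leq_card/fsubsetP => g /imfsetP[u /= uA ->].
apply/negPn/negP => nF.
have := hn u uA; rewrite leNgt => /negP; apply.
apply: lt_le_trans (_ : 1 <= _).
  rewrite mulrC ltr_pdivrMr // mul1r ltr_nat; exact: ltnW.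
rewrite -[1]/(1%:R) ler_nat cardfs_gt0; apply/fset0Pn; exists h.
by rewrite !inE /= hF.
Qed.

(** Each new shape is put in front: being chosen after the others, it can be made nearly invariant
    under all their elements. Shape 0, which the tower uses before the others, is thus the most
    invariant. *)
Lemma shapes (eta : R) (N J : nat) : 0 < eta -> exists n : nat -> nat,
  (forall l, (N <= n l)%N) /\ forall l i s, (l < i)%N -> (i < J)%N -> s \in F (n i) ->
     #|` [fset t in F (n l) | (s^-1 * t)%g \notin F (n l)]%fset|%:R <= eta * #|` F (n l)|%:R.
Proof.
move=> eta0; elim: J => [|J [n [nN hn]]]; first by exists (fun=> N).
pose W := (\bigcup_(i <- iota 0 J) F (n i))%fset.
have := near_fset (A := W) (fun s _ => folner_in F_folner s^-1%g eta0).
move=> [M _ hM]; pose n0 := maxn M N.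
exists (fun l => if l is l'.+1 then n l' else n0); split.
  by case=> [|l]; [exact: leq_maxr|exact: nN].
case=> [|l] [|i] s //.
  move=> _; rewrite ltnS => iJ sF; apply: (hM n0 (leq_maxl _ _)).
  by apply/bigfcupP; exists i => //; rewrite mem_iota add0n iJ.
by rewrite !ltnS; exact: hn.
Qed.

End Shapes.

(** * Measure entropy is bounded by topological entropy *)

Section Separated.
Context {R : realType} {G : groupType} {dX : measure_display} {X : measurableType dX}
  (d : X -> X -> R) (act : G -> X -> X).
Hypothesis d_metric : is_metric d.
Hypothesis X_compact : d_compact d.
Hypothesis X_borel : @measurable _ X = <<s [set A | d_open d A] >>.
Hypothesis act_action : is_action act.
Hypothesis act_cont : forall g, d_continuous d (act g).
Local Notation cont := (@d_continuous_real R X d).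
Local Notation dF := (@dF R G X act d).
Let dm := d_metric.

Lemma dF_leP (A : {fset G}) x y (e : R) : 0 <= e -> (forall g, g \in A -> d (act g x) (act g y) <= e) -> dF A x y <= e.
Proof. by move=> e0 h; rewrite /Defs.dF big_seq; apply: bigmax_le. Qed.

Lemma dF_ge (A : {fset G}) g x y : g \in A -> d (act g x) (act g y) <= dF A x y.
Proof. by move=> gA; rewrite /Defs.dF; apply: (le_bigmax_seq 0 g xpredT (fun g => d (act g x) (act g y))). Qed.

Lemma dF_ge0 (A : {fset G}) x y : 0 <= dF A x y.
Proof. by rewrite /Defs.dF; elim/big_rec: _ => // g r _ r0; rewrite le_max r0 orbT. Qed.

Lemma dF_sym (A : {fset G}) x y : dF A x y = dF A y x.
Proof. by apply: eq_bigr => g _; rewrite (d_sym dm). Qed.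

Lemma dF_tri (A : {fset G}) y x z : dF A x z <= dF A x y + dF A y z.
Proof.
apply: dF_leP => [|g gA]; first by rewrite addr_ge0 ?dF_ge0.
by apply: le_trans (d_tri dm (act g y) _ _) _; rewrite lerD ?dF_ge.
Qed.

Lemma cont_dF (A : {fset G}) p : cont (fun x => dF A x p).
Proof.
rewrite /Defs.dF; elim: (enum_fset A) => [|g s IH].
  rewrite (_ : (fun x => _) = fun=> 0); first exact: cont_cst.
  by apply/funext => x; rewrite big_nil.
rewrite (_ : (fun x => _) = fun x => Num.max (d (act g x) (act g p)) (\big[Num.max/0]_(h <- s) d (act h x) (act h p))).
  by apply: cont_max => //; exact: (cont_comp (act_cont g) (cont_d dm (act g p))).
by apply/funext => x; rewrite big_cons.
Qed.

Lemma dF_xx (A : {fset G}) x : dF A x x = 0.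
Proof.
by apply/eqP; rewrite eq_le dF_ge0 andbT; apply: dF_leP => // g _; rewrite (d_xx dm).
Qed.

Definition separated (A : {fset G}) (delta : R) (n : nat) :=
  exists p : 'I_n -> X, forall i j, i != j -> delta < dF A (p i) (p j).

Lemma separated_bounded A (delta : R) : 0 < delta -> exists N, forall n, separated A delta n -> (n <= N)%N.
Proof.
move=> d0; have [|x|s hs] := compact_cover X_compact (U := fun p : X => [set x | dF A x p < delta / 2]).
- move=> p; rewrite (_ : [set x | _] = [set x | - (delta / 2) < - dF A x p]).
    by apply: d_open_gt; apply: (contN dm); exact: cont_dF.
  by apply/seteqP; split=> x /=; rewrite ltrN2.
- by exists x; rewrite /= dF_xx divr_gt0.
exists (size s) => n [p hp].
have /choice[j hj] : forall i : 'I_n, exists j : 'I_(size s), dF A (p i) (nth point s j) < delta / 2.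
  move=> i; have [q qs hq] := hs (p i).
  have qi : (index q s < size s)%N by rewrite index_mem.
  by exists (Ordinal qi); rewrite /= nth_index.
have ji : injective j.
  move=> a b ab; apply/eqP/negPn/negP => /hp; apply/negP; rewrite -leNgt.
  apply: le_trans (dF_tri A (nth point s (j a)) _ _) _; rewrite [X in _ + X]dF_sym {2}ab.
  by have := hj a; have := hj b; lra.
by have := leq_card j ji; rewrite !card_ord.
Qed.

Lemma first_label (N : nat) (C : nat -> set X) : (forall i, measurable (C i)) ->
  (forall x, exists2 i, (i < N)%N & C i x) ->
  exists f : X -> nat, (forall x, (f x < N)%N /\ C (f x) x) /\ forall i, measurable [set x | f x = i].
Proof.
move=> mC cC.
have ex x : exists i, `[< C i x >] by have [i _ /asboolP] := cC x; exists i.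
pose f x := ex_minn (ex x).
have fC x : C (f x) x by rewrite /f; case: ex_minnP => i /asboolP.
have fmin x i : C i x -> (f x <= i)%N by rewrite /f; case: ex_minnP => j _ h Ci; apply: h; exact/asboolP.
exists f; split=> [x|i].
  by split=> //; have [i iN /fmin h] := cC x; exact: leq_ltn_trans h iN.
rewrite (_ : [set x | _] = C i `&` \big[setI/setT]_(j < i) ~` C j).
  by apply: measurableI => //; apply: bigsetI_measurable => j _; exact: measurableC.
rewrite -(bigcap_mkord i (fun j => ~` C j)); apply/seteqP; split=> x /=.
  by move=> <-; split=> // j /= jf /fmin; rewrite leqNgt jf.
move=> [Ci h]; apply/eqP; rewrite eqn_leq fmin //= leqNgt; apply/negP => fi.
exact: (h (f x) fi (fC x)).
Qed.

(** A maximal separated set is a net, so its points name all of X; taking the least admissible index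
    keeps the names Borel. *)
Lemma names A (delta : R) : 0 < delta -> exists N (f : X -> nat) (p : nat -> X),
  [/\ (0 < N)%N, N%:R <= sep_num act d A delta, forall x, (f x < N)%N,
    forall i, measurable [set x | f x = i] & forall x, dF A x (p (f x)) <= delta].
Proof.
move=> d0; have [N0 hN0] := separated_bounded A d0.
have ex0 : exists n, `[< separated A delta n >].
  by exists 0%N; apply/asboolP; exists (fun _ => point) => -[].
have bd n : `[< separated A delta n >] -> (n <= N0)%N by move/asboolP; exact: hN0.
case: (ex_maxnP ex0 bd) => N /asboolP sN maxN.
have N1 : (0 < N)%N.
  apply: maxN; apply/asboolP; exists (fun _ => point) => i j; by rewrite !ord1 eqxx.
have [p hp] := sN.
pose q i := if insub i is Some j then p j else point.
have qE (i : 'I_N) : q i = p i by rewrite /q valK.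
pose C i := [set x | dF A x (q i) <= delta].
have mC i : measurable (C i).
  rewrite (_ : C i = ~` [set x | delta < dF A x (q i)]).
    by apply/measurableC/(open_meas X_borel)/d_open_gt; exact: cont_dF.
  by apply/seteqP; split=> x; rewrite /C /= leNgt => /negP.
have cC x : exists2 i, (i < N)%N & C i x.
  apply: contrapT => no.
  have hx (i : 'I_N) : delta < dF A x (p i).
    by rewrite ltNge; apply/negP => h; apply: no; exists i => //; rewrite /C /= qE.
  suff /maxN : `[< separated A delta N.+1 >] by rewrite ltnn.
  apply/asboolP; exists (fun i => if unlift ord0 i is Some j then p j else x) => i j.
  case: unliftP => [i' ->|->]; case: unliftP => [j' ->|->] //.
  - by move=> ij; apply: hp; apply: contra ij => /eqP ->.
  - by move=> _; rewrite dF_sym.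
have [f [hf mf]] := first_label mC cC.
exists N, f, q; split=> //; last by move=> x; exact: (hf x).2.
  apply: ub_le_sup; last by exists N.
  by exists N0%:R => _ [n hn <-]; rewrite ler_nat; exact: hN0.
by move=> x; exact: (hf x).1.
Qed.

Lemma static_label (r : R) : 0 < r -> exists N (f : X -> 'I_N.+1), ofin measurable f /\
  forall x y, f x = f y -> d x y <= 2 * r.
Proof.
move=> r0; have [N [f [p [N0 _ fN mf hf]]]] := names [fset 1%g]%fset r0.
have fK x : val (inord (f x) : 'I_N.+1) = f x by rewrite /= inordK // ltnS ltnW.
exists N, (fun x => inord (f x)); split.
  move=> i; rewrite (_ : [set x | _] = [set x | f x = i]); first exact: mf.
  by apply/seteqP; split=> x /=; [move=> <-; rewrite fK|move=> fx; apply: val_inj; rewrite fK].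
move=> x y /(congr1 val); rewrite !fK => fxy.
have one z : d z (p (f z)) <= r.
  have := le_trans (dF_ge z (p (f z)) (fset11 1%g)) (hf z).
  by rewrite !act_action.1.
apply: le_trans (d_tri d_metric (p (f x)) _ _) _; rewrite mulrDl mul1r; apply: lerD; first exact: one.
by rewrite (d_sym d_metric) fxy; exact: one.
Qed.


End Separated.

(** * Coding by quasi-tilings *)

Section Coding.
Context {R : realType} {G : groupType} {dX : measure_display} {X : measurableType dX}
  (d : X -> X -> R) (act : G -> X -> X) (F : nat -> {fset G}).
Hypothesis d_metric : is_metric d.
Hypothesis X_compact : d_compact d.
Hypothesis X_borel : @measurable _ X = <<s [set A | d_open d A] >>.
Hypothesis act_action : is_action act.
Hypothesis act_cont : forall g, d_continuous d (act g).
Hypothesis F_folner : @folner R G F.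
Hypothesis G_inf : exists e : nat -> G, injective e.
Variable nu : probability X R.
Hypothesis nu_inv : invariant_measure act nu.
Let mact := act_pre X_borel act_cont.
Let cm := charge_pm nu.
Let m_inv := pm_inv nu_inv.

Lemma sum_option (T : finType) (f : option T -> R) : \sum_t f t = f None + \sum_t f (Some t).
Proof.
rewrite (bigD1 None) //=; congr (_ + _).
rewrite (reindex_omap Some id) //=; first by apply: eq_bigl => u; rewrite eqxx.
by case.
Qed.

Lemma ent_subr1 (b : R) : b <= 1 -> ent (1 - b) <= b.
Proof.
move=> b1; have h : 0 <= 1 - b by rewrite subr_ge0.
have yx : 1 = 0 :> R -> 1 - b = 0 by move/eqP; rewrite oner_eq0.
by have := ent_gibbs h ler01 yx; rewrite ln1 mulr0; lra.
Qed.

(** The alphabet bound M is separate from the number of names, so that the labels of all tile shapes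
    share one type. *)
Definition opt_label (M : nat) (B : set X) (f : X -> nat) (x : X) : option 'I_M.+1 :=
  if x \in B then Some (inord (f x)) else None.

Lemma opt_label_ent (N M : nat) (B : set X) (f : X -> nat) : measurable B ->
  (forall i, measurable [set x | f x = i]) -> (forall x, (f x < N)%N) -> (N <= M.+1)%N ->
  ofin measurable (opt_label M B f) /\
  Hent (pm nu) (opt_label M B f) <= ent (pm nu B) + pm nu B * ln N%:R + pm nu B.
Proof.
move=> mB mf fN NM.
have fM x : (f x < M.+1)%N := leq_trans (fN x) NM.
have EN : [set x | opt_label M B f x = None] = ~` B.
  apply/seteqP; split=> x /=; rewrite /opt_label; first by case: ifP => // /negbT/negP + _; rewrite in_setE.
  by move=> nB; rewrite ifF //; apply/negP; rewrite in_setE.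
have ES (i : 'I_M.+1) : [set x | opt_label M B f x = Some i] = B `&` [set x | f x = i].
  apply/seteqP; split=> x /=; rewrite /opt_label.
    by case: ifP => //; rewrite in_setE => Bx [<-]; split=> //; rewrite inordK.
  by move=> [Bx fi]; rewrite ifT ?in_setE // fi inord_val.
have mo : ofin measurable (opt_label M B f).
  by move=> [i|]; rewrite ?EN ?ES; [exact: measurableI|exact: measurableC].
split=> //; rewrite /Hent sum_option EN.
have pB : pm nu (~` B) = 1 - pm nu B.
  by have := ch_split cm (chT cm) mB; rewrite (ch_1 cm) !setTI; lra.
have B1 := ch_le1 cm mB.
rewrite pB addrC; apply: lerD; last exact: ent_subr1.
pose P := [pred i : 'I_M.+1 | (i < N)%N].
have Z (i : 'I_M.+1) : ~~ P i -> pm nu [set x | opt_label M B f x = Some i] = 0.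
  move=> nP; rewrite ES (_ : _ `&` _ = set0) ?(ch0 cm) //.
  by apply/seteqP; split=> x //= [_ fi]; move: nP; rewrite /P /= -fi fN.
have sB : \sum_(i | P i) pm nu [set x | opt_label M B f x = Some i] = pm nu B.
  have := ch_sum1 cm mo; rewrite sum_option EN pB (bigID P) /= [X in _ + (_ + X)]big1; last by move=> i /Z.
  lra.
rewrite (bigID P) /= [X in _ + X]big1 ?addr0; last by move=> i /Z ->; rewrite ent0.
rewrite -sB; apply: sum_ent_le => [i|]; first by apply: (ch_ge0 cm); exact: mo.
rewrite cardE -(size_map val) -[leqRHS](size_iota 0).
apply: uniq_leq_size; first by rewrite map_inj_uniq ?enum_uniq //; exact: val_inj.
by move=> i /mapP[j]; rewrite mem_enum => Pj ->; rewrite mem_iota add0n.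
Qed.

(** The F_n-name under a is read off the E^-1 F_n-name under c, and E^-1 F_n exceeds F_n by a
    negligible number of coordinates. *)
Lemma factor_entropy (T S : finType) (a : X -> T) (c : X -> S) (E : {fset G}) (la lc : R) :
  ofin measurable a -> ofin measurable c ->
  (forall x y, (forall s, s \in E -> c (act s^-1%g x) = c (act s^-1%g y)) -> a x = a y) ->
  #|` F n|%:R^-1 * Hwin act (pm nu) a (F n) @[n --> \oo] --> la ->
  #|` F n|%:R^-1 * Hwin act (pm nu) c (F n) @[n --> \oo] --> lc -> la <= lc.
Proof.
move=> ma mc ac cva cvc; set L : R := ln #|S|%:R.
have L0 : 0 <= L := ln_card_ge0 _.
have mono n : Hwin act (pm nu) a (F n) <= Hwin act (pm nu) c (inv_prod E (F n)).
  apply: (Hent_mono cm); [exact: (ofin_win cm mact)|exact: (ofin_win cm mact)|].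
  move=> x y /win_eqP h; apply/win_eqP => g gF; apply: ac => s sE.
  rewrite -!act_action.2; apply: h; apply/mem_inv_prod; exists s => //; by rewrite mulVKg.
have split_le n : Hwin act (pm nu) c (inv_prod E (F n)) <=
    Hwin act (pm nu) c (F n) + #|` (inv_prod E (F n) `\` F n)%fset|%:R * L.
  set W := inv_prod E (F n); set D := (W `\` F n)%fset.
  have h := Hwin_submod cm mact mc (F n) D.
  have h0 : 0 <= Hwin act (pm nu) c (F n `&` D)%fset by apply: (Hent_ge0 cm); exact: (ofin_win cm mact).
  have h1 : Hwin act (pm nu) c D <= #|` D|%:R * L := Hwin_le_ln cm mact mc D.
  have h2 : Hwin act (pm nu) c W <= Hwin act (pm nu) c (F n `|` D)%fset.
    apply: (Hwin_mono cm mact mc); apply/fsubsetP => g gW; rewrite !inE gW andbT orbN //.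
  lra.
apply/ler_addgt0Pr => e e0; have e1 : 0 < e / (L + 1) by rewrite divr_gt0 // ltr_wpDl.
apply: (ler_cvg_to cva (cvgD cvc (cvg_cst e))).
have := folner_inv_prod F_folner E e1; apply: filterS => n hn.
have Fp := folner_card_gt0 F_folner n.
rewrite /= -(ler_pM2l Fp) mulrDr !mulVKf ?gt_eqF //.
apply: le_trans (mono n) _; apply: le_trans (split_le n) _; rewrite lerD2l.
apply: le_trans (ler_wpM2r L0 hn) _; rewrite mulrAC [leRHS]mulrC ler_wpM2r //.
by rewrite mulrAC ler_pdivrMr ?ltr_wpDl // ler_pM2l // lerDl.
Qed.

(** In a long window only about one coordinate in k carries information. The errors are the entropy
    of the stabilizer pattern, the boundary of the window and the exceptional set; each is at most e
    / 3 per coordinate. *)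
Lemma stab_entropy (T : finType) (f : X -> T) (k : nat) (l : R) : ofin measurable f -> (0 < k)%N ->
  (forall e : R, 0 < e -> exists K : {fset G}, pm nu [set x | (#|stab_in act K x| < k)%N] <= e) ->
  #|` F n|%:R^-1 * Hwin act (pm nu) f (F n) @[n --> \oo] --> l ->
  l <= Hent (pm nu) f / k%:R.
Proof.
move=> mf k0 Zk cvl; set L : R := ln #|T|%:R.
have L0 : 0 <= L := ln_card_ge0 _.
have [l' [cvl' _ lE]] := Hwin_cvg act_action cm mact mf m_inv F_folner.
have {cvl'} -> : l = l' by exact: (cvg_unique (@Rhausdorff R) cvl cvl').
apply/ler_addgt0Pr => e e0.
pose e1 := e / (3 * (L + 1)); have e1p : 0 < e1 by rewrite divr_gt0 // mulr_gt0 // ltr_wpDl.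
have [K hK] := Zk e1 e1p.
have e2p : 0 < e1 / (#|` K|%:R + 1) by rewrite divr_gt0 // ltr_wpDl.
have near1 := near_fset (A := K) (fun u _ => folner_in F_folner u^-1%g e2p).
have near2 := folner_card_infty F_folner G_inf.
have [M hM] : exists M : nat, 3 * ln #|{set K}|%:R / e <= M%:R.
  exists (Num.trunc (3 * ln #|{set K}|%:R / e)).+1; apply: ltW; exact: truncnS_gt.
have [n [h1 h2]] := @filter_ex _ \oo _ _ (filterI near1 (near2 M)).
(* The letter at e is repeated at e u, so the window must be nearly invariant under right
   translation; the inverse of a left Folner set is, and any window bounds the rate. *)
pose E := [fset g^-1%g | g in F n]%fset.
have cE : #|` E| = #|` F n| by rewrite card_imfset //=; exact: invg_inj.
have Fp := folner_card_gt0 F_folner n.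
have E0 : E != fset0%fset by rewrite -cardfs_gt0 cE cardfs_gt0; exact: F_folner.1.
apply: le_trans (lE E E0) _; rewrite cE ler_pdivrMr //.
apply: le_trans (Hwin_stab act_action cm mact m_inv (meas_fix d_metric X_borel act_cont) mf K E k0) _.
rewrite cE -/L.
have bad : #|` [fset e in E | ~~ [forall u : K, (e * val u)%g \in E]]%fset|%:R <= e1 * #|` F n|%:R.
  have le1 : (#|` [fset e in E | ~~ [forall u : K, (e * val u)%g \in E]]%fset| <=
      \sum_(u <- K) #|` [fset h in F n | (u^-1 * h)%g \notin F n]%fset|)%N.
    rewrite (eq_bigr (fun u : G => #|` [fset h^-1%g | h in [fset h in F n | (u^-1 * h)%g \notin F n]%fset]%fset|)); last first.
      by move=> u _; rewrite [RHS]card_imfset //=; exact: invg_inj.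
    apply: leq_trans (leq_card_bigfcup _ _); apply/fsubset_leq_card/fsubsetP => g.
    rewrite !inE /= => /andP[/imfsetP[h /= hF ->] /forallPn[u hu]].
    apply/bigfcupP; exists (val u); first by rewrite andbT; exact: valP.
    apply/imfsetP; exists h => //=; rewrite !inE /= hF /=; apply: contra hu => uhF.
    by apply/imfsetP; exists ((val u)^-1 * h)%g => //=; rewrite invgM invgK.
  apply: le_trans (_ : (\sum_(u <- K) #|` [fset h in F n | (u^-1 * h)%g \notin F n]%fset|)%:R <= _).
    by rewrite ler_nat.
  rewrite natr_sum big_seq.
  apply: le_trans (ler_sum _ (fun u uK => h1 u uK)) _.
  rewrite -big_seq sum_fset_const mulrA ler_wpM2r //.
  by rewrite mulrA ler_pdivrMr ?ltr_wpDl // mulrC ler_pM2l // lerDl.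
have b1 : ln #|{set K}|%:R <= e / 3 * #|` F n|%:R.
  have : 3 * ln #|{set K}|%:R / e <= #|` F n|%:R by apply: le_trans hM _; rewrite ler_nat.
  rewrite ler_pdivrMr // => h; lra.
have b2 : (#|` [fset e in E | ~~ [forall u : K, (e * val u)%g \in E]]%fset|%:R +
   pm nu [set x | (#|stab_in act K x| < k)%N] * #|` F n|%:R) * L <= 2 * (e / 3) * #|` F n|%:R.
  apply: le_trans (_ : 2 * (e1 * #|` F n|%:R) * L <= _).
    rewrite ler_wpM2r //; have := ler_wpM2r (ltW Fp) hK; lra.
  have e1L : e1 * L <= e / 3.
    rewrite /e1 mulrAC ler_pdivrMr ?mulr_gt0 ?ltr_wpDl //.
    have -> : e / 3 * (3 * (L + 1)) = e * (L + 1) by field.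
    by rewrite ler_pM2l // lerDl.
  have -> : 2 * (e1 * #|` F n|%:R) * L = 2 * #|` F n|%:R * (e1 * L) by ring.
  have -> : 2 * (e / 3) * #|` F n|%:R = 2 * #|` F n|%:R * (e / 3) by ring.
  by rewrite ler_pM2l // mulr_gt0.
have -> : (Hent (pm nu) f / k%:R + e) * #|` F n|%:R = #|` F n|%:R / k%:R * Hent (pm nu) f + (e / 3 * #|` F n|%:R + 2 * (e/3) * #|` F n|%:R).
  by field; rewrite pnatr_eq0 -lt0n k0.
apply: le_trans (lerD (lerD b1 (lexx _)) b2) _.
by rewrite le_eqVlt; apply/orP; left; apply/eqP; ring.
Qed.

Lemma ofin_factor (T S : finType) (g : X -> T) (h : X -> S) : ofin measurable g ->
  (forall x y, g x = g y -> h x = h y) -> ofin measurable h.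
Proof.
move=> mg gh t.
rewrite (_ : [set x | h x = t] = [set x | `[< exists2 y, g y = g x & h y = t >]]).
  exact: (ofin_pred cm (fun u => `[< exists2 y, g y = u & h y = t >]) mg).
apply/seteqP; split=> x /=; first by move=> hx; apply/asboolP; exists x.
by move=> /asboolP[y /gh <-].
Qed.

(* The label a records, for x = s y in a tile of shape S_l with centre y, the name of y in a delta-net
   for d_(S_l). It is a function of the translates of the label c that only lives on centres; the
   multiplicity k of the tower is compensated by stab_entropy. *)
Lemma coding_bound (k : nat) (delta T : R) : (0 < k)%N ->
  (forall e : R, 0 < e -> exists K : {fset G}, pm nu [set x | (#|stab_in act K x| < k)%N] <= e) ->
  (forall K : {fset G}, nu [set x | (k < #|stab_in act K x|)%N] = 0%E) ->
  0 < delta -> 0 <= T ->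
  (\forall n \near \oo, ln (sep_num act d (F n) delta) <= T * #|` F n|%:R) ->
  exists (A : finType) (a : X -> A), [/\ ofin measurable a, forall x y, a x = a y -> d x y <= 2 * delta &
    forall l, #|` F n|%:R^-1 * Hwin act (pm nu) a (F n) @[n --> \oo] --> l -> l <= 2 * T + 5].
Proof.
move=> k0 Zk Zk1 d0 T0 [N1 _ hN1].
have kp : (0 : R) < k%:R by rewrite ltr0n.
have nm A := names d_metric X_compact X_borel act_cont A d0.
have [N0 [f0 [p0 [N0p _ f0N mf0 hf0]]]] := nm [fset 1%g]%fset.
have L0 : 0 <= ln N0%:R :> R by rewrite ln_ge0 // ler1n.
(* The uncovered part will have measure at most p, so that a static name on it costs at most p ln N0
   <= 1. Half of p is allotted to 2^-J, the other half to 4 k eta. *)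
pose p : R := (ln N0%:R + 1)^-1; have pp : 0 < p by rewrite invr_gt0 ltr_wpDl.
have [J hJ] : exists J, 2^-1 ^+ J <= p / 2.
  have : `|2^-1 : R| < 1 by rewrite ger0_norm; lra.
  move/cvg_expr/cvgrPdist_le => /(_ (p / 2)) [|J _ h]; first by rewrite divr_gt0.
  exists J; have := h J (leqnn J); rewrite sub0r normrN ger0_norm //.
pose eta := p / (8 * k%:R); have eta0 : 0 < eta by rewrite divr_gt0 // mulr_gt0.
have [N2 _ hN2] := folner_card_infty F_folner G_inf J.
have [n [nN nS]] := shapes F_folner (maxn N1 N2) J eta0.
pose S l := F (n l).
have S0 l : S l != fset0%fset := F_folner.1 _.
have SJ l : (J <= #|` S l|)%N by apply: hN2 => /=; exact: leq_trans (leq_maxr _ _) (nN l).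
have ST l : ln (sep_num act d (S l) delta) <= T * #|` S l|%:R.
  by apply: hN1 => /=; exact: leq_trans (leq_maxl _ _) (nN l).
have [B [mB sB cB]] := tower d_metric X_compact X_borel act_action act_cont nu_inv S0
  (fun i => Zk1 (inv_prod (S i) (S i))) (ltW eta0) nS.
set U := [set x | _] in cB.
have mU : measurable U.
  rewrite (_ : U = \big[setU/set0]_(l < J) sweep act (S l) (B l)).
    by apply: bigsetU_measurable => l _; exact: (meas_sweep X_borel act_cont).
  rewrite -(bigcup_mkord J (fun l => sweep act (S l) (B l))).
  by apply/seteqP; split=> x [l lJ h]; exists l.
have mUC : measurable (~` U) by exact: measurableC.
have /choice[Nf hNf] : forall l : nat, exists Nf : nat * (X -> nat) * (nat -> X),
  [/\ (0 < Nf.1.1)%N, Nf.1.1%:R <= sep_num act d (S l) delta, forall x, (Nf.1.2 x < Nf.1.1)%N,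
    forall i, measurable [set x | Nf.1.2 x = i] & forall x, dF act d (S l) x (Nf.2 (Nf.1.2 x)) <= delta].
  by move=> l; have [N [f [q h]]] := nm (S l); exists (N, f, q).
pose N l := (Nf l).1.1; pose f l := (Nf l).1.2; pose q l := (Nf l).2.
pose M := (\sum_(l < J) N l)%N.
have NM (l : 'I_J) : (N l <= M.+1)%N by rewrite leqW // /M (bigD1 l) //= leq_addr.
have hf (l : 'I_J) x : (f l x < M.+1)%N by have [_ _ h _ _] := hNf l; exact: leq_trans (h x) (NM l).
have hd l x : dF act d (S l) x (q l (f l x)) <= delta by have [_ _ _ _ h] := hNf l; exact: h.
have C l : ofin measurable (opt_label M (B l) (f l)) /\ ((l < J)%N ->
   Hent (pm nu) (opt_label M (B l) (f l)) <= (T + 1) * (#|` S l|%:R * pm nu (B l)) + J.+1%:R^-1).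
  have [_ _ fN mf _] := hNf l.
  have [lJ|lJ] := ltnP l J; last first.
    split=> // -[i|].
      rewrite (_ : [set x | _] = B l `&` \bigcup_(j in [set j | inord j = i]) [set x | f l x = j]).
        by apply: measurableI => //; apply: bigcup_measurable => j _; exact: mf.
      apply/seteqP; split=> x; rewrite /opt_label /=.
        by case: ifP => //; rewrite in_setE => Bx [<-]; split=> //; exists (f l x).
      by move=> [Bx [j ji fj]]; rewrite ifT ?in_setE // fj ji.
    rewrite (_ : [set x | _] = ~` B l); first exact: measurableC.
    apply/seteqP; split=> x; rewrite /opt_label /=.
      by case: ifP => // /negbT/negP + _; rewrite in_setE.
    by move=> nB; rewrite ifF //; apply/negP; rewrite in_setE.
  have [mo ho] := opt_label_ent (mB l) mf fN (NM (Ordinal lJ)).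
  split=> // _; apply: le_trans ho _.
  have [Np Ns _ _ _] := hNf l.
  set b := pm nu (B l); set s : R := #|` S l|%:R.
  have b0 : 0 <= b by exact: (ch_ge0 cm).
  have lnN : ln (N l)%:R <= T * s.
    apply: le_trans (ST l); rewrite ler_ln ?posrE ?ltr0n //.
    by apply: lt_le_trans Ns; rewrite ltr0n.
  (* Marking the centres of shape l costs ent b, which is compared with exp(-|S_l|): the result is
     |S_l| b plus an error at most 1/(J+1), since |S_l| >= J, and these errors sum to at most 1 over
     the J shapes. *)
  have es : expR (- s) <= J.+1%:R^-1.
    rewrite expRN lef_pV2 ?posrE ?expR_gt0 //.
    apply: le_trans (expR_ge1Dx s); rewrite -natr1 addrC lerD2l ler_nat; exact: SJ.
  have g : ent b <= b * s + (expR (- s) - b).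
    have yx : expR (- s) = 0 -> b = 0 by move=> e0; have := expR_gt0 (- s); rewrite e0 ltxx.
    by have := ent_gibbs b0 (expR_ge0 (- s)) yx; rewrite expRK mulrN opprK.
  have : b * ln (N l)%:R <= b * (T * s) by rewrite ler_wpM2l.
  rewrite -/(N l) => h; apply: le_trans (lerD (lerD g h) (lexx b)) _.
  have -> : b * s + (expR (- s) - b) + b * (T * s) + b = (T + 1) * (s * b) + expR (- s) by ring.
  by rewrite lerD2l.
have [ms hs] := opt_label_ent mUC mf0 f0N (leqnSn N0).
pose c1 x : {ffun 'I_J -> option 'I_M.+1} := [ffun l : 'I_J => opt_label M (B l) (f l) x].
pose c x := (c1 x, opt_label N0 (~` U) f0 x).
have [mc1 hc1] := Hent_ffun_le (f := fun l : 'I_J => opt_label M (B l) (f l)) cm (fun l => (C l).1).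
have mc : ofin measurable c := ofin_pair cm mc1 ms.
(* The tiles have total mass at most 2 k, so the centres and their names cost 2 k (T + 1) + 1; the
   uncovered part adds 2. *)
have Hc : Hent (pm nu) c <= 2 * k%:R * (T + 1) + 3.
  apply: le_trans (Hent_le_pair cm mc1 ms) _.
  have h1 : Hent (pm nu) c1 <= 2 * k%:R * (T + 1) + 1.
    apply: le_trans hc1 _; apply: le_trans (ler_sum _ (fun (l : 'I_J) _ => (C l).2 (ltn_ord l))) _.
    rewrite big_split /= -mulr_sumr sumr_const card_ord; apply: lerD.
      by rewrite [leRHS]mulrC ler_wpM2l ?addr_ge0.
    by rewrite -[leLHS]mulr_natl ler_pdivrMr // mul1r ler_nat.
  have h2 : Hent (pm nu) (opt_label N0 (~` U) f0) <= 2.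
    apply: le_trans hs _; set u := pm nu (~` U).
    have u0 : 0 <= u by exact: (ch_ge0 cm).
    have yx : 1 = 0 :> R -> u = 0 by move/eqP; rewrite oner_eq0.
    have := ent_gibbs u0 ler01 yx; rewrite ln1 mulr0 oppr0 add0r => g.
    have up : u <= p.
      apply: le_trans cB _; rewrite /eta.
      have -> : 4 * k%:R * (p / (8 * k%:R)) = p / 2 by field; rewrite pnatr_eq0 -lt0n k0.
      lra.
    have : u * ln N0%:R <= 1.
      apply: le_trans (_ : p * (ln N0%:R + 1) <= _).
        by apply: ler_pM => //; rewrite lerDl.
      by rewrite /p mulVf // gt_eqF // ltr_wpDl.
    lra.
  lra.
pose W := (\bigcup_(l <- iota 0 J) S l)%fset.
have SW (l : 'I_J) s : s \in S l -> s \in W.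
  by move=> sS; apply/bigfcupP; exists (l : nat) => //; rewrite mem_iota add0n ltn_ord.
pose Q x (z : 'I_J * W) := (val z.2 \in S z.1) && `[< B z.1 (act (val z.2)^-1%g x) >].
(* A point may lie in several tiles. [pick] depends only on which tiles contain x, so the choice is
   itself read off the label c. *)
pose a x : ('I_J * W) * 'I_M.+1 + 'I_N0.+1 :=
  if [pick z | Q x z] is Some z then inl (z, inord (f z.1 (act (val z.2)^-1%g x)))
  else inr (inord (f0 x)).
have QU x z : Q x z -> U x.
  by case: z => l s /andP[/= sS /asboolP Bs]; exists l => //; exists (val s).
have UQ x : U x -> exists z, Q x z.
  move=> [l lJ [s sS Bs]]; have sW := SW (Ordinal lJ) s sS.
  by exists (Ordinal lJ, [` sW]%fset); rewrite /Q /= sS; apply/asboolP.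
pose E := (1%g |` W)%fset.
have ac x y : (forall s, s \in E -> c (act s^-1%g x) = c (act s^-1%g y)) -> a x = a y.
  move=> h.
  have hB (l : 'I_J) s : s \in E -> opt_label M (B l) (f l) (act s^-1%g x) = opt_label M (B l) (f l) (act s^-1%g y).
    by move=> sE; have [/ffunP/(_ l) + _] := h s sE; rewrite !ffunE.
  have QQ : Q x =1 Q y.
    move=> [l s]; rewrite /Q /=; congr (_ && _).
    have sE : val s \in E by rewrite !inE (valP s) orbT.
    have := hB l _ sE; rewrite /opt_label; case: ifP; case: ifP => //.
      by rewrite !in_setE => h1 h2 _; do 2 (case: asboolP => //).
    move=> /negbT/negP + /negbT/negP + _; rewrite !in_setE => h1 h2.
    by do 2 (case: asboolP => //).
  rewrite /a -(eq_pick QQ); case: pickP => [z Qz|nQ].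
    congr (inl (_, _)); case: z Qz => l s Qz.
    have sE : val s \in E by rewrite !inE (valP s) orbT.
    have Qz' : Q y (l, s) by rewrite -QQ.
    move: Qz Qz' => /andP[/= _ /asboolP b1] /andP[/= _ /asboolP b2].
    by have := hB l _ sE; rewrite /opt_label !ifT ?in_setE // => -[].
  congr inr.
  have E1 : 1%g \in E by rewrite !inE eqxx.
  have nU z : Q z =1 xpred0 -> (~` U) z by move=> nQz /UQ[w]; rewrite nQz.
  have nUx := nU x nQ.
  have nUy : (~` U) y by apply: nU => z; rewrite -QQ.
  by have [_] := h _ E1; rewrite invg1 !act_action.1 /opt_label !ifT ?in_setE // => -[].
have ma : ofin measurable a.
  apply: (ofin_factor (g := win act c [fset s^-1%g | s in E]%fset)); first exact: (ofin_win cm mact).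
  move=> x y /win_eqP h; apply: ac => s sE; apply: h; apply/imfsetP; by exists s.
have [lc [cvc _ lcE]] := Hwin_cvg act_action cm mact mc m_inv F_folner.
exists (('I_J * W) * 'I_M.+1 + 'I_N0.+1)%type, a; split=> //.
- move=> x y; rewrite /a; case: pickP => [[l s] Qx|nx]; case: pickP => [z Qy|ny] //.
    move=> [ez ef]; rewrite -{z}ez in Qy ef *; move: Qx Qy => /andP[/= sS _] _.
    have {}ef : f l (act (val s)^-1%g x) = f l (act (val s)^-1%g y).
      by move/(congr1 val): ef; rewrite /= !inordK.
    have hx := hd l (act (val s)^-1%g x); have hy := hd l (act (val s)^-1%g y).
    have := le_trans (dF_ge d act _ _ sS) hx; have := le_trans (dF_ge d act _ _ sS) hy.
    rewrite !(act_VK act_action) ef => dy dx.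
    apply: le_trans (d_tri d_metric _ _ _) _; last rewrite mulrDl mul1r; apply: lerD dx _.
    by rewrite (d_sym d_metric).
  move=> [ef]; have {}ef : f0 x = f0 y.
    by move/(congr1 val): ef; rewrite /= !inordK // ltnS ltnW.
  have one z : d z (p0 (f0 z)) <= delta.
    have := le_trans (dF_ge d act z (p0 (f0 z)) (fset11 1%g)) (hf0 z).
    by rewrite !act_action.1.
  apply: le_trans (d_tri d_metric (p0 (f0 x)) _ _) _; rewrite mulrDl mul1r; apply: lerD; first exact: one.
  by rewrite (d_sym d_metric) ef; exact: one.
- move=> l cva; apply: le_trans (factor_entropy ma mc ac cva cvc) _.
  apply: le_trans (stab_entropy mc k0 Zk cvc) _; rewrite ler_pdivrMr //.
  apply: le_trans Hc _; have -> : (2 * T + 5) * k%:R = 2 * k%:R * (T + 1) + 3 * k%:R by ring.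
  by rewrite lerD2l -[leLHS]mulr1 ler_wpM2l // ler1n.
Qed.

End Coding.

(** * The upper bound for an ergodic measure *)

Section UpperBound.
Context {R : realType} {G : groupType} {dX : measure_display} {X : measurableType dX}
  (d : X -> X -> R) (act : G -> X -> X) (F : nat -> {fset G}).
Hypothesis d_metric : is_metric d.
Hypothesis X_compact : d_compact d.
Hypothesis X_borel : @measurable _ X = <<s [set A | d_open d A] >>.
Hypothesis act_action : is_action act.
Hypothesis act_cont : forall g, d_continuous d (act g).
Hypothesis F_folner : @folner R G F.
Hypothesis G_count : exists e : nat -> G, bijective e.
Variable nu : probability X R.
Hypothesis nu_erg : ergodic_measure act nu.
Let mact := act_pre X_borel act_cont.
Let cm := charge_pm nu.
Let nu_inv := nu_erg.1.

Lemma G_injective : exists e : nat -> G, injective e.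
Proof. by have [e be] := G_count; exists e; exact: bij_inj. Qed.

Let mst (K : {fset G}) : ofin measurable (stab_in act K).
Proof. exact: (ofin_stab cm (meas_fix d_metric X_borel act_cont)). Qed.

(** Having at least k stabilizer elements is an invariant property, because stabilizers along an
    orbit are conjugate; ergodicity decides it. When it holds almost everywhere, exhausting G by
    finite sets makes the exceptional set small. *)
Lemma stab_dichotomy (k : nat) :
  (forall K : {fset G}, nu [set x | (k <= #|stab_in act K x|)%N] = 0%E) \/
  (forall e : R, 0 < e -> exists K : {fset G}, pm nu [set x | (#|stab_in act K x| < k)%N] <= e).
Proof.
have [e [e' eK e'K]] := G_count.
pose K n := [fset e (val i) | i in 'I_n]%fset.
have memK n g : (g \in K n) = (e' g < n)%N.
  apply/imfsetP/idP => [[i _ ->]|h]; first by rewrite /= eK ltn_ord.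
  by exists (Ordinal h) => //=; rewrite e'K.
pose Z := [set x | exists2 A : {fset G}, (k <= #|` A|)%N & forall u, u \in A -> act u x = x].
have mge (L : {fset G}) : measurable [set x | (k <= #|stab_in act L x|)%N].
  exact: (ofin_pred cm (fun c : {set L} => k <= #|c|)%N (@mst L)).
have mlt (L : {fset G}) : measurable [set x | (#|stab_in act L x| < k)%N].
  exact: (ofin_pred cm (fun c : {set L} => #|c| < k)%N (@mst L)).
have LZ (L : {fset G}) : [set x | (k <= #|stab_in act L x|)%N] `<=` Z.
  move=> x /= h; exists [fset val u | u in stab_in act L x]%fset.
    by rewrite card_imfset /=; [rewrite -cardE|exact: val_inj].
  by move=> _ /imfsetP[u /= us ->]; move: us; rewrite inE => /asboolP.
have fK (A L : {fset G}) x : (A `<=` L)%fset -> (forall u, u \in A -> act u x = x) -> (#|` A| <= #|stab_in act L x|)%N.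
  move=> AL h; rewrite cardfE -(card_imset _ (f := fun e : A => (Sub (val e) (fsubsetP AL _ (valP e)) : L))).
    by apply/subset_leq_card/fintype.subsetP => u /imsetP[g _ ->]; rewrite inE /=; apply/asboolP/h/valP.
  by move=> g h' /(congr1 val) /= /val_inj.
have ZE : Z = \bigcup_n [set x | (k <= #|stab_in act (K n) x|)%N].
  apply/seteqP; split=> x; last by move=> [n _ /LZ].
  move=> [A kA hA]; exists (\sum_(g <- A) (e' g).+1)%N => //=; apply: leq_trans kA (fK _ _ _ _ hA).
  apply/fsubsetP => g gA; rewrite memK (big_fsetD1 g) //=; exact: leq_addr.
have mZ : measurable Z by rewrite ZE; exact: bigcup_measurable.
have Zi g : act g @^-1` Z = Z.
  have h x u : Z x -> Z (act u x).
    move=> [A kA hA]; exists [fset (u * v * u^-1)%g | v in A]%fset.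
      by rewrite card_imfset //= => v w /mulIg/mulgI.
    by move=> _ /imfsetP[v /= vA ->]; rewrite !act_action.2 (act_KV act_action) hA.
  apply/seteqP; split=> x /=; last exact: h.
  by move=> /(h _ g^-1%g); rewrite (act_KV act_action).
have [Z0|Z1] := nu_erg.2 Z mZ Zi.
  left=> L; apply/eqP; rewrite eq_le measure_ge0 andbT -Z0.
  by apply: le_measure; [exact: (mem_set (mge L))|exact: (mem_set mZ)|exact: LZ].
right=> t t0; apply: contrapT => no.
have no' n : pm nu [set x | (k <= #|stab_in act (K n) x|)%N] <= 1 - t.
  have [|h] := leP (pm nu [set x | (#|stab_in act (K n) x| < k)%N]) t; first by move=> h; case: no; exists (K n).
  have := ch_split cm (chT cm) (mlt (K n)); rewrite (ch_1 cm) !setTI.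
  rewrite (_ : ~` _ = [set x | (k <= #|stab_in act (K n) x|)%N]); first lra.
  apply/seteqP; split=> x /=; first by move=> /negP; rewrite -leqNgt.
  by move=> h'; apply/negP; rewrite -leqNgt.
have := pm_bigcup_le (fun n => mge (K n)) _ no'; rewrite -ZE.
have -> : pm nu Z = 1 by rewrite /pm Z1.
move=> h; suff : 1 <= 1 - t by lra.
apply: h => n x /= kx; apply: leq_trans kx _.
rewrite -(card_imset _ (f := fun u : K n => (insubd u (val u) : K n))) //; last by move=> u v; rewrite !valKd.
have sub : (K n `<=` K n.+1)%fset by apply/fsubsetP => g; rewrite !memK => /ltnW.
rewrite card_imset; last by move=> u v; rewrite !valKd.
rewrite -(card_imset _ (f := fun u : K n => (Sub (val u) (fsubsetP sub _ (valP u)) : K n.+1))); last first.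
  by move=> u v /(congr1 val) /= /val_inj.
by apply/subset_leq_card/fintype.subsetP => u /imsetP[g gs ->]; move: gs; rewrite !inE.
Qed.

Lemma upper_bound (delta T : R) : 0 < delta -> 0 <= T ->
  (\forall n \near \oo, ln (sep_num act d (F n) delta) <= T * #|` F n|%:R) ->
  h_eps act d F nu (2 * delta) <= 2 * T + 5.
Proof.
move=> d0 T0 hT.
suff [A [a [ma da la]]] : exists (A : finType) (a : X -> A), [/\ ofin measurable a, forall x y, a x = a y -> d x y <= 2 * delta &
    forall l, #|` F n|%:R^-1 * Hwin act (pm nu) a (F n) @[n --> \oo] --> l -> l <= 2 * T + 5].
  have [k [alpha [pa dal cv]]] := label_entropy d mact act_action F_folner nu_inv ma.
  apply: le_trans (la _ cv); apply: ge_inf; last by exists k, alpha; split=> //; exact: dal.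
  exists 0 => _ [k' [beta [pb _ ->]]].
  by have [? []] := partition_entropy mact act_action F_folner nu_inv pb.
pose P k := `[< forall K : {fset G}, nu [set x | (k < #|stab_in act K x|)%N] = 0%E >].
(* The least k such that almost all stabilizers have at most k elements is their common order; it is
   positive because the identity fixes every point. *)
have [[k0 hk0]|nP] := pselect (exists k, P k).
  have ex : exists k, P k by exists k0.
  case: (ex_minnP ex) => k /asboolP Pk mk.
  have kpos : (0 < k)%N.
    rewrite lt0n; apply/eqP => k00; rewrite k00 in Pk.
    have := Pk [fset 1%g]%fset; rewrite (_ : [set x | _] = setT).
      by rewrite probability_setT => /eqP; rewrite onee_eq0.
    apply/seteqP; split=> // x _ /=; apply/card_gt0P; exists [` fset11 1%g]%fset.
    by rewrite inE; apply/asboolP; rewrite /= act_action.1.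
  apply: (coding_bound d_metric X_compact X_borel act_action act_cont F_folner G_injective nu_inv kpos) => //.
  have [h|//] := stab_dichotomy k; suff : P k.-1 by move/mk; rewrite leqNgt prednK // leqnn.
  by apply/asboolP => K; rewrite prednK.
have Zk k : forall e : R, 0 < e -> exists K : {fset G}, pm nu [set x | (#|stab_in act K x| < k)%N] <= e.
  have [h|//] := stab_dichotomy k.
  case: nP; exists k; apply/asboolP => K; apply/eqP; rewrite eq_le measure_ge0 andbT -(h K).
  apply: le_measure; last by move=> x; exact: ltnW.
  - exact: mem_set (ofin_pred cm (fun c : {set K} => k < #|c|)%N (@mst K)).
  - exact: mem_set (ofin_pred cm (fun c : {set K} => k <= #|c|)%N (@mst K)).
(* Almost all stabilizers are infinite: a static label has rate at most H / k for every k, and k > H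
   already makes this at most 1. *)
have [N0 [f0 [ma df]]] := static_label d_metric X_compact X_borel act_action act_cont d0.
exists 'I_N0.+1, f0; split=> //.
- move=> l cv; set H := Hent (pm nu) f0.
  have hM : H < (Num.trunc H).+1%:R := truncnS_gt H.
  have := stab_entropy d_metric X_borel act_action act_cont F_folner G_injective nu_inv ma (ltn0Sn _) (Zk (Num.trunc H).+1) cv.
  move=> /le_trans; apply; rewrite ler_pdivrMr // -/H.
  apply: le_trans (ltW hM) _; rewrite ler_peMl //; lra.
Qed.

End UpperBound.

(** * Ergodic measures of large entropy *)

Lemma prod_close {R : realType} (I : Type) (s : seq I) (u v : I -> R) :
  (forall i, 0 <= u i <= 1) -> (forall i, 0 <= v i <= 1) ->
  0 <= \prod_(i <- s) u i <= 1 /\ `|\prod_(i <- s) u i - \prod_(i <- s) v i| <= \sum_(i <- s) `|u i - v i|.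
Proof.
move=> u01 v01; elim: s => [|i s [/andP[IH0 IH1] IH]].
  by rewrite !big_nil subrr normr0 lexx ler01 lexx.
rewrite !big_cons; have /andP[u0 u1] := u01 i; have /andP[v0 v1] := v01 i.
split; first by rewrite mulr_ge0 //= mulr_ile1.
set U := \prod_(i <- s) u i in IH0 IH1 IH *; set V := \prod_(i <- s) v i in IH *.
rewrite (_ : u i * U - v i * V = (u i - v i) * U + v i * (U - V)); last by ring.
apply: le_trans (ler_normD _ _) _; rewrite !normrM (ger0_norm IH0) (ger0_norm v0); apply: lerD.
  by rewrite ler_piMr.
by apply: le_trans IH; rewrite ler_piMl.
Qed.

Section Robust.
Context {R : realType} {G : groupType} {dX : measure_display} {X : measurableType dX}
  (d : X -> X -> R) (act : G -> X -> X).
Hypothesis d_metric : is_metric d.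
Hypothesis X_compact : d_compact d.
Hypothesis X_borel : @measurable _ X = <<s [set A | d_open d A] >>.
Hypothesis act_action : is_action act.
Hypothesis act_cont : forall g, d_continuous d (act g).
Local Notation cont := (@d_continuous_real R X d).
Let mact := act_pre X_borel act_cont.
Let dm := d_metric.
Let cbm := cont_bm d_metric X_compact X_borel.

Variable nu : probability X R.
Let cm := charge_pm nu.

(** An L1-approximation of the indicator is multiplied by a cutoff that is 1 within eps of a point c
    of B and 0 from distance 2 eps on. B lies in the eps-ball of c, so the error does not grow,
    while the cozero set gets diameter at most 4 eps. *)
Lemma local_approx (B : set X) (eps k : R) : measurable B -> 0 < eps -> 0 < k ->
  (forall x y, B x -> B y -> d x y <= eps) ->
  exists f, [/\ cont f, forall x, 0 <= f x <= 1, Ex nu (fun x => `|\1_B x - f x|) <= k &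
    forall x y, 0 < f x -> 0 < f y -> d x y <= 4 * eps].
Proof.
move=> mB e0 k0 dB; have [[c Bc]|nB] := pselect (exists c, B c); last first.
  exists (fun=> 0); split; [exact: cont_cst|by move=> x; rewrite lexx ler01| |by move=> x y; rewrite ltxx].
  rewrite (_ : (fun x => _) = fun=> 0) ?Ex_cst ?ltW //.
  by apply/funext => x; rewrite ind0 ?subrr ?normr0 // => Bx; apply: nB; exists x.
have [f [cf f01 fk]] := L1_dense d_metric X_compact X_borel nu mB k0.
pose g x : R := Num.max 0 (Num.min 1 (2 - eps^-1 * d x c)).
have g01 x : 0 <= g x <= 1 by rewrite /g le_max lexx /= ge_max ler01 ge_min lexx.
have cg : cont g.
  apply: cont_max; [exact: dm|exact: cont_cst|apply: cont_min; [exact: dm|exact: cont_cst|]].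
  by apply: (contB dm); [exact: cont_cst|apply: (contM dm); [exact: cont_cst|exact: cont_d]].
have fg01 x : 0 <= f x * g x <= 1.
  by have /andP[? ?] := f01 x; have /andP[? ?] := g01 x; rewrite mulr_ge0 //= mulr_ile1.
have bB := bm_indic mB (R := R).
exists (fun x => f x * g x); split=> //; first exact: (contM dm).
- apply: le_trans fk; apply: Ex_le.
  + by apply/bm_norm/bmB => //; apply: bmM; exact: cbm.
  + by apply/bm_norm/bmB => //; exact: cbm.
  + move=> x; have [Bx|nBx] := pselect (B x).
      rewrite (_ : g x = 1) ?mulr1 // /g.
      have h : eps^-1 * d x c <= 1 by rewrite ler_pdivrMl // mulr1; exact: dB.
      by rewrite min_l ?max_r //; lra.
    rewrite (ind0 nBx) !sub0r !normrN; have /andP[f0 f1] := f01 x; have /andP[g0 g1] := g01 x.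
    by rewrite !ger0_norm ?mulr_ge0 // ler_piMr.
- have key x : 0 < f x * g x -> d x c <= 2 * eps.
    move=> h; have gx : 0 < g x.
      have /andP[g0 _] := g01 x; rewrite lt_def g0 andbT; apply/eqP => gx; move: h; by rewrite gx mulr0 ltxx.
    move: gx; rewrite /g lt_max ltxx /= lt_min => /andP[_]; rewrite subr_gt0 mulrC.
    by rewrite ltr_pdivrMr // => /ltW.
  move=> x y /key hx /key hy; apply: le_trans (d_tri dm c _ _) _.
  rewrite (d_sym dm c); lra.
Qed.

Hypothesis nu_inv : invariant_measure act nu.

(* The atoms of a are replaced by disjoint cozero sets {psi_i > 0}, so the law of the coarser label b is
   controlled from below by finitely many integrals of continuous functions; a law close from below
   to a given one has nearly smaller entropy. *)
Lemma robust (A : finType) (a : X -> A) (eps : R) (E : {fset G}) : ofin measurable a -> 0 < eps ->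
  (forall x y, a x = a y -> d x y <= eps) ->
  exists (S : finType) (b : X -> S) (l : {ffun E -> S} -> X -> R) (eta : R),
  [/\ ofin measurable b /\ (forall x y, b x = b y -> d x y <= 4 * eps), forall c, cont (l c),
    forall c x, 0 <= l c x <= (win act b E x == c)%:R, 0 < eta &
    forall q : {ffun E -> S} -> R, (forall c, 0 <= q c) -> \sum_c q c = 1 ->
      (forall c, Ex nu (l c) - eta <= q c) -> \sum_c ent (q c) <= Hwin act (pm nu) a E + 1].
Proof.
move=> ma e0 da; have [N [st [mst dst]]] := static_label d_metric X_compact X_borel act_action act_cont (mulr_gt0 (ltr0n R 2) e0).
(* Points outside all the cozero sets will receive a static label, also of diameter 4 eps; a' is a
   read in this larger alphabet. *)
pose S := (A + 'I_N.+1)%type; pose a' x : S := inl (a x).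
have ma' : ofin measurable a' by apply: (ofin_factor nu ma) => x y; rewrite /a' => ->.
have mw := ofin_win cm mact (A := E) ma'.
pose p c := pm nu [set x | win act a' E x = c].
have p0 c : 0 <= p c by exact: (ch_ge0 cm (mw c)).
have p1 : \sum_c p c = 1 := ch_sum1 cm mw.
have [e ep he] := sum_ent_usc p0 p1.
have HE : \sum_c ent (p c) = Hwin act (pm nu) a E.
  apply: (Hent_eq cm (ofin_win cm mact ma) mw) => x y.
  by split=> /win_eqP h; apply/win_eqP => g gE; have := h g gE; rewrite /a'; [move=> ->|case].
(* Chosen so that |E| coordinates, each with error at most 2 |A| k, contribute at most e / 2. *)
pose k := e / (2 * (#|A|%:R * 2 * #|` E|%:R + 1)).
have kpos : 0 < k by rewrite divr_gt0 // mulr_gt0 // ltr_wpDl // !mulr_ge0.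
have /choice[f hf] : forall i : A, exists f, [/\ cont f, forall x, 0 <= f x <= 1,
     Ex nu (fun x => `|\1_[set x | a x = i] x - f x|) <= k &
     forall x y, 0 < f x -> 0 < f y -> d x y <= 4 * eps].
  move=> i; apply: (local_approx (ma i) e0 kpos).
  by move=> x y /= ax ay; apply: da; rewrite ax ay.
have cf i : cont (f i) by case: (hf i).
have f01 i x : 0 <= f i x <= 1 by case: (hf i) => _ h _ _.
(* Positivity of psi i forces f i above every other f j, so the cozero sets are disjoint. Where the
   f j are close to the indicators, psi i is close to 1/2 on the atom i, whence the factor 2 in
   [chi]. *)
pose psi i x : R := Num.max 0 (f i x - \sum_(j | j != i) f j x - 2^-1).
have cpsi i : cont (psi i).
  apply: cont_max; [exact: dm|exact: cont_cst|apply: (contB dm); last exact: cont_cst].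
  by apply: (contB dm) => //; exact: cont_sum.
have sumf0 i x : 0 <= \sum_(j | j != i) f j x by apply: sumr_ge0 => j _; have /andP[] := f01 j x.
have psi0 i x : 0 <= psi i x by rewrite /psi le_max lexx.
have psile i x : psi i x <= 2^-1.
  by rewrite /psi ge_max; have := sumf0 i x; have /andP[] := f01 i x => *; apply/andP; split; lra.
have psif i x : 0 < psi i x -> \sum_(j | j != i) f j x + 2^-1 < f i x.
  by rewrite /psi lt_max ltxx /=; lra.
have psiu i j x : 0 < psi i x -> 0 < psi j x -> i = j.
  move=> /psif hi /psif hj; apply/eqP/negPn/negP => ij.
  have le1 (u v : A) : v != u -> f v x <= \sum_(m | m != u) f m x.
    by move=> vu; rewrite (bigD1 v) //= lerDl; apply: sumr_ge0 => m _; have /andP[] := f01 m x.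
  have := le1 j i ij; have := le1 i j; rewrite eq_sym ij => /(_ isT); lra.
pose b x : S := if [pick i | 0 < psi i x] is Some i then inl i else inr (st x).
have bE i x : 0 < psi i x -> b x = inl i.
  by move=> h; rewrite /b; case: pickP => [j hj|/(_ i)]; [rewrite (psiu _ _ _ hj h)|rewrite h].
have mb : ofin measurable b.
  have mpos (i : A) : ofin measurable (fun x => 0 < psi i x).
    have ho : measurable [set x | 0 < psi i x] by apply/(open_meas X_borel)/d_open_gt.
    case; first exact: ho.
    rewrite (_ : [set x | _] = ~` [set x | 0 < psi i x]); first exact: measurableC.
    by apply/seteqP; split=> x /=; [move=> ->|move=> /negP/negbTE].
  apply: (ofin_factor nu (ofin_pair cm (Hent_ffun_le cm mpos).1 mst)) => x y [/ffunP h1 h2].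
  rewrite /b h2 (eq_pick (Q := fun i => 0 < psi i y)) // => i.
  by have := h1 i; rewrite !ffunE.
pose chi (s : S) x : R := if s is inl i then 2 * psi i x else 0.
have cchi s : cont (chi s).
  by case: s => [i|t]; [apply: (contM dm) => //; exact: cont_cst|exact: cont_cst].
have chi01 s x : 0 <= chi s x <= 1.
  case: s => [i|t] /=; last by rewrite lexx ler01.
  by have := psi0 i x; have := psile i x => *; apply/andP; split; lra.
have chib s x : b x != s -> chi s x = 0.
  case: s => [i|t] //= bx; have := psi0 i x; rewrite le_eqVlt => /orP[/eqP <-|/bE h].
    by rewrite mulr0.
  by rewrite h eqxx in bx.
pose l (c : {ffun E -> S}) x := \prod_(g : E) chi (c g) (act (val g) x).
pose Df x := 2 * \sum_(j : A) `|\1_[set x | a x = j] x - f j x|.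
have chiD s x : `|\1_[set x | a' x = s] x - chi s x| <= Df x.
  have D0 (P : pred A) : 0 <= \sum_(j | P j) `|\1_[set x | a x = j] x - f j x| by apply: sumr_ge0.
  case: s => [i|t]; last first.
    by rewrite ind0 // subrr normr0 /Df mulr_ge0 // D0.
  rewrite /Df (bigD1 i) //=; have := D0 (fun j => j != i); set Sg := \sum_(j | j != i) `| _ |.
  move=> Sg0; have /andP[f0 f1] := f01 i x; have [axi|axi] := eqVneq (a x) i.
    rewrite !ind1 //= /a' ?axi // distrC.
    have SE : Sg = \sum_(j | j != i) f j x.
      apply: eq_bigr => j ji; rewrite ind0; last by move=> /= axj; move: ji; rewrite -axj axi eqxx.
      by rewrite sub0r normrN ger0_norm //; have /andP[] := f01 j x.
    have -> : `|1 - f i x| = 1 - f i x by rewrite ger0_norm // subr_ge0.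
    have := psile i x; have := psi0 i x => h1 h2.
    rewrite ler0_norm; last lra.
    have : f i x - Sg - 2^-1 <= psi i x by rewrite /psi SE le_max lexx orbT.
    lra.
  rewrite !ind0 //=; [|by apply/eqP|by rewrite /a' => -[] /eqP; rewrite (negbTE axi)].
  rewrite !sub0r !normrN !ger0_norm ?mulr_ge0 // ler_pM2l //.
  rewrite /psi ge_max addr_ge0 //=; have := sumf0 i x; lra.
have bD j : bm (fun x => `|\1_[set x | a x = j] x - f j x|).
  by apply/bm_norm/bmB; [exact/bm_indic/ma|exact: cbm].
have bDf : bm Df by apply/bmZ/bm_sum => j; exact: bD.
have ExD : Ex nu Df <= #|A|%:R * 2 * k.
  rewrite /Df ExZ; last by apply: bm_sum => j; exact: bD.
  rewrite (Ex_sum nu _ _ bD) mulrAC [leRHS]mulrC ler_pM2l //.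
  rewrite mulr_natl -sumr_const; apply: ler_sum => j _; by case: (hf j).
have cl c : cont (l c) by apply: (cont_prod dm) => g; exact: (cont_act act_cont).
have l01 c x : 0 <= l c x <= 1.
  exact: (@prod_close _ _ _ _ (fun g => chi (c g) (act (val g) x)) _ _).1.
have pl c : p c - e / 2 <= Ex nu (l c).
  have bl : bm (l c) := cbm (cl c).
  have bw : bm (\1_[set x | win act a' E x = c] : X -> R) := bm_indic (mw c).
  rewrite lerBlDr -lerBlDl /p -(Ex_indic nu (mw c)) -ExB //.
  have bDg g : bm (fun x => Df (act g x)) by exact: (bm_act X_borel act_cont g bDf).
  apply: le_trans (_ : Ex nu (fun x => \sum_(g : E) Df (act (val g) x)) <= _).
    apply: Ex_le; [exact: bmB|by apply: bm_sum => g; exact: bDg|] => x.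
    apply: le_trans (ler_norm _) _.
    rewrite (_ : \1_[set x | win act a' E x = c] x = \prod_(g : E) \1_[set y | a' y = c g] (act (val g) x)).
      apply: le_trans (prod_close _ (fun g => ind01 _ _) (fun g => chi01 _ _)).2 _.
      by apply: ler_sum => g _; exact: chiD.
    have [wc|wc] := pselect (win act a' E x = c).
      by rewrite ind1 // big1 // => g _; rewrite ind1 //= -wc ffunE.
    rewrite ind0 //; have [g hg] : exists g : E, a' (act (val g) x) <> c g.
      by apply: contrapT => no; apply: wc; apply/ffunP => g; rewrite ffunE; apply: contrapT => h; apply: no; exists g.
    by rewrite (bigD1 g) //= ind0 // mul0r.
  rewrite (Ex_sum nu _ _ (fun g : E => bDg (val g))).
  apply: le_trans (_ : \sum_(g : E) #|A|%:R * 2 * k <= _).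
    by apply: ler_sum => g _; rewrite (Ex_act X_borel act_cont (val g) nu_inv bDf).
  rewrite sumr_const -cardfE -[leLHS]mulr_natl.
  pose y : R := #|A|%:R * 2 * #|` E|%:R.
  have y0 : 0 <= y by rewrite !mulr_ge0.
  have ky : 2 * (y * k) + 2 * k = e.
    by rewrite /k -/y; field; rewrite gt_eqF // ltr_wpDl.
  have -> : #|` E|%:R * (#|A|%:R * 2 * k) = y * k by rewrite /y; ring.
  lra.
have db x y : b x = b y -> d x y <= 4 * eps.
  rewrite /b; case: pickP => [i hi|_]; case: pickP => [j hj|_] //.
    move=> [ij]; rewrite -ij in hj; have [_ _ _ h] := hf i; apply: h.
      by have := psif _ _ hi; have := sumf0 i x; lra.
    by have := psif _ _ hj; have := sumf0 i y; lra.
  by move=> [/dst]; rewrite mulrA -natrM.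
exists S, b, l, (e / 2); split=> //; last first.
- move=> q q0 q1 ql; rewrite -HE; apply: he => // c; have := ql c; have := pl c; lra.
- by rewrite divr_gt0.
- move=> c x; have /andP[l0 l1] := l01 c x; rewrite l0 /=.
  have [//|wc] := eqVneq (win act b E x) c.
  have [g hg] : exists g : E, b (act (val g) x) != c g.
    apply: contrapT => no; move/eqP: wc; apply; apply/ffunP => g; rewrite ffunE.
    by apply/eqP/negPn/negP => h; apply: no; exists g.
  by rewrite /l (bigD1 g) //= chib // mul0r.
Qed.

End Robust.

(** * Empirical measures of separated sets *)

Section Empirical.
Context {R : realType} {X : Type} (N : nat) (p : 'I_N.+1 -> X).

Definition emp (B : set X) : R := N.+1%:R^-1 * \sum_i (\1_B (p i) : R).

Lemma emp_charge : charge setT emp.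
Proof.
split=> //.
- by move=> A _; rewrite mulr_ge0 // sumr_ge0 // => i _; rewrite indicE.
- rewrite /emp (eq_bigr (fun=> 1)) => [|i _]; last by rewrite indicE mem_set.
  by rewrite sumr_const card_ord mulVf // pnatr_eq0.
- move=> A B _ _; rewrite /emp -mulrDr -big_split; congr (_ * _); apply: eq_bigr => i _ /=.
  by rewrite !indicE in_setI in_setI in_setC; case: (_ \in A); case: (_ \in B); rewrite /= ?addr0 ?add0r.
Qed.

Lemma emp_ent (T : finType) (f : X -> T) : (forall i j, f (p i) = f (p j) -> i = j) ->
  ln N.+1%:R <= Hent emp f.
Proof.
move=> fi; have cm := emp_charge.
have N0 : (0 : R) < N.+1%:R by rewrite ltr0n.
have mf : ofin setT f by [].
apply: le_trans (_ : (\sum_t emp [set x | f x = t]) * ln N.+1%:R <= _).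
  by rewrite (ch_sum1 cm mf) mul1r.
rewrite mulr_suml.
apply: ler_sum => t _; set a := emp _.
have a0 : 0 <= a by exact: (ch_ge0 cm).
have a1 : a <= N.+1%:R^-1.
  rewrite /a /emp ler_piMr ?invr_ge0 //.
  have [[i fit]|no] := pselect (exists i, f (p i) = t); last first.
    by rewrite big1 // => i _; rewrite indicE memNset // => h; apply: no; exists i.
  rewrite (bigD1 i) //= indicE mem_set // big1 ?addr0 // => j ji.
  by rewrite indicE memNset //= => fj; move/eqP: ji; apply; apply: fi; rewrite fj.
move: a0; rewrite le_eqVlt => /orP[/eqP <-|a0]; first by rewrite mul0r ent0.
rewrite /ent -mulrN ler_pM2l // -lnV ?posrE // ler_ln ?posrE ?invr_gt0 //.
by rewrite -[leLHS]invrK lef_pV2 ?posrE ?invr_gt0.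
Qed.

End Empirical.

(** * Misiurewicz' argument: an invariant measure of large entropy *)

Section Misiurewicz.
Context {R : realType} {G : groupType} {dX : measure_display} {X : measurableType dX}
  (d : X -> X -> R) (act : G -> X -> X) (F : nat -> {fset G}).
Hypothesis d_metric : is_metric d.
Hypothesis X_compact : d_compact d.
Hypothesis X_borel : @measurable _ X = <<s [set A | d_open d A] >>.
Hypothesis act_action : is_action act.
Hypothesis act_cont : forall g, d_continuous d (act g).
Hypothesis F_folner : @folner R G F.
Local Notation cont := (@d_continuous_real R X d).
Local Notation avg := (@orbit_avg R G dX X act).
Let F0 n : F n != fset0%fset := F_folner.1 n.

Lemma separated_max A (delta : R) : 0 < delta -> exists N, separated d act A delta N.+1 /\
  sep_num act d A delta <= N.+1%:R.
Proof.
move=> d0; have [N0 hN0] := separated_bounded d_metric X_compact act_cont A d0.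
have ex0 : exists n, `[< separated d act A delta n >].
  by exists 0%N; apply/asboolP; exists (fun _ => point) => -[].
have bd n : `[< separated d act A delta n >] -> (n <= N0)%N by move/asboolP; exact: hN0.
case: (ex_maxnP ex0 bd) => N /asboolP sN maxN.
have N1 : (0 < N)%N.
  by apply: maxN; apply/asboolP; exists (fun _ => point) => i j; rewrite !ord1 eqxx.
exists N.-1; rewrite prednK //; split=> //; apply: ge_sup; first by exists N%:R; exists N.
by move=> _ [n /asboolP/maxN nN <-]; rewrite ler_nat.
Qed.

(** The name over A distinguishes the N + 1 points, so its entropy is at least ln (N + 1), and
    Shearer's inequality applies to it. For g in A the term is at most the entropy of the E-name at
    g, and concavity bounds the average over g by the entropy of the mean law q; the other g are
    boundary and cost |E| L each. *)
Lemma empirical_window N (p : 'I_N.+1 -> X) (A E : {fset G}) (S : finType) (b : X -> S) (q : {ffun E -> S} -> R) (H L : R) :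
  A != fset0%fset -> E != fset0%fset -> (forall i j, win act b A (p i) = win act b A (p j) -> i = j) ->
  (forall c, q c = #|` A|%:R^-1 * \sum_(g <- A) emp p [set x | win act b E (act g x) = c]) ->
  \sum_c ent (q c) <= H -> ln #|S|%:R <= L ->
  #|` E|%:R * ln N.+1%:R <= #|` A|%:R * H + #|` (inv_prod E A `\` A)%fset|%:R * (#|` E|%:R * L).
Proof.
move=> A0 E0 inj qE qH SL; have cm := emp_charge p (R := R).
have Ap : (0 : R) < #|` A|%:R by rewrite ltr0n cardfs_gt0.
have MA : forall g B, (setT : set (set X)) B -> (setT : set (set X)) (act g @^-1` B) by [].
have mb : ofin setT b by [].
pose eta := Hwin act (emp p : _ -> R) b.
have sh := shearer (Hwin0 cm MA mb) (Hwin_mono cm MA mb) (Hwin_submod cm MA mb) E A.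
have h0 : ln N.+1%:R <= eta A by exact: emp_ent.
apply: le_trans (ler_wpM2l (ler0n _ _) h0) _; apply: le_trans sh _.
have ge0 W : 0 <= eta W by exact: (Hent_ge0 cm).
rewrite (big_fsetID _ (mem A)) /=; apply: lerD; last first.
  rewrite (_ : [fset x in inv_prod E A | x \notin A]%fset = (inv_prod E A `\` A)%fset); last first.
    by apply/fsetP => g; rewrite !inE andbC.
  rewrite -sum_fset_const; apply: ler_sum => g _.
  apply: le_trans (Hwin_mono cm MA mb (fsubsetIl _ _)) _.
  apply: le_trans (Hwin_le_ln cm MA mb _) _.
  rewrite (_ : #|` rtrans E g| = #|` E|); first by rewrite ler_wpM2l.
  by rewrite card_imfset //=; exact: mulIg.
have JE g : Hwin act (emp p : _ -> R) b (rtrans E g) = Hent (emp p : _ -> R) (win act b E \o act g).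
  exact: (Hwin_rtransE act_action cm MA mb).
apply: le_trans (_ : \sum_(g <- A) Hent (emp p) (win act b E \o act g) <= _).
  apply: le_trans (_ : \sum_(g <- A) (if g \in inv_prod E A then eta (rtrans E g `&` A)%fset else 0) <= _).
    rewrite -big_mkcond /= [leRHS]big_fset_condE le_eqVlt; apply/orP; left; apply/eqP.
    by apply: eq_fbigl => g; rewrite !inE andbC.
  apply: ler_sum => g _; rewrite -JE; case: ifP => _; last exact: ge0.
  exact: (Hwin_mono cm MA mb (fsubsetIl _ _)).
rewrite -ler_pdivrMl //; apply: le_trans qH.
rewrite /Hent exchange_big /= mulr_sumr; apply: ler_sum => c _; rewrite qE.
rewrite (big_seq_fsetE _ A xpredT (fun g => ent (emp p [set x | (win act b E \o act g) x = c]))) /=.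
rewrite (big_seq_fsetE _ A xpredT (fun g => emp p [set x | win act b E (act g x) = c])) /=.
rewrite !mulr_sumr; apply: ent_jensen => [g|g|].
- by rewrite invr_ge0.
- exact: (ch_ge0 cm).
- by rewrite sumr_const -cardfE -[LHS]mulr_natl divff // gt_eqF.
Qed.

(** The measure is fixed before the partition. For a given a, the robust label b has diameter at
    most 4 eps <= delta, so its names still tell a separated set apart, and finitely many continuous
    integrals carry the entropy bound from mu to the empirical laws. *)
Lemma misiurewicz (eps delta T : R) : 0 < eps -> 4 * eps <= delta ->
  (forall N, exists2 n, (N <= n)%N & T * #|` F n|%:R <= ln (sep_num act d (F n) delta)) ->
  exists mu : probability X R, invariant_measure act mu /\
    forall (A : finType) (a : X -> A) l, ofin measurable a -> (forall x y, a x = a y -> d x y <= eps) ->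
      #|` F n|%:R^-1 * Hwin act (pm mu) a (F n) @[n --> \oo] --> l -> T - 1 <= l.
Proof.
move=> e0 ed hT; have d0 : 0 < delta by apply: lt_le_trans ed; rewrite mulr_gt0.
have /choice[n hn] : forall k, exists n, (k <= n)%N /\ T * #|` F n|%:R <= ln (sep_num act d (F n) delta).
  by move=> k; have [n kn h] := hT k; exists n.
have /choice[N hN] : forall k, exists N, separated d act (F (n k)) delta N.+1 /\ T * #|` F (n k)|%:R <= ln N.+1%:R.
  move=> k; have [N [sN leN]] := separated_max (F (n k)) d0; exists N; split=> //.
  apply: le_trans (hn k).2 _; have [s0|s0] := leP (sep_num act d (F (n k)) delta) 0.
    by rewrite ln0 // ln_ge0 // ler1n.
  by rewrite ler_ln ?posrE.
have hp k : {p : 'I_(N k).+1 -> X | forall i j, i != j -> delta < dF act d (F (n k)) (p i) (p j)}.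
  by apply: cid; have [] := (hN k).1 => p; exists p.
pose p k := sval (hp k); have pP k : forall i j, i != j -> delta < dF act d (F (n k)) (p k i) (p k j) := svalP (hp k).
pose L k f : R := (N k).+1%:R^-1 * \sum_i avg (F (n k)) f (p k i).
have sL k : state d (L k).
  split=> [f g cf cg|c f cf|f g cf cg fg|]; rewrite /L.
  - by rewrite -mulrDr -big_split; congr (_ * _); apply: eq_bigr => i _; exact: avgD.
  - by rewrite mulrCA; congr (_ * _); rewrite mulr_sumr; apply: eq_bigr => i _; exact: avgZ.
  - by rewrite ler_wpM2l ?invr_ge0 //; apply: ler_sum => i _; exact: avg_le.
  - rewrite (eq_bigr (fun=> 1)) => [|i _]; last exact: avg_cst.
    by rewrite sumr_const card_ord mulVf // pnatr_eq0.
have [U [UU Uo]] := @ultraFilterLemma nat \oo _.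
have [mu hmu] := state_ulim d_metric X_compact X_borel UU sL.
have mui : invariant_measure act mu.
  apply: (inv_measureP d_metric X_compact X_borel act_cont) => g f cf.
  have [M M0 fM] := cont_bounded d_metric X_compact cf.
  have h1 := hmu _ cf; have h2 := hmu _ (cont_act act_cont g cf).
  have h3 : L k (f \o act g) - L k f @[k --> U] --> Ex mu (f \o act g) - Ex mu f by exact: cvgB.
  have h4 : L k (f \o act g) - L k f @[k --> U] --> (0 : R).
    move=> B hB; apply: Uo; move: B hB.
    change (L k (f \o act g) - L k f @[k --> \oo] --> (0 : R)).
    apply/cvgrPdist_le => e ep; have e1 : 0 < e / (M + 1) by rewrite divr_gt0 // ltr_wpDl.
    have [K _ hK] := folner_near F_folner g e1.
    exists K => // k /= Kk; rewrite sub0r normrN /L -mulrBr -sumrB.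
    rewrite normrM ger0_norm ?invr_ge0 // ler_pdivrMl ?ltr0n //.
    apply: le_trans (ler_norm_sum _ _ _) _.
    rewrite -[X in X%:R * _](card_ord (N k).+1) mulr_natl -sumr_const; apply: ler_sum => i _.
    apply: le_trans (avg_shift act_action _ _ _ fM) _.
    have := hK (n k) (leq_trans Kk (hn k).1).
    rewrite /= => h5; have Fp := folner_card_gt0 F_folner (n k).
    apply: le_trans (_ : M * (e / (M + 1)) <= _).
      by rewrite ler_wpM2l // ler_pdivrMr.
    by rewrite mulrA ler_pdivrMr ?ltr_wpDl // mulrC ler_pM2l // lerDl.
  by apply/eqP; rewrite -subr_eq0; apply/eqP; exact: (cvg_unique (@Rhausdorff R) h3 h4).
exists mu; split=> // A a l ma da cvl.
have key E : E != fset0%fset -> #|` E|%:R * T <= Hwin act (pm mu) a E + 1.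
  move=> E0; have Ep : (0 : R) < #|` E|%:R by rewrite ltr0n cardfs_gt0.
  have [S [b [lc [eta [[mb db] clc lc01 eta0 hq]]]]] := robust d_metric X_compact X_borel act_action act_cont mui E ma e0 da.
  set LS : R := ln #|S|%:R.
  have LS0 : 0 <= LS := ln_card_ge0 _.
  apply/ler_addgt0Pr => r r0.
  pose r1 := r / (#|` E|%:R * LS + 1).
  have r1p : 0 < r1 by rewrite divr_gt0 // ltr_wpDl // mulr_ge0.
  have near1 : \forall k \near U, forall c, Ex mu (lc c) - eta <= L k (lc c).
    apply: filter_forall => c; have := hmu _ (clc c) => /cvgrPdist_le /(_ eta eta0).
    by apply: filterS => k; rewrite ler_distlC => /andP[].
  have near2 : \forall k \near U, #|` (inv_prod E (F (n k)) `\` F (n k))%fset|%:R <= r1 * #|` F (n k)|%:R.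
    apply: Uo; have [K _ hK] := folner_inv_prod F_folner E r1p.
    by exists K => // k /= Kk; apply: hK; exact: leq_trans Kk (hn k).1.
  have [k [h1 h2]] := @filter_ex _ U _ _ (filterI near1 near2).
  set B := F (n k) in h2 *; have Bp : (0 : R) < #|` B|%:R := folner_card_gt0 F_folner (n k).
  have cm := emp_charge (p k) (R := R).
  pose q (c : {ffun E -> S}) : R := #|` B|%:R^-1 * \sum_(g <- B) emp (p k) [set x | win act b E (act g x) = c].
  have inj i j : win act b B (p k i) = win act b B (p k j) -> i = j.
    move=> /win_eqP h; apply/eqP/negPn/negP => /(pP k); apply/negP; rewrite -leNgt.
    apply: le_trans ed; apply: dF_leP => [|g gB]; first by rewrite mulr_ge0 // ltW.
    by apply: db; exact: h.
  have q0 c : 0 <= q c by rewrite mulr_ge0 ?invr_ge0 // sumr_ge0 // => g _; exact: (ch_ge0 cm).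
  have q1 : \sum_c q c = 1.
    rewrite /q -mulr_sumr exchange_big /= (eq_bigr (fun=> 1)); last first.
      by move=> g _; exact: (ch_sum1 cm (f := win act b E \o act g)).
    by rewrite sum_fset_const mulr1 mulVf // gt_eqF.
  have ql c : Ex mu (lc c) - eta <= q c.
    apply: le_trans (h1 c) _; rewrite /L /q -/B /orbit_avg -mulr_sumr mulrCA ler_wpM2l ?invr_ge0 //.
    rewrite exchange_big /= mulr_sumr.
    apply: ler_sum => g _; rewrite /emp ler_wpM2l ?invr_ge0 //; apply: ler_sum => i _.
    have /andP[_ /le_trans] := lc01 c (act g (p k i)); apply.
    rewrite indicE; case: eqP => // h; by rewrite mem_set.
  have := empirical_window (F0 (n k)) E0 inj (fun c => erefl (q c)) (hq q q0 q1 ql) (lexx _).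
  rewrite -/B -/LS => h3.
  have h4 : #|` E|%:R * (T * #|` B|%:R) <= #|` E|%:R * ln (N k).+1%:R by rewrite ler_pM2l //; exact: (hN k).2.
  rewrite -(ler_pM2r Bp) -mulrA; apply: le_trans h4 _; apply: le_trans h3 _.
  rewrite [leRHS]mulrDl; apply: lerD; first by rewrite mulrC.
  apply: le_trans (ler_wpM2r _ h2) _; first by rewrite mulr_ge0.
  rewrite mulrAC ler_pM2r // /r1 mulrAC ler_pdivrMr ?ltr_wpDl ?mulr_ge0 //.
  by rewrite ler_pM2l // lerDl.
(* For E = F m the additive 1 is divided by |F m| >= 1, so a loss of 1 in the rate is sufficient. *)
apply: (ler_cvg_to (cvg_cst (T - 1)) cvl); near=> m.
have Fp := folner_card_gt0 F_folner m.
rewrite ler_pdivlMl //; have := key _ (F0 m).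
have : 1 <= #|` F m|%:R :> R by rewrite ler1n cardfs_gt0 F0.
set c := #|` F m|%:R; rewrite mulrBr mulr1; lra.
Unshelve. all: end_near. Qed.

End Misiurewicz.

(** * Almost invariant boxes approximating ergodic components *)

Section Boxes.
Context {R : realType} {G : groupType} {dX : measure_display} {X : measurableType dX}
  (d : X -> X -> R) (act : G -> X -> X).
Hypothesis d_metric : is_metric d.
Hypothesis X_compact : d_compact d.
Hypothesis X_borel : @measurable _ X = <<s [set A | d_open d A] >>.
Hypothesis act_cont : forall g, d_continuous d (act g).
Local Notation cont := (@d_continuous_real R X d).
Variable mu : probability X R.
Hypothesis mu_inv : invariant_measure act mu.
Let mact := act_pre X_borel act_cont.
Let cm := charge_pm mu.
Let cbm := cont_bm d_metric X_compact X_borel.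
Variables phi phis : nat -> X -> R.
Hypothesis cphi : forall i, cont (phi i).
Hypothesis dphi : forall f (e : R), cont f -> 0 < e -> exists n (a : nat -> R), forall x,
     `|f x - \sum_(i < n) a i * phi i x| < e.
Hypothesis bphis : forall i, bm (phis i).
Hypothesis phis01 : forall i x, 0 <= phis i x <= 1.
Hypothesis phis_inv : forall g, {ae mu, forall x, forall i, phis i (act g x) = phis i x}.
Hypothesis phis_Ex : forall A i, measurable A -> (forall g, {ae mu, forall x, A (act g x) <-> A x}) ->
     Ex mu (fun x => \1_A x * phi i x) = Ex mu (fun x => \1_A x * phis i x).

Lemma pm_ae_eq A B : measurable A -> measurable B -> {ae mu, forall x, A x <-> B x} -> pm mu A = pm mu B.
Proof.
move=> mA mB AB; rewrite -(Ex_indic mu mA) -(Ex_indic mu mB).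
apply: Ex_ae_eq; [exact: bm_indic|exact: bm_indic|apply: filterS AB => x [h1 h2]].
by have [Ax|Ax] := pselect (A x); [rewrite !ind1 //; exact: h1|rewrite !ind0 // => /h2].
Qed.

(** The first k invariant coordinates at precision 2^-k: a finite almost invariant partition on
    whose cells the ergodic component is nearly constant in the weak sense. *)
Definition box (k : nat) (x : X) : {ffun 'I_k -> 'I_(2 ^ k).+1} :=
  [ffun i : 'I_k => inord (Num.truncn ((2 ^ k)%:R * phis i x))].

Let k0 k : (0 : R) < (2 ^ k)%:R. Proof. by rewrite ltr0n expn_gt0. Qed.

Let trunc_le k i x : (Num.truncn ((2 ^ k)%:R * phis i x : R) < (2 ^ k).+1)%N.
Proof.
have /andP[p0 p1] := phis01 i x.
have h : 0 <= (2 ^ k)%:R * phis i x by rewrite mulr_ge0.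
have /andP[h1 _] := truncn_itv h; rewrite ltnS -(ler_nat R); apply: le_trans h1 _.
by rewrite ler_piMr.
Qed.

Lemma ofin_box k : ofin measurable (box k).
Proof.
apply: (Hent_ffun_le (f := fun (i : 'I_k) x => inord (Num.truncn ((2 ^ k)%:R * phis i x))) cm _).1 => i t.
rewrite (_ : [set x | _] = (fun x => (2 ^ k)%:R * phis i x) @^-1` `[(t : nat)%:R, (t : nat).+1%:R[).
  by rewrite -[_ @^-1` _]setTI; apply: (bmZ _ (bphis i)).1.
apply/seteqP; split=> x; rewrite /= in_itv /=.
  have /andP[p0 p1] := phis01 i x.
  have h : 0 <= (2 ^ k)%:R * phis i x by rewrite mulr_ge0.
  by move=> <-; rewrite inordK //; exact: truncn_itv.
by move=> h; apply: val_inj; rewrite /= inordK //; exact: truncn_def.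
Qed.

Lemma box_near k x y i : box k x = box k y -> (i < k)%N -> `|phis i x - phis i y| <= (2 ^ k)%:R^-1.
Proof.
move=> /ffunP h ik; have := h (Ordinal ik); rewrite !ffunE /= => /(congr1 val); rewrite /= !inordK // => e.
have itv z := truncn_itv (mulr_ge0 (ltW (k0 k)) (andP (phis01 i z)).1).
have /andP[a1 a2] := itv x; have /andP[b1 b2] := itv y.
rewrite -(ler_pM2l (k0 k)) divff ?gt_eqF // -[X in X * _](ger0_norm (ltW (k0 k))) -normrM mulrBr.
rewrite e in a1 a2; move: a1 a2 b1 b2; rewrite -natr1; move: (_%:R * phis i x) (_ * phis i y) => u v.
by move=> *; rewrite ler_norml; apply/andP; split; lra.
Qed.

Lemma box_inv k g : {ae mu, forall x, box k (act g x) = box k x}.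
Proof. by apply: filterS (phis_inv g) => x h; apply/ffunP => i; rewrite !ffunE h. Qed.

Lemma box_set_inv k r g : {ae mu, forall x, [set y | box k y = r] (act g x) <-> [set y | box k y = r] x}.
Proof. by apply: filterS (box_inv k g) => x /= ->. Qed.

(** Over an almost invariant set phi i has the same integral as phis i, which on the box of x is
    nearly the constant Ex nu (phi i); uniform approximation passes to f. The error is proportional
    to the mass of the box, so that errors can be summed over boxes. *)
Lemma box_close f (e : R) : cont f -> 0 < e -> exists K, forall k, (K <= k)%N -> forall x (nu : probability X R),
  (forall i, Ex nu (phi i) = phis i x) -> forall A, A = [set y | box k y = box k x] ->
  `|Ex mu (fun y => \1_A y * f y) - pm mu A * Ex nu f| <= e * pm mu A.
Proof.
move=> cf e0; have e3 : 0 < e / 3 by rewrite divr_gt0.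
have [n [a ha]] := dphi cf e3.
pose S x := \sum_(i < n) a i * phi i x; pose s : R := \sum_(i < n) `|a i|.
have s0 : 0 <= s by apply: sumr_ge0.
have [K0 hK0] : exists K, s * (2 ^ K)%:R^-1 <= e / 3.
  exists (Num.truncn (s / (e / 3))).+1; set t := Num.truncn _.
  rewrite ler_pdivrMr // mulrC -ler_pdivrMr //.
  apply: le_trans (ltW (truncnS_gt _)) _; rewrite -/t ler_nat ltnW // ltn_expl //.
exists (maxn n K0) => k kK x nu hnu A AE.
have nk := leq_trans (leq_maxl _ _) kK; have Kk := leq_trans (leq_maxr _ _) kK.
have mA : measurable A by rewrite AE; exact: ofin_box.
have Ai : forall g, {ae mu, forall x, A (act g x) <-> A x} by move=> g; rewrite AE; exact: box_set_inv.
have bA := bm_indic mA (R := R).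
have bp i := cbm (cphi i).
have bS : bm S by apply: bm_sum => i; exact/bmZ/bp.
have bf := cbm cf.
set m := pm mu A; have m0 : 0 <= m := ch_ge0 cm mA.
have A1 (h1 h2 : X -> R) t : bm h1 -> bm h2 -> (forall y, A y -> `|h1 y - h2 y| <= t) ->
   `|Ex mu (fun y => \1_A y * h1 y) - Ex mu (fun y => \1_A y * h2 y)| <= t * m.
  move=> b1 b2 h; rewrite -ExB; [|exact: bmM|exact: bmM].
  rewrite /m -(Ex_indic mu mA) -ExZ //.
  have bd : bm (fun y => \1_A y * h1 y - \1_A y * h2 y) by apply: bmB; exact: bmM.
  apply: le_trans (Ex_norm mu bd) _; apply: Ex_le; [exact: bm_norm|exact: bmZ|move=> y].
  rewrite -mulrBr normrM; have [Ay|nA] := pselect (A y).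
    by rewrite ind1 // normr1 mul1r mulr1; exact: h.
  by rewrite ind0 // normr0 mul0r mulr0.
have t1 : `|Ex mu (fun y => \1_A y * f y) - Ex mu (fun y => \1_A y * S y)| <= e / 3 * m.
  by apply: A1 => // y _; exact: ltW (ha y).
have t2 : `|Ex mu (fun y => \1_A y * S y) - m * Ex nu S| <= e / 3 * m.
  have bAp i : bm (fun y => a i * (\1_A y * phi i y)) by apply/bmZ/bmM => //; exact: bp.
  rewrite (_ : (fun y => \1_A y * S y) = fun y => \sum_(i < n) a i * (\1_A y * phi i y)); last first.
    by apply/funext => y; rewrite mulr_sumr; apply: eq_bigr => i _; rewrite mulrCA.
  rewrite (Ex_sum mu _ _ (fun i : 'I_n => bAp i)) (Ex_sum nu _ _ (fun i : 'I_n => bmZ (a i) (bp i))).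
  rewrite mulr_sumr -sumrB; apply: le_trans (ler_norm_sum _ _ _) _.
  apply: le_trans (_ : \sum_(i < n) `|a i| * ((2 ^ k)%:R^-1 * m) <= _); last first.
    rewrite -mulr_suml mulrA ler_wpM2r //; apply: le_trans hK0; rewrite ler_wpM2l //.
    by rewrite lef_pV2 ?posrE // ler_nat leq_exp2l.
  apply: ler_sum => i _; rewrite (ExZ mu _ (bmM bA (bp i))) (ExZ nu _ (bp i)) hnu phis_Ex //.
  rewrite mulrCA -mulrBr normrM ler_wpM2l //.
  have -> : m * phis i x = Ex mu (fun y => \1_A y * phis i x).
    rewrite /m -(Ex_indic mu mA) mulrC -ExZ //; congr Ex; apply/funext => y; by rewrite mulrC.
  apply: A1; [exact: bphis|exact: bm_cst|move=> y Ay].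
  by rewrite AE in Ay; apply: (box_near Ay); exact: leq_trans (ltn_ord i) nk.
have t3 : `|Ex nu S - Ex nu f| <= e / 3.
  by apply: Ex_close => // y; rewrite distrC; exact: ltW (ha y).
have t4 : `|m * Ex nu S - m * Ex nu f| <= e / 3 * m.
  by rewrite -mulrBr normrM (ger0_norm m0) mulrC ler_wpM2r.
have := ler_normD (Ex mu (fun y => \1_A y * f y) - Ex mu (fun y => \1_A y * S y)) (Ex mu (fun y => \1_A y * S y) - m * Ex nu S + (m * Ex nu S - m * Ex nu f)).
have := ler_normD (Ex mu (fun y => \1_A y * S y) - m * Ex nu S) (m * Ex nu S - m * Ex nu f).
rewrite !addrA !subrK => h1 h2.
have -> : e * m = e / 3 * m + e / 3 * m + e / 3 * m by field.
apply: le_trans h2 _; rewrite -addrA; apply: lerD => //; apply: le_trans h1 _; exact: lerD.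
Qed.

Lemma cond_inv k r g B : measurable B ->
  cond (pm mu) [set x | box k x = r] (act g @^-1` B) = cond (pm mu) [set x | box k x = r] B.
Proof.
move=> mB; rewrite /cond; congr (_ / _).
have mA : measurable [set x | box k x = r] := ofin_box r.
rewrite -[RHS](pm_inv mu_inv g) ?preimage_setI; last exact: measurableI.
apply: pm_ae_eq; [by apply: measurableI => //; exact: mact|by apply: measurableI; exact: mact|].
by apply: filterS (box_set_inv r g) => x [h1 h2]; split=> -[? ?]; split=> //; [exact: h2|exact: h1].
Qed.

Lemma cond_full A P (T : finType) (f : X -> T) : measurable A -> measurable P -> ofin measurable f ->
  {ae mu, forall x, P x} -> pm mu (A `&` P) = pm mu A /\ Hent (cond (pm mu) (A `&` P)) f = Hent (cond (pm mu) A) f.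
Proof.
move=> mA mP mf aeP.
have E B : measurable B -> pm mu (B `&` (A `&` P)) = pm mu (B `&` A).
  move=> mB; apply: pm_ae_eq; [by do 2 apply: measurableI => //|exact: measurableI|].
  by apply: filterS aeP => x Px; split=> [[? []]//|[? ?]].
have EA : pm mu (A `&` P) = pm mu A by have := E setT measurableT; rewrite !setTI.
split=> //; apply: eq_bigr => t _; congr ent.
by rewrite /cond EA E //; exact: mf.
Qed.

End Boxes.

(** * From invariant to ergodic measures of large entropy *)

Section ErgodicLower.
Context {R : realType} {G : groupType} {dX : measure_display} {X : measurableType dX}
  (d : X -> X -> R) (act : G -> X -> X) (F : nat -> {fset G}).
Hypothesis d_metric : is_metric d.
Hypothesis X_compact : d_compact d.
Hypothesis X_borel : @measurable _ X = <<s [set A | d_open d A] >>.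
Hypothesis act_action : is_action act.
Hypothesis act_cont : forall g, d_continuous d (act g).
Hypothesis F_folner : @folner R G F.
Hypothesis G_inf : exists e : nat -> G, injective e.
Local Notation cont := (@d_continuous_real R X d).
Let mact := act_pre X_borel act_cont.
Let F0 n : F n != fset0%fset := F_folner.1 n.

(* If every ergodic measure had a partition of small entropy, robustness would extend it to all
   ergodic components in a small box; gluing over the boxes contradicts misiurewicz. *)
Lemma ergodic_lower (eps delta T : R) : 0 < eps -> 16 * eps <= delta ->
  (forall N, exists2 n, (N <= n)%N & T * #|` F n|%:R <= ln (sep_num act d (F n) delta)) ->
  exists nu : probability X R, ergodic_measure act nu /\
    forall (A : finType) (a : X -> A) l, ofin measurable a -> (forall x y, a x = a y -> d x y <= eps) ->
      #|` F n|%:R^-1 * Hwin act (pm nu) a (F n) @[n --> \oo] --> l -> T - 4 <= l.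
Proof.
move=> e0 ed hT.
have e40 : 0 < 4 * eps by rewrite mulr_gt0.
have ed4 : 4 * (4 * eps) <= delta by rewrite mulrA -natrM.
(* The scale is 4 eps because the label glued below has diameter 4 eps. *)
have [mu [mui hmu]] := misiurewicz d_metric X_compact X_borel act_action act_cont F_folner e40 ed4 hT.
have [phi [cphi phi01 dphi]] := test_family d_metric X_compact.
have [phis [bphis phis01 pinv pnu pEx]] := erg_decomp d_metric X_compact X_borel act_action act_cont F_folner cphi phi01 dphi mui.
have cm := charge_pm mu.
have mbox k := ofin_box mu bphis phis01 (k := k).
apply: contrapT => no.
have bad (nu : probability X R) : ergodic_measure act nu -> exists (A : finType) (a : X -> A) l,
   [/\ ofin measurable a, forall x y, a x = a y -> d x y <= eps,
     #|` F n|%:R^-1 * Hwin act (pm nu) a (F n) @[n --> \oo] --> l & l < T - 4].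
  move=> hnu; apply: contrapT => h; apply: no; exists nu; split=> // A a l ma da cvl.
  by rewrite leNgt; apply/negP => lT; apply: h; exists A, a, l.
(* Budget: a rate below T - 4 for an ergodic component gives, with one unit lost to robustness, T -
   3 on good boxes. The other boxes together cost at most 1, so the glued rate is at most T - 2,
   against the lower bound T - 1. *)
pose good k r := exists s (b : X -> 'I_s.+1) (E : {fset G}), [/\ E != fset0%fset, ofin measurable b,
   forall x y, b x = b y -> d x y <= 4 * eps &
   0 < pm mu [set x | box phis k x = r] -> Hwin act (cond (pm mu) [set x | box phis k x = r]) b E <= #|` E|%:R * (T - 3)].
have cvA (A : finType) (a : X -> A) l (nu : probability X R) : ofin measurable a ->
    #|` F n|%:R^-1 * Hwin act (pm nu) a (F n) @[n --> \oo] --> l -> 0 <= l.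
  move=> ma cvl; apply: (ler_cvg_to (cvg_cst 0) cvl); near=> n.
  by rewrite mulr_ge0 ?invr_ge0 //; apply: (Hent_ge0 (charge_pm nu)); exact: (ofin_win (charge_pm nu) mact).
have evgood : {ae mu, forall x, \forall k \near \oo, good k (box phis k x)}.
  apply: filterS pnu => x [nu [nue hnu]]; have [A [a [l [ma da cvl lT]]]] := bad nu nue.
  have : \forall n \near \oo, #|` F n|%:R^-1 * Hwin act (pm nu) a (F n) < T - 4 by exact: (cvgr_lt _ cvl).
  move=> [n _ /(_ n (leqnn n)) /= hn]; set E := F n in hn.
  have Ep : (0 : R) < #|` E|%:R := folner_card_gt0 F_folner n.
  have [S [b [lc [eta [[mb db] clc lc01 eta0 hq]]]]] := robust d_metric X_compact X_borel act_action act_cont nue.1 E ma e0 da.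
  have /choice[K hK] : forall c, exists K, forall k, (K <= k)%N ->
     forall B, B = [set y | box phis k y = box phis k x] -> `|Ex mu (fun y => \1_B y * lc c y) - pm mu B * Ex nu (lc c)| <= eta * pm mu B.
    move=> c; have [K hK] := box_close d_metric X_compact X_borel cphi dphi bphis phis01 pinv pEx (clc c) eta0.
    by exists K => k Kk; exact: hK.
  exists (\sum_c K c)%N => // k /= Kk.
  have iS y : val (inord (enum_rank (b y)) : 'I_#|S|.+1) = enum_rank (b y) by rewrite /= inordK // ltnS ltnW.
  have bb y z : (inord (enum_rank (b y)) : 'I_#|S|.+1) = inord (enum_rank (b z)) -> b y = b z.
    by move/(congr1 val); rewrite !iS => /val_inj /enum_rank_inj.
  have mb' : ofin measurable (fun y => inord (enum_rank (b y)) : 'I_#|S|.+1).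
    by apply: (ofin_factor mu mb) => y z ->.
  exists #|S|, (fun y => inord (enum_rank (b y))), E; split=> //; [exact: F0|by move=> y z /bb; exact: db|].
  set B := [set y | _]; move=> B0; have BE : B = [set y | box phis k y = box phis k x] by []; have mB : measurable B := mbox k _.
  have cc := charge_cond cm mB B0.
  have mw := ofin_win cm mact (A := E) mb.
  apply: le_trans (_ : Hwin act (cond (pm mu) B) b E <= _).
    apply: (Hent_mono cc (ofin_win cc mact mb) (ofin_win cc mact mb')).
    by move=> y z /win_eqP h; apply/win_eqP => g gE; rewrite h.
  apply: le_trans (hq (fun c => cond (pm mu) B [set y | win act b E y = c]) _ _ _) _.
  - by move=> c; exact: (ch_ge0 cc).
  - exact: (ch_sum1 cc mw).
  - move=> c; have bl := cont_bm d_metric X_compact X_borel (clc c).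
    have kc : (K c <= k)%N by apply: leq_trans Kk; rewrite (bigD1 c) //= leq_addr.
    have hc := hK c k kc B BE.
    rewrite /cond ler_pdivlMr //.
    apply: le_trans (_ : Ex mu (fun y => \1_B y * lc c y) <= _).
      by move: hc; rewrite ler_norml => /andP[h _]; lra.
    have mI : measurable ([set y | win act b E y = c] `&` B) by apply: measurableI.
    rewrite -(Ex_indic mu mI); apply: Ex_le; [by apply: bmM => //; exact: bm_indic|exact: bm_indic|move=> y].
    have [By|nB] := pselect (B y); last by rewrite (ind0 nB) mul0r indicE.
    rewrite (ind1 By) mul1r; have /andP[_ /le_trans] := lc01 c y; apply.
    by case: eqP => [h|//]; rewrite ind1.
  - have : Hwin act (pm nu) a E <= #|` E|%:R * (T - 4) by rewrite -ler_pdivrMl //; exact: ltW.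
    have : 1 <= #|` E|%:R :> R by rewrite ler1n cardfs_gt0 F0.
    by set h := #|` E|%:R; rewrite !mulrBr => ? ?; lra.
(* Rates are nonnegative and some component has a rate below T - 4. Positivity of T - 3 is needed
   when it is weighted with the mass of the good boxes. *)
have T4 : 4 < T.
  have [x [nu [nue _]]] := ae_ex pnu.
  have [A [a [l [ma da cvl lT]]]] := bad nu nue.
  by have := cvA _ _ _ _ ma cvl; lra.
have e20 : 0 < 2 * eps by rewrite mulr_gt0.
have [N0 [st [mst dst]]] := static_label d_metric X_compact X_borel act_action act_cont e20.
pose LN : R := ln N0.+1%:R; have LN0 : 0 <= LN by rewrite ln_ge0 // ler1n.
pose Y k := [set x | `[< good k (box phis k x) >]].
have mY k : measurable (Y k) by exact: (ofin_pred cm (fun r => `[< good k r >]) (mbox k)).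
have [k hk] : exists k, (1 - pm mu (Y k)) * LN <= 1.
  have cvY : Ex mu (\1_(Y n)) @[n --> \oo] --> Ex mu (fun=> 1).
    apply: (@Ex_cvg_ae _ _ _ _ _ _ 1).
    - by move=> n; exact: (bm_indic (mY n)).1.
    - exact: bm_cst.
    - by move=> n x; rewrite indicE; case: (x \in _); rewrite /= ?normr1 ?normr0.
    - apply: filterS evgood => x [M _ hM].
      apply: cvg_near_cst; exists M => // n /hM h; by rewrite ind1 //; exact/asboolP.
  rewrite Ex_cst in cvY.
  have p0 : 0 < (LN + 1)^-1 by rewrite invr_gt0 ltr_wpDl.
  have /cvgrPdist_le/(_ _ p0)[k _ /(_ k (leqnn k)) /= h] := cvY.
  exists k; move: h; rewrite (Ex_indic mu (mY k)) ler_norml => /andP[_ h].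
  apply: le_trans (ler_wpM2r LN0 h) _; rewrite mulrC ler_pdivrMr ?ltr_wpDl // mul1r lerDl //.
pose Lt := {ffun 'I_k -> 'I_(2 ^ k).+1}; pose m (r : Lt) := pm mu [set x | box phis k x = r].
have /choice[bb hbb] : forall r : Lt, exists sb : {s : nat & X -> 'I_s.+1}, good k r ->
   exists E : {fset G}, [/\ E != fset0%fset, ofin measurable (projT2 sb),
   forall x y, projT2 sb x = projT2 sb y -> d x y <= 4 * eps &
   0 < m r -> Hwin act (cond (pm mu) [set x | box phis k x = r]) (projT2 sb) E <= #|` E|%:R * (T - 3)].
  move=> r; have [[s [b [E hE]]]|nr] := pselect (good k r); last by exists (existT _ N0 st).
  by exists (existT _ s b) => _; exists E.
pose M := ((\sum_r projT1 (bb r)) + N0)%N.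
pose v (r : Lt) x : 'I_M.+1 := if `[< good k r >] then inord (projT2 (bb r) x) else inord (st x).
have bM (r : Lt) x : (projT2 (bb r) x < M.+1)%N.
  by apply: leq_trans (ltn_ord _) _; rewrite ltnS /M (bigD1 r) //= -addnA leq_addr.
have sM x : (st x < M.+1)%N by apply: leq_trans (ltn_ord _) _; rewrite ltnS leq_addl.
have mv r : ofin measurable (v r).
  rewrite /v; case: asboolP => gr.
    by have [E [_ mb _ _]] := hbb r gr; apply: (ofin_factor mu mb) => x y ->.
  by apply: (ofin_factor mu mst) => x y ->.
(* The label glued from the boxes. Recording the box costs a fixed entropy, which disappears in the
   rate because |F n| tends to infinity. *)
pose c x := (box phis k x, v (box phis k x) x).
have mc : ofin measurable c.
  have mvv : ofin measurable (fun x => (box phis k x, [ffun r => v r x])).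
    by apply: (ofin_pair cm (mbox k)); exact: (Hent_ffun_le cm mv).1.
  apply: (ofin_factor mu mvv) => x y [h1 /ffunP h2]; rewrite /c h1; congr (_, _).
  by have := h2 (box phis k y); rewrite !ffunE.
have dc x y : c x = c y -> d x y <= 4 * eps.
  move=> [] -> ; rewrite /v; case: asboolP => gr /(congr1 val); rewrite /= !inordK // => /val_inj.
    by have [E [_ _ db _]] := hbb _ gr; exact: db.
  by move=> /dst; rewrite mulrA -natrM.
have [l [cvl _ _]] := Hwin_cvg act_action cm mact mc (pm_inv mui) F_folner.
have lT := hmu _ _ _ mc dc cvl.
have /choice[lr hlr] : forall r : Lt, exists lr : R, [/\ 0 <= lr,
   m r * (#|` F n|%:R^-1 * Hwin act (cond (pm mu) [set x | box phis k x = r]) (v r) (F n)) @[n --> \oo] --> m r * lr,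
   good k r -> lr <= T - 3 & ~ good k r -> lr <= LN].
  move=> r; have mr := mbox k r.
  have := ch_ge0 cm mr; rewrite -/(m r) le_eqVlt => /orP[/eqP m0|m0].
    exists 0; rewrite -m0 mul0r; split=> //; last by move=> _; lra.
    by under eq_fun do rewrite mul0r; exact: cvg_cst.
  have cc := charge_cond cm mr m0.
  have ci : forall g B, measurable B -> cond (pm mu) [set x | box phis k x = r] (act g @^-1` B) = cond (pm mu) [set x | box phis k x = r] B.
    by move=> g B mB; exact: (cond_inv X_borel act_cont mui bphis phis01 pinv r g mB).
  have [lr [cvr lr0 lrE]] := Hwin_cvg act_action cc mact (mv r) ci F_folner.
  exists lr; split=> //.
  - by apply: cvgM => //; exact: cvg_cst.
  - move=> gr; have [E [E0 mb _ hE]] := hbb r gr; apply: le_trans (lrE E E0) _.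
    have Ep : (0 : R) < #|` E|%:R by rewrite ltr0n cardfs_gt0.
    rewrite ler_pdivrMr // [leRHS]mulrC; apply: le_trans (hE m0).
    apply: (Hent_mono cc (ofin_win cc mact mb) (ofin_win cc mact (mv r))).
    move=> y z /win_eqP h; apply/win_eqP => g gE; rewrite /v; case: asboolP => // _; by rewrite h.
  - move=> gr; have E0 := F0 0%N; apply: le_trans (lrE _ E0) _.
    have Ep : (0 : R) < #|` F 0%N|%:R by rewrite ltr0n cardfs_gt0.
    rewrite ler_pdivrMr // [leRHS]mulrC.
    apply: le_trans (_ : Hwin act (cond (pm mu) [set x | box phis k x = r]) st (F 0%N) <= _).
      apply: (Hent_mono cc (ofin_win cc mact mst) (ofin_win cc mact (mv r))).
      move=> y z /win_eqP h; apply/win_eqP => g gE; rewrite /v; case: asboolP => // _; by rewrite h.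
    by apply: le_trans (Hwin_le_ln cc mact mst _) _; rewrite card_ord.
have up n : Hwin act (pm mu) c (F n) <= Hent (pm mu) (box phis k) +
    \sum_r m r * Hwin act (cond (pm mu) [set x | box phis k x = r]) (v r) (F n).
  have mwc := ofin_win cm mact (A := F n) mc.
  apply: le_trans (Hent_le_chain cm (mbox k) mwc) _; rewrite lerD2l; apply: ler_sum => r _.
  rewrite -/(m r); have mr := mbox k r.
  have := ch_ge0 cm mr; rewrite -/(m r) le_eqVlt => /orP[/eqP <-|m0]; first by rewrite !mul0r.
  (* Off a null set the whole window of x stays in the box of x, so that on box r the name under c
     is determined by the name under v r. *)
  rewrite ler_pM2l //; pose P := \big[setI/setT]_(g <- F n) [set x | box phis k (act g x) = box phis k x].
  have mP : measurable P.
    apply: bigsetI_measurable => g _.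
    rewrite (_ : [set x | _] = [set x | box phis k (act g x) == box phis k x]).
      exact: (ofin_pred cm (fun t : Lt * Lt => t.1 == t.2) (ofin_pair cm (ofin_act mact g (mbox k)) (mbox k))).
    by apply/seteqP; split=> x /= /eqP.
  have aeP : {ae mu, forall x, P x}.
    rewrite /P; elim: (enum_fset (F n)) => [|g s IH]; first by apply: aeW => x; rewrite big_nil.
    by apply: filterS2 IH (box_inv pinv k g) => x h1 h2; rewrite big_cons; split.
  have [_ E1] := cond_full mr mP mwc aeP; rewrite -E1.
  have mwv := ofin_win cm mact (A := F n) (mv r).
  have [E2 E3] := cond_full mr mP mwv aeP; rewrite -[leRHS]E3.
  apply: (Hent_cond_mono cm) => //; [exact: measurableI|by rewrite E2|].
  have PE x g : P x -> g \in F n -> box phis k (act g x) = box phis k x.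
    by rewrite /P -bigcap_fset => h gF; exact: h.
  move=> x y [/= xr Px] [/= yr Py] /win_eqP h; apply/win_eqP => g gF; rewrite /c.
  by rewrite !PE // xr yr h.
have lim2 : #|` F n|%:R^-1 * (Hent (pm mu) (box phis k) +
    \sum_r m r * Hwin act (cond (pm mu) [set x | box phis k x = r]) (v r) (F n)) @[n --> \oo] --> \sum_r m r * lr r.
  rewrite -[X in _ --> X]add0r.
  rewrite (_ : (fun n => _) = (fun n => #|` F n|%:R^-1 * Hent (pm mu) (box phis k) + \sum_r m r * (#|` F n|%:R^-1 * Hwin act (cond (pm mu) [set x | box phis k x = r]) (v r) (F n)))); last first.
    by apply/funext => n; rewrite mulrDr; congr (_ + _); rewrite mulr_sumr; apply: eq_bigr => r _; rewrite mulrCA.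
  apply: cvgD; last by apply: cvg_big => [|r _]; [exact: add_continuous|case: (hlr r)].
  set H := Hent _ _; have H0 : 0 <= H := Hent_ge0 cm (mbox k).
  apply/cvgrPdist_le => e ep.
  have := folner_card_infty F_folner G_inf (Num.truncn (H / e)).+1; apply: filterS => n hn.
  have Fp := folner_card_gt0 F_folner n.
  rewrite sub0r normrN ger0_norm ?mulr_ge0 ?invr_ge0 //.
  rewrite ler_pdivrMl // -ler_pdivrMr //; apply: le_trans (ltW (truncnS_gt _)) _; by rewrite ler_nat.
have le1 : l <= \sum_r m r * lr r.
  apply: (ler_cvg_to cvl lim2); near=> n; have Fp := folner_card_gt0 F_folner n.
  by rewrite ler_pM2l ?invr_gt0.
have m0 r : 0 <= m r by exact: (ch_ge0 cm (mbox k r)).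
have sm : \sum_r m r = 1 := ch_sum1 cm (mbox k).
have sY : \sum_(r | `[< good k r >]) m r = pm mu (Y k).
  rewrite (ch_sum cm (mbox k) (mY k)) big_mkcond /=; apply: eq_bigr => r _; case: asboolP => gr.
    congr (pm mu _); apply/seteqP; split=> x /=; last by case.
    by move=> h; split=> //; rewrite /Y /= h; exact/asboolP.
  rewrite (_ : _ `&` _ = set0) ?(ch0 cm) //; apply/seteqP; split=> x //= -[/asboolP + h].
  by rewrite h.
have : \sum_r m r * lr r <= T - 3 + 1.
  rewrite (bigID (fun r => `[< good k r >])) /=; apply: lerD.
    apply: le_trans (_ : \sum_(r | `[< good k r >]) m r * (T - 3) <= _).
      by apply: ler_sum => r /asboolP gr; rewrite ler_wpM2l //; case: (hlr r) => _ _ h _; exact: h.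
    by rewrite -mulr_suml sY ler_piMl ?(ch_le1 cm (mY k)) //; lra.
  apply: le_trans hk; apply: le_trans (_ : \sum_(r | ~~ `[< good k r >]) m r * LN <= _).
    by apply: ler_sum => r /asboolP gr; rewrite ler_wpM2l //; case: (hlr r) => _ _ _ h; exact: h.
  rewrite -mulr_suml ler_wpM2r //; move: sm; rewrite (bigID (fun r => `[< good k r >])) /= sY; lra.
lra.
Unshelve. all: end_near. Qed.

End ErgodicLower.

(** * Entropy dimensions *)

Section LimSup.
Context {R : realType} {T : choiceType} {X : filteredType T}.

Lemma limf_esup_le (f : X -> \bar R) (F : set (set X)) c :
  F [set x | (f x <= c)%E] -> (limf_esup f F <= c)%E.
Proof.
move=> h; apply: le_trans (_ : ereal_sup [set f x | x in [set x | (f x <= c)%E]] <= c)%E.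
  by apply: ereal_inf_lbound; exists [set x | (f x <= c)%E].
by apply: ge_ereal_sup => _ [x /= fx <-].
Qed.

Lemma limf_esup_ge (f : X -> \bar R) (F : set (set X)) c :
  (forall V, F V -> exists2 x, V x & (c <= f x)%E) -> (c <= limf_esup f F)%E.
Proof.
move=> h; apply: le_ereal_inf_tmp => _ [V /h[x Vx cx] <-].
by apply: le_trans cx _; apply: ereal_sup_ubound; exists x.
Qed.

Lemma limf_esup_lt (f : X -> \bar R) (F : set (set X)) c : (limf_esup f F < c)%E ->
  exists2 V, F V & forall x, V x -> (f x < c)%E.
Proof.
move=> /ereal_inf_lt[_ [V FV <-] h]; exists V => // x Vx.
by apply: le_lt_trans h; apply: ereal_sup_ubound; exists x.
Qed.

End LimSup.

Section Logs.
Context {R : realType}.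

Lemma at_right0P (P : R -> Prop) :
  (\forall x \near 0^'+, P x) <-> exists2 r : R, 0 < r & forall x, 0 < x -> x < r -> P x.
Proof.
split=> [[r /= r0 h]|[r r0 h]].
  exists r => // x x0 xr; apply: h => //=; by rewrite sub0r normrN gtr0_norm.
exists r => //= x; rewrite /= sub0r normrN => xr x0; apply: h => //.
by move: xr; rewrite gtr0_norm.
Qed.

Lemma log_gt (e M : R) : 0 < e -> e < expR (- M) -> M < ln (e^-1).
Proof.
by move=> e0 eM; rewrite lnV ?posrE // ltrNr -[X in _ < X](expRK (- M)) ltr_ln ?posrE ?expR_gt0.
Qed.

Lemma log_big (s M : R) : 0 < s -> exists2 r : R, 0 < r & forall e, 0 < e -> e < r -> M <= ln (e^-1) `^ s /\ 1 <= ln (e^-1).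
Proof.
move=> s0; pose M' := Num.max M 1; have M1 : 1 <= M' by rewrite le_max lexx orbT.
pose K := Num.max 1 (M' `^ (s^-1)).
exists (expR (- K)); first exact: expR_gt0.
move=> e e0 eK; have := ltW (log_gt e0 eK); rewrite /K ge_max => /andP[h1 h2]; split=> //.
apply: le_trans (_ : M' <= _); first by rewrite le_max lexx.
have -> : M' = (M' `^ s^-1) `^ s by rewrite -powRrM mulVf ?gt_eqF // powRr1 //; lra.
by apply: ge0_ler_powR; rewrite ?nnegrE ?powR_ge0 // ?(ltW s0) //; lra.
Qed.

(** Dividing the scale by c adds ln c to the logarithm, which at most doubles it when e <= 1/c. *)
Lemma log_scale (c s e : R) : 0 < s -> 1 <= c -> 0 < e -> e <= c^-1 -> e < 1 ->
  ln ((e / c)^-1) `^ s <= 2 `^ s * ln (e^-1) `^ s.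
Proof.
move=> s0 c1 e0 ec e1; have c0 : 0 < c by lra.
have l0 : 0 <= ln (e^-1) by rewrite ln_ge0 // invf_ge1 // ltW.
have lc : 0 <= ln c by exact: ln_ge0.
rewrite -powRM //; apply: ge0_ler_powR; rewrite ?nnegrE ?mulr_ge0 ?(ltW s0) //.
  by rewrite invfM invrK lnM ?posrE ?invr_gt0 // addr_ge0.
rewrite invfM invrK lnM ?posrE ?invr_gt0 // mulrDl mul1r lerD2l.
by rewrite ler_ln ?posrE ?invr_gt0 // -[leLHS]invrK lef_pV2 ?posrE ?invr_gt0.
Qed.

End Logs.

(** * The inequality for every invariant measure *)

Section Assembly.
Context {R : realType} {G : groupType} {dX : measure_display} {X : measurableType dX}
  (d : X -> X -> R) (act : G -> X -> X) (F : nat -> {fset G}).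
Hypothesis d_metric : is_metric d.
Hypothesis X_compact : d_compact d.
Hypothesis X_borel : @measurable _ X = <<s [set A | d_open d A] >>.
Hypothesis act_action : is_action act.
Hypothesis act_cont : forall g, d_continuous d (act g).
Hypothesis F_folner : @folner R G F.
Hypothesis G_count : exists e : nat -> G, bijective e.
Local Notation cont := (@d_continuous_real R X d).
Let mact := act_pre X_borel act_cont.
Let F0 n : F n != fset0%fset := F_folner.1 n.
Let G_inf := G_injective G_count.
Let cbm := cont_bm d_metric X_compact X_borel.

Local Notation ht := (htop_eps act d F).

Lemma htop_lt (e T : R) : (ht e < T%:E)%E ->
  \forall n \near \oo, ln (sep_num act d (F n) e) <= T * #|` F n|%:R.
Proof.
move=> /limf_esup_lt[V [N _ NV] h]; exists N => // n /NV/h; rewrite lte_fin => /ltW.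
by rewrite ler_pdivrMl ?(folner_card_gt0 F_folner) // mulrC.
Qed.

Lemma htop_gt (e T : R) : (T%:E < ht e)%E ->
  forall N, exists2 n, (N <= n)%N & T * #|` F n|%:R <= ln (sep_num act d (F n) e).
Proof.
move=> h N; apply: contrapT => no; move: h; rewrite ltNge => /negP; apply.
apply: limf_esup_le; exists N => // n /= Nn; rewrite lee_fin leNgt; apply/negP => h; apply: no.
exists n => //; apply: ltW; move: h; by rewrite ltr_pdivlMl ?(folner_card_gt0 F_folner) // mulrC.
Qed.

Lemma ln_sep_ge0 A (e : R) : 0 < e -> 0 <= ln (sep_num act d A e).
Proof.
move=> e0; have [N [f [p [N0 h _ _ _]]]] := names d_metric X_compact X_borel act_cont A e0.
by apply: ln_ge0; apply: le_trans h; rewrite ler1n.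
Qed.

Lemma htop_ge0 (e : R) : 0 < e -> (0 <= ht e)%E.
Proof.
move=> e0; apply: limf_esup_ge => V [N _ NV]; exists N; first exact: (NV N (leqnn N)).
by rewrite lee_fin mulr_ge0 ?invr_ge0 // ln_sep_ge0.
Qed.

Lemma h_eps_ge0 (nu : probability X R) (e : R) : invariant_measure act nu -> 0 < e -> 0 <= h_eps act d F nu e.
Proof.
move=> nui e0; have e2 : 0 < e / 2 by rewrite divr_gt0.
have [N [f [mf df]]] := static_label d_metric X_compact X_borel act_action act_cont e2.
have [k [al [pal dal _]]] := label_entropy d mact act_action F_folner nui mf.
apply: lb_le_inf; first by exists (h_part act F nu al), k, al; split=> //; apply: dal => x y /df; rewrite mulrC divfK.
move=> _ [k' [beta [pb _ ->]]].
by have [? []] := partition_entropy mact act_action F_folner nui pb.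
Qed.

Lemma Fcomb_ge0 c (e : R) : ergodic_comb_ok act c -> 0 < e -> 0 <= Fcomb act d F c e.
Proof.
move=> [_ _ ce _] e0; apply: sumr_ge0 => j _; rewrite mulr_ge0 // h_eps_ge0 //.
exact: (ce j (ltn_ord j)).1.
Qed.

Lemma Fcomb_upper c (e T : R) : ergodic_comb_ok act c -> 0 < e -> 0 <= T -> (ht (e / 2) < T%:E)%E ->
  Fcomb act d F c e <= 2 * T + 5.
Proof.
move=> [_ c1 ce _] e0 T0 hT; have e2 : 0 < e / 2 by rewrite divr_gt0.
apply: le_trans (_ : (\sum_(j < ec_n c) (ec_w c j)%:num) * (2 * T + 5) <= _); last by rewrite c1 mul1r.
rewrite mulr_suml; apply: ler_sum => j _; rewrite ler_wpM2l //.
have := upper_bound d_metric X_compact X_borel act_action act_cont F_folner G_count (ce j (ltn_ord j)) e2 T0 (htop_lt hT).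
by rewrite [2 * (e / 2)]mulrC divfK.
Qed.

(** The existence of a family is part of the hypotheses because the supremum over no family would be
    -oo instead of 0. *)
Lemma mdim_meas_zero (mu : probability X R) (s : R) : 0 < s -> mdimM_top act d F s = 0%E ->
  (exists fam, in_MG act d mu fam) -> mdimM_meas act d F mu s = 0%E.
Proof.
move=> s0 mt0 [fam0 hfam0]; have s2 : 0 < (2 : R) `^ s by exact: powR_gt0.
have lim0 fam : in_MG act d mu fam -> limf_esup (fun eps => ((Fcomb act d F (fam eps) eps) * (ln (eps^-1) `^ s)^-1)%:E) (at_right (0:R)) = 0%E.
  move=> [fok _]; apply/eqP; rewrite eq_le; apply/andP; split; last first.
    apply: limf_esup_ge => V VF; have /at_right0P[r r0 h] := VF.
    have r2 : 0 < r / 2 by rewrite divr_gt0.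
    exists (r / 2); first by apply: h => //; lra.
    by rewrite lee_fin mulr_ge0 ?invr_ge0 ?powR_ge0 // Fcomb_ge0 //; exact: fok.
  apply/lee_addgt0Pr => e e0; rewrite add0e; apply: limf_esup_le.
  (* Halving the scale costs 2^s. With T = e1 l2 + 1 the bound 2 T + 5 is at most (e / 2) l + 7, and
     the threshold 14 / e for l absorbs the 7. *)
  pose e1 := e / (4 * 2 `^ s); have e10 : 0 < e1 by rewrite divr_gt0 // mulr_gt0.
  have : (mdimM_top act d F s < e1%:E)%E by rewrite mt0 lte_fin.
  move=> /limf_esup_lt[V /at_right0P[r r0 rV] hV].
  have [r' r'0 hr'] := log_big (14 / e) s0.
  apply/at_right0P; exists (Num.min (Num.min r r') (2^-1)); first by rewrite !lt_min r0 r'0 invr_gt0 ltr0n.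
  move=> x x0; rewrite !lt_min => /andP[/andP[xr xr'] x2].
  have [lM l1] := hr' x x0 xr'.
  have x20 : 0 < x / 2 by rewrite divr_gt0.
  have := hV _ (rV _ x20 _); move=> /(_ (_ : x / 2 < r)) h1.
  have {}h1 : (ht (x / 2) * ((ln ((x / 2)^-1) `^ s)^-1)%:E < e1%:E)%E by apply: h1; lra.
  set l := ln (x^-1) `^ s in lM *; set l2 := ln ((x / 2)^-1) `^ s in h1.
  have lp : 0 < l by apply: powR_gt0; lra.
  have l2p : 0 < l2.
    apply: powR_gt0; rewrite invfM invrK lnM ?posrE ?invr_gt0 // ltr_wpDr ?ln_ge0 //; lra.
  have ll2 : l2 <= 2 `^ s * l by apply: log_scale => //; lra.
  have hfin : (ht (x / 2) < (e1 * l2 + 1)%:E)%E.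
    have : (ht (x / 2) < (e1 * l2)%:E)%E by rewrite EFinM -lte_pdivrMr.
    by move=> /lt_le_trans; apply; rewrite lee_fin lerDl.
  have T0 : 0 <= e1 * l2 + 1 by rewrite addr_ge0 // mulr_ge0 // ltW.
  have := Fcomb_upper (fok x x0) x0 T0 hfin.
  rewrite /= lee_fin ler_pdivrMr // => /le_trans; apply.
  have h2 : e1 * l2 <= e / 4 * l.
    apply: le_trans (_ : e1 * (2 `^ s * l) <= _); first by rewrite ler_pM2l.
    by rewrite le_eqVlt; apply/orP; left; apply/eqP; rewrite /e1; field; rewrite gt_eqF.
  have h3 : 14 <= l * e by rewrite -ler_pdivrMr.
  rewrite -/l; lra.
rewrite /mdimM_meas; apply/eqP; rewrite eq_le; apply/andP; split.
  by apply: ge_ereal_sup => _ [fam hf <-]; rewrite lim0.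
by apply: ereal_sup_ubound; exists fam0 => //; exact: lim0.
Qed.

Lemma integral_comb (c : @ergodic_comb R dX X) f : bm f -> (\int[ec_measure c]_x (f x)%:E)%E = (\sum_(j < ec_n c) (ec_w c j)%:num * Ex (ec_mu c j) f)%:E.
Proof.
move=> bf; pose fp x := Num.max (f x) 0; pose fm x := Num.max (- f x) 0.
have bmax g : bm g -> bm (fun x => Num.max (g x) 0).
  move=> [mg [M gM]]; split; first by apply: measurable_maxr => //; exact: measurable_cst.
  exists (Num.max M 0) => x; rewrite ger0_norm; last by rewrite le_max lexx orbT.
  rewrite ge_max [0 <= _]le_max lexx orbT andbT.
  by apply: le_trans (ler_norm _) _; apply: le_trans (gM x) _; rewrite le_max lexx.
have bp : bm fp by exact: bmax.
have bn : bm fm by apply: bmax; exact: bmN.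
have g0 (g : X -> R) : bm g -> (forall x, 0 <= g x) ->
    (\int[ec_measure c]_x (g x)%:E)%E = (\sum_(j < ec_n c) (ec_w c j)%:num * Ex (ec_mu c j) g)%:E.
  move=> bg gg0; have mg : measurable_fun setT (fun x => (g x)%:E) by apply/measurable_EFinP; exact: bg.1.
  rewrite /ec_measure ge0_integral_measure_sum //; last by move=> x _; rewrite lee_fin.
  rewrite -sumEFin; apply: eq_bigr => j _; rewrite ge0_integral_mscale //; last by move=> x _; rewrite lee_fin.
  by rewrite ExE.
rewrite integralE.
rewrite [X in (X - _)%E](eq_integral (fun x => (fp x)%:E)); last by move=> x _; rewrite funeposE EFin_max.
rewrite [X in (_ - X)%E](eq_integral (fun x => (fm x)%:E)); last by move=> x _; rewrite funenegE -EFinN EFin_max.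
rewrite !g0 //; try by move=> x; rewrite le_max lexx orbT.
rewrite -EFinB -sumrB; congr (_%:E); apply: eq_bigr => j _.
rewrite -mulrBr -ExB //; congr (_ * Ex _ _); apply/funext => x; rewrite /fp /fm.
by case: (leP (f x) 0) => h; case: (leP (- f x) 0) => h'; lra.
Qed.

(** For each k one ergodic measure is chosen per box of positive mass and weighted with that mass.
    Measures of different boxes differ because their integrals determine the box, and the errors in
    [box_close] sum to e. The scale eps uses k equal to the integer part of 1/eps. *)
Lemma ergodic_family (mu : probability X R) : invariant_measure act mu -> exists fam, in_MG act d mu fam.
Proof.
move=> mui; have [phi [cphi phi01 dphi]] := test_family d_metric X_compact.
have [phis [bphis phis01 pinv pnu pEx]] := erg_decomp d_metric X_compact X_borel act_action act_cont F_folner cphi phi01 dphi mui.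
have cm := charge_pm mu; have mbox k := ofin_box mu bphis phis01 (k := k).
pose Lt k := {ffun 'I_k -> 'I_(2 ^ k).+1}.
pose m k (r : Lt k) := pm mu [set x | box phis k x = r].
have m0 k (r : Lt k) : 0 <= m k r by exact: (ch_ge0 cm (mbox k r)).
have rep k (r : Lt k) : exists xnu : X * probability X R, 0 < m k r ->
   [/\ box phis k xnu.1 = r, ergodic_measure act xnu.2 & forall i, Ex xnu.2 (phi i) = phis i xnu.1].
  have [mr|mr] := ltP 0 (m k r); last by exists (point, mu).
  have [x [xr [nu [nue hnu]]]] : exists x, box phis k x = r /\ exists nu : probability X R, ergodic_measure act nu /\ forall i, Ex nu (phi i) = phis i x.
    apply: contrapT => no; move: mr; rewrite /m (pm_ae_eq (mbox k r) measurable0) ?(ch0 cm) ?ltxx //.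
    apply: filterS pnu => x hx; split=> // xr; apply: no; exists x; split=> //.
  by exists (x, nu).
have /choice[xn hxn] : forall kr : {k : nat & Lt k}, exists xnu : X * probability X R, 0 < m _ (projT2 kr) ->
   [/\ box phis _ xnu.1 = projT2 kr, ergodic_measure act xnu.2 & forall i, Ex xnu.2 (phi i) = phis i xnu.1].
  by move=> [k r]; exact: rep.
pose s k := [seq r <- enum (Lt k) | 0 < m k r].
pose r0 k : Lt k := [ffun=> ord0].
pose w k j : {nonneg R} := NngNum (m0 k (nth (r0 k) (s k) j)).
pose nu k j := (xn (existT _ k (nth (r0 k) (s k) j))).2.
pose comb k := ErgComb (size (s k)) (w k) (nu k).
have sP k j : (j < size (s k))%N -> 0 < m k (nth (r0 k) (s k) j).
  by move=> js; have := mem_nth (r0 k) js; rewrite mem_filter => /andP[].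
have us k : uniq (s k) by rewrite filter_uniq // enum_uniq.
have sum_s k (f : Lt k -> R) : (forall r, m k r = 0 -> f r = 0) -> \sum_(j < size (s k)) f (nth (r0 k) (s k) j) = \sum_r f r.
  move=> f0; rewrite -(big_mkord xpredT (fun j => f (nth (r0 k) (s k) j))) -(big_nth (r0 k) xpredT f).
  rewrite big_filter big_enum_cond /= big_mkcond /=; apply: eq_bigr => r _.
  by case: ifP => // /negbT; rewrite -leNgt => h; rewrite f0 //; apply/eqP; rewrite eq_le h m0.
have ok k : ergodic_comb_ok act (comb k).
  split=> [j /sP //||j /sP h|i j /= is' js e].
  - by rewrite /= (sum_s k (m k)) //; exact: (ch_sum1 cm (mbox k)).
  - by have [_ h2 _] := hxn (existT _ k _) h.
  - have [bi _ Ei] := hxn (existT _ k _) (sP k i is'); have [bj _ Ej] := hxn (existT _ k _) (sP k j js).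
    have : nth (r0 k) (s k) i = nth (r0 k) (s k) j.
      rewrite -[LHS]bi -[RHS]bj /=; apply/ffunP => l; rewrite !ffunE; congr (inord (Num.truncn (_ * _))).
      by rewrite -Ei -Ej -/(nu k i) -/(nu k j) e.
    by move/eqP; rewrite nth_uniq // => /eqP.
have conv f : cont f -> forall e : R, 0 < e -> exists K, forall k, (K <= k)%N ->
    `|\sum_(j < size (s k)) m k (nth (r0 k) (s k) j) * Ex (nu k j) f - Ex mu f| <= e.
  move=> cf e e0; have [K hK] := box_close d_metric X_compact X_borel cphi dphi bphis phis01 pinv pEx cf e0.
  have bf := cbm cf; have [M M0 fM] := cont_bounded d_metric X_compact cf.
  exists K => k Kk; rewrite (sum_s k (fun r => m k r * Ex (xn (existT _ k r)).2 f)); last by move=> r ->; rewrite mul0r.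
  have bA r := bm_indic (mbox k r) (R := R).
  have -> : Ex mu f = \sum_r Ex mu (fun x => \1_[set y | box phis k y = r] x * f x).
    rewrite -(Ex_sum mu _ _ (fun r => bmM (bA r) bf)); congr Ex; apply/funext => x.
    rewrite (bigD1 (box phis k x)) //= ind1 // mul1r big1 ?addr0 // => r rx.
    by rewrite ind0 ?mul0r //= => h; rewrite h eqxx in rx.
  rewrite -sumrB; apply: le_trans (ler_norm_sum _ _ _) _.
  have -> : e = \sum_r e * m k r by rewrite -mulr_sumr (ch_sum1 cm (mbox k)) mulr1.
  apply: ler_sum => r _; rewrite distrC.
  have := m0 k r; rewrite le_eqVlt => /orP[/eqP mr|mr].
    rewrite -mr mul0r subr0 mulr0; apply: le_trans (Ex_norm mu (bmM (bA r) bf)) _.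
    apply: le_trans (_ : Ex mu (fun x => M * \1_[set y | box phis k y = r] x) <= _).
      apply: Ex_le; [exact/bm_norm/bmM|exact: bmZ|move=> x].
      rewrite normrM mulrC; have /andP[h _] := ind01 (R := R) [set y | box phis k y = r] x.
      by rewrite (ger0_norm h) ler_wpM2r.
    by rewrite (ExZ mu _ (bA r)) (Ex_indic mu (mbox k r)) -/(m k r) -mr mulr0.
  have [b1 _ b3] := hxn (existT _ k r) mr.
  by apply: (hK k Kk _ _ b3); rewrite b1.
exists (fun eps => comb (Num.truncn eps^-1)); split=> [eps _|f cf]; first exact: ok.
have bf := cbm cf; rewrite ExE //.
rewrite (_ : (fun eps => _) = fun eps => (\sum_(j < size (s (Num.truncn eps^-1))) m _ (nth (r0 _) (s (Num.truncn eps^-1)) j) * Ex (nu (Num.truncn eps^-1) j) f)%:E); last first.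
  by apply/funext => eps; rewrite integral_comb.
apply: cvg_EFin; first by near=> x.
apply/cvgrPdist_le => e e0; have [K hK] := conv f cf e e0.
apply/at_right0P; exists (K.+1%:R^-1) => [|x x0 xK]; first by rewrite invr_gt0.
rewrite distrC; apply: hK; rewrite truncn_ge_nat ?invr_ge0 ?(ltW x0) //.
apply: le_trans (_ : K.+1%:R <= _); first by rewrite ler_nat.
by rewrite -[leLHS]invrK lef_pV2 ?posrE ?invr_gt0 // ltW.
Unshelve. all: end_near. Qed.

Lemma upper_part (mu : probability X R) : invariant_measure act mu -> (DM_meas act d F mu <= DM_top act d F)%E.
Proof.
move=> mui; apply: le_ereal_inf => _ [s [s0 hs] <-]; exists s => //; split=> //.
exact: mdim_meas_zero s0 hs (ergodic_family mui).
Qed.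

End Assembly.

(** * A measure attaining the maximum *)

Section Attained.
Context {R : realType} {G : groupType} {dX : measure_display} {X : measurableType dX}
  (d : X -> X -> R) (act : G -> X -> X) (F : nat -> {fset G}).
Hypothesis d_metric : is_metric d.
Hypothesis X_compact : d_compact d.
Hypothesis X_borel : @measurable _ X = <<s [set A | d_open d A] >>.
Hypothesis act_action : is_action act.
Hypothesis act_cont : forall g, d_continuous d (act g).
Hypothesis F_folner : @folner R G F.
Hypothesis G_count : exists e : nat -> G, bijective e.
Local Notation cont := (@d_continuous_real R X d).
Let mact := act_pre X_borel act_cont.
Let F0 n : F n != fset0%fset := F_folner.1 n.
Let G_inf := G_injective G_count.
Let cbm := cont_bm d_metric X_compact X_borel.
Local Notation ht := (htop_eps act d F).
Local Notation D := (DM_top act d F).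

(** Otherwise the entropy would be at most M ln(1/e)^s at all small scales, and an exponent s'
    strictly between s and D would already give dimension 0. *)
Lemma htop_frequently_large (s r M : R) : 0 < s -> (s%:E < D)%E -> 0 < r ->
  exists e, [/\ 0 < e, e < r & ((M * ln (e^-1) `^ s)%:E < ht e)%E].
Proof.
move=> s0 sD r0; apply: contrapT => no.
have [s' [ss' s'D]] : exists s', s < s' /\ (s'%:E < D)%E.
  move: sD; case: D => [t| |] //.
    by rewrite lte_fin => st; exists ((s + t) / 2); rewrite lte_fin; split; lra.
  by move=> _; exists (s + 1); rewrite ltry; split=> //; lra.
have s'0 : 0 < s' by lra.
suff h0 : mdimM_top act d F s' = 0%E.
  move: s'D; rewrite ltNge => /negP; apply; apply: ereal_inf_lbound; by exists s'.
apply/eqP; rewrite eq_le; apply/andP; split; last first.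
  apply: limf_esup_ge => V /at_right0P[t t0 tV]; exists (t / 2); first by apply: tV; lra.
  by rewrite mule_ge0 ?lee_fin ?invr_ge0 ?powR_ge0 // htop_ge0 // divr_gt0.
apply/lee_addgt0Pr => e e0; rewrite add0e; apply: limf_esup_le.
have ds : 0 < s' - s by lra.
have [t t0 hlog] := log_big (`|M| / e) ds.
apply/at_right0P; exists (Num.min r t) => [|x x0]; first by rewrite lt_min r0.
rewrite lt_min => /andP[xr xt]; have [hl l1] := hlog x x0 xt.
have hx : (ht x <= (M * ln (x^-1) `^ s)%:E)%E.
  by rewrite leNgt; apply/negP => h; apply: no; exists x.
have lp : 0 < ln (x^-1) by lra.
have lps := powR_gt0 s lp; have lps' := powR_gt0 s' lp.
rewrite /= lee_pdivrMr //; apply: le_trans hx _; rewrite -EFinM lee_fin.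
have -> : ln (x^-1) `^ s' = ln (x^-1) `^ s * ln (x^-1) `^ (s' - s).
  by rewrite -powRD ?gt_eqF ?implybT // addrC subrK.
rewrite mulrCA [leLHS]mulrC ler_pM2l //; apply: le_trans (ler_norm M) _.
by rewrite mulrC -ler_pdivrMr.
Qed.

Lemma large_entropy_measure (s r : R) : 0 < s -> (s%:E < D)%E -> 0 < r ->
  exists enu : R * probability X R, [/\ 0 < enu.1, enu.1 < r, ergodic_measure act enu.2 &
    ln (enu.1^-1) `^ s <= h_eps act d F enu.2 enu.1].
Proof.
move=> s0 sD r0; have [t t0 hlog] := log_big 1 s0.
(* 2^s pays for the passage from scale de to de / 16, and 4 for the loss in [ergodic_lower], because
   l >= 1. *)
pose M : R := 2 `^ s + 4.
have [|de [de0]] := @htop_frequently_large s (Num.min (Num.min r t) (16^-1)) M s0 sD.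
  by rewrite !lt_min r0 t0 invr_gt0 ltr0n.
rewrite !lt_min => /andP[/andP[der det] de16] hde.
have [l1 l2] := hlog de de0 det; set l := ln (de^-1) `^ s in l1 hde.
have e0 : 0 < de / 16 by rewrite divr_gt0.
have ed : 16 * (de / 16) <= de by lra.
have [nu [nue hnu]] := ergodic_lower d_metric X_compact X_borel act_action act_cont F_folner G_inf e0 ed (htop_gt F_folner hde).
exists (de / 16, nu); split=> //=; first lra.
apply: le_trans (_ : M * l - 4 <= _).
  apply: le_trans (log_scale (c := 16) s0 _ de0 _ _) _; [lra|exact: ltW|lra|].
  by rewrite -/l /M; lra.
have e2 : 0 < de / 16 / 2 by rewrite divr_gt0.
have [N [f [mf df]]] := static_label d_metric X_compact X_borel act_action act_cont e2.
have [k [al [pal dal _]]] := label_entropy d mact act_action F_folner nue.1 mf.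
apply: lb_le_inf.
  exists (h_part act F nu al), k, al; split=> //; apply: dal => x y /df.
  by rewrite [2 * _]mulrC divfK.
move=> _ [k' [beta [pb db ->]]].
have [a [ma ha cv _ _]] := partition_entropy mact act_action F_folner nue.1 pb.
apply: (hnu _ a _ ma _ cv) => x y axy; apply: (db (a x)); by rewrite ha.
Qed.

(** One exponent per scale: strictly below D, so that large entropy is available, yet eventually
    above any s < D. D may be infinite. *)
Lemma exhausting_sequence : (0 < D)%E -> exists sm : nat -> R,
  (forall m, 0 < sm m /\ ((sm m)%:E < D)%E) /\
  forall s : R, (s%:E < D)%E -> exists K, forall m, (K <= m)%N -> s <= sm m.
Proof.
case: D => [t| |] //.
- rewrite lte_fin => t0; exists (fun m => t * (1 - m.+2%:R^-1)); split=> [m|s].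
    have h : (0 : R) < m.+2%:R^-1 by rewrite invr_gt0.
    have h1 : (m.+2%:R^-1 : R) < 1 by rewrite invf_lt1 // ltr1n.
    rewrite lte_fin mulr_gt0 ?subr_gt0 //; split=> //.
    by rewrite -[X in _ < X]mulr1 ltr_pM2l // ltrBlDr ltrDl.
  rewrite lte_fin => st; have p : 0 < (t - s) / t by rewrite divr_gt0 // subr_gt0.
  have [K _ hK] := near_infty_natSinv_lt (PosNum p).
  exists K => m Km; have := hK m Km; rewrite /= => h.
  have h2 : (m.+2%:R^-1 : R) <= m.+1%:R^-1 by rewrite lef_pV2 ?posrE // ler_nat.
  have : m.+2%:R^-1 * t <= t - s by rewrite -ler_pdivlMr //; apply: le_trans h2 (ltW h).
  by rewrite mulrBr mulr1 [t * _]mulrC lerBrDr addrC -lerBrDr.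
- move=> _; exists (fun m => m.+1%:R); split=> [m|s _]; first by rewrite ltr0n ltry.
  exists (Num.truncn s) => m Km; apply: ltW; apply: lt_le_trans (truncnS_gt s) _.
  by rewrite ler_nat ltnS.
Qed.

(** The case T = 0 of [ergodic_lower], where the growth hypothesis is automatic. *)
Lemma invariant_exists : exists mu : probability X R, invariant_measure act mu.
Proof.
have e0 : (0 : R) < 1 := ltr01.
have ed : 16 * 1 <= 16 :> R by rewrite mulr1.
have [|nu [nue _]] := @ergodic_lower _ _ _ _ d act F d_metric X_compact X_borel act_action act_cont F_folner G_inf 1 16 0 e0 ed.
  by move=> N; exists N => //; rewrite mul0r; exact: (ln_sep_ge0 d_metric X_compact X_borel act_cont).
by exists nu; exact: nue.1.
Qed.

Lemma DM_meas_ge0 (mu : probability X R) : (0 <= DM_meas act d F mu)%E.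
Proof. by apply: le_ereal_inf_tmp => _ [s [s0 _] <-]; rewrite lee_fin ltW. Qed.

Definition single (nu : probability X R) : ergodic_comb := ErgComb 1 (fun=> 1%:nng) (fun=> nu).

Lemma single_ok nu : ergodic_measure act nu -> ergodic_comb_ok act (single nu).
Proof.
move=> nue; split=> //=; first by rewrite big_ord1.
by move=> [|i] [|j].
Qed.

(** The limit comes from an ultrafilter, but a family indexed by eps needs a genuine subsequence: n
    k brings the integrals of the first k test functions within 1/(k+1) of their limits. *)
Lemma weak_limit (nu : nat -> probability X R) : (forall m, ergodic_measure act (nu m)) ->
  exists (mu : probability X R) (n : nat -> nat), [/\ invariant_measure act mu, forall k, (k <= n k)%N &
    forall f, cont f -> forall e : R, 0 < e -> exists K, forall k, (K <= k)%N -> `|Ex (nu (n k)) f - Ex mu f| <= e].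
Proof.
move=> nue; have [U [UU Uo]] := @ultraFilterLemma nat \oo _.
have [mu hmu] := state_ulim d_metric X_compact X_borel UU (fun m => state_Ex d_metric X_compact X_borel (nu m)).
have [phi [cphi phi01 dphi]] := test_family d_metric X_compact.
have /choice[n hn] : forall k, exists m, (k <= m)%N /\ forall i : 'I_k, `|Ex (nu m) (phi i) - Ex mu (phi i)| <= k.+1%:R^-1.
  move=> k; have n1 : \forall m \near U, (k <= m)%N by apply: Uo; exists k.
  have n2 : \forall m \near U, forall i : 'I_k, `|Ex (nu m) (phi i) - Ex mu (phi i)| <= k.+1%:R^-1.
    apply: filter_forall => i; have k0 : (0 : R) < k.+1%:R^-1 by rewrite invr_gt0.
    have := hmu _ (cphi i) => /cvgrPdist_le/(_ _ k0); apply: filterS => m; by rewrite distrC.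
  by have [m [h1 h2]] := @filter_ex _ U _ _ (filterI n1 n2); exists m.
exists mu, n; split=> [|k|f cf e e0]; last 2 first.
- exact: (hn k).1.
- have e3 : 0 < e / 3 by rewrite divr_gt0.
  have [N [a ha]] := dphi f _ cf e3.
  pose s : R := \sum_(i < N) `|a i|; have s0 : 0 <= s by apply: sumr_ge0.
  pose K0 := (Num.truncn (s / (e / 3))).+1.
  exists (maxn N K0) => k kK; have Nk := leq_trans (leq_maxl _ _) kK; have Kk := leq_trans (leq_maxr _ _) kK.
  pose S x := \sum_(i < N) a i * phi i x.
  have bp i := cbm (cphi i).
  have bS : bm S by apply: bm_sum => i; exact/bmZ/bp.
  have h1 : `|Ex (nu (n k)) f - Ex (nu (n k)) S| <= e / 3 by apply: Ex_close => // [|x]; [exact: cbm|exact/ltW/ha].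
  have h2 : `|Ex mu S - Ex mu f| <= e / 3.
    by apply: Ex_close => // [|x]; [exact: cbm|rewrite distrC; exact/ltW/ha].
  have h3 : `|Ex (nu (n k)) S - Ex mu S| <= e / 3.
    rewrite !(Ex_sum _ _ _ (fun i : 'I_N => bmZ (a i) (bp i))) -sumrB.
    apply: le_trans (ler_norm_sum _ _ _) _.
    apply: le_trans (_ : \sum_(i < N) `|a i| * k.+1%:R^-1 <= _).
      apply: ler_sum => i _; rewrite !(ExZ _ _ (bp i)) -mulrBr normrM ler_wpM2l //.
      exact: (hn k).2 (Ordinal (leq_trans (ltn_ord i) Nk)).
    rewrite -mulr_suml -/s ler_pdivrMr // mulrC -ler_pdivrMr //.
    by apply: le_trans (ltW (truncnS_gt _)) _; rewrite ler_nat; exact: leq_trans Kk (leqnSn k).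
  have := ler_normD (Ex (nu (n k)) f - Ex (nu (n k)) S) (Ex (nu (n k)) S - Ex mu S + (Ex mu S - Ex mu f)).
  have := ler_normD (Ex (nu (n k)) S - Ex mu S) (Ex mu S - Ex mu f).
  rewrite !addrA !subrK; lra.
apply: (inv_measureP d_metric X_compact X_borel act_cont) => g f cf.
have c1 := hmu _ cf; have c2 := hmu _ (cont_act act_cont g cf).
apply: (cvg_unique (@Rhausdorff R) c2).
rewrite (_ : (fun m => _) = fun m => Ex (nu m) f) //.
by apply/funext => m; rewrite (Ex_act X_borel act_cont g (nue m).1) //; exact: cbm.
Qed.

Lemma positive_below (e : nat -> R) K : (forall k, 0 < e k) ->
  exists2 r : R, 0 < r & forall k, (k < K)%N -> r <= e k.
Proof.
move=> e0; elim: K => [|K [r r0 h]]; first by exists 1.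
exists (Num.min r (e K)); first by rewrite lt_min r0 e0.
move=> k; rewrite ltnS leq_eqVlt => /orP[/eqP ->|/h]; first by rewrite ge_min lexx orbT.
by move=> rk; rewrite ge_min rk.
Qed.

Lemma attained : exists mu : probability X R, invariant_measure act mu /\ DM_meas act d F mu = D.
Proof.
have up mu := @upper_part _ _ _ _ d act F d_metric X_compact X_borel act_action act_cont F_folner G_count mu.
have [D0|D0] := leP D 0%E.
  have [mu mui] := invariant_exists; exists mu; split=> //; apply/eqP.
  by rewrite eq_le up //= (le_trans D0 (DM_meas_ge0 mu)).
have [sm [smP smD]] := exhausting_sequence D0.
have /choice[en hen] : forall m, exists enu : R * probability X R, [/\ 0 < enu.1, enu.1 < m.+1%:R^-1, ergodic_measure act enu.2 &
    ln (enu.1^-1) `^ (sm m) <= h_eps act d F enu.2 enu.1].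
  by move=> m; have [s0 sD] := smP m; apply: large_entropy_measure => //; rewrite invr_gt0.
have nue m : ergodic_measure act (en m).2 by case: (hen m).
have [mu [n [mui kn hconv]]] := weak_limit nue.
have [fam0 [fok0 fcv0]] := ergodic_family d_metric X_compact X_borel act_action act_cont F_folner mui.
pose ep k := (en (n k)).1; have ep0 k : 0 < ep k by case: (hen (n k)).
have epk k : ep k < k.+1%:R^-1.
  have [_ h _ _] := hen (n k); apply: lt_le_trans h _.
  by rewrite lef_pV2 ?posrE // ler_nat ltnS.
(* Different k may share a scale; [idx] selects one index for each scale that occurs. *)
have /choice[idx hidx] : forall e, exists k, (exists k', e = ep k') -> e = ep k.
  by move=> e; have [[k' ->]|nk] := pselect (exists k', e = ep k'); [exists k'|exists 0%N => h; case: nk].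
(* the scales ep k alone witness the limsup; elsewhere any family converging to mu will do *)
pose fam e := if `[< exists k, e = ep k >] then single (en (n (idx e))).2 else fam0 e.
exists mu; split=> //; apply/eqP; rewrite eq_le up //=.
have ffam : in_MG act d mu fam.
  split=> [e e0|f cf]; first by rewrite /fam; case: asboolP => h; [exact/single_ok/nue|exact: fok0].
  have bf := cbm cf; rewrite ExE //.
  pose g c : R := \sum_(j < ec_n c) (ec_w c j)%:num * Ex (ec_mu c j) f.
  have cv0 : g (fam0 e) @[e --> 0^'+] --> Ex mu f.
    have := fcv0 f cf; rewrite ExE //.
    rewrite (_ : (fun e => _) = fun e => (g (fam0 e))%:E); last by apply/funext => e; rewrite integral_comb.
    by move/fine_cvg.
  rewrite (_ : (fun e => _) = fun e => (g (fam e))%:E); last by apply/funext => e; rewrite integral_comb.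
  apply: cvg_EFin; first by near=> e.
  apply/cvgrPdist_le => e e0; have /cvgrPdist_le/(_ e e0)/at_right0P[r r0 hr] := cv0.
  (* The indices below K have finitely many scales, so every scale below r' has an index at least K,
     whichever index [idx] selects. *)
  have [K hK] := hconv f cf e e0; have [r' r'0 hr'] := positive_below K ep0.
  apply/at_right0P; exists (Num.min r r'); first by rewrite lt_min r0.
  move=> x x0; rewrite lt_min => /andP[xr xr']; rewrite /= /fam; case: asboolP => [h|_]; last exact: hr.
  rewrite /g /= big_ord1 /= mul1r distrC; apply: hK; rewrite leqNgt; apply/negP => /hr'.
  by rewrite -(hidx x h) leNgt xr'.
apply: le_ereal_inf_tmp => _ [s [s0 hs] <-]; rewrite leNgt; apply/negP => sD.
have [K hK] := smD s sD; have [r' r'0 hr'] := positive_below K ep0.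
have [t t0 hlog] := log_big 1 s0.
(* At small scales ep k the exponent exceeds s, and the logarithm is at least 1, so the normalized
   entropy of the family is at least 1 there; this contradicts dimension 0 at exponent s. *)
suff : (1%:E <= mdimM_meas act d F mu s)%E by rewrite hs lee_fin ler10.
apply: le_trans (_ : limf_esup (fun e => (Fcomb act d F (fam e) e * (ln (e^-1) `^ s)^-1)%:E) (at_right (0 : R)) <= _)%E; last first.
  by apply: ereal_sup_ubound; exists fam.
apply: limf_esup_ge => V /at_right0P[r r0 rV].
have q0 : 0 < Num.min (Num.min r r') t by rewrite !lt_min r0 r'0.
have [k _ /(_ k (leqnn k)) /= hk] := near_infty_natSinv_lt (PosNum q0).
have := lt_trans (epk k) hk; rewrite !lt_min => /andP[/andP[kr kr'] kt].
exists (ep k); first exact: rV.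
have ek : exists k', ep k = ep k' by exists k.
have ei := hidx _ ek; set i := idx (ep k) in ei.
have Ki : (K <= i)%N by rewrite leqNgt; apply/negP => /hr'; rewrite -ei leNgt kr'.
have [_ l1] := hlog _ (ep0 k) kt.
rewrite lee_fin ler_pdivlMr ?powR_gt0 //; last lra.
rewrite mul1r /fam; case: asboolP => // _; rewrite /Fcomb big_ord1 /= mul1r -/i.
have [_ _ _] := hen (n i); rewrite -/(ep i) -ei; apply: le_trans.
by apply: ler_powR => //; apply: hK; exact: leq_trans Ki (kn i).
Unshelve. all: end_near. Qed.

End Attained.

Theorem theorem1p3
  (R : realType) (G : groupType)
  (G_countably_infinite : exists e : nat -> G, bijective e)
  (dX : measure_display) (X : measurableType dX)
  (d : X -> X -> R)
  (d_metric : is_metric d)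
  (X_compact : d_compact d)
  (X_borel : @measurable _ X = <<s [set A | d_open d A] >>)
  (act : G -> X -> X)
  (act_action : is_action act)
  (act_cont : forall g, d_continuous d (act g))
  (F : nat -> {fset G})
  (F_folner : @folner R G F)
  (F_tempered : @tempered R G F) :
  (exists mu : probability X R,
      invariant_measure act mu /\ DM_meas act d F mu = DM_top act d F) /\
  (forall mu : probability X R,
      invariant_measure act mu -> (DM_meas act d F mu <= DM_top act d F)%E).
Proof.
by split=> [|mu mui]; [exact: attained|exact: upper_part].
Qed.
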